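(* Let $F:A\to[0,\infty)$, $A\subset TM$, be a conic Finsler metric on a manifold $M$ such that $A$ is pointwise convex (i.e. $A_x=A\cap T_xM$ is convex for every $x\in M$). Let $p\in M$ and $r>0$, and assume that $\exp_p$ is defined on the ball $B^+_0(r)=\{v\in A_p:F(v)<r\}$ of $(T_pM,F|_{A_p})$ and that it is a diffeomorphism from $B^+_0(r)$ onto the geodesic ball $B^+_p(r):=\exp_p(B^+_0(r))$. Then, for any $q\in B^+_p(r)$, the radial geodesic from $p$ to $q$ is, up to reparametrizations, the unique minimizer of the $F$-length among the admissible curves from $p$ to $q$ contained in $B^+_p(r)$.
   Context: Let $\pi:TM\to M$ be the natural projection. A conic Finsler metric on $M$ is a pair $(A,F)$ where $A\subset TM$ is open with $\pi(A)=M$ and conic ($v\in A$, $\lambda>0$ imply $\lambda v\in A$), and $F:A\to[0,\infty)$ is continuous, smooth on $A$ except at most at the zero vectors, with $F(v)=0$ iff $v$ is a zero vector, $F(\lambda v)=\lambda F(v)$ for $\lambda>0$, $v\in A$, and such that the fundamental tensor $g_v(u,w)=\frac12\frac{\partial^2}{\partial t\partial s}F(v+tu+sw)^2|_{t=s=0}$ ($u,w\in T_{\pi(v)}M$) is positive definite for every nonzero $v\in A$. The zero vector of $T_xM$ may belong to $A$ only if $T_xM\subset A$. A piecewise smooth curve $\alpha:[a,b]\to M$ is admissible if its right and left derivatives (those which make sense) belong to $A$ at every $t\in[a,b]$; its length is $\ell_F(\alpha)=\int_a^bF(\dot\alpha(t))\,dt$. Geodesics are the admissible curves which are critical points of the energy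 functional $E_F(\alpha)=\int_a^bF(\dot\alpha(t))^2\,dt$ among admissible curves with the same fixed endpoints; as $g$ is non-degenerate, they are the constant-speed solutions of the corresponding second order Euler-Lagrange (geodesic) equation, and are uniquely determined by their velocity at one point. The exponential map at $p$ is $\exp_p(v)=\gamma(1)$, for $v\in A_p$, where $\gamma$ is the geodesic with $\gamma(0)=p$, $\dot\gamma(0)=v$, whenever $\gamma$ is defined on $[0,1]$. For $q=\exp_p(v)$ with $v\in B^+_0(r)$, the radial geodesic from $p$ to $q$ is $t\mapsto\exp_p(tv)$, $t\in[0,1]$ (starting at $p$ for $t=0$). Convention: since $0\in T_pM$ may not belong to $A_p$, a curve $c:[a,b]\to M$ starting at $p$ is said to be contained in $B^+_p(r)$ if $c((a,b])\subset B^+_p(r)$ (and $\dot c(a)\in A_p$, as $c$ is admissible). *)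

(* Defs.v *)
From mathcomp Require Export all_boot all_order all_algebra.
From mathcomp Require Export all_classical all_reals all_analysis.
Export numFieldNormedType.Exports.
Export Order.TTheory GRing.Theory Num.Theory.

Set Implicit Arguments.
Unset Strict Implicit.
Unset Printing Implicit Defensive.

Global Open Scope classical_set_scope.
Global Open Scope ring_scope.

(* Differentiability classes between normed spaces.  The recursion through   *)
(* directional derivatives is the usual C^k for a finite-dimensional source  *)
(* and an open domain, which are the only cases used below.                  *)

Fixpoint Ck (R : realType) (V W : normedModType R) (k : nat)
    (U : set V) (f : V -> W) : Prop :=
  match k with
  | 0%N => forall x, U x -> {for x, continuous f}
  | k'.+1 => (forall x, U x -> differentiable f x) /\
             (forall v : V, Ck k' U (fun x => 'D_v f x))
  end.

(* [Some k] stands for C^k, [None] for C^oo *)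
Definition Cr (R : realType) (V W : normedModType R) (k : option nat)
    (U : set V) (f : V -> W) : Prop :=
  if k is Some m then Ck m U f else forall m, Ck m U f.

(* On an arbitrary set: locally the restriction of a C^k map defined on an   *)
(* open set; on a closed interval this is smoothness up to the endpoints.    *)
Definition Cr_on (R : realType) (V W : normedModType R) (k : option nat)
    (S : set V) (f : V -> W) : Prop :=
  forall x, S x -> exists (U : set V) (g : V -> W),
    [/\ open U, U x, Cr k U g & forall y, S y -> U y -> f y = g y].

Record chart (R : realType) (n : nat) (M : topologicalType) := Chart {
  cdom : set M;
  cimg : set 'rV[R]_n;
  cmap : M -> 'rV[R]_n;
  cinv : 'rV[R]_n -> M;
  cdom_open : open cdom;
  cimg_open : open cimg;
  cmap_img : forall x, cdom x -> cimg (cmap x);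
  cinv_dom : forall y, cimg y -> cdom (cinv y);
  cmapK : forall x, cdom x -> cinv (cmap x) = x;
  cinvK : forall y, cimg y -> cmap (cinv y) = y;
  cmap_continuous : forall x, cdom x -> {for x, continuous cmap};
  cinv_continuous : forall y, cimg y -> {for y, continuous cinv}
}.

Record manifold (R : realType) (n : nat) := Manifold {
  msort :> topologicalType;
  atlas : set (chart R n msort);
  atlas_cover : forall x : msort, exists c, atlas c /\ cdom c x;
  atlas_compat : forall c c', atlas c -> atlas c' ->
    Cr None (cimg c `&` cinv c @^-1` cdom c') (cmap c' \o cinv c);
  manifold_hausdorff : hausdorff_space msort;
  manifold_countable : @second_countable msort
}.
Arguments atlas {R n} M : rename.

(* A chart around x, chosen once and for all.  It identifies T_xM with R^n:  *)
(* the vector v : 'rV_n, seen in T_xM, is the tangent vector whose           *)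
(* coordinates in [chart_at x] are v.  A subset of TM is thus a family       *)
(* [A : M -> set 'rV_n], and a function on TM a function of (x, v).          *)
Definition chart_at (R : realType) (n : nat) (M : manifold R n) (x : M) :
  chart R n M := projT1 (cid (atlas_cover x)).

(* the tangent vector at [cinv c y] whose coordinates in the chart c are w   *)
Definition of_coord (R : realType) (n : nat) (M : manifold R n)
    (c : chart R n M) (y w : 'rV[R]_n) : 'rV[R]_n :=
  'd (cmap (chart_at (cinv c y)) \o cinv c) y w.

Section ConicFinsler.
Context (R : realType) (n : nat) (M : manifold R n).
Implicit Types (A : M -> set 'rV[R]_n) (F : M -> 'rV[R]_n -> R).

Definition coord_set A (c : chart R n M) : set ('rV[R]_n * 'rV[R]_n) :=
  [set z | cimg c z.1 /\ A (cinv c z.1) (of_coord c z.1 z.2)].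

Definition coord_fun F (c : chart R n M) (z : 'rV[R]_n * 'rV[R]_n) : R :=
  F (cinv c z.1) (of_coord c z.1 z.2).

Definition fundamental_tensor F (x : M) (v u w : 'rV[R]_n) : R :=
  2^-1 * derive1 (fun t => derive1 (fun s =>
    F x (v + t *: u + s *: w) ^+ 2) 0) 0.

(* The values of F outside A are irrelevant. *)
Record conic_finsler A F : Prop := ConicFinsler {
  cf_open : forall c, atlas M c -> open (coord_set A c);
  cf_onto : forall x, A x !=set0;
  cf_conic : forall x v (l : R), A x v -> 0 < l -> A x (l *: v);
  cf_zero : forall x, A x 0 -> A x = setT;
  cf_ge0 : forall x v, A x v -> 0 <= F x v;
  cf_continuous : forall c, atlas M c ->
    forall z, coord_set A c z -> {for z, continuous (coord_fun F c)};
  cf_smooth : forall c, atlas M c ->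
    Cr None (coord_set A c `&` [set z | z.2 != 0]) (coord_fun F c);
  cf_eq0 : forall x v, A x v -> (F x v = 0 <-> v = 0);
  cf_homog : forall x v (l : R), A x v -> 0 < l -> F x (l *: v) = l * F x v;
  cf_posdef : forall x v, A x v -> v != 0 ->
    forall u, u != 0 -> 0 < fundamental_tensor F x v u u
}.

Definition pointwise_convex A : Prop := forall x : M, convex_set (A x).

Definition Cr_map (V : normedModType R) (k : option nat)
    (S : set V) (f : V -> M) : Prop :=
  forall x, S x -> exists U : set V, [/\ open U, U x,
    forall y, S y -> U y -> cdom (chart_at (f x)) (f y) &
    Cr_on k (S `&` U) (cmap (chart_at (f x)) \o f)].

Definition Cr_from (W : normedModType R) (k : option nat)
    (O : set M) (g : M -> W) : Prop :=
  forall c, atlas M c -> Cr k (cimg c `&` cinv c @^-1` O) (g \o cinv c).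

Definition piecewise (P : set R -> Prop) (a b : R) : Prop :=
  exists2 s : seq R, itv_partition a b s &
    forall i, (i < size s)%N -> P `[nth b (a :: s) i, nth b s i]%classic.

(* Curves on [a, b] are functions R -> M considered on [a, b] only.          *)

Definition piecewise_smooth (a b : R) (c : R -> M) : Prop :=
  piecewise (fun I => Cr_map None I c) a b.

Definition velocity (c : R -> M) (t : R) : 'rV[R]_n :=
  derive1 (cmap (chart_at (c t)) \o c) t.

Definition right_velocity (c : R -> M) (t : R) : 'rV[R]_n :=
  let f := cmap (chart_at (c t)) \o c in
  lim (h^-1 *: (f (t + h) - f t) @[h --> 0^'+]).

Definition left_velocity (c : R -> M) (t : R) : 'rV[R]_n :=
  let f := cmap (chart_at (c t)) \o c in
  lim (h^-1 *: (f (t + h) - f t) @[h --> 0^'-]).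

Definition admissible A (a b : R) (c : R -> M) : Prop :=
  [/\ a < b, piecewise_smooth a b c,
      forall t, a <= t -> t < b -> A (c t) (right_velocity c t) &
      forall t, a < t -> t <= b -> A (c t) (left_velocity c t)].

(* [velocity] is meaningless at the endpoints and at the finitely many       *)
(* breaks; these do not contribute to the integrals.                         *)

Definition curve_length F (a b : R) (c : R -> M) : R :=
  \int[lebesgue_measure]_(t in `[a, b]%classic) F (c t) (velocity c t).

Definition energy F (a b : R) (c : R -> M) : R :=
  \int[lebesgue_measure]_(t in `[a, b]%classic) F (c t) (velocity c t) ^+ 2.

Definition admissible_variation A (a b : R) (c : R -> M)
    (e : R) (H : R -> R -> M) : Prop :=
  [/\ 0 < e,
      piecewise (fun I => Cr_map None (`]- e, e[%classic `*` I)
                            (fun z : R * R => H z.1 z.2)) a b,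
      forall t, a <= t <= b -> H 0 t = c t &
      forall s, - e < s < e ->
        [/\ admissible A a b (H s), H s a = c a & H s b = c b]].

Definition geodesic A F (a b : R) (c : R -> M) : Prop :=
  admissible A a b c /\
  forall e H, admissible_variation A a b c e H ->
    is_derive (0 : R) 1 (fun s => energy F a b (H s)) 0.

Definition exp_graph A F (p : M) (v : 'rV[R]_n) (q : M) : Prop :=
  exists c : R -> M, [/\ geodesic A F 0 1 c, c 0 = p,
    right_velocity c 0 = v & c 1 = q].

Definition exp_defined A F (p : M) (v : 'rV[R]_n) : Prop :=
  exists q, exp_graph A F p v q.

Definition expmap A F (p : M) (v : 'rV[R]_n) : M :=
  xget p [set q | exp_graph A F p v q].

(* B^+_0(r) in T_pM and B^+_p(r) in M *)
Definition tangent_ball A F (p : M) (r : R) : set 'rV[R]_n :=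
  [set v | A p v /\ F p v < r].

Definition geodesic_ball A F (p : M) (r : R) : set M :=
  expmap A F p @` tangent_ball A F p r.

(* Diffeomorphism from B, a subset of a tangent space, onto its image, in    *)
(* the sense suited to exponential maps of Finsler metrics: smooth in both   *)
(* directions off the zero vector and C^1 in both directions at it (when it  *)
(* is in B).  The exponential map of a Finsler metric is in general not C^2  *)
(* at the zero vector.                                                       *)
Definition diffeo_onto_image (B : set 'rV[R]_n) (f : 'rV[R]_n -> M) : Prop :=
  open (f @` B) /\
  exists g : M -> 'rV[R]_n,
    [/\ forall v, B v -> g (f v) = v,
        Cr_map (Some 1%N) B f,
        Cr_from (Some 1%N) (f @` B) g,
        Cr_map None (B `\ 0) f &
        Cr_from None (f @` (B `\ 0)) g].

Definition radial_geodesic A F (p : M) (v : 'rV[R]_n) (t : R) : M :=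
  if t == 0 then p else expmap A F p (t *: v).

(* Membership of the initial velocity in A_p is part of admissibility. *)
Definition contained_from (a b : R) (c : R -> M) (B : set M) : Prop :=
  forall t, a < t <= b -> B (c t).

Definition competitor A F (p q : M) (r a b : R) (c : R -> M) : Prop :=
  [/\ admissible A a b c, c a = p, c b = q &
      contained_from a b c (geodesic_ball A F p r)].

Definition length_minimizer A F (p q : M) (r a b : R) (c : R -> M) : Prop :=
  competitor A F p q r a b c /\
  forall a' b' c', competitor A F p q r a' b' c' ->
    curve_length F a b c <= curve_length F a' b' c'.

(* c on [a, b] is a reparametrization of c0 on [0, 1].  The change of        *)
(* parameter is only weakly increasing, since an admissible curve may stop   *)
(* where the zero vector belongs to A.                                       *)
Definition reparametrization (c0 : R -> M) (a b : R) (c : R -> M) : Prop :=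
  exists phi : R -> R,
    [/\ piecewise (fun I => Cr_on None I phi) a b,
        phi a = 0, phi b = 1,
        forall s t, a <= s -> s <= t -> t <= b -> phi s <= phi t &
        forall t, a <= t <= b -> c t = c0 (phi t)].

End ConicFinsler.

(* Main.v *)
(** Let [h (exp_p v) = F_p v] on the geodesic ball.  By the Gauss lemma the
differential of [h] at [exp_p v] is the momentum of the radial geodesic divided
by its speed, so the fundamental inequality, which needs the fibres of [A] to be
convex, gives [dh (w) <= F w] with equality only for radial [w].  Integrating
along a competitor [c], its length is at least [F_p v] as soon as [h (c t)] tends
to [0] at the last visit to [p].  If [0] is in [A_p], this is continuity of the
inverse of [exp_p] at [p].  Otherwise [c] starts at [p] with a nonzero velocity
[u0] in [A_p], and for small [s] the map [u |-> (exp_p (s u) - p) / s] is so close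
to the identity near a multiple of [u0] that it attains the value belonging to
[c]; hence [c t = exp_p (s u)] with [u] bounded and [s] small.

In the equality case the velocity of [c] is radial, so that [c = exp_p (phi v)]
with [phi = h (c) / F_p v]; at the starting time, where [h] need not be smooth,
[phi] is recovered from a coordinate of the radial geodesic by the
one-dimensional inverse function theorem.

Geodesics are only given as critical points of the energy.  Varying the energy
along piecewise linear hats shows that they satisfy the Euler-Lagrange equation
and have no corners.  Uniqueness of solutions and their dependence on the initial
velocity come from the momentum [P = dL/dy]: its strict monotonicity in the
velocity gives [|dy| <= C (|dP| + |dx|)], while [P] is Lipschitz in time. *)

(* The zero vector shapes the proof. If [0] is in [A p], the energy density need not be smooth
   there; if it is not, the hypothesis on [exp_p] says nothing at the origin. So [exp_p] is turned
   into a chart on nonzero vectors only. In that chart a radial geodesic is [t *: u], and the Gauss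
   lemma, the length bound and the equality case become statements about a curve of vectors.
   Whatever concerns [t] tending to [0] is read in an ordinary chart at [p], with bounds on
   [exp_p (t u)] that are uniform in [u] and of the right order in [t]. A geodesic, too, might stop
   or start moving at a break. There the first variation is replaced by a lower bound for small
   positive parameters, available because a curve at rest has the least possible energy. Existence
   of geodesics is part of the hypotheses. What the equation must supply is uniqueness and
   dependence on the initial velocity, by an absorption argument on short intervals; real induction
   then extends local facts (constant speed, uniqueness, confinement to a ball, solvability of an
   equation) to whole intervals. *)
From HB Require Import structures.
From mathcomp Require Import ring lra measurable_realfun.
Require Import Defs.

Set Implicit Arguments.
Unset Strict Implicit.
Unset Printing Implicit Defensive.

(* [lra] inspects every hypothesis, which is slow in large contexts. *)
Ltac order_lra := repeat match goal with
  | H : is_true (@Order.le _ _ _ _) |- _ => revert H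
  | H : is_true (@Order.lt _ _ _ _) |- _ => revert H
  | H : is_true (_ && _) |- _ => revert H
  end; clear; intros; lra.

(** * Differential calculus *)

Section ContinuousLinear.
Context (R : realType).
Implicit Types V W X : normedModType R.

(** An unbundled predicate, so that it applies to maps such as [fun w => 'D_w f y] that come without
    a linear structure. *)
Definition clin V W (f : V -> W) : Prop :=
  linear f /\ continuous f.

(** Finite dimension through continuous functionals [l i] and vectors [e i] that reproduce every
    vector. This passes to products at once, and it turns a direction that varies with the point
    into a finite sum over fixed directions, the only ones that [Ck] differentiates along. *)
Definition findim W : Prop :=
  exists m (e : 'I_m -> W) (l : 'I_m -> W -> R),
    (forall i, clin (l i)) /\ forall w, w = \sum_i l i w *: e i.

Lemma clin_pack V W (f : V -> W) : clin f ->
  exists g : {linear V -> W}, f = g :> (V -> W).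
Proof.
move=> [lf cf].
pose fM := GRing.isLinear.Build _ _ _ _ f lf.
pose fL : {linear _ -> _} := HB.pack f fM.
by exists fL.
Qed.

Lemma clin_differentiable V W (f : V -> W) x : clin f -> differentiable f x.
Proof.
move=> cf; have [g fg] := clin_pack cf; move: cf.2; rewrite fg => cg.
exact: linear_differentiable.
Qed.

Lemma clin_diff V W (f : V -> W) x : clin f -> 'd f x = f :> (V -> W).
Proof.
move=> cf; have [g fg] := clin_pack cf; move: cf.2; rewrite fg => cg.
exact: diff_lin.
Qed.

Lemma clin_derive V W (f : V -> W) x v : clin f -> 'D_v f x = f v.
Proof.
by move=> cf; rewrite deriveE ?clin_diff//; exact: clin_differentiable.
Qed.

Lemma clin_of_diff V W (f : V -> W) x : differentiable f x -> clin ('d f x).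
Proof. by move=> df; split; [exact: linearP|exact: diff_continuous]. Qed.

Lemma clin0 V W (f : V -> W) : clin f -> f 0 = 0.
Proof. by move=> /clin_pack[g ->]; rewrite linear0. Qed.

Lemma clinZ V W (f : V -> W) a x : clin f -> f (a *: x) = a *: f x.
Proof. by move=> /clin_pack[g ->]; rewrite linearZ. Qed.

Lemma clinD V W (f : V -> W) x y : clin f -> f (x + y) = f x + f y.
Proof. by move=> /clin_pack[g ->]; rewrite linearD. Qed.

Lemma clinB V W (f : V -> W) x y : clin f -> f (x - y) = f x - f y.
Proof. by move=> /clin_pack[g ->]; rewrite linearB. Qed.

Lemma clin_sum V W (f : V -> W) m (F : 'I_m -> V) :
  clin f -> f (\sum_i F i) = \sum_i f (F i).
Proof. by move=> /clin_pack[g ->]; rewrite linear_sum. Qed.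

Lemma clin_bound V W (f : V -> W) : clin f ->
  exists2 k, 0 < k & forall x, `|f x| <= k * `|x|.
Proof.
move=> cf; have [g fg] := clin_pack cf; move: cf.2; rewrite fg => cg.
exact: linear_lipschitz.
Qed.

Lemma clin_id V : clin (@id V).
Proof. by split=> // x; exact: cvg_id. Qed.

Lemma clin_comp V W X (f : V -> W) (g : W -> X) : clin f -> clin g ->
  clin (g \o f).
Proof.
move=> [lf cf] [lg cg]; split; first by move=> a x y /=; rewrite lf lg.
by move=> x; apply: continuous_comp; [exact: cf|exact: cg].
Qed.

Lemma clin_fst V W : clin (@fst V W).
Proof. by split=> // x; exact: cvg_fst. Qed.

Lemma clin_snd V W : clin (@snd V W).
Proof. by split=> // x; exact: cvg_snd. Qed.

Lemma clin_pair V W X (f : V -> W) (g : V -> X) : clin f -> clin g ->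
  clin (fun v => (f v, g v)).
Proof.
move=> [lf cf] [lg cg]; split; first by move=> a x y /=; rewrite lf lg.
by move=> x; apply: cvg_pair; [exact: cf|exact: cg].
Qed.

Lemma clin_zero V W : clin (fun _ : V => 0 : W).
Proof.
by split; [move=> a x y; rewrite scaler0 addr0|move=> x; exact: cvg_cst].
Qed.

Lemma clin_scalel W (w : W) : clin (fun a : R => a *: w).
Proof.
split; last exact: scalel_continuous.
by move=> a x y; rewrite scalerDl scalerA.
Qed.

Lemma clin_scaler W (a : R) : clin (fun w : W => a *: w).
Proof.
split; last exact: scaler_continuous.
by move=> b x y; rewrite scalerDr !scalerA mulrC.
Qed.

Lemma clin_coord n (i : 'I_n) : clin (fun v : 'rV[R]_n => (v : 'M[R]_(1, n)) 0 i).
Proof.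
split; last exact: coord_continuous.
by move=> a x y; rewrite !mxE.
Qed.

Lemma findim_R : findim R.
Proof.
exists 1%N, (fun _ => 1), (fun _ => id); split; first by move=> _; exact: clin_id.
by move=> w; rewrite big_ord1 /GRing.scale /= mulr1.
Qed.

Lemma findim_rV n : findim 'rV[R]_n.
Proof.
exists n, (fun i => delta_mx 0 i), (fun i (v : 'rV[R]_n) => v 0 i); split.
  by move=> i; exact: clin_coord.
by move=> w; exact: row_sum_delta.
Qed.

Lemma pairDE V W (a b : V) (c d : W) : (a, c) + (b, d) = (a + b, c + d).
Proof. by []. Qed.

Lemma findim_prod V W : findim V -> findim W -> findim (V * W)%type.
Proof.
move=> [m [e [l [cl el]]]] [m' [e' [l' [cl' el']]]].
pose E (i : 'I_(m + m')) : V * W :=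
  match fintype.split i with inl j => (e j, 0) | inr j => (0, e' j) end.
pose L (i : 'I_(m + m')) (z : V * W) :=
  match fintype.split i with inl j => l j z.1 | inr j => l' j z.2 end.
exists (m + m')%N, E, L; split.
  move=> i; rewrite /L; case: fintype.split => j.
    exact: (clin_comp (clin_fst _ _) (cl j)).
  exact: (clin_comp (clin_snd _ _) (cl' j)).
move=> [v w]; rewrite big_split_ord /=.
have -> : \sum_(i < m) L (lshift m' i) (v, w) *: E (lshift m' i) = (v, 0).
  have lf : clin (fun x : V => (x, 0 : W)).
    by apply: clin_pair; [exact: clin_id|exact: clin_zero].
  transitivity ((fun x : V => (x, 0 : W)) v) => //.
  rewrite [in RHS](el v) (clin_sum _ lf); apply: eq_bigr => i _.
  rewrite /L /E; case: split_ordP => j /= ij; last by move/eqP: ij; rewrite eq_lrshift.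
  have -> : i = j by move/lshift_inj: ij.
  exact/esym/(clinZ _ _ lf).
have -> : \sum_(i < m') L (rshift m i) (v, w) *: E (rshift m i) = (0, w).
  have lf : clin (fun x : W => (0 : V, x)).
    by apply: clin_pair; [exact: clin_zero|exact: clin_id].
  transitivity ((fun x : W => (0 : V, x)) w) => //.
  rewrite [in RHS](el' w) (clin_sum _ lf); apply: eq_bigr => i _.
  rewrite /L /E; case: split_ordP => j /= ij; first by move/eqP: ij; rewrite eq_rlshift.
  have -> : i = j by move/rshift_inj: ij.
  exact/esym/(clinZ _ _ lf).
by rewrite pairDE addr0 add0r.
Qed.

End ContinuousLinear.
#[global] Hint Resolve findim_R findim_rV findim_prod : core.

(** * Calculus of C^k maps *)

Section Ck.
Context (R : realType).
Implicit Types V W X : normedModType R.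

(** [Ck] puts conditions on globally defined functions at the points of [U], so it can be tested on
    singletons. Restriction to a subset and localization follow. *)
Lemma Ck_at V W k (U : set V) (f : V -> W) :
  Ck k U f <-> forall x, U x -> Ck k [set x] f.
Proof.
elim: k f => [|k IH] f /=.
  split; first by move=> h x Ux y ->; exact: h.
  by move=> h x Ux; exact: (h x Ux x erefl).
split.
  move=> [df Df] x Ux; split; first by move=> y ->; exact: df.
  by move=> v; exact: ((IH _).1 (Df v)).
move=> h; split; first by move=> x Ux; exact: ((h x Ux).1 x erefl).
by move=> v; apply/IH => x Ux; exact: (h x Ux).2.
Qed.

Lemma Ck_sub V W k (U U' : set V) (f : V -> W) : U' `<=` U ->
  Ck k U f -> Ck k U' f.
Proof. by move=> s /Ck_at h; apply/Ck_at => x /s; exact: h. Qed.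

Lemma near_eq_differentiable V W (f g : V -> W) (x : V) :
  (\near x, f x = g x) -> differentiable f x -> differentiable g x.
Proof.
move=> fg /diff_locallyP [cf ef]; apply/diff_locallyP.
suff h : g \o shift x = cst (g x) + 'd f x +o_ 0 id.
  by rewrite (diff_unique cf h).
apply/eqaddoP => e e0; move/eqaddoP: ef => /(_ e e0).
have fg0 : \forall y \near (0 : V), f (y + x) = g (y + x).
  have := (near_shift x 0 (fun y => f (y + x) = g (y + x))).
  by rewrite sub0r => ->; apply: filterS fg => y /=; rewrite subrK.
move=> ef; near=> y.
have -> : (g \o shift x - (cst (g x) + 'd f x)) y =
          (f \o shift x - (cst (f x) + 'd f x)) y.
  rewrite -[LHS]/(g (y + x) - (g x + 'd f x y)).
  rewrite -[RHS]/(f (y + x) - (f x + 'd f x y)).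
  by rewrite (nbhs_singleton fg); congr (_ - _); apply/esym; near: y.
by near: y.
Unshelve. all: by end_near. Qed.

Lemma Ck_near V W k (U : set V) (f g : V -> W) :
  (forall x, U x -> \near x, f x = g x) -> Ck k U f -> Ck k U g.
Proof.
elim: k U f g => [|k IH] U f g fg /=.
  move=> h x Ux; have fgx := fg x Ux.
  suff : g @ x --> g x by [].
  rewrite -(nbhs_singleton fgx); apply: cvg_trans (h x Ux).
  exact: near_eq_cvg.
move=> [df Df]; split.
  by move=> x Ux; apply: near_eq_differentiable (df x Ux); exact: fg.
move=> v; apply: IH (Df v) => x Ux.
(* Agreement near [x] is agreement near every point close to [x], which is what equality of the
   derivatives near [x] requires. *)
by have := fg x Ux => /near_join; apply: filterS => y; exact: near_eq_derive.
Qed.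

Lemma Ck_eq V W k (U : set V) (f g : V -> W) : open U ->
  (forall x, U x -> f x = g x) -> Ck k U f -> Ck k U g.
Proof.
move=> oU fg; apply: Ck_near => x Ux.
by have := open_nbhs_nbhs (conj oU Ux); apply: filterS.
Qed.

Lemma Ck_continuous V W k (U : set V) (f : V -> W) x :
  Ck k U f -> U x -> {for x, continuous f}.
Proof.
case: k => [|k] /=; first exact.
by move=> [df _] Ux; exact/differentiable_continuous/df.
Qed.

Lemma CkW V W k (U : set V) (f : V -> W) : Ck k.+1 U f -> Ck k U f.
Proof.
elim: k f => [|k IH] f; first by move=> h x Ux; exact: Ck_continuous h Ux.
by move=> [df Df]; split=> // v; apply: IH; exact: Df.
Qed.

Lemma Ck_cst V W k (U : set V) (w : W) : Ck k U (fun _ : V => w).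
Proof.
elim: k w => [|k IH] w; first by move=> x _; exact: cst_continuous.
split; first by move=> x _; exact: differentiable_cst.
move=> v; have -> : (fun x : V => 'D_v (fun=> w) x) = fun=> 0.
  by apply/funext => x; exact: derive_cst.
exact: IH.
Qed.

Lemma Ck_clin V W k (U : set V) (f : V -> W) : clin f -> Ck k U f.
Proof.
case: k => [|k] cf; first by move=> x _; exact: cf.2.
split; first by move=> x _; exact: clin_differentiable.
move=> v; have -> : (fun x : V => 'D_v f x) = fun=> f v.
  by apply/funext => x; exact: clin_derive.
exact: Ck_cst.
Qed.

Lemma CkD V W k (U : set V) (f g : V -> W) : open U ->
  Ck k U f -> Ck k U g -> Ck k U (fun x => f x + g x).
Proof.
move=> oU; elim: k f g => [|k IH] f g.
  by move=> hf hg x Ux; apply: cvgD; [exact: hf|exact: hg].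
move=> [df Df] [dg Dg]; split.
  by move=> x Ux; apply: differentiableD; [exact: df|exact: dg].
move=> v; apply: (Ck_eq oU) (IH _ _ (Df v) (Dg v)) => x Ux.
by rewrite -deriveD//; apply/diff_derivable; [exact: df|exact: dg].
Qed.

Lemma Ck_sum V W k (U : set V) m (f : 'I_m -> V -> W) : open U ->
  (forall i, Ck k U (f i)) -> Ck k U (fun x => \sum_i f i x).
Proof.
move=> oU; elim: m f => [|m IH] f h.
  by apply: (Ck_eq oU) (Ck_cst k U 0) => x _; rewrite big_ord0.
apply: (Ck_eq oU) (CkD oU (h ord0) (IH (fun i => f (lift ord0 i)) _)).
  by move=> x _; rewrite big_ord_recl.
by move=> i; exact: h.
Qed.

Lemma Ck_comp_clin V W X k (U : set V) (f : V -> W) (l : W -> X) : open U ->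
  clin l -> Ck k U f -> Ck k U (fun x => l (f x)).
Proof.
move=> oU cl; elim: k f => [|k IH] f.
  by move=> hf x Ux; apply: continuous_comp; [exact: hf|exact: cl.2].
move=> [df Df]; split.
  move=> x Ux; apply: differentiable_comp; first exact: df.
  exact: clin_differentiable.
move=> v; apply: (Ck_eq oU) (IH _ (Df v)) => x Ux.
have dl := clin_differentiable (f x) cl.
rewrite [RHS]deriveE; last by apply: differentiable_comp => //; exact: df.
rewrite [in RHS]diff_comp//=; last exact: df.
by rewrite clin_diff// deriveE//; exact: df.
Qed.

Lemma CkZr V W k (U : set V) (f : V -> R) (w : W) : open U ->
  Ck k U f -> Ck k U (fun x => f x *: w).
Proof. by move=> oU; exact: (Ck_comp_clin oU (clin_scalel w)). Qed.

Lemma CkN V W k (U : set V) (f : V -> W) : open U ->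
  Ck k U f -> Ck k U (fun x => - f x).
Proof.
move=> oU hf; apply: (Ck_eq oU) (Ck_comp_clin oU (clin_scaler W (-1)) hf) => x _.
by rewrite scaleN1r.
Qed.

Lemma CkM V k (U : set V) (f g : V -> R) : open U ->
  Ck k U f -> Ck k U g -> Ck k U (fun x => f x * g x).
Proof.
move=> oU; elim: k f g => [|k IH] f g.
  by move=> hf hg x Ux; apply: cvgM; [exact: hf|exact: hg].
move=> hf hg; have [df Df] := hf; have [dg Dg] := hg; split.
  by move=> x Ux; apply: differentiableM; [exact: df|exact: dg].
move=> v; apply: (Ck_eq oU) (CkD oU (IH _ _ (CkW hf) (Dg v)) (IH _ _ (CkW hg) (Df v))).
by move=> x Ux; rewrite -deriveM//; apply/diff_derivable; [exact: df|exact: dg].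
Qed.

Lemma CkV V k (U : set V) (f : V -> R) : open U ->
  (forall x, U x -> f x != 0) -> Ck k U f -> Ck k U (fun x => (f x)^-1).
Proof.
move=> oU f0; elim: k => [|k IH] hf.
  by move=> x Ux; apply: cvgV; [exact: f0|exact: hf].
have [df Df] := hf; split.
  by move=> x Ux; apply: differentiableV; [exact: df|exact: f0].
move=> v; have hi := IH (CkW hf).
apply: (Ck_eq oU) (CkN oU (CkM oU (CkM oU hi hi) (Df v))) => x Ux.
rewrite [RHS]deriveV; [|exact: f0|exact/diff_derivable/df].
by rewrite expr2 invfM -mulNr.
Qed.

Lemma Ck_coords V W k (U : set V) (f : V -> W) : open U -> findim W ->
  (forall l : W -> R, clin l -> Ck k U (fun x => l (f x))) -> Ck k U f.
Proof.
move=> oU [m [e [l [cl el]]]] h.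
have := Ck_sum oU (fun i => CkZr (e i) oU (h _ (cl i))).
by apply: (Ck_eq oU) => x _; rewrite -el.
Qed.

Lemma CkZ V W k (U : set V) (f : V -> R) (g : V -> W) : open U -> findim W ->
  Ck k U f -> Ck k U g -> Ck k U (fun x => f x *: g x).
Proof.
move=> oU fW hf hg; apply: Ck_coords => // l cl.
apply: (Ck_eq oU) (CkM oU hf (Ck_comp_clin oU cl hg)) => x _.
by rewrite (clinZ _ _ cl).
Qed.

Lemma Ck_pair V W X k (U : set V) (f : V -> W) (g : V -> X) : open U ->
  Ck k U f -> Ck k U g -> Ck k U (fun x => (f x, g x)).
Proof.
move=> oU hf hg.
have c1 : clin (fun w : W => (w, 0 : X)).
  by apply: clin_pair; [exact: clin_id|exact: clin_zero].
have c2 : clin (fun w : X => (0 : W, w)).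
  by apply: clin_pair; [exact: clin_zero|exact: clin_id].
apply: (Ck_eq oU) (CkD oU (Ck_comp_clin oU c1 hf) (Ck_comp_clin oU c2 hg)).
by move=> x _; rewrite pairDE addr0 add0r.
Qed.

(** The chain rule differentiates [g] in the direction ['D_v f x], which moves with [x]. Expanded in
    coordinates of [W] it becomes [\sum_i l i ('D_v f x) *: 'D_(e i) g (f x)], to which the
    induction hypothesis applies. *)
Lemma Ck_comp V W X k (U : set V) (U' : set W) (f : V -> W) (g : W -> X) :
  open U -> open U' -> findim W -> findim X ->
  (forall x, U x -> U' (f x)) ->
  Ck k U f -> Ck k U' g -> Ck k U (fun x => g (f x)).
Proof.
move=> oU oU' fW fX fU; have [m [e [l [cl el]]]] := fW.
elim: k g => [|k IH] g.
  move=> hf hg x Ux; apply: continuous_comp; first exact: hf.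
  by apply: hg; exact: fU.
move=> hf [dg Dg]; have [df Df] := hf; split.
  by move=> x Ux; apply: differentiable_comp; [exact: df|exact/dg/fU].
move=> v.
have h i : Ck k U (fun x => l i ('D_v f x) *: 'D_(e i) g (f x)).
  apply: CkZ => //; first exact: Ck_comp_clin (cl i) (Df v).
  by apply: IH (Dg _); exact: CkW.
apply: (Ck_eq oU) (Ck_sum oU h) => x Ux.
have dfx := df x Ux; have dgx := dg _ (fU x Ux).
rewrite [RHS]deriveE; last exact: differentiable_comp.
rewrite diff_comp//= -(deriveE v dfx).
rewrite [in RHS](el ('D_v f x)) (clin_sum _ (clin_of_diff dgx)).
by apply: eq_bigr => i _; rewrite (clinZ _ _ (clin_of_diff dgx)) (deriveE _ dgx).
Qed.

(** Joint regularity in the point and the direction: by linearity of ['d f x] the map is a sum of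
    coordinates of the direction times the partial derivatives ['D_(e i) f]. *)
Lemma Ck_diff V W k (U : set V) (f : V -> W) : open U -> findim V -> findim W ->
  Ck k.+1 U f ->
  Ck k [set z : V * V | U z.1] (fun z : V * V => 'd f (z.1) (z.2)).
Proof.
move=> oU fV fW [df Df]; have [m [e [l [cl el]]]] := fV.
have oU2 : open [set z : V * V | U z.1].
  by apply: open_comp => // z _; exact: cvg_fst.
have h i : Ck k [set z : V * V | U z.1] (fun z => l i z.2 *: 'D_(e i) f (z.1)).
  apply: CkZ => //.
    by apply: Ck_clin; exact: (clin_comp (clin_snd _ _) (cl i)).
  apply: (Ck_comp oU2 oU) (Df (e i)) => //.
  by apply: Ck_clin; exact: clin_fst.
apply: (Ck_eq oU2) (Ck_sum oU2 h) => -[x v] /= Ux.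
have dfx := df x Ux.
rewrite [in RHS](el v) (clin_sum _ (clin_of_diff dfx)).
by apply: eq_bigr => i _; rewrite (clinZ _ _ (clin_of_diff dfx)) deriveE.
Qed.

Lemma diff_compE V W X (f : V -> W) (g : W -> X) x v :
  differentiable f x -> differentiable g (f x) ->
  'd (fun y => g (f y)) x v = 'd g (f x) ('d f x v).
Proof. by move=> df dg; rewrite (@diff_comp _ _ _ _ f g x). Qed.

Lemma derive_compE V W X (f : V -> W) (g : W -> X) x v :
  differentiable f x -> differentiable g (f x) ->
  'D_v (fun y => g (f y)) x = 'd g (f x) ('D_v f x).
Proof.
move=> df dg; rewrite deriveE; last exact: differentiable_comp.
by rewrite diff_compE// (deriveE v df).
Qed.

Lemma derive_cocycle V W X (f : V -> W) (g : W -> X) (h : V -> X) y w :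
  differentiable f y -> differentiable g (f y) -> (\near y, g (f y) = h y) ->
  'D_('D_w f y) g (f y) = 'D_w h y.
Proof.
move=> df dg fgh; rewrite -(near_eq_derive _ fgh) (derive_compE w df dg).
exact: deriveE.
Qed.

Lemma derive_near_id V (f : V -> V) y w : (\near y, f y = y) -> 'D_w f y = w.
Proof.
by move=> e; rewrite (near_eq_derive _ e) derive_id.
Qed.

Lemma derive_clin V W (f : V -> W) y : differentiable f y ->
  clin (fun w => 'D_w f y).
Proof.
move=> df; have -> : (fun w => 'D_w f y) = 'd f y.
  by apply/funext => w; exact: deriveE.
exact: clin_of_diff.
Qed.

Lemma Cr_comp V W X (U : set V) (U' : set W) (f : V -> W) (g : W -> X) :
  open U -> open U' -> findim W -> findim X ->
  (forall x, U x -> U' (f x)) ->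
  Cr None U f -> Cr None U' g -> Cr None U (fun x => g (f x)).
Proof.
by move=> oU oU' fW fX fU hf hg m; exact: (Ck_comp oU oU' fW fX fU (hf m) (hg m)).
Qed.

Lemma Cr_eq V W (U : set V) (f g : V -> W) : open U ->
  (forall x, U x -> f x = g x) -> Cr None U f -> Cr None U g.
Proof. by move=> oU fg hf m; exact: (Ck_eq oU fg (hf m)). Qed.

Lemma Cr_sub V W (U U' : set V) (f : V -> W) : U' `<=` U ->
  Cr None U f -> Cr None U' f.
Proof. by move=> s hf m; exact: Ck_sub s (hf m). Qed.

Lemma Cr_at V W (U : set V) (f : V -> W) :
  (forall x, U x -> exists2 U' : set V, U' x & Cr None U' f) -> Cr None U f.
Proof.
move=> h m; apply/Ck_at => x /h [U' U'x /(_ m) hf].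
by apply: Ck_sub hf => y ->.
Qed.

Lemma Cr_pair V W X (U : set V) (f : V -> W) (g : V -> X) : open U ->
  Cr None U f -> Cr None U g -> Cr None U (fun x => (f x, g x)).
Proof. by move=> oU hf hg m; exact: (Ck_pair oU (hf m) (hg m)). Qed.

Lemma Cr_clin V W (U : set V) (f : V -> W) : clin f -> Cr None U f.
Proof. by move=> cf m; exact: Ck_clin. Qed.

Lemma Cr_continuous V W (U : set V) (f : V -> W) x :
  Cr None U f -> U x -> {for x, continuous f}.
Proof. by move=> hf; exact: Ck_continuous (hf 0%N). Qed.

Lemma Cr_S V W (U : set V) (f : V -> W) v :
  Cr None U f -> Cr None U (fun x => 'D_v f x).
Proof. by move=> h m; exact: (h m.+1).2. Qed.

Lemma Cr_differentiable V W (U : set V) (f : V -> W) x :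
  Cr None U f -> U x -> differentiable f x.
Proof. by move=> h Ux; exact: (h 1%N).1. Qed.

(** Linearity in [v] reduces the bound to finitely many partial derivatives; by continuity each is
    bounded near [x0] by its norm at [x0] plus one. The summand [1] in the constant keeps it
    positive when the sum is empty. *)
Lemma Ck_locally_bounded V W (U : set V) (f : V -> W) (x0 : V) :
  open U -> findim V -> U x0 -> Ck 1 U f ->
  exists d K : R, [/\ 0 < d, 0 < K, ball x0 d `<=` U &
    forall x v, ball x0 d x -> `|'D_v f x| <= K * `|v|].
Proof.
move=> oU fV Ux0 [df Df]; have [m [e [l [cl el]]]] := fV.
have [c hc] : {c : 'I_m -> R & forall i, 0 < c i /\ forall x, `|l i x| <= c i * `|x|}.
  apply: (@choice _ _ (fun i c => 0 < c /\ forall x, `|l i x| <= c * `|x|)) => i.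
  by have [k k0 hk] := clin_bound (cl i); exists k.
have nb : \forall x \near x0, U x /\
   forall i, `|'D_(e i) f x| < `|'D_(e i) f x0| + 1.
  apply: filterI; first exact: open_nbhs_nbhs.
  apply: filter_forall => i.
  have h : 'D_(e i) f x @[x --> x0] --> 'D_(e i) f x0 := Df (e i) x0 Ux0.
  by apply: (cvgr_norm_lt _ h); rewrite ltrDl.
have /nbhs_ballP [d d0 hd] := nb.
exists d, (1 + \sum_i c i * (`|'D_(e i) f x0| + 1)); split=> //.
- rewrite ltr_pwDl// sumr_ge0// => i _.
  by rewrite mulr_ge0// ?addr_ge0//; have [/ltW] := hc i.
- by move=> x /hd[].
move=> x v /hd[Ux hx]; rewrite deriveE; last exact: df.
rewrite {1}(el v) (clin_sum _ (clin_of_diff (df x Ux))).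
apply: le_trans (ler_norm_sum _ _ _) _.
rewrite mulrDl mul1r ler_wpDl// mulr_suml; apply: ler_sum => i _.
rewrite (clinZ _ _ (clin_of_diff (df x Ux))) normrZ -deriveE; last exact: df.
rewrite mulrAC; apply: ler_pM => //; first by have [_ ->] := hc i.
by apply: ltW; exact: hx.
Qed.

Lemma ball_segment V (x0 x y : V) (d t : R) : 0 <= t <= 1 ->
  ball x0 d x -> ball x0 d y -> ball x0 d (y + t *: (x - y)).
Proof.
move=> /andP[t0 t1]; rewrite -!ball_normE /ball_ /= => bx by_.
have -> : x0 - (y + t *: (x - y)) = t *: (x0 - x) + (1 - t) *: (x0 - y).
  rewrite scalerBl scale1r [RHS]addrCA -scalerBr opprD addrA -scalerN !opprB.
  by congr (_ + _ *: _); rewrite [RHS]addrC addrA subrK.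
move: t0; rewrite le_eqVlt => /predU1P[<-|t0]; first by rewrite scale0r add0r subr0 scale1r.
apply: le_lt_trans (ler_normD _ _) _; rewrite !normrZ !ger0_norm ?subr_ge0// ?ltW//.
apply: (@lt_le_trans _ _ (t * d + (1 - t) * d)); last by rewrite -mulrDl addrC subrK mul1r.
by rewrite ltr_leD ?ltr_pM2l// ler_wpM2l ?subr_ge0// ltW.
Qed.

Lemma is_derive_line V W (f : V -> W) (y w : V) (t : R) :
  differentiable f (y + t *: w) ->
  is_derive t 1 (fun s : R => f (y + s *: w)) ('D_w f (y + t *: w)).
Proof.
move=> df; have dl : is_diff t (fun s : R => y + s *: w) (fun s : R => s *: w).
  have := is_diffD (is_diff_cst y t) (is_diff_scalel t w).
  by move=> h; apply: is_diff_eq h _; apply/funext => s; rewrite /= add0r.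
have d1 : differentiable (fun s : R => f (y + s *: w)) t.
  by apply: (@differentiable_comp _ _ _ _ (fun s : R => y + s *: w)) => //.
apply: DeriveDef; first exact: diff_derivable.
rewrite deriveE// (@diff_comp _ _ _ _ (fun s : R => y + s *: w) f t)//=.
by rewrite diff_val deriveE// scale1r.
Qed.

Lemma derive1_line V (f : V -> R) (y w : V) : differentiable f y ->
  derive1 (fun s : R => f (y + s *: w)) 0 = 'D_w f y.
Proof.
move=> df; have := @is_derive_line V _ f y w 0.
rewrite scale0r addr0 => /(_ df) h.
by rewrite derive1E; exact: derive_val.
Qed.

Lemma derive1_line2 V (f : V -> R) (U : set V) (y w : V) : open U -> U y ->
  Ck 2 U f ->
  derive1 (fun t : R => derive1 (fun s : R => f (y + t *: w + s *: w)) 0) 0 =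
  'D_w ('D_w f) y.
Proof.
move=> oU Uy [df Df].
rewrite -(derive1_line w ((Df w).1 _ Uy)) !derive1E; apply: near_eq_derive.
have c0 : {for 0, continuous (fun t : R => y + t *: w)}.
  by apply: continuousD; [exact: cvg_cst|exact: scalel_continuous].
have : \forall t \near (0 : R), U (y + t *: w).
  by apply: c0; rewrite scale0r addr0; exact: open_nbhs_nbhs.
by apply: filterS => t /df dt; rewrite -derive1_line.
Qed.

Lemma derive_scale V (f : V -> R) (a : R) (y w : V) : differentiable f y ->
  'D_w (fun z => a * f z) y = a * 'D_w f y.
Proof. by move=> df; apply: deriveMl; exact: diff_derivable. Qed.

Lemma pairZE V W (a : R) (v : V) (w : W) : a *: (v, w) = (a *: v, a *: w).
Proof. by []. Qed.

(** Rewrites the fundamental tensor, given by iterated one-variable derivatives, as a fibre Hessian,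
    the form on which the calculus above operates. *)
Lemma fundamental_derive2 V W (U : set (V * W)) (f : V * W -> R) (y : V) (w u : W) :
  open U -> U (y, w) -> Cr None U f ->
  2^-1 * derive1 (fun t : R => derive1 (fun s : R => f (y, w + t *: u + s *: u) ^+ 2) 0) 0 =
  'D_(0, u) ('D_(0, u) (fun z => 2^-1 * f z ^+ 2)) (y, w).
Proof.
move=> oU Uz hf.
have hf2 m : Ck m U (fun z => f z ^+ 2).
  by apply: (Ck_eq oU) (CkM oU (hf m) (hf m)) => x _; rewrite expr2.
have -> : (fun t : R => derive1 (fun s : R => f (y, w + t *: u + s *: u) ^+ 2) 0) =
   (fun t : R => derive1 (fun s : R => (fun z => f z ^+ 2) ((y, w) + t *: (0, u) + s *: (0, u))) 0).
  apply/funext => t; congr (derive1 _ 0); apply/funext => s.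
  by rewrite !pairZE !pairDE !scaler0 !addr0.
rewrite (derive1_line2 _ oU Uz (hf2 2%N)) -derive_scale; last exact: (((hf2 2%N).2 (0, u)).1 _ Uz).
apply: near_eq_derive; apply: filterS (open_nbhs_nbhs (conj oU Uz)) => x Ux.
by rewrite derive_scale//; exact: (hf2 1%N).1.
Qed.

Lemma Cr_derive2 V W (U : set V) (f : V -> W) : open U ->
  findim V -> findim W -> Cr None U f ->
  Cr None [set z : V * V | U z.1] (fun z : V * V => 'D_(z.2) f (z.1)).
Proof.
move=> oU fV fW hf m.
have oU2 : open [set z : V * V | U z.1].
  by apply: open_comp => // z _; exact: cvg_fst.
apply: (Ck_eq oU2) (Ck_diff oU fV fW (hf m.+1)) => z Uz.
by rewrite deriveE//; exact: (hf 1%N).1.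
Qed.

Lemma Cr_tangent V W (U : set V) (f : V -> W) : open U ->
  findim V -> findim W -> Cr None U f ->
  Cr None [set z : V * V | U z.1] (fun z : V * V => (f z.1, 'D_(z.2) f (z.1))).
Proof.
move=> oU fV fW hf.
have oU2 : open [set z : V * V | U z.1].
  by apply: open_comp => // z _; exact: cvg_fst.
apply: Cr_pair => //; last exact: Cr_derive2.
by apply: (@Cr_comp _ _ _ _ U fst f) => //; exact: Cr_clin (clin_fst V V).
Qed.

Lemma Ck1_lipschitz V (U : set V) (f : V -> R) (x0 : V) :
  open U -> findim V -> U x0 -> Ck 1 U f ->
  exists d K : R, [/\ 0 < d, 0 < K, ball x0 d `<=` U &
    forall x y, ball x0 d x -> ball x0 d y -> `|f x - f y| <= K * `|x - y|].
Proof.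
move=> oU fV Ux0 hf; have [d [K [d0 K0 dU hK]]] := Ck_locally_bounded oU fV Ux0 hf.
exists d, K; split=> // x y bx by_.
pose g (t : R) := f (y + t *: (x - y)).
have dg (t : R) : 0 <= t <= 1 -> is_derive t 1 g ('D_(x - y) f (y + t *: (x - y))).
  by move=> t01; apply: is_derive_line; apply: hf.1; apply: dU; exact: ball_segment.
have [||c cI] := @MVT_segment R g (fun t => 'D_(x - y) f (y + t *: (x - y))) 0 1 ler01.
- by move=> t; rewrite in_itv /= => /andP[/ltW a /ltW b]; apply: dg; rewrite a.
- by apply: derivable_within_continuous => t; rewrite in_itv /= => /dg h; exact: ex_derive.
rewrite /g scale1r scale0r addr0 subr0 mulr1 [y + (x - y)]addrC subrK => ->.
by apply: hK; apply: ball_segment => //; move: cI; rewrite in_itv.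
Qed.
End Ck.

(** * Charts *)

HB.lock Definition trans (R : realType) (n : nat) (M : manifold R n)
  (k k' : chart R n M) (y : 'rV[R]_n) : 'rV[R]_n := cmap k' (cinv k y).

HB.lock Definition dtr (R : realType) (n : nat) (M : manifold R n)
  (k k' : chart R n M) (y w : 'rV[R]_n) : 'rV[R]_n := 'D_w (trans k k') y.

Section Charts.
Context (R : realType) (n : nat) (M : manifold R n).
Implicit Types (k c : chart R n M).

Definition tdom k k' : set 'rV[R]_n := cimg k `&` cinv k @^-1` cdom k'.

(* The exponential chart, although compatible with the atlas, need not be in it. *)
Definition smooth_chart k : Prop := forall c, atlas M c ->
  Cr None (tdom k c) (trans k c) /\ Cr None (tdom c k) (trans c k).

Lemma transD k k' : trans k k' = cmap k' \o cinv k.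
Proof. by rewrite unlock. Qed.

Lemma open_cimg k : open (cimg k). Proof. exact: cimg_open. Qed.
Lemma open_cdom k : open (cdom k). Proof. exact: cdom_open. Qed.

Lemma open_preimage_on (T U : topologicalType) (D : set T) (f : T -> U) (O : set U) :
  open D -> (forall x, D x -> {for x, continuous f}) -> open O ->
  open (D `&` f @^-1` O).
Proof.
move=> oD cf oO; rewrite openE => x [Dx Ofx]; apply: filterI.
  exact: open_nbhs_nbhs.
exact: (cf x Dx _ (open_nbhs_nbhs (conj oO Ofx))).
Qed.

Lemma open_tdom k k' : open (tdom k k').
Proof.
apply: open_preimage_on; [exact: cimg_open|exact: cinv_continuous|exact: cdom_open].
Qed.

Lemma atlas_smooth_chart c : atlas M c -> smooth_chart c.
Proof. by move=> ac c' ac'; split; rewrite transD; apply: atlas_compat. Qed.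

Lemma chart_at_atlas (x : M) : atlas M (chart_at x).
Proof. by rewrite /chart_at; case: cid => c []. Qed.

Lemma chart_at_dom (x : M) : cdom (chart_at x) x.
Proof. by rewrite /chart_at; case: cid => c []. Qed.

Lemma chart_at_smooth (x : M) : smooth_chart (chart_at x).
Proof. exact/atlas_smooth_chart/chart_at_atlas. Qed.

Lemma tdom_trans k k' y : tdom k k' y -> cinv k' (trans k k' y) = cinv k y.
Proof. by move=> [_ d]; rewrite transD /= cmapK. Qed.

Lemma tdom_sym k k' y : tdom k k' y -> tdom k' k (trans k k' y).
Proof.
move=> h; split; first by rewrite transD; apply: cmap_img; case: h.
by rewrite /preimage /= tdom_trans//; apply: cinv_dom; case: h.
Qed.

Lemma tdom_comp k1 k2 k3 y : tdom k1 k2 y -> tdom k1 k3 y ->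
  tdom k2 k3 (trans k1 k2 y).
Proof.
move=> h1 h2; split; first by rewrite transD; apply: cmap_img; case: h1.
by rewrite /preimage /= tdom_trans//; case: h2.
Qed.

Lemma transE k1 k2 k3 y : tdom k1 k2 y ->
  trans k2 k3 (trans k1 k2 y) = trans k1 k3 y.
Proof. by move=> h; rewrite (transD k2) /= (tdom_trans h) transD. Qed.

(** Each chart is compatible with the atlas, so near a given point the transition factors smoothly
    through an atlas chart around that point. *)
Lemma smooth_trans k1 k2 : smooth_chart k1 -> smooth_chart k2 ->
  Cr None (tdom k1 k2) (trans k1 k2).
Proof.
move=> s1 s2; apply: Cr_at => y hy.
pose c := chart_at (cinv k1 y).
have [h1 _] := s1 c (chart_at_atlas _); have [_ h2] := s2 c (chart_at_atlas _).
pose D := tdom k1 k2 `&` tdom k1 c.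
have oD : open D by apply: openI; exact: open_tdom.
exists D; first by split=> //; split; [case: hy|exact: chart_at_dom].
have Dc z : D z -> tdom c k2 (trans k1 c z) by move=> [z1 z2]; exact: tdom_comp.
have hD : Cr None D (trans k1 c) by apply: Cr_sub h1 => z [].
have := Cr_comp oD (@open_tdom c k2) (findim_rV R n) (findim_rV R n) Dc hD h2.
by apply: (Cr_eq oD) => z [_ z2]; rewrite (transE _ z2).
Qed.

Lemma trans_differentiable k1 k2 y : smooth_chart k1 -> smooth_chart k2 ->
  tdom k1 k2 y -> differentiable (trans k1 k2) y.
Proof. by move=> s1 s2; apply: Cr_differentiable; exact: smooth_trans. Qed.

Lemma dtrD k k' y w : dtr k k' y w = 'D_w (trans k k') y.
Proof. by rewrite dtr.unlock. Qed.

Lemma dtr_comp k1 k2 k3 y w : smooth_chart k1 -> smooth_chart k2 ->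
  smooth_chart k3 -> tdom k1 k2 y -> tdom k1 k3 y ->
  dtr k2 k3 (trans k1 k2 y) (dtr k1 k2 y w) = dtr k1 k3 y w.
Proof.
move=> s1 s2 s3 h2 h3; rewrite dtr.unlock.
have d12 := trans_differentiable s1 s2 h2.
have d23 := trans_differentiable s2 s3 (tdom_comp h2 h3).
apply: (derive_cocycle _ d12 d23).
have := open_nbhs_nbhs (conj (@open_tdom k1 k2) h2).
by apply: filterS => z hz; rewrite (transE _ hz).
Qed.

Lemma dtr_id k y w : cimg k y -> dtr k k y w = w.
Proof.
move=> h; rewrite dtr.unlock; apply: derive_near_id.
have := open_nbhs_nbhs (conj (@open_cimg k) h).
by apply: filterS => z hz; rewrite transD /= cinvK.
Qed.

Lemma tdom_refl k y : cimg k y -> tdom k k y.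
Proof. by move=> h; split=> //; exact: cinv_dom. Qed.

Lemma dtrK k1 k2 y w : smooth_chart k1 -> smooth_chart k2 ->
  tdom k1 k2 y -> dtr k2 k1 (trans k1 k2 y) (dtr k1 k2 y w) = w.
Proof.
move=> s1 s2 h; rewrite dtr_comp ?dtr_id//; first by case: h.
by apply: tdom_refl; case: h.
Qed.

Lemma dtr_clin k1 k2 y : smooth_chart k1 -> smooth_chart k2 ->
  tdom k1 k2 y -> clin (dtr k1 k2 y).
Proof.
move=> s1 s2 h; rewrite dtr.unlock; apply: derive_clin.
exact: trans_differentiable.
Qed.

Lemma tdom_chart_at k y : cimg k y -> tdom k (chart_at (cinv k y)) y.
Proof. by move=> h; split=> //; exact: chart_at_dom. Qed.

Lemma of_coordE k y w : smooth_chart k -> cimg k y ->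
  of_coord k y w = dtr k (chart_at (cinv k y)) y w.
Proof.
move=> s h; rewrite dtr.unlock /of_coord -transD; symmetry; apply: deriveE.
exact: (trans_differentiable s (chart_at_smooth _) (tdom_chart_at h)).
Qed.

(** The cocycle law, read in the preferred chart of the common point. It makes admissibility of a
    vector and its [F]-norm independent of the chart in which they are computed. *)
Lemma of_coord_trans k1 k2 y w : smooth_chart k1 -> smooth_chart k2 ->
  tdom k1 k2 y -> of_coord k2 (trans k1 k2 y) (dtr k1 k2 y w) = of_coord k1 y w.
Proof.
move=> s1 s2 h; have h1 : cimg k1 y by case: h.
have h2 : cimg k2 (trans k1 k2 y) by case: (tdom_sym h).
rewrite !of_coordE// (tdom_trans h).
exact: (dtr_comp w s1 s2 (chart_at_smooth _) h (tdom_chart_at h1)).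
Qed.

Lemma of_coord_clin k y : smooth_chart k -> cimg k y -> clin (of_coord k y).
Proof.
move=> s h; have -> : of_coord k y = dtr k (chart_at (cinv k y)) y.
  by apply/funext => w; exact: of_coordE.
exact: (dtr_clin s (chart_at_smooth _) (tdom_chart_at h)).
Qed.

Lemma of_coord_bij k y : smooth_chart k -> cimg k y ->
  exists g, cancel (of_coord k y) g /\ cancel g (of_coord k y).
Proof.
move=> s h; have t := tdom_chart_at h.
set c := chart_at (cinv k y) in t *; have sc : smooth_chart c := chart_at_smooth _.
exists (dtr c k (trans k c y)); split => w; rewrite of_coordE//.
  exact: (dtrK _ s sc t).
have := dtrK w sc s (tdom_sym t); rewrite (transE _ t).
by have -> : trans k k y = y by rewrite transD /= cinvK.
Qed.

Lemma of_coord_eq0 k y w : smooth_chart k -> cimg k y ->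
  (of_coord k y w == 0) = (w == 0).
Proof.
move=> s h; have [g [gK _]] := of_coord_bij s h.
have o0 : of_coord k y 0 = 0 := clin0 (of_coord_clin s h).
apply/eqP/eqP => [e|->]; last exact: o0.
by rewrite -(gK w) e -[X in g X]o0 gK.
Qed.

Lemma of_coord_chart_at (x : M) w :
  of_coord (chart_at x) (cmap (chart_at x) x) w = w.
Proof.
have h : cimg (chart_at x) (cmap (chart_at x) x) by apply: cmap_img; exact: chart_at_dom.
rewrite of_coordE//; last exact: chart_at_smooth.
rewrite cmapK; last exact: chart_at_dom.
exact: dtr_id.
Qed.

Section LocalRep.
Context (V : normedModType R).

(** The representative [g] lives on an open [W] that may stick out of [S]: for a curve on a closed
    interval it extends beyond the endpoint. The chart is free, whereas [Cr_map] imposes the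
    preferred chart at the image point. *)
Definition locrep (S : set V) (f : V -> M) (x : V) k : Prop :=
  exists (W : set V) (g : V -> 'rV[R]_n),
    [/\ open W, W x, Cr None W g, (forall y, W y -> cimg k (g y)) &
        forall y, S y -> W y -> f y = cinv k (g y)].

Lemma locrep_trans (S : set V) (f : V -> M) (x : V) k k' :
  smooth_chart k -> smooth_chart k' -> S x -> cdom k' (f x) ->
  locrep S f x k -> locrep S f x k'.
Proof.
move=> s s' Sx dx [W [g [oW Wx hg gi fg]]].
pose W' := W `&` g @^-1` tdom k k'.
have oW' : open W'.
  apply: open_preimage_on; [exact: oW| |exact: open_tdom].
  by move=> y Wy; apply: Cr_continuous hg Wy.
exists W', (trans k k' \o g); split=> //.
- by split=> //; split; [exact: gi|rewrite /preimage /= -fg].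
- have h1 : Cr None W' g by apply: Cr_sub hg => y [].
  have h2 y : W' y -> tdom k k' (g y) by case.
  exact: (Cr_comp oW' (@open_tdom k k') (findim_rV R n) (findim_rV R n) h2 h1 (smooth_trans s s')).
- by move=> y [_ /tdom_sym[]].
- by move=> y Sy [Wy ty]; rewrite /= tdom_trans// fg.
Qed.

Lemma Cr_map_locrep (S : set V) (f : V -> M) (x : V) k :
  smooth_chart k -> Cr_map None S f -> S x -> cdom k (f x) -> locrep S f x k.
Proof.
move=> s hf Sx dx; apply: (locrep_trans (chart_at_smooth (f x))) => //.
have [U [oU Ux fU hU]] := hf x Sx.
have [U' [g [oU' U'x hg fg]]] := hU x (conj Sx Ux).
set c := chart_at (f x) in fU hU fg *.
pose W := (U `&` U') `&` g @^-1` cimg c.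
have oW : open W.
  apply: open_preimage_on; [exact: openI| |exact: cimg_open].
  by move=> y [_ Wy]; apply: Cr_continuous hg Wy.
exists W, g; split=> //.
- split=> //; rewrite /preimage /= -fg//.
  by apply: cmap_img; exact: chart_at_dom.
- by move=> m; apply: Ck_sub (hg m) => y [[]].
- by move=> y [].
- by move=> y Sy [[Uy U'y] _]; rewrite -(fg y)//= cmapK//; exact: fU.
Qed.

Lemma locrep_Cr_map (S : set V) (f : V -> M) :
  (forall x, S x -> exists2 k, smooth_chart k & locrep S f x k) ->
  Cr_map None S f.
Proof.
move=> h x Sx; have [k s hk] := h x Sx.
have [W [g [oW Wx hg gi fg]]] :=
  locrep_trans s (chart_at_smooth (f x)) Sx (chart_at_dom (f x)) hk.
exists W; split=> //.
  by move=> y Sy Wy; rewrite (fg y)//; apply: cinv_dom; exact: gi.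
move=> y [Sy Wy]; exists W, g; split=> // z [Sz _] Wz.
by rewrite /= (fg z)// cinvK//; exact: gi.
Qed.

Lemma locrep_continuous (S : set V) (f : V -> M) (x : V) k : locrep S f x k ->
  S x -> f y @[y --> within S (nbhs x)] --> f x.
Proof.
move=> [W [g [oW Wx hg gi fg]]] Sx; rewrite (fg x)//.
apply: (@cvg_trans _ ((cinv k \o g) @ within S (nbhs x))).
  apply: near_eq_cvg; rewrite near_withinE.
  have := open_nbhs_nbhs (conj oW Wx); apply: filterS => y Wy Sy.
  by rewrite /= -fg.
apply: cvg_within_filter; apply: continuous_comp.
  exact: Cr_continuous hg Wx.
by apply: cinv_continuous; exact: gi.
Qed.

End LocalRep.

Section Velocity.

(* One-sided and two-sided velocities are all limits of the same quotient *)
(* along a filter that refines the punctured neighbourhood filter. *)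
Lemma quotient_cvg k (c : R -> M) (g : R -> 'rV[R]_n) (t : R)
    (G : set_system R) {FG : Filter G} :
  smooth_chart k -> G `=>` 0^' ->
  c t = cinv k (g t) -> cimg k (g t) -> differentiable g t ->
  (\forall h \near G, c (t + h) = cinv k (g (t + h))) ->
  let f := cmap (chart_at (c t)) \o c in
  h^-1 *: (f (t + h) - f t) @[h --> G] --> of_coord k (g t) ('D_1 g t).
Proof.
move=> s hG ct gi dg cg f.
have td : tdom k (chart_at (c t)) (g t).
  by rewrite ct; exact: tdom_chart_at.
have dT := trans_differentiable s (chart_at_smooth (c t)) td.
have dTg : differentiable (trans k (chart_at (c t)) \o g) t.
  exact: differentiable_comp.
have -> : of_coord k (g t) ('D_1 g t) = 'D_1 (trans k (chart_at (c t)) \o g) t.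
    rewrite of_coordE// dtr.unlock -ct; symmetry.
  rewrite (derive_compE _ dg dT); symmetry; exact: deriveE.
set T := trans k (chart_at (c t)) in dT dTg *.
have dc : h^-1 *: (T (g (t + h)) - T (g t)) @[h --> 0^'] --> 'D_1 (T \o g) t.
  have : derivable (T \o g) t 1 by exact: diff_derivable.
  apply: cvg_trans; apply: near_eq_cvg; apply: nearW => h /=.
  have -> : h%:A = h by rewrite /GRing.scale /= mulr1.
  by rewrite [h + t]addrC.
apply: cvg_trans (cvg_trans (cvg_app _ hG) dc).
apply: near_eq_cvg; apply: filterS cg => h ch.
by rewrite /f /= ch /T transD /= -ct.
Qed.

Lemma velocityE k (c : R -> M) (g : R -> 'rV[R]_n) (t : R) :
  smooth_chart k -> cimg k (g t) -> differentiable g t ->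
  (\forall s \near t, c s = cinv k (g s)) ->
  velocity c t = of_coord k (g t) ('D_1 g t).
Proof.
move=> s gi dg cg; rewrite /velocity derive1E; apply/cvg_lim => //.
have := @quotient_cvg k c g t 0^' _ s (fun _ => id) (nbhs_singleton cg) gi dg.
have n0 : \forall h \near 0^', c (t + h) = cinv k (g (t + h)).
  have h0 : \forall h \near (0 : R), c (t + h) = cinv k (g (t + h)).
    have := (near_shift t (0 : R) (fun y => c (t + y) = cinv k (g (t + y)))).
    rewrite sub0r => ->; near=> y; rewrite /= addrCA subrr addr0.
    by near: y.
  exact: cvg_within h0.
move=> /(_ _ n0); apply: cvg_trans; apply: near_eq_cvg; apply: nearW => h /=.
have -> : h%:A = h by rewrite /GRing.scale /= mulr1.
by rewrite [h + t]addrC.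
Unshelve. all: by end_near. Qed.

Lemma right_velocityE k (c : R -> M) (g : R -> 'rV[R]_n) (t e : R) :
  smooth_chart k -> cimg k (g t) -> differentiable g t -> 0 < e ->
  (forall s, t <= s < t + e -> c s = cinv k (g s)) ->
  right_velocity c t = of_coord k (g t) ('D_1 g t).
Proof.
move=> s gi dg e0 cg; apply/cvg_lim => //.
apply: (quotient_cvg s) => //.
- move=> P; rewrite /dnbhs /at_right /within /= => h; near=> x => x0.
  by have := near h x; apply=> //; rewrite gt_eqF.
- by apply: cg; rewrite lexx ltrDl.
- near=> h; apply: cg; rewrite lerDl ltrD2l; apply/andP; split; last by near: h; exact: nbhs_right_lt.
  by near: h; exact: nbhs_right_ge.
Unshelve. all: by end_near. Qed.

Lemma left_velocityE k (c : R -> M) (g : R -> 'rV[R]_n) (t e : R) :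
  smooth_chart k -> cimg k (g t) -> differentiable g t -> 0 < e ->
  (forall s, t - e < s <= t -> c s = cinv k (g s)) ->
  left_velocity c t = of_coord k (g t) ('D_1 g t).
Proof.
move=> s gi dg e0 cg; apply/cvg_lim => //.
apply: (quotient_cvg s) => //.
- move=> P; rewrite /dnbhs /at_left /within /= => h; near=> x => x0.
  by have := near h x; apply=> //; rewrite lt_eqF.
- by apply: cg; rewrite lexx gtrDl oppr_lt0 e0.
- near=> h; apply: cg; rewrite ltrD2l gerDl; apply/andP; split; last by near: h; exact: nbhs_left_le.
  by near: h; apply: nbhs_left_gt; rewrite oppr_lt0.
Unshelve. all: by end_near. Qed.

End Velocity.
End Charts.

(** * The metric in coordinates *)

Section Finsler.
Context (R : realType) (n : nat) (M : manifold R n)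
  (A : M -> set 'rV[R]_n) (F : M -> 'rV[R]_n -> R) (hF : conic_finsler A F).
Implicit Types (k c : chart R n M).
Local Notation V := 'rV[R]_n.
Implicit Types (y v w u : V) (z : V * V).
Local Notation CS := (coord_set A).
Local Notation CF := (coord_fun F).

Definition ttrans k1 k2 (z : V * V) : V * V := (trans k1 k2 z.1, dtr k1 k2 z.1 z.2).

Lemma coord_set_trans k1 k2 z : smooth_chart k1 -> smooth_chart k2 ->
  tdom k1 k2 z.1 -> CS k2 (ttrans k1 k2 z) <-> CS k1 z.
Proof.
move=> s1 s2 h; rewrite /coord_set /= (tdom_trans h) of_coord_trans//.
have [h1 _] := h; have [h2 _] := tdom_sym h.
by split=> -[].
Qed.

Lemma coord_fun_trans k1 k2 z : smooth_chart k1 -> smooth_chart k2 ->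
  tdom k1 k2 z.1 -> CF k2 (ttrans k1 k2 z) = CF k1 z.
Proof.
by move=> s1 s2 h; rewrite /coord_fun /= (tdom_trans h) of_coord_trans.
Qed.

Lemma open_fst_tdom k1 k2 : open [set z : V * V | tdom k1 k2 z.1].
Proof. by apply: open_comp (@open_tdom _ _ _ k1 k2) => z _; exact: cvg_fst. Qed.

Lemma Cr_ttrans k1 k2 : smooth_chart k1 -> smooth_chart k2 ->
  Cr None [set z : V * V | tdom k1 k2 z.1] (ttrans k1 k2).
Proof.
move=> s1 s2; have o := @open_fst_tdom k1 k2.
have h := smooth_trans s1 s2.
have := Cr_tangent (@open_tdom _ _ _ k1 k2) (findim_rV R n) (findim_rV R n) h.
by apply: Cr_eq => // z _; rewrite /ttrans dtrD.
Qed.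

(** The axioms of a conic Finsler metric speak of atlas charts. The tangent map [ttrans] carries
    them to any compatible chart, in particular to the exponential chart. *)
Lemma open_coord_set k : smooth_chart k -> open (CS k).
Proof.
move=> s; rewrite openE => z [z1 Az].
pose c := chart_at (cinv k z.1).
have sc : smooth_chart c := chart_at_smooth _.
have td : tdom k c z.1 := tdom_chart_at z1.
have o : open ([set z : V * V | tdom k c z.1] `&` ttrans k c @^-1` CS c).
  apply: open_preimage_on; first exact: open_fst_tdom.
    by move=> x hx; apply: (Cr_continuous (Cr_ttrans s sc) hx).
  exact: cf_open hF _ (chart_at_atlas _).
have hz : ([set z : V * V | tdom k c z.1] `&` ttrans k c @^-1` CS c) z.
  by split=> //; apply/(coord_set_trans s sc td).
apply: filterS (open_nbhs_nbhs (conj o hz)) => x [hx1 hx2].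
exact/(coord_set_trans s sc hx1).
Qed.

Lemma open_nonzero : open [set z : V * V | z.2 != 0].
Proof.
have -> : [set z : V * V | z.2 != 0] = snd @^-1` ~` [set 0].
  by apply/seteqP; split=> z /= /eqP.
apply: open_comp; first by move=> z _; exact: cvg_snd.
rewrite openC; apply: accessible_closed_set1.
by apply: hausdorff_accessible; exact: norm_hausdorff.
Qed.

(** The slit domain: [F] is smooth there, possibly not at zero vectors. *)
Definition CSn k : set (V * V) := CS k `&` [set z | z.2 != 0].

Lemma open_CSn k : smooth_chart k -> open (CSn k).
Proof. by move=> s; apply: openI; [exact: open_coord_set|exact: open_nonzero]. Qed.

Lemma dtr_eq0 k1 k2 y w : smooth_chart k1 -> smooth_chart k2 ->
  tdom k1 k2 y -> (dtr k1 k2 y w == 0) = (w == 0).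
Proof.
move=> s1 s2 h; apply/eqP/eqP => [e|->]; last exact: (clin0 (dtr_clin s1 s2 h)).
by rewrite -(dtrK w s1 s2 h) e (clin0 (dtr_clin s2 s1 (tdom_sym h))).
Qed.

Lemma Cr_coord_fun k : smooth_chart k -> Cr None (CSn k) (CF k).
Proof.
move=> s; apply: Cr_at => z [[z1 Az] z2].
pose c := chart_at (cinv k z.1).
have sc : smooth_chart c := chart_at_smooth _.
have td : tdom k c z.1 := tdom_chart_at z1.
have o : open ([set z : V * V | tdom k c z.1] `&` ttrans k c @^-1` CSn c).
  apply: open_preimage_on; first exact: open_fst_tdom.
    by move=> x hx; apply: (Cr_continuous (Cr_ttrans s sc) hx).
  exact: open_CSn.
exists ([set z : V * V | tdom k c z.1] `&` ttrans k c @^-1` CSn c).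
  split=> //; split; first exact/(coord_set_trans s sc td).
  by rewrite /= dtr_eq0.
have h := cf_smooth hF (chart_at_atlas (cinv k z.1)).
have h1 : Cr None ([set z : V * V | tdom k c z.1] `&` ttrans k c @^-1` CSn c) (ttrans k c).
  by apply: Cr_sub (Cr_ttrans s sc) => x [].
have h2 x : ([set z : V * V | tdom k c z.1] `&` ttrans k c @^-1` CSn c) x -> CSn c (ttrans k c x) by case.
have := Cr_comp o (open_CSn sc) (findim_prod (findim_rV R n) (findim_rV R n)) (findim_R R) h2 h1 h.
by apply: Cr_eq => // x [hx _]; rewrite (coord_fun_trans s sc hx).
Qed.

Lemma coord_fun_continuous k z : smooth_chart k -> CS k z -> {for z, continuous (CF k)}.
Proof.
move=> s hz; have [z1 Az] := hz.
pose c := chart_at (cinv k z.1).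
have sc : smooth_chart c := chart_at_smooth _.
have td : tdom k c z.1 := tdom_chart_at z1.
have hc : {for ttrans k c z, continuous (CF c)}.
  apply: (cf_continuous hF (chart_at_atlas _)).
  exact/(coord_set_trans s sc td).
have ht : {for z, continuous (ttrans k c)} := Cr_continuous (Cr_ttrans s sc) td.
have := continuous_comp ht hc.
suff e : \near z, (CF c \o ttrans k c) z = CF k z.
  rewrite /continuous_at => h; suff : CF k @ z --> CF k z by [].
  rewrite -(nbhs_singleton e); apply: cvg_trans h; apply: near_eq_cvg.
  by apply: filterS e => x.
have := open_nbhs_nbhs (conj (@open_fst_tdom k c) td).
by apply: filterS => x hx; rewrite /= (coord_fun_trans s sc hx).
Qed.

Section Fibre.
Context (k : chart R n M) (s : smooth_chart k).

Let ofc y : cimg k y -> clin (of_coord k y).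
Proof. exact: of_coord_clin. Qed.

Lemma CS_conic y w l : CS k (y, w) -> 0 < l -> CS k (y, l *: w).
Proof.
move=> [/= hy Aw] l0; split=> //=; rewrite (clinZ _ _ (ofc hy)).
exact: (cf_conic hF).
Qed.

Lemma CF_homog y w l : CS k (y, w) -> 0 < l -> CF k (y, l *: w) = l * CF k (y, w).
Proof.
move=> [/= hy Aw] l0; rewrite /coord_fun /= (clinZ _ _ (ofc hy)).
exact: (cf_homog hF).
Qed.

Lemma CF_ge0 z : CS k z -> 0 <= CF k z.
Proof. by move=> [hy Aw]; exact: (cf_ge0 hF). Qed.

Lemma CF_eq0 z : CS k z -> CF k z = 0 <-> z.2 = 0.
Proof.
move=> [hy Aw]; rewrite /coord_fun (cf_eq0 hF Aw).
split=> /eqP; first by rewrite of_coord_eq0// => /eqP.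
by move=> h; apply/eqP; rewrite of_coord_eq0.
Qed.

Lemma CF_gt0 z : CSn k z -> 0 < CF k z.
Proof.
move=> [hz z2]; rewrite lt_neqAle CF_ge0// andbT eq_sym.
by apply: contra z2 => /eqP/(CF_eq0 hz)/eqP.
Qed.

Lemma CS_convex (hA : pointwise_convex A) y v w (t : R) :
  CS k (y, v) -> CS k (y, w) -> 0 <= t <= 1 -> CS k (y, w + t *: (v - w)).
Proof.
move=> [/= hy Av] [/= _ Aw] /andP[t0 t1]; split=> //=.
rewrite (clinD _ _ (ofc hy)) (clinZ _ _ (ofc hy)) (clinB _ _ (ofc hy)).
have := hA (cinv k y) (of_coord k y v) (of_coord k y w) (Itv01 t0 t1).
rewrite !inE => /(_ Av Aw).
have -> // : conv (Itv01 t0 t1) (of_coord k y v : convex_lmodType V) (of_coord k y w) =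
  of_coord k y w + t *: (of_coord k y v - of_coord k y w).
transitivity (t *: of_coord k y v + (1 - t) *: of_coord k y w) => //.
by rewrite scalerBl scale1r scalerBr addrCA.
Qed.

(** The energy density. With the factor [2^-1] its fibre Hessian is the fundamental tensor, and its
    fibre derivative at [v] along [v] is the square of the norm of [v]. *)
Definition lag (z : V * V) : R := 2^-1 * CF k z ^+ 2.

Lemma Cr_lag : Cr None (CSn k) lag.
Proof.
have o := open_CSn s; have h := Cr_coord_fun s => m.
have h2 := Ck_comp_clin o (clin_scaler R 2^-1) (CkM o (h m) (h m)).
by apply: (Ck_eq o) h2 => z _; rewrite /lag expr2.
Qed.

Lemma lag_homog y w l : CS k (y, w) -> 0 < l -> lag (y, l *: w) = l ^+ 2 * lag (y, w).
Proof. by move=> h l0; rewrite /lag CF_homog// exprMn mulrCA. Qed.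

(** [of_coord] is linear in the vector, so it carries the second derivatives that define the
    fundamental tensor to those of [coord_fun] in the fibre. *)
Lemma lag_posdef y w u : CSn k (y, w) -> u != 0 ->
  0 < 'D_(0, u) ('D_(0, u) lag) (y, w).
Proof.
move=> hz u0; have [[/= hy Aw] w0] := hz.
have h1 : of_coord k y w != 0 by rewrite of_coord_eq0.
have h2 : of_coord k y u != 0 by rewrite of_coord_eq0.
have := cf_posdef hF Aw h1 h2.
suff -> : fundamental_tensor F (cinv k y) (of_coord k y w) (of_coord k y u) (of_coord k y u) =
   'D_(0, u) ('D_(0, u) lag) (y, w) by [].
suff -> : fundamental_tensor F (cinv k y) (of_coord k y w) (of_coord k y u) (of_coord k y u) =
   'D_(0, u) ('D_(0, u) lag) (y, w) by [].
rewrite -(fundamental_derive2 _ (open_CSn s) hz (Cr_coord_fun s)) /fundamental_tensor.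
have e : (fun t0 s0 : R => F (cinv k y)
     (of_coord k y w + t0 *: of_coord k y u + s0 *: of_coord k y u) ^+ 2) =
   (fun t0 s0 : R => CF k (y, w + t0 *: u + s0 *: u) ^+ 2).
  apply/funext => t1; apply/funext => t2.
  by rewrite /coord_fun /= !(clinD _ _ (ofc hy)) !(clinZ _ _ (ofc hy)).
exact: (congr1 (fun f : R -> R -> R => 2^-1 * derive1 (fun t => derive1 (f t) 0) 0) e).
Qed.

End Fibre.
End Finsler.

(** * Lagrangian systems *)

Section OneVariable.
Context (R : realType).
Implicit Types V W : normedModType R.

Lemma is_derive_comp V W (g : R -> V) (h : V -> W) (t : R) (dg : V) :
  is_derive t 1 g dg -> differentiable h (g t) ->
  is_derive t 1 (fun s => h (g s)) ('D_dg h (g t)).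
Proof.
move=> [dvg <-] dh; have dfg : differentiable g t by exact/derivable1_diffP.
apply: DeriveDef; first by apply: diff_derivable; exact: differentiable_comp.
by rewrite (derive_compE _ dfg dh); symmetry; exact: deriveE.
Qed.

Lemma is_derive_clin V W (g : R -> V) (l : V -> W) (t : R) (dg : V) :
  is_derive t 1 g dg -> clin l -> is_derive t 1 (fun s => l (g s)) (l dg).
Proof.
move=> hg cl; rewrite -(clin_derive (g t) dg cl).
by apply: is_derive_comp => //; exact: clin_differentiable.
Qed.

Lemma is_derive_pair V W (f : R -> V) (g : R -> W) (t : R) (df : V) (dg : W) :
  is_derive t 1 f df -> is_derive t 1 g dg ->
  is_derive t 1 (fun s => (f s, g s)) (df, dg).
Proof.
move=> hf hg.
have c1 : clin (fun v : V => (v, 0 : W)).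
  by apply: clin_pair; [exact: clin_id|exact: clin_zero].
have c2 : clin (fun w : W => (0 : V, w)).
  by apply: clin_pair; [exact: clin_zero|exact: clin_id].
have := is_deriveD (is_derive_clin hf c1) (is_derive_clin hg c2).
rewrite pairDE addr0 add0r; congr is_derive; apply/funext => s.
by rewrite -[LHS]/((f s, 0) + (0, g s)) pairDE addr0 add0r.
Qed.

Lemma Cr_jet V (W : set R) (g : R -> V) : open W -> Cr None W g ->
  Cr None W (fun t => (g t, 'D_1 g t)).
Proof. by move=> oW hg; apply: Cr_pair => //; exact: Cr_S. Qed.

Lemma within_comp V W (D : set R) (g : R -> V) (h : V -> W) :
  {within D, continuous g} -> (forall t, D t -> {for g t, continuous h}) ->
  {within D, continuous (fun t => h (g t))}.
Proof.
move=> cg ch; apply/subspace_continuousP => t Dt.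
by move/subspace_continuousP: cg => /(_ t Dt) h1; apply: cvg_comp h1 _; exact: ch.
Qed.

Lemma within_pair V W (D : set R) (f : R -> V) (g : R -> W) :
  {within D, continuous f} -> {within D, continuous g} ->
  {within D, continuous (fun t => (f t, g t))}.
Proof.
move=> /subspace_continuousP cf /subspace_continuousP cg.
by apply/subspace_continuousP => t Dt; apply: cvg_pair; [exact: cf|exact: cg].
Qed.

Lemma within_itv_sub V (a b a' b' : R) (f : R -> V) : a <= a' -> b' <= b ->
  {within `[a, b], continuous f} -> {within `[a', b'], continuous f}.
Proof.
move=> aa bb; apply: continuous_subspaceW => t /=.
by rewrite !in_itv /= => /andP[h1 h2]; rewrite (le_trans aa h1) (le_trans h2 bb).
Qed.

Lemma abs_mvt (f df : R -> R) (a b M : R) : a <= b ->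
  {within `[a, b], continuous f} ->
  (forall t, a < t < b -> is_derive t 1 f (df t)) ->
  (forall t, a < t < b -> `|df t| <= M) -> `|f b - f a| <= M * (b - a).
Proof.
move=> ab cf hf hM; move: ab; rewrite le_eqVlt => /predU1P[<-|ab].
  by rewrite !subrr normr0 mulr0.
have hf' (t : R) : t \in `]a, b[%R -> is_derive t 1 f (df t).
  by rewrite in_itv /=; exact: hf.
have [c] := MVT ab hf' cf.
rewrite in_itv /= => hc ->; rewrite normrM [X in _ * X]ger0_norm ?subr_ge0 ?(ltW ab)//.
by rewrite ler_wpM2r ?subr_ge0 ?(ltW ab)//; exact: hM.
Qed.

(** The scalar mean value theorem applied to each coordinate. The price is a constant [K] that
    depends on the space alone and can be fixed before curves and intervals are chosen. *)
Lemma vec_mvt V : findim V -> exists2 K : R, 0 < K &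
  forall (f df : R -> V) (a b M : R), a <= b ->
  {within `[a, b], continuous f} ->
  (forall t, a < t < b -> is_derive t 1 f (df t)) ->
  (forall t, a < t < b -> `|df t| <= M) -> `|f b - f a| <= K * M * (b - a).
Proof.
move=> [m [e [l [cl el]]]].
have [c hc] : {c : 'I_m -> R & forall i, 0 < c i /\ forall x, `|l i x| <= c i * `|x|}.
  apply: (@choice _ _ (fun i c => 0 < c /\ forall x, `|l i x| <= c * `|x|)) => i.
  by have [k k0 hk] := clin_bound (cl i); exists k.
exists (1 + \sum_i c i * `|e i|).
  by rewrite ltr_pwDl// sumr_ge0// => i _; rewrite mulr_ge0//; have [/ltW] := hc i.
move=> f df a b M ab cf hf hM; move: ab; rewrite le_eqVlt => /predU1P[<-|ab].
  by rewrite !subrr normr0 mulr0.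
have M0 : 0 <= M.
  have h : a < (a + b) / 2 < b by rewrite midf_lt//= midf_lt.
  by apply: le_trans (hM _ h).
rewrite {1}(el (f b - f a)); apply: le_trans (ler_norm_sum _ _ _) _.
apply: (@le_trans _ _ ((\sum_i c i * `|e i|) * M * (b - a))); last first.
  by rewrite ler_wpM2r ?subr_ge0 ?(ltW ab)// ler_wpM2r// lerDr.
rewrite !mulr_suml.
apply: ler_sum => i _; rewrite normrZ.
have -> : c i * `|e i| * M * (b - a) = (c i * (M * (b - a))) * `|e i| by ring.
rewrite ler_wpM2r//.
rewrite (clinB _ _ (cl i)).
have := @abs_mvt (fun t => l i (f t)) (fun t => l i (df t)) a b (c i * M) (ltW ab).
rewrite -mulrA; apply.
- by apply: within_comp cf _ => t _; exact: (cl i).2.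
- by move=> t /hf h; exact: is_derive_clin.
- move=> t /hM h; apply: le_trans ((hc i).2 _) _.
  by rewrite ler_wpM2l//; have [/ltW] := hc i.
Qed.

Lemma abs_prod_le (p q h h0 a b e r : R) : `|p| <= a * r -> `|q| <= b * r ->
  `|h - h0| <= e -> `|p * (q * h) - p * (q * h0)| <= a * b * e * r ^+ 2.
Proof.
move=> hp hq hh; have -> : a * b * e * r ^+ 2 = ((a * r) * (b * r)) * e by ring.
have -> : p * (q * h) - p * (q * h0) = p * q * (h - h0) by ring.
by rewrite !normrM; apply: ler_pM => //; apply: ler_pM.
Qed.

End OneVariable.

(** * Local estimates for a Lagrangian that is positive definite in the fibres *)

Section Lagrangian.
Context (R : realType) (V : normedModType R) (fV : findim V)
  (cS : compact [set v : V | `|v| = 1])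
  (U : set (V * V)) (oU : open U) (L : V * V -> R) (hL : Cr None U L)
  (posL : forall (z : V * V) (u : V), U z -> u != 0 -> 0 < 'D_(0, u) ('D_(0, u) L) z).

Let fVV : findim (V * V)%type. Proof. exact: findim_prod. Qed.

Lemma derive_lin z (a : R) (u v : V * V) : U z ->
  'D_(a *: u + v) L z = a * 'D_u L z + 'D_v L z.
Proof.
move=> Uz; have dL := Cr_differentiable hL Uz.
exact: ((derive_clin dL).1 a u v).
Qed.

Lemma lag_lipschitz z0 : U z0 -> exists d C : R,
  [/\ 0 < d, 0 < C, ball z0 d `<=` U &
   (forall z1 z2 u, ball z0 d z1 -> ball z0 d z2 ->
      `|'D_u L z1 - 'D_u L z2| <= C * `|u| * `|z1 - z2|) /\
   (forall z u, ball z0 d z -> `|'D_u L z| <= C * `|u|)].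
Proof.
move=> Uz0; have [m [e [l [cl el]]]] := fVV.
have [c hc] : {c : 'I_m -> R & forall i, 0 < c i /\ forall x, `|l i x| <= c i * `|x|}.
  apply: (@choice _ _ (fun i c => 0 < c /\ forall x, `|l i x| <= c * `|x|)) => i.
  by have [k k0 hk] := clin_bound (cl i); exists k.
have [d [K [d0 K0 dU hK]]] := Ck_locally_bounded oU fVV Uz0 (hL 1%N).
have [D hD] : {D : 'I_m -> R * R & forall i, [/\ 0 < (D i).1, 0 < (D i).2 &
   forall x y, ball z0 (D i).1 x -> ball z0 (D i).1 y ->
     `|'D_(e i) L x - 'D_(e i) L y| <= (D i).2 * `|x - y|]}.
  apply: (@choice _ _ (fun i D => [/\ 0 < D.1, 0 < D.2 &
   forall x y, ball z0 D.1 x -> ball z0 D.1 y ->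
     `|'D_(e i) L x - 'D_(e i) L y| <= D.2 * `|x - y|])) => i.
  have [d' [K' [d'0 K'0 _ h]]] := Ck1_lipschitz oU fVV Uz0 ((hL 2%N).2 (e i)).
  by exists (d', K').
have [r r0 hr] : exists2 r : R, 0 < r & forall i, r <= (D i).1.
  exists (\big[Num.min/1]_i (D i).1).
    by elim/big_ind : _ => // [x y x0 y0|i _]; [rewrite lt_min x0|have [] := hD i].
  by move=> i; rewrite (bigminD1 i)// ge_min lexx.
exists (Num.min d r), (K + \sum_i c i * (D i).2); split.
- by rewrite lt_min d0.
- by rewrite ltr_pwDl// sumr_ge0// => i _; rewrite mulr_ge0 ?ltW//; [have [] := hc i|have [] := hD i].
- by move=> x hx; apply: dU; apply: le_ball hx; rewrite ge_min lexx.
split; last first.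
  move=> z u hz; apply: (@le_trans _ _ (K * `|u|)).
    by apply: hK; apply: le_ball hz; rewrite ge_min lexx.
  rewrite ler_wpM2r// lerDl sumr_ge0// => i _.
  by rewrite mulr_ge0 ?ltW//; [have [] := hc i|have [] := hD i].
move=> z1 z2 u h1 h2.
have U1 : U z1 by apply: dU; apply: le_ball h1; rewrite ge_min lexx.
have U2 : U z2 by apply: dU; apply: le_ball h2; rewrite ge_min lexx.
have E z : U z -> 'D_u L z = \sum_i l i u * 'D_(e i) L z.
  move=> Uz; have dL := derive_clin (Cr_differentiable hL Uz).
  rewrite {1}(el u) (clin_sum _ dL); apply: eq_bigr => i _.
  by rewrite (clinZ _ _ dL).
rewrite !E// -sumrB; apply: le_trans (ler_norm_sum _ _ _) _.
apply: (@le_trans _ _ ((\sum_i c i * (D i).2) * `|u| * `|z1 - z2|)); last first.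
  by rewrite ler_wpM2r// ler_wpM2r// lerDr ltW.
rewrite !mulr_suml; apply: ler_sum => i _.
rewrite -mulrBr normrM.
have [_ Di0 hDi] := hD i.
apply: (@le_trans _ _ (c i * `|u| * ((D i).2 * `|z1 - z2|))).
  apply: ler_pM => //; first by have [_ ->] := hc i.
  apply: hDi; [apply: le_ball h1|apply: le_ball h2]; by rewrite ge_min (hr i) orbT.
by rewrite mulrACA -!mulrA.
Qed.

(** At [z0] the Hessian form has a positive minimum on the compact unit sphere. Its finitely many
    matrix entries are continuous, so half of that minimum survives nearby. *)
Lemma hess_lower z0 : U z0 -> exists d c : R,
  [/\ 0 < d, 0 < c, ball z0 d `<=` U &
   forall z (u : V), ball z0 d z -> c * `|u| ^+ 2 <= 'D_(0, u) ('D_(0, u) L) z].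
Proof.
move=> Uz0; have [m [e [l [cl el]]]] := fV.
have [a ha] : {a : 'I_m -> R & forall i, 0 < a i /\ forall x, `|l i x| <= a i * `|x|}.
  apply: (@choice _ _ (fun i c => 0 < c /\ forall x, `|l i x| <= c * `|x|)) => i.
  by have [k k0 hk] := clin_bound (cl i); exists k.
have dsum (f : V * V -> R) z (u : V) : differentiable f z ->
    'D_(0, u) f z = \sum_i l i u * 'D_(0, e i) f z.
  move=> df; have cL := clin_comp (clin_pair (clin_zero V V) (clin_id V)) (derive_clin df).
  transitivity ('D_(0, \sum_i l i u *: e i) f z); first by rewrite -el.
  apply: etrans (clin_sum (fun i => l i u *: e i) cL) _.
  by apply: eq_bigr => i _; exact: (clinZ _ _ cL).
pose H i j (z : V * V) : R := 'D_(0, e i) ('D_(0, e j) L) z.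
have H2 z (u : V) : U z -> 'D_(0, u) ('D_(0, u) L) z = \sum_i \sum_j l i u * (l j u * H i j z).
  move=> Uz.
  have E : \near z, 'D_(0, u) L z = \sum_j l j u * 'D_(0, e j) L z.
    apply: filterS (open_nbhs_nbhs (conj oU Uz)) => x Ux.
    exact: dsum (Cr_differentiable hL Ux).
  rewrite (near_eq_derive _ E).
  have dj j : differentiable ('D_(0, e j) L) z := ((hL 2%N).2 (0, e j)).1 _ Uz.
  have eS : (fun z => \sum_j l j u * 'D_(0, e j) L z) = \sum_j (fun z => l j u * 'D_(0, e j) L z).
    by apply/funext => x; rewrite fct_sumE.
  have dS : differentiable (fun z => \sum_j l j u * 'D_(0, e j) L z) z.
    by rewrite eS; apply: differentiable_sum => j; exact: (differentiableZ (l j u) (dj j)).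
  rewrite (dsum _ _ _ dS); apply: eq_bigr => i _.
  rewrite eS derive_sum; last first.
    by move=> j; apply: diff_derivable; exact: (differentiableZ (l j u) (dj j)).
  rewrite mulr_sumr; apply: eq_bigr => j _.
  by rewrite derive_scale.
(* Without unit vectors the space is trivial: every [u] is zero and any constant serves. *)
have [v0|nv0] := pselect (exists v : V, `|v| = 1); last first.
  have [d [C [d0 C0 dU _]]] := lag_lipschitz Uz0.
  exists d, 1; split=> // z u hz; have [->|u0] := eqVneq u 0.
    rewrite normr0 expr0n mulr0 H2; last exact: dU.
    by rewrite big1// => i _; rewrite big1// => j _; rewrite (clin0 (cl i)) mul0r.
  exfalso; apply: nv0; exists (`|u|^-1 *: u).
  by rewrite normrZ normfV normr_id mulVf// normr_eq0.
have cq : continuous (fun u : V => 'D_(0, u) ('D_(0, u) L) z0).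
  have -> : (fun u : V => 'D_(0, u) ('D_(0, u) L) z0) =
     (fun u => \sum_i \sum_j l i u * (l j u * H i j z0)).
    by apply/funext => u; rewrite H2.
  move=> u; apply: continuous_big => // [|i _]; first exact: add_continuous.
  apply: continuous_big => // [|j _]; first exact: add_continuous.
  move=> x; apply: cvgM; first exact: (cl i).2.
  by apply: cvgM; [exact: (cl j).2|exact: cvg_cst].
have [v /= v1 hv] : exists2 v : V, v \in [set v : V | `|v| = 1] &
    forall t, t \in [set v : V | `|v| = 1] ->
      'D_(0, v) ('D_(0, v) L) z0 <= 'D_(0, t) ('D_(0, t) L) z0.
  apply: (compact_EVT_min (f := fun u : V => 'D_(0, u) ('D_(0, u) L) z0)) => //.
  exact: continuous_subspaceT.
have [c0 c0E] : exists c0 : R, c0 = 'D_(0, v) ('D_(0, v) L) z0 by eexists.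
rewrite -c0E in hv.
have c0p : 0 < c0.
  rewrite c0E; apply: posL => //; move: v1; rewrite inE /= => v1.
  by rewrite -normr_eq0 v1 oner_eq0.
have hq (u : V) : c0 * `|u| ^+ 2 <= 'D_(0, u) ('D_(0, u) L) z0.
  have [->|u0] := eqVneq u 0.
    rewrite normr0 expr0n mulr0 H2//.
    by rewrite big1// => i _; rewrite big1// => j _; rewrite (clin0 (cl i)) mul0r.
  have n0 : `|u| != 0 by rewrite normr_eq0.
  have nu1 : [set v : V | `|v| = 1] (`|u|^-1 *: u).
    by rewrite /= normrZ normfV normr_id mulVf.
  have := hv _ (mem_set nu1); rewrite (H2 _ _ Uz0) (H2 _ _ Uz0) => h.
  have -> : \sum_i \sum_j l i u * (l j u * H i j z0) =
     (\sum_i \sum_j l i (`|u|^-1 *: u) * (l j (`|u|^-1 *: u) * H i j z0)) * `|u| ^+ 2.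
    rewrite mulr_suml; apply: eq_bigr => i _; rewrite mulr_suml; apply: eq_bigr => j _.
    by rewrite (clinZ _ _ (cl i)) (clinZ _ _ (cl j)) /GRing.scale /=; field.
  by rewrite ler_wpM2r ?exprn_ge0.
set S := \sum_i \sum_j a i * a j.
have S0 : 0 <= S.
  apply: sumr_ge0 => i _; apply: sumr_ge0 => j _.
  by rewrite mulr_ge0 ?ltW//; [exact: (ha i).1|exact: (ha j).1].
(* Moving each entry by at most [ep] moves the form by at most [S * ep * |u| ^+ 2], and
   [S * ep <= c0 / 2]. *)
pose ep : R := c0 / 2 / (1 + S).
have ep0 : 0 < ep by rewrite !divr_gt0// ltr_pwDl.
have hij i j : \forall z \near z0, `|H i j z - H i j z0| < ep.
  have h : {for z0, continuous (H i j)} := ((hL 2%N).2 (0, e j)).2 (0, e i) z0 Uz0.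
  have h' : H i j x @[x --> z0] --> H i j z0 := h.
  by move/cvgrPdistC_lt: h'; apply.
have hi i : \forall z \near z0, forall j, `|H i j z - H i j z0| < ep.
  exact: (@filter_forall _ _ _ (nbhs z0) _ (hij i)).
pose Q i z := forall j, `|H i j z - H i j z0| < ep.
have nQ : \forall z \near z0, forall i, Q i z.
  exact: (@filter_forall _ _ _ (nbhs z0) _ hi).
have nH : \forall z \near z0, U z /\ forall i, Q i z.
  by apply: filterI => //; exact: open_nbhs_nbhs.
have /nbhs_ballP [d d0 hd] := nH.
exists d, (c0 / 2); split; [exact: d0|by rewrite divr_gt0|by move=> z /hd[]|].
move=> z u /hd[Uz hz].
have : `|'D_(0, u) ('D_(0, u) L) z - 'D_(0, u) ('D_(0, u) L) z0| <= c0 / 2 * `|u| ^+ 2.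
  rewrite !H2// -sumrB; apply: le_trans (ler_norm_sum _ _ _) _.
  apply: (@le_trans _ _ (S * ep * `|u| ^+ 2)); last first.
    rewrite ler_wpM2r ?exprn_ge0// /ep mulrA ler_pdivrMr ?ltr_pwDl//.
    by rewrite mulrC ler_wpM2l ?lerDr// ltW// divr_gt0.
  rewrite !mulr_suml; apply: ler_sum => i _.
  rewrite -sumrB; apply: le_trans (ler_norm_sum _ _ _) _.
  rewrite !mulr_suml; apply: ler_sum => j _.
  exact: (abs_prod_le ((ha i).2 u) ((ha j).2 u) (ltW (hz i j))).
have := hq u; rewrite ler_distl => h1 /andP[h2 _]; apply: le_trans h2.
by rewrite lerBrDl; apply: le_trans h1; rewrite -mulrDl -splitr.
Qed.

(** The mean value theorem on a fibre segment turns the Hessian bound into strong monotonicity of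
    the momentum in the velocity. *)
Lemma lag_monotone z0 : U z0 -> exists d c : R,
  [/\ 0 < d, 0 < c, ball z0 d `<=` U &
   forall x y1 y2, ball z0 d (x, y1) -> ball z0 d (x, y2) ->
   c * `|y2 - y1| ^+ 2 <= 'D_(0, y2 - y1) L (x, y2) - 'D_(0, y2 - y1) L (x, y1)].
Proof.
move=> Uz0; have [d [c [d0 c0 dU h]]] := hess_lower Uz0.
exists d, c; split=> // x y1 y2 b1 b2.
set u := y2 - y1.
pose f (t : R) := 'D_(0, u) L ((x, y1) + t *: (0, u)).
have bt (t : R) : 0 <= t <= 1 -> ball z0 d ((x, y1) + t *: (0, u)).
  move=> ht; have := ball_segment ht b2 b1.
  by have -> : (x, y2) - (x, y1) = (0, u) by rewrite -[LHS]/(x - x, y2 - y1) subrr.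
have df (t : R) : 0 <= t <= 1 -> is_derive t 1 f ('D_(0, u) ('D_(0, u) L) ((x, y1) + t *: (0, u))).
  move=> /bt/dU Ut; apply: is_derive_line.
  exact: (((hL 2%N).2 (0, u)).1 _ Ut).
have [||s sI] := @MVT_segment R f (fun t => 'D_(0, u) ('D_(0, u) L) ((x, y1) + t *: (0, u))) 0 1 ler01.
- by move=> t; rewrite in_itv /= => /andP[/ltW a /ltW b]; apply: df; rewrite a.
- by apply: derivable_within_continuous => t; rewrite in_itv /= => /df ?; exact: ex_derive.
rewrite /f scale1r scale0r addr0 subr0 mulr1.
have -> : (x, y1) + (0, u) = (x, y2) by rewrite pairDE addr0 addrC subrK.
by move=> ->; apply: h; apply: bt; move: sI; rewrite in_itv.
Qed.

(** The third estimate recovers the velocity from the momentum. Monotonicity compares velocities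
    over a single base point, so the momentum at [(x1, y2)] is inserted; passing from there to
    [(x2, y2)] costs a Lipschitz term in [x1 - x2]. One factor [|y2 - y1|] then cancels. *)
Lemma lag_local z0 : U z0 -> exists d C : R,
  [/\ 0 < d, 0 < C, ball z0 d `<=` U &
  [/\ (forall z1 z2 u, ball z0 d z1 -> ball z0 d z2 ->
      `|'D_u L z1 - 'D_u L z2| <= C * `|u| * `|z1 - z2|),
      (forall z u, ball z0 d z -> `|'D_u L z| <= C * `|u|) &
      (forall x1 y1 x2 y2 (m : R), 0 <= m -> ball z0 d (x1, y1) -> ball z0 d (x2, y2) ->
        (forall u, `|'D_(0, u) L (x1, y1) - 'D_(0, u) L (x2, y2)| <= m * `|u|) ->
        `|y1 - y2| <= C * (m + `|x1 - x2|))]].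
Proof.
move=> Uz0; have [d1 [C1 [d10 C10 dU [h1 h2]]]] := lag_lipschitz Uz0.
have [d2 [c [d20 c0 _ h3]]] := lag_monotone Uz0.
have sb z : ball z0 (Num.min d1 d2) z -> ball z0 d1 z /\ ball z0 d2 z.
  by move=> hz; split; apply: le_ball hz; rewrite ge_min lexx ?orbT.
exists (Num.min d1 d2), (C1 + c^-1 * (1 + C1)); split.
- by rewrite lt_min d10.
- by rewrite addr_gt0 ?mulr_gt0 ?invr_gt0 ?addr_gt0.
- by move=> z /sb[/dU].
have CC : C1 <= C1 + c^-1 * (1 + C1).
  by rewrite lerDl mulr_ge0 ?invr_ge0 ?addr_ge0 ?ltW.
split.
- move=> z1 z2 u /sb[b1 _] /sb[b2 _]; apply: le_trans (h1 _ _ _ b1 b2) _.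
  by rewrite -!mulrA ler_wpM2r// mulr_ge0.
- by move=> z u /sb[b1 _]; apply: le_trans (h2 _ _ b1) _; rewrite ler_wpM2r.
move=> x1 y1 x2 y2 m m0 b1 b2 hm.
(* Balls of the product norm are products of balls, so the mixed point lies in the same ball. *)
have b12 : ball z0 (Num.min d1 d2) (x1, y2) by split; [exact: b1.1|exact: b2.2].
have n1 : `|(x1, y2) - (x2, y2)| = `|x1 - x2|.
  by rewrite -[(x1, y2) - (x2, y2)]/(x1 - x2, y2 - y2) subrr prod_normE /= normr0; apply/max_idPl.
have := h3 x1 y1 y2 (sb _ b1).2 (sb _ b12).2.
set u := y2 - y1 => hu.
have nu : `|((0 : V), u)| = `|u| by rewrite prod_normE /= normr0; apply/max_idPr.
have hu2 : c * `|u| ^+ 2 <= (m + C1 * `|x1 - x2|) * `|u|.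
  apply: le_trans hu _.
  have -> : 'D_(0, u) L (x1, y2) - 'D_(0, u) L (x1, y1) =
     ('D_(0, u) L (x1, y2) - 'D_(0, u) L (x2, y2)) + ('D_(0, u) L (x2, y2) - 'D_(0, u) L (x1, y1)).
    by rewrite addrA subrK.
  rewrite mulrDl addrC; apply: lerD.
    by apply: le_trans (ler_norm _) _; rewrite distrC; exact: hm.
  apply: le_trans (ler_norm _) _; have := h1 _ _ (0, u) (sb _ b12).1 (sb _ b2).1.
  by rewrite n1 nu mulrAC.
have ci0 : 0 < c^-1 by rewrite invr_gt0.
have q0 : 0 <= (c^-1 * C1) * m by rewrite !mulr_ge0// ltW.
have q1 : 0 <= c^-1 * `|x1 - x2| by rewrite mulr_ge0// ltW.
have q2 : 0 <= C1 * (m + `|x1 - x2|) by rewrite mulr_ge0 ?addr_ge0// ltW.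
rewrite distrC -/u; have [->|u0] := eqVneq u 0.
  by rewrite normr0 mulr_ge0 ?addr_ge0 ?mulr_ge0 ?addr_ge0 ?(ltW C10) ?(ltW ci0).
move: hu2; rewrite expr2 mulrA ler_pM2r ?normr_gt0// -ler_pdivlMl// => /le_trans; apply.
nra.
Qed.

(** The Euler-Lagrange equation as a first-order system. The velocity [y] is only continuous and it
    is the momentum that is differentiated: this is what variations give across breaks, before
    anything is known about the acceleration. *)
Definition EL (a b : R) (x y : R -> V) : Prop :=
  [/\ {within `[a, b], continuous x}, {within `[a, b], continuous y} &
   forall t : R, a < t < b -> is_derive t 1 x (y t) /\
     forall u, is_derive t 1 (fun s => 'D_(0, u) L (x s, y s)) ('D_(u, 0) L (x t, y t))].

Lemma EL_sub a b a' b' x y : a <= a' -> b' <= b -> EL a b x y -> EL a' b' x y.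
Proof.
move=> aa bb [cx cy h]; split; [exact: within_itv_sub cx|exact: within_itv_sub cy|].
by move=> t /andP[h1 h2]; apply: h; rewrite (le_lt_trans aa) ?(lt_le_trans h2).
Qed.

Lemma EL_momentum_continuous a b x y u : EL a b x y ->
  (forall t, a <= t <= b -> U (x t, y t)) ->
  {within `[a, b], continuous (fun s => 'D_(0, u) L (x s, y s))}.
Proof.
move=> [cx cy _] hU.
apply: (@within_comp _ _ _ _ (fun s => (x s, y s)) ('D_(0, u) L)); first exact: within_pair.
move=> t /=; rewrite in_itv /= => /hU Ut.
exact: (Cr_continuous (Cr_S (0, u) hL) Ut).
Qed.

Lemma normZ0 (u : V) : `|((0 : V), u)| = `|u|.
Proof. by rewrite prod_normE /= normr0; apply/max_idPr. Qed.

Lemma norm0Z (u : V) : `|(u, (0 : V))| = `|u|.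
Proof. by rewrite prod_normE /= normr0; apply/max_idPl. Qed.

Lemma norm_pairB_le (x1 x2 y1 y2 : V) : `|(x1, y1) - (x2, y2)| <= `|x1 - x2| + `|y1 - y2|.
Proof.
rewrite -[(x1, y1) - (x2, y2)]/(x1 - x2, y1 - y2) prod_normE /=.
by rewrite ge_max lerDl lerDr !normr_ge0.
Qed.

(** Gronwall by absorption. Let [S] be the maximum of [D = |x1 - x2| + |y1 - y2|]. Integrating the
    equation bounds the differences of positions and of momenta by a multiple of [D a] plus a
    multiple of [S * (t - a)]; recovering velocities from momenta yields
    [S <= B1 * D a + B2 * (c - a) * S], where [c] is the point of maximum, and on a short interval
    the last term is absorbed. The second part integrates a single solution: its velocity is
    Lipschitz in time, so its position is quadratically close to a straight line. *)
Lemma EL_stab z0 : U z0 -> exists d T C : R,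
  [/\ 0 < d, 0 < T, 0 < C, ball z0 d `<=` U &
  (forall a b x1 y1 x2 y2, a <= b <= a + T -> EL a b x1 y1 -> EL a b x2 y2 ->
    (forall t, a <= t <= b -> ball z0 d (x1 t, y1 t)) ->
    (forall t, a <= t <= b -> ball z0 d (x2 t, y2 t)) ->
    forall t, a <= t <= b -> `|y1 t - y2 t| <= C * (`|x1 a - x2 a| + `|y1 a - y2 a|) /\
     `|x1 t - x2 t| <= `|x1 a - x2 a| + C * (t - a) * (`|x1 a - x2 a| + `|y1 a - y2 a|)) /\
  (forall a b x y, a <= b <= a + T -> EL a b x y ->
    (forall t, a <= t <= b -> ball z0 d (x t, y t)) ->
    forall t, a <= t <= b -> `|y t - y a| <= C * (t - a) /\
      `|x t - x a - (t - a) *: y a| <= C * (t - a) ^+ 2)].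
Proof.
move=> Uz0; have [d [C [d0 C0 dU [h1 h2 h3]]]] := lag_local Uz0.
have [K K0 hK] := vec_mvt fV.
pose N := `|z0| + d.
have N0 : 0 < N by rewrite ltr_wpDl.
pose B1 := 1 + C * (C + 1); pose B2 := K + C * (C + K); pose B3 := C * (C + K * N).
have CK0 : 0 < C * K by rewrite mulr_gt0.
have CC0 : 0 < C * C by rewrite mulr_gt0.
have B10 : 0 < B1 by rewrite addr_gt0// mulr_gt0// addr_gt0.
have B20 : 0 < B2 by rewrite addr_gt0// mulr_gt0// addr_gt0.
have B30 : 0 < B3 by rewrite mulr_gt0// addr_gt0// mulr_gt0.
(* Makes [B2 * T] equal to [1 / 2], so that half of [S] is absorbed. *)
pose T := (2 * B2)^-1.
have T0 : 0 < T by rewrite invr_gt0 mulr_gt0.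
have BT : B2 * T = 1 / 2 by rewrite /T; field; rewrite gt_eqF.
have KB1 : 0 < K * B1 by rewrite mulr_gt0.
have KB3 : 0 < K * B3 by rewrite mulr_gt0.
(* One constant above four bounds: [2 * B1] for a difference of velocities, [2 * (K * B1)] for a
   difference of positions, [B3] and [K * B3] for a single solution. *)
exists d, T, (2 * B1 + 2 * (K * B1) + B3 + K * B3); split=> //.
  by rewrite !addr_gt0// mulr_gt0.
split.
- move=> a b x1 y1 x2 y2 /andP[ab bT] E1 E2 hb1 hb2.
  pose D t := `|x1 t - x2 t| + `|y1 t - y2 t|.
  have [cx1 cy1 e1] := E1; have [cx2 cy2 e2] := E2.
  have cD : {within `[a, b], continuous D}.
    move=> t; apply: cvgD; apply: cvg_norm; apply: cvgB;
      [exact: cx1|exact: cx2|exact: cy1|exact: cy2].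
  have [c cI hc] := EVT_max ab cD.
  have {}hc s : a <= s <= b -> D s <= D c by move=> sI; apply: hc; rewrite in_itv.
  set S := D c in hc.
  have Da0 : 0 <= D a by rewrite addr_ge0.
  have S0 : 0 <= S by rewrite addr_ge0.
  have zD s : `|(x1 s, y1 s) - (x2 s, y2 s)| <= D s by exact: norm_pairB_le.
  have hx t : a <= t <= b -> `|x1 t - x2 t| <= `|x1 a - x2 a| + K * S * (t - a).
    move=> /andP[at_ tb].
    have := hK (fun s => x1 s - x2 s) (fun s => y1 s - y2 s) a t S at_.
    have h : {within `[a, t], continuous (fun s => x1 s - x2 s)}.
      apply: (@within_itv_sub _ _ a b) => // s.
      by apply: cvgB; [exact: cx1|exact: cx2].
    have h' s : a < s < t -> is_derive s 1 (fun s => x1 s - x2 s) (y1 s - y2 s).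
      move=> /andP[as_ st]; have sI : a < s < b by rewrite as_ (lt_le_trans st).
      by apply: is_deriveB; [exact: (e1 s sI).1|exact: (e2 s sI).1].
    move=> /(_ h h') h''; rewrite -lerBlDl; apply: le_trans (h'' _); last first.
      move=> s /andP[as_ st]; apply: le_trans (hc s _); first by rewrite lerDr.
      by rewrite (ltW as_) (le_trans (ltW st)).
    exact: lerB_dist.
  have hP t u : a <= t <= b ->
      `|'D_(0, u) L (x1 t, y1 t) - 'D_(0, u) L (x2 t, y2 t)| <= (C * D a + C * S * (t - a)) * `|u|.
    move=> /andP[at_ tb].
    have aI : a <= a <= b by rewrite lexx.
    have := @abs_mvt R (fun s => 'D_(0, u) L (x1 s, y1 s) - 'D_(0, u) L (x2 s, y2 s))
      (fun s => 'D_(u, 0) L (x1 s, y1 s) - 'D_(u, 0) L (x2 s, y2 s)) a t (C * `|u| * S) at_.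
    have h : {within `[a, t], continuous (fun s => 'D_(0, u) L (x1 s, y1 s) - 'D_(0, u) L (x2 s, y2 s))}.
      apply: (@within_itv_sub _ _ a b) => // s.
      have c1 := EL_momentum_continuous (u := u) E1 (fun r rI => dU _ (hb1 r rI)).
      have c2 := EL_momentum_continuous (u := u) E2 (fun r rI => dU _ (hb2 r rI)).
      by apply: cvgB; [exact: c1|exact: c2].
    have h' s : a < s < t -> is_derive s 1 (fun s => 'D_(0, u) L (x1 s, y1 s) - 'D_(0, u) L (x2 s, y2 s))
       ('D_(u, 0) L (x1 s, y1 s) - 'D_(u, 0) L (x2 s, y2 s)).
      move=> /andP[as_ st]; have sI : a < s < b by rewrite as_ (lt_le_trans st).
      by apply: is_deriveB; [exact: (e1 s sI).2|exact: (e2 s sI).2].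
    move=> /(_ h h') h''.
    have ha : `|'D_(0, u) L (x1 a, y1 a) - 'D_(0, u) L (x2 a, y2 a)| <= C * `|u| * D a.
      apply: le_trans (h1 _ _ (0, u) (hb1 a aI) (hb2 a aI)) _.
      by rewrite normZ0 ler_wpM2l ?mulr_ge0// ltW.
    have {}h'' : `|('D_(0, u) L (x1 t, y1 t) - 'D_(0, u) L (x2 t, y2 t)) -
       ('D_(0, u) L (x1 a, y1 a) - 'D_(0, u) L (x2 a, y2 a))| <= C * `|u| * S * (t - a).
      apply: h'' => s /andP[as_ st].
      have sI : a <= s <= b by rewrite (ltW as_) (le_trans (ltW st)).
      apply: le_trans (h1 _ _ (u, 0) (hb1 s sI) (hb2 s sI)) _.
      rewrite norm0Z ler_wpM2l ?mulr_ge0 ?(ltW C0)//.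
      by apply: le_trans (hc s sI).
    have := lerD h'' ha; have := ler_normD (('D_(0, u) L (x1 t, y1 t) - 'D_(0, u) L (x2 t, y2 t)) -
       ('D_(0, u) L (x1 a, y1 a) - 'D_(0, u) L (x2 a, y2 a))) ('D_(0, u) L (x1 a, y1 a) - 'D_(0, u) L (x2 a, y2 a)).
    rewrite subrK => q1 q2; apply: le_trans (le_trans q1 q2) _.
    by rewrite le_eqVlt; apply/orP; left; apply/eqP; ring.
  have hy t : a <= t <= b -> `|y1 t - y2 t| <= C * ((C + 1) * D a + (C + K) * S * (t - a)).
    move=> tI; have ta : 0 <= t - a by rewrite subr_ge0; case/andP: tI.
    have m0 : 0 <= C * D a + C * S * (t - a) by rewrite addr_ge0 ?mulr_ge0// ltW.
    apply: le_trans (h3 _ _ _ _ _ m0 (hb1 t tI) (hb2 t tI) (fun u => hP t u tI)) _.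
    rewrite ler_pM2l//; have := hx t tI.
    have : `|x1 a - x2 a| <= D a by rewrite lerDl.
    by move=> q1 q2; order_lra.
  have hS : S <= 2 * B1 * D a.
    have cI' : a <= c <= b by move: cI; rewrite in_itv.
    have := hx c cI'; have := hy c cI'.
    have q0 : `|x1 a - x2 a| <= D a by rewrite lerDl.
    have ca : 0 <= c - a <= T.
      by case/andP: cI' => q1 q2; rewrite subr_ge0 q1 lerBlDl (le_trans q2).
    move=> q1 q2.
    have : S <= B1 * D a + B2 * (c - a) * S.
      rewrite /S {1}/D; apply: le_trans (lerD q2 q1) _; rewrite -/S /B1 /B2.
      by move: q0; order_lra.
    have : B2 * (c - a) * S <= 1 / 2 * S.
      by rewrite ler_wpM2r// -BT ler_pM2l//; case/andP: ca.
    by order_lra.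
  move=> t tI; have ta : 0 <= t - a by rewrite subr_ge0; case/andP: tI.
  have q0 : 0 <= K * B1 * D a by rewrite mulr_ge0// ltW.
  have q1 : 0 <= B3 * D a by rewrite mulr_ge0// ltW.
  have q2 : 0 <= K * B3 * D a by rewrite mulr_ge0// ltW.
  have q3 : 0 <= B1 * D a by rewrite mulr_ge0// ltW.
  split.
    have : `|y1 t - y2 t| <= S by apply: le_trans (hc t tI); rewrite lerDr.
    rewrite -/(D a); move: hS; order_lra.
  apply: le_trans (hx t tI) _; rewrite lerD2l -/(D a).
  have : K * S * (t - a) <= K * (2 * B1 * D a) * (t - a).
    by rewrite ler_wpM2r// ler_pM2l.
  have : 0 <= (t - a) * (2 * (B1 * D a) + B3 * D a + K * B3 * D a).
    by rewrite mulr_ge0// !addr_ge0// mulr_ge0.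
  by order_lra.
- move=> a b x y /andP[ab bT] E hb.
  have [cx cy e] := E.
  have yN t : a <= t <= b -> `|y t| <= N.
    move=> /hb [_ /=]; rewrite -ball_normE /ball_ /= => h.
    have : `|z0.2| <= `|z0| by rewrite prod_normE le_max lexx orbT.
    have := ler_normB z0.2 (z0.2 - y t); rewrite opprB addrC subrK.
    by rewrite /N => q1 q2; apply: le_trans q1 _; rewrite lerD// ltW.
  have hx t : a <= t <= b -> `|x t - x a| <= K * N * (t - a).
    move=> /andP[at_ tb]; apply: (hK x y) => //; first exact: within_itv_sub cx.
      by move=> s /andP[as_ st]; apply: (e s _).1; rewrite as_ (lt_le_trans st).
    by move=> s /andP[as_ st]; apply: yN; rewrite (ltW as_) (le_trans (ltW st)).
  have hP t u : a <= t <= b ->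
      `|'D_(0, u) L (x t, y t) - 'D_(0, u) L (x a, y a)| <= C * (t - a) * `|u|.
    move=> /andP[at_ tb]; rewrite mulrAC.
    apply: (@abs_mvt R (fun s => 'D_(0, u) L (x s, y s)) (fun s => 'D_(u, 0) L (x s, y s))) => //.
    - apply: (@within_itv_sub _ _ a b) => //.
      by apply: EL_momentum_continuous E _ => s /hb /dU.
    - by move=> s /andP[as_ st]; apply: (e s _).2; rewrite as_ (lt_le_trans st).
    - move=> s /andP[as_ st]; rewrite -norm0Z; apply: h2; apply: hb.
      by rewrite (ltW as_) (le_trans (ltW st)).
  have hy t : a <= t <= b -> `|y t - y a| <= B3 * (t - a).
    move=> tI; have ta : 0 <= t - a by rewrite subr_ge0; case/andP: tI.
    have aI : a <= a <= b by rewrite lexx.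
    have m0 : 0 <= C * (t - a) by rewrite mulr_ge0// ltW.
    apply: le_trans (h3 _ _ _ _ _ m0 (hb t tI) (hb a aI) (fun u => hP t u tI)) _.
    by rewrite /B3 -mulrA ler_pM2l// mulrDl lerD2l; exact: hx.
  move=> t tI; have ta : 0 <= t - a by rewrite subr_ge0; case/andP: tI.
  have e0 : 0 <= (t - a) * (2 * B1 + 2 * (K * B1)) by rewrite mulr_ge0// addr_ge0// mulr_ge0// ltW.
  have e1 : 0 <= (t - a) * B3 by rewrite mulr_ge0// ltW.
  have e2 : 0 <= (t - a) * (K * B3) by rewrite mulr_ge0// ltW.
  split; first by apply: le_trans (hy t tI) _; order_lra.
  case/andP: (tI) => at_ tb.
  have := hK (fun s => x s - (s - a) *: y a) (fun s => y s - y a) a t (B3 * (t - a)) at_.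
  have h : {within `[a, t], continuous (fun s => x s - (s - a) *: y a)}.
    apply: (@within_itv_sub _ _ a b) => // s; apply: cvgB; first exact: cx.
    have : continuous (fun r : R => (r - a) *: y a).
      move=> r; apply: cvgZr_tmp; apply: cvgB; [exact: cvg_id|exact: cvg_cst].
    by move/continuous_subspaceT => /(_ `[a, b]%classic) /(_ s).
  have h' s : a < s < t -> is_derive s 1 (fun s => x s - (s - a) *: y a) (y s - y a).
    move=> /andP[as_ st]; have sI : a < s < b by rewrite as_ (lt_le_trans st).
    apply: is_deriveB; first exact: (e s sI).1.
    have -> : (fun r : R => (r - a) *: y a) = (fun r : R => - a *: y a + r *: y a).
      by apply/funext => r; rewrite scalerBl addrC scaleNr.
    have := @is_derive_line R _ _ id (- a *: y a) (y a) s.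
    by rewrite derive_id; apply.
  move=> /(_ h h') h''.
  have -> : x t - x a - (t - a) *: y a = (x t - (t - a) *: y a) - (x a - (a - a) *: y a).
    by rewrite subrr scale0r subr0 addrAC.
  apply: le_trans (h'' _) _.
    move=> s /andP[as_ st]; have sI : a <= s <= b by rewrite (ltW as_) (le_trans (ltW st)).
    apply: le_trans (hy s sI) _; rewrite ler_pM2l// lerB// ltW//.
  have : 0 <= (t - a) * ((t - a) * (2 * B1 + 2 * (K * B1) + B3)).
    by rewrite mulr_ge0// mulrDr addr_ge0.
  by order_lra.
Qed.

(** Two mean values along the segment, one for [L] and one for its derivative: the remainder over
    the tangent is a value of the Hessian form times a positive number. *)
Lemma strict_convex x v u : (forall t : R, 0 <= t <= 1 -> U (x, v + t *: (u - v))) ->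
  u != v -> L (x, v) + 'D_(0, u - v) L (x, v) < L (x, u).
Proof.
move=> seg uv; set w := u - v.
have w0 : w != 0 by rewrite subr_eq0.
have lineE (t : R) : (x, v) + t *: ((0 : V), w) = (x, v + t *: w).
  by rewrite pairZE pairDE scaler0 addr0.
have dg (t : R) : 0 <= t <= 1 -> is_derive t 1 (fun s : R => L ((x, v) + s *: (0, w)))
    ('D_(0, w) L ((x, v) + t *: (0, w))).
  move=> tI; apply: is_derive_line; apply: (Cr_differentiable hL).
  by rewrite lineE; exact: seg.
have dg2 (t : R) : 0 <= t <= 1 -> is_derive t 1 (fun s : R => 'D_(0, w) L ((x, v) + s *: (0, w)))
    ('D_(0, w) ('D_(0, w) L) ((x, v) + t *: (0, w))).
  move=> tI; apply: is_derive_line; apply: (((hL 2%N).2 (0, w)).1).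
  by rewrite lineE; exact: seg.
have mvt (f df : R -> R) (b : R) : 0 < b <= 1 ->
   (forall t : R, 0 <= t <= 1 -> is_derive t 1 f (df t)) ->
   exists2 c, 0 < c < b & f b - f 0 = df c * b.
  move=> /andP[b0 b1] hf; have [||c] := @MVT R f df 0 b b0.
  - move=> t; rewrite in_itv /= => /andP[/ltW h1 /ltW h2].
    by apply: hf; rewrite h1 (le_trans h2).
  - apply: derivable_within_continuous => t; rewrite in_itv /= => /andP[h1 h2].
    have tI : 0 <= t <= 1 by rewrite h1 (le_trans h2).
    by have [] := hf t tI.
  by rewrite in_itv /= subr0 => ? ?; exists c.
have i1 : 0 < (1 : R) <= 1 by rewrite ltr01 lexx.
have [c /andP[c0 c1] e1] := mvt _ _ 1 i1 dg.
have ic : 0 < c <= 1 by rewrite c0 ltW.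
have [c' /andP[c'0 c'1] e2] := mvt _ _ c ic dg2.
move: e1 e2; rewrite scale1r scale0r addr0 mulr1.
have -> : (x, v) + (0, w) = (x, u) by rewrite pairDE addr0 addrC subrK.
move=> e1 e2; rewrite addrC -ltrBrDr e1 -subr_gt0 e2 mulr_gt0// lineE.
by apply: posL => //; apply: seg; rewrite (ltW c'0) (le_trans (ltW c'1))// ltW.
Qed.

(** Conservation of the Hamiltonian. The equation turns the derivative of momentum times velocity
    into ['D_(y t, 0) L + 'D_(0, a) L], which is the derivative of [L] along the jet. *)
Lemma EL_energy (x y : R -> V) (t : R) (a : V) : U (x t, y t) ->
  is_derive t 1 x (y t) -> is_derive t 1 y a ->
  (forall u, is_derive t 1 (fun s => 'D_(0, u) L (x s, y s)) ('D_(u, 0) L (x t, y t))) ->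
  is_derive t 1 (fun s => 'D_(0, y s) L (x s, y s) - L (x s, y s)) 0.
Proof.
move=> Ut dx dy dP; have [m [e [l [cl el]]]] := fV.
have dz := is_derive_pair dx dy.
have dLt := Cr_differentiable hL Ut.
have dL := is_derive_comp dz dLt.
have cz : {for t, continuous (fun s => (x s, y s))}.
  by apply/differentiable_continuous/derivable1_diffP; case: dz.
have nU : \forall s \near t, U (x s, y s) by apply: cz; exact: open_nbhs_nbhs.
have lin u z : U z -> 'D_(0, u) L z = \sum_i l i u * 'D_(0, e i) L z.
  move=> Uz; have cL := clin_comp (clin_pair (clin_zero V V) (clin_id V)) (derive_clin (Cr_differentiable hL Uz)).
  transitivity ('D_(0, \sum_i l i u *: e i) L z); first by rewrite -el.
  apply: etrans (clin_sum (fun i => l i u *: e i) cL) _.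
  by apply: eq_bigr => i _; exact: (clinZ _ _ cL).
have lin' u z : U z -> 'D_(u, 0) L z = \sum_i l i u * 'D_(e i, 0) L z.
  move=> Uz; have cL := clin_comp (clin_pair (clin_id V) (clin_zero V V)) (derive_clin (Cr_differentiable hL Uz)).
  transitivity ('D_(\sum_i l i u *: e i, 0) L z); first by rewrite -el.
  apply: etrans (clin_sum (fun i => l i u *: e i) cL) _.
  by apply: eq_bigr => i _; exact: (clinZ _ _ cL).
have dS : is_derive t 1 (\sum_i (fun s => l i (y s) * 'D_(0, e i) L (x s, y s)))
   (\sum_i (l i (y t) * 'D_(e i, 0) L (x t, y t) + 'D_(0, e i) L (x t, y t) * l i a)).
  apply: is_derive_sum => i.
  exact: (is_deriveM (is_derive_clin dy (cl i)) (dP (e i))).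
have dD : is_derive t 1 (fun s => 'D_(0, y s) L (x s, y s))
   ('D_(y t, 0) L (x t, y t) + 'D_(0, a) L (x t, y t)).
  have e1 := lin a _ Ut; have e2 := lin' (y t) _ Ut.
  have -> : 'D_(y t, 0) L (x t, y t) + 'D_(0, a) L (x t, y t) =
     \sum_i (l i (y t) * 'D_(e i, 0) L (x t, y t) + 'D_(0, e i) L (x t, y t) * l i a).
    rewrite e1 e2 -big_split; apply: eq_bigr => i _; congr (_ + _).
    exact: mulrC.
  apply: near_eq_is_derive dS; apply: filterS nU => s Us.
  by rewrite fct_sumE; exact/esym/lin.
have -> : 0 = ('D_(y t, 0) L (x t, y t) + 'D_(0, a) L (x t, y t)) - 'D_(y t, a) L (x t, y t).
  have -> : (y t, a) = 1 *: (y t, 0) + (0, a) by rewrite scale1r pairDE addr0 add0r.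
  by rewrite derive_lin// mul1r subrr.
exact: is_deriveB.
Qed.

End Lagrangian.

(** * Piecewise smooth curves *)

Section Piecewise.
Context (R : realType).
Implicit Types (P Q : set R -> Prop) (a b : R).

Lemma piecewise_nil P a b : piecewise P a b -> a <= b.
Proof.
move=> [s [ps /eqP <-] _]; elim: s a ps => [|x s IH] a //= /andP[ax ps].
exact: le_trans (ltW ax) (IH _ ps).
Qed.

Lemma piecewise_refl P a : piecewise P a a.
Proof. by exists [::]; [split=> /=|]. Qed.

Lemma piecewise_cons P a x b : a < x -> P `[a, x]%classic -> piecewise P x b ->
  piecewise P a b.
Proof.
move=> ax Pax [s [ps ls] hs]; exists (x :: s); first by split=> //=; rewrite ax.
move=> [|i] //= hi; rewrite ltnS in hi.
exact: (hs i hi).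
Qed.

(** Induction that removes the first piece; a statement about piecewise objects then needs one piece
    and a concatenation. *)
Lemma piecewise_ind P (Q : R -> R -> Prop) :
  (forall a, Q a a) ->
  (forall a x b, a < x -> x <= b -> P `[a, x]%classic -> piecewise P x b -> Q x b -> Q a b) ->
  forall a b, piecewise P a b -> Q a b.
Proof.
move=> Q0 Q1 a b [s [ps ls] hs]; elim: s a ps ls hs => [|x s IH] a /=.
  by move=> _ /eqP <- _; exact: Q0.
move=> /andP[ax ps] ls hs.
have hx : piecewise P x b.
  exists s; first by split.
  by move=> i hi; have := hs i.+1 hi.
apply: (Q1 a x b) => //; first exact: piecewise_nil hx.
  exact: (hs 0%N).
by apply: IH => // i hi; have := hs i.+1 hi.
Qed.

Lemma piecewise_single P a b : a < b -> P `[a, b]%classic -> piecewise P a b.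
Proof. by move=> ab Pab; apply: (piecewise_cons ab Pab); exact: piecewise_refl. Qed.

Lemma piecewise_cat P a m b : piecewise P a m -> piecewise P m b -> piecewise P a b.
Proof.
move=> h; elim/(@piecewise_ind P) : a m / h b => // a x m ax _ Pax _ IH b h.
by apply: (piecewise_cons ax Pax); exact: IH.
Qed.

Lemma piecewise_imp P Q a b : (forall I, P I -> Q I) -> piecewise P a b -> piecewise Q a b.
Proof. by move=> h [s ps hs]; exists s => // i hi; apply: h; exact: hs. Qed.

Lemma piecewise_imp_in P Q a b : (forall s u, a <= s -> s < u -> u <= b ->
  P `[s, u]%classic -> Q `[s, u]%classic) -> piecewise P a b -> piecewise Q a b.
Proof.
move=> h hp; elim/(@piecewise_ind P) : a b / hp h => [a _|a x b ax xb Pax hx IH h].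
  exact: piecewise_refl.
apply: (piecewise_cons ax); first exact: (h a x).
by apply: IH => s u h1 h2 h3; apply: h => //; exact: le_trans (ltW ax) h1.
Qed.

Definition hereditary P := forall I J : set R, J `<=` I -> P I -> P J.

Lemma subset_seg (s u s' u' : R) : s <= s' -> u' <= u -> `[s', u']%classic `<=` `[s, u]%classic.
Proof.
move=> ss uu t /=; rewrite !in_itv /= => /andP[h1 h2].
by rewrite (le_trans ss h1) (le_trans h2 uu).
Qed.

Lemma piecewise_restrict P a m b : hereditary P -> a <= m <= b ->
  piecewise P a b -> piecewise P a m /\ piecewise P m b.
Proof.
move=> hP /[swap] hp; elim/(@piecewise_ind P) : a b / hp m => [a|a x b ax xb Pax hx IH] m.
  by move=> h; have -> : m = a; [apply/le_anti; rewrite andbC|split; exact: piecewise_refl].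
move=> /andP[am mb]; case: (leP x m) => [xm|mx].
  have [h1 h2] := IH m (introT andP (conj xm mb)); split=> //.
  exact: (piecewise_cons ax).
move: am; rewrite le_eqVlt => /predU1P[<-|am].
  by split; [exact: piecewise_refl|exact: (piecewise_cons ax)].
split; first by apply: piecewise_single => //; apply: hP Pax; apply: subset_seg => //; exact: ltW.
by apply: (piecewise_cons mx) => //; apply: hP Pax; apply: subset_seg => //; exact: ltW.
Qed.

Lemma piecewise_right P a b t : hereditary P -> piecewise P a b -> a <= t -> t < b ->
  exists u, [/\ t < u, u <= b & P `[t, u]%classic].
Proof.
move=> hP hp at_ tb; have [|_] := piecewise_restrict (m := t) hP _ hp; first by rewrite at_ ltW.
move=> h; have : t < b := tb; case: (pselect (t = b)) => [->|_ _]; first by rewrite ltxx.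
elim/(@piecewise_ind P) : t b / h tb {at_ hp} => [x|x u b' xu ub Px _ _ _]; first by rewrite ltxx.
by exists u.
Qed.

Lemma piecewise_left P a b t : hereditary P -> piecewise P a b -> a < t -> t <= b ->
  exists s, [/\ s < t, a <= s & P `[s, t]%classic].
Proof.
move=> hP hp at_ tb; have [|h _] := piecewise_restrict (m := t) hP _ hp; first by rewrite tb ltW.
elim/(@piecewise_ind P) : a t / h at_ {tb hp} => [x|x u b' xu ub Px hu IH _]; first by rewrite ltxx.
move: ub; rewrite le_eqVlt => /predU1P[e|ub].
  by exists x; split=> //; rewrite -e.
by have [s [h1 h2 h3]] := IH ub; exists s; split=> //; exact: le_trans (ltW xu) h2.
Qed.

Lemma piecewise_breaks P a b : hereditary P -> piecewise P a b ->
  exists E : seq R, forall t, a < t < b -> t \notin E ->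
    exists s u, [/\ a <= s, s < t, t < u, u <= b & P `[s, u]%classic].
Proof.
move=> hP hp; elim/(@piecewise_ind P) : a b / hp => [a|a x b ax xb Pax hx [E hE]].
  by exists [::] => t /andP[h1 h2]; have := lt_trans h1 h2; rewrite ltxx.
exists (x :: E) => t /andP[at_ tb]; rewrite inE negb_or => /andP[tx tE].
case: (ltgtP t x) tx => // [tx|xt] _.
  by exists a, x.
have [|s [u [h1 h2 h3 h4 h5]]] := hE t _ tE; first by rewrite xt.
by exists s, u; split=> //; exact: le_trans (ltW ax) h1.
Qed.

End Piecewise.

(** * Integrals of piecewise continuous functions *)

Section Integrals.
Context (R : realType).
Notation mu := (@lebesgue_measure R).
Implicit Types (f g h e : R -> R) (a b s u t : R).

Lemma integrable_oo_cc f s u : s < u -> mu.-integrable `]s, u[ (EFin \o f) ->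
  mu.-integrable `[s, u] (EFin \o f).
Proof.
move=> su /integrableP[mf hf]; apply/integrableP.
have mf1 := (emeasurable_fun_itv_bndo_bndcP (BRight s) u (EFin \o f)).1 mf.
have mf2 := (emeasurable_fun_itv_obnd_cbndP s (BRight u) (EFin \o f)).1 mf1.
split; first exact: mf2.
rewrite -integral_itv_obnd_cbnd; last by apply: measurableT_comp mf1.
by rewrite -integral_itv_bndo_bndc//; apply: measurableT_comp mf.
Qed.

Lemma itv_cat a m b : a <= m -> m <= b ->
  `[a, b]%classic = `[a, m]%classic `|` `[m, b]%classic :> set R.
Proof.
move=> am mb; apply/seteqP; split => t /=; rewrite !in_itv /=.
  move=> /andP[h1 h2]; case: (leP t m) => h; first by left; rewrite h1.
  by right; rewrite (ltW h).
case=> /andP[h1 h2]; first by rewrite h1 (le_trans h2).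
by rewrite h2 (le_trans am).
Qed.

Lemma integrable_cat f a m b : a <= m -> m <= b -> mu.-integrable `[a, m] (EFin \o f) ->
  mu.-integrable `[m, b] (EFin \o f) -> mu.-integrable `[a, b] (EFin \o f).
Proof.
move=> am mb /integrableP[m1 h1] /integrableP[m2 h2]; apply/integrableP.
split; first by rewrite (itv_cat am mb); apply/measurable_funU.
rewrite (_ : `[a, b]%classic = `[a, m]%classic `|` `]m, b]%classic); last first.
  apply/seteqP; split => t /=; rewrite !in_itv /=.
    move=> /andP[q1 q2]; case: (leP t m) => h; first by left; rewrite q1.
    by right; rewrite q2.
  case=> /andP[q1 q2]; first by rewrite q1 (le_trans q2).
  by rewrite q2 (le_trans am (ltW q1)).
have m3 : measurable_fun `]m, b] (EFin \o f).
  by apply: measurable_funS m2 => //; apply: subset_itvr; rewrite bnd_simp.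
have n2 : measurable_fun `[m, b] (fun x => `|(EFin \o f) x|)%E.
  by apply: measurableT_comp m2.
have n1 : measurable_fun `[a, m] (fun x => `|(EFin \o f) x|)%E.
  by apply: measurableT_comp m1.
have n3 : measurable_fun `]m, b] (fun x => `|(EFin \o f) x|)%E.
  by apply: measurableT_comp m3.
rewrite ge0_integral_setU //.
- apply: lte_add_pinfty => //; apply: le_lt_trans h2.
  by apply: ge0_subset_integral => //; apply: subset_itvr; rewrite bnd_simp.
- by apply/measurable_funU.
- apply/disj_setPS => y [/=]; rewrite 2!in_itv/= => /andP[_ yx] /andP[].
  by rewrite ltNge yx.
Qed.

(** What the fundamental theorem of calculus asks for off finitely many points, in a form stable
    under concatenation and restriction. *)
Definition pcont f a b : Prop := mu.-integrable `[a, b] (EFin \o f) /\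
  exists E : seq R, forall t, a < t < b -> t \notin E -> {for t, continuous f}.

(** The ends of a piece are a null set. Speeds have meaningless values there, and only inside the
    piece do they agree with a function continuous up to the ends. *)
Lemma pcont_piece f e s u : s < u -> {within `[s, u], continuous e} ->
  (forall t, s < t < u -> f t = e t) -> pcont f s u.
Proof.
move=> su ce fe; split.
  apply: integrable_oo_cc => //.
  have : mu.-integrable `]s, u[ (EFin \o e); last first.
    apply: eq_integrable => //.
    by move=> t; rewrite inE /= in_itv /= => tI; rewrite fe.
  have := continuous_compact_integrable (@segment_compact R s u) ce.
  apply: integrableS => //; exact: subset_itv_oo_cc.
exists [::] => t tI _.
have ct : {for t, continuous e}.
  have := continuous_subspaceW (@subset_itv_oo_cc _ _ s u) ce.
  rewrite continuous_open_subspace; last exact: interval_open.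
  by apply; rewrite inE /= in_itv.
have e1 : \near t, f t = e t.
  have : nbhs t `]s, u[%classic.
    apply: open_nbhs_nbhs; split; first exact: interval_open.
    by rewrite /= in_itv.
  by apply: filterS => x /=; rewrite in_itv; exact: fe.
suff : f @ t --> f t by [].
rewrite (fe t)//; apply: cvg_trans ct; apply: near_eq_cvg.
by apply: filterS e1 => x.
Qed.

Lemma pcont_cat f a m b : a <= m -> m <= b -> pcont f a m -> pcont f m b -> pcont f a b.
Proof.
move=> am mb [i1 [E1 h1]] [i2 [E2 h2]]; split; first exact: integrable_cat i1 i2.
exists (m :: E1 ++ E2) => t /andP[at_ tb]; rewrite inE mem_cat !negb_or => /and3P[tm t1 t2].
case: (ltgtP t m) tm => // h _; first by apply: h1; rewrite ?at_.
by apply: h2; rewrite ?h.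
Qed.

Lemma pcont_sub f a b s u : a <= s -> u <= b -> pcont f a b -> pcont f s u.
Proof.
move=> as_ ub [i [E h]]; split.
  by apply: integrableS i => //; exact: subset_seg.
exists E => t /andP[h1 h2]; apply: h.
by rewrite (le_lt_trans as_ h1) (lt_le_trans h2 ub).
Qed.

Lemma pcont_primitive f a b : a <= b -> pcont f a b ->
  let L t := (\int[mu]_(x in `[a, t]) f x) in
  {within `[a, b], continuous L} /\
  exists E : seq R, forall t, a < t < b -> t \notin E -> is_derive t 1 L (f t).
Proof.
move=> ab [i [E h]] L; split; first exact: parameterized_integral_continuous.
exists E => t /andP[at_ tb] tE.
have [|d1 d2] := continuous_FTC1_closed tb i at_; first by apply: h => //; rewrite at_.
apply: DeriveDef; first exact: d1.
rewrite -derive1E; exact: d2.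
Qed.

Lemma int_split f a m b : a <= m -> m <= b -> mu.-integrable `[a, b] (EFin \o f) ->
  \int[mu]_(x in `[a, b]) f x = \int[mu]_(x in `[a, m]) f x + \int[mu]_(x in `[m, b]) f x.
Proof.
move=> am mb i.
have := @Rintegral_itvB R f (BLeft a) (BRight b) m i.
rewrite !bnd_simp => /(_ am mb) h.
rewrite -[X in _ + X]Rintegral_itv_obnd_cbnd -?h; first by rewrite addrC subrK.
apply: integrableS i => //; move=> t /=; rewrite !in_itv /= => /andP[h1 h2].
by rewrite (le_trans am (ltW h1)).
Qed.

Lemma eq_int_oo f g s u : (forall t, s < t < u -> f t = g t) ->
  mu.-integrable `[s, u] (EFin \o f) -> mu.-integrable `[s, u] (EFin \o g) ->
  \int[mu]_(x in `[s, u]) f x = \int[mu]_(x in `[s, u]) g x.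
Proof.
move=> fg i1 i2.
have s1 : `]s, u] `<=` (`[s, u] : set R) by apply: subset_itvr; rewrite bnd_simp.
have s2 : `]s, u[ `<=` (`[s, u] : set R) by exact: subset_itv_oo_cc.
have red k : mu.-integrable `[s, u] (EFin \o k) ->
    \int[mu]_(x in `[s, u]) k x = \int[mu]_(x in `]s, u[) k x.
  move=> i; rewrite -Rintegral_itv_obnd_cbnd; last exact: integrableS i.
  by rewrite -Rintegral_itv_bndo_bndc//; exact: integrableS i.
rewrite !red//; apply: eq_Rintegral => t; rewrite inE /= in_itv; exact: fg.
Qed.

(** Induction on the exceptional points: if the head of the list lies inside, the interval is cut
    there, and continuity makes both halves usable. *)
Lemma ge0_derive_mono g (E : seq R) a b : a <= b -> {within `[a, b], continuous g} ->
  (forall t : R, a < t < b -> t \notin E -> exists2 d, 0 <= d & is_derive t 1 g d) ->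
  g a <= g b.
Proof.
elim: E a b => [|x E IH] a b ab cg h.
  have dg t : t \in `]a, b[%R -> derivable g t 1.
    by rewrite in_itv => /h/(_ isT)[d _ []].
  have dg0 t : t \in `]a, b[%R -> 0 <= derive1 g t.
    by rewrite in_itv derive1E => /h/(_ isT)[d d0 [_ ->]].
  by apply: (ger0_derive1_le_cc dg dg0 cg) => //; rewrite in_itv /= lexx ab.
case: (boolP (a < x < b)) => [/andP[ax xb]|nx].
  apply: (@le_trans _ _ (g x)).
    apply: IH; [exact: ltW|by apply: within_itv_sub cg => //; exact: ltW|].
    move=> t /andP[h1 h2] tE; apply: h; first by rewrite h1 (lt_trans h2).
    by rewrite inE negb_or tE lt_eqF.
  apply: IH; [exact: ltW|by apply: within_itv_sub cg => //; exact: ltW|].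
  move=> t /andP[h1 h2] tE; apply: h; first by rewrite (lt_trans ax).
  by rewrite inE negb_or tE gt_eqF.
apply: IH => // t tI tE; apply: h => //.
by rewrite inE negb_or tE andbT; apply: contra nx => /eqP <-.
Qed.

(** The primitive of [f] minus [h] is continuous with nonnegative derivative off finitely many
    points. Every lower bound on a length comes from here. *)
Lemma int_lower f h (E : seq R) a b : a <= b -> pcont f a b ->
  {within `[a, b], continuous h} ->
  (forall t : R, a < t < b -> t \notin E -> exists2 d, d <= f t & is_derive t 1 h d) ->
  h b - h a <= \int[mu]_(x in `[a, b]) f x.
Proof.
move=> ab pf ch hh; have [cL [E' hL]] := pcont_primitive ab pf.
set L := (fun t => _) in cL hL.
have := @ge0_derive_mono (fun t => L t - h t) (E ++ E') a b ab.
have La : L a = 0 by rewrite /L set_itv1 Rintegral_set1.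
rewrite La sub0r -[\int[mu]_(x in _) _]/(L b) => H.
suff : - h a <= L b - h b by lra.
apply: H; first by move=> t; apply: cvgB; [exact: cL|exact: ch].
move=> t tI; rewrite mem_cat negb_or => /andP[t1 t2].
have [d d1 d2] := hh t tI t1; exists (f t - d); first by rewrite subr_ge0.
by apply: is_deriveB => //; exact: hL.
Qed.

End Integrals.

(** * Admissible curves in charts *)

Section Admissible.
Context (R : realType) (n : nat) (M : manifold R n)
  (A : M -> set 'rV[R]_n) (F : M -> 'rV[R]_n -> R) (hF : conic_finsler A F).
Implicit Types (k : chart R n M) (c : R -> M) (S : set R) (a b s t u : R).
Local Notation V := 'rV[R]_n.
Local Notation CS := (coord_set A).
Local Notation CF := (coord_fun F).

(** Stronger than [locrep]: the whole jet of the representative stays in [A], also on the part of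
    [W] outside the piece. As [coord_set] is open, this leaves room for perturbations. *)
Definition arep k S c t : Prop := exists (W : set R) (g : R -> V),
  [/\ open W, W t, Cr None W g, (forall y, W y -> CS k (g y, 'D_1 g y)) &
      forall y, S y -> W y -> c y = cinv k (g y)].

(* The endpoints of a piece are covered too: near them the representative is a
   smooth admissible extension of [c] to an open interval. *)
Definition apiece c S : Prop := forall t, S t -> forall k, smooth_chart k ->
  cdom k (c t) -> arep k S c t.

Lemma derive_trans k k' (g : R -> V) t : smooth_chart k -> smooth_chart k' ->
  differentiable g t -> tdom k k' (g t) ->
  'D_1 (trans k k' \o g) t = dtr k k' (g t) ('D_1 g t).
Proof.
move=> s s' dg h; rewrite dtrD; have dT := trans_differentiable s s' h.
by apply: etrans (derive_compE _ dg dT) _; symmetry; exact: deriveE.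
Qed.

Lemma arep_trans k k' S c t : smooth_chart k -> smooth_chart k' -> S t ->
  cdom k' (c t) -> arep k S c t -> arep k' S c t.
Proof.
move=> s s' St ct [W [g [oW Wt hg cg eg]]].
pose W' := W `&` g @^-1` tdom k k'.
have oW' : open W'.
  apply: open_preimage_on; [exact: oW| |exact: open_tdom].
  by move=> y Wy; apply: Cr_continuous hg Wy.
exists W', (trans k k' \o g); split=> //.
- split=> //; split; first by have [] := cg _ Wt.
  by rewrite /preimage /= -eg.
- have h1 : Cr None W' g by apply: Cr_sub hg => y [].
  have h2 y : W' y -> tdom k k' (g y) by case.
  exact: (Cr_comp oW' (@open_tdom _ _ _ k k') (findim_rV R n) (findim_rV R n) h2 h1 (smooth_trans s s')).
- move=> y [Wy ty]; have dg := Cr_differentiable hg Wy.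
  rewrite derive_trans//.
  have h := (@coord_set_trans _ _ _ A _ _ (g y, 'D_1 g y) s s' ty).2 (cg y Wy).
  exact: h.
- by move=> y Sy [Wy ty]; rewrite /= tdom_trans// eg.
Qed.

Lemma arep_apiece c S :
  (forall t, S t -> exists2 k, smooth_chart k & arep k S c t) -> apiece c S.
Proof.
move=> h t St k sk ct; have [k' sk' r] := h t St.
exact: (arep_trans sk' sk St ct r).
Qed.

Lemma arep_sub k S S' c t : S' `<=` S -> arep k S c t -> arep k S' c t.
Proof.
by move=> ss [W [g [h1 h2 h3 h4 h5]]]; exists W, g; split=> // y /ss; exact: h5.
Qed.

Lemma apiece_hereditary c : hereditary (apiece c).
Proof. by move=> S S' ss h t St k sk ct; apply: (arep_sub ss); apply: h => //; exact: ss. Qed.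

Lemma apiece_Cr_map c S : apiece c S -> Cr_map None S c.
Proof.
move=> h; apply: locrep_Cr_map => t St; exists (chart_at (c t)); first exact: chart_at_smooth.
have [W [g [h1 h2 h3 h4 h5]]] := h t St _ (chart_at_smooth (c t)) (chart_at_dom (c t)).
by exists W, g; split=> // y /h4[].
Qed.

Lemma open_ballR (W : set R) t : open W -> W t -> exists2 e : R, 0 < e &
  forall y, t - e < y < t + e -> W y.
Proof.
move=> oW Wt; have /nbhs_ballP [e e0 he] := open_nbhs_nbhs (conj oW Wt).
exists e => // y /andP[h1 h2]; apply: he; rewrite -ball_normE /ball_ /=.
by rewrite ltr_distlC h1 h2.
Qed.

Lemma rep_right_velocity k W (g : R -> V) c t u : smooth_chart k -> open W -> W t ->
  t < u -> differentiable g t -> cimg k (g t) ->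
  (forall y, t <= y <= u -> W y -> c y = cinv k (g y)) ->
  right_velocity c t = of_coord k (g t) ('D_1 g t).
Proof.
move=> sk oW Wt tu dg ig hg; have [e e0 he] := open_ballR oW Wt.
apply: (@right_velocityE _ _ _ k c g t (Num.min e (u - t))) => //.
  by rewrite lt_min e0 subr_gt0.
move=> y /andP[h1 h2]; apply: hg; first by rewrite h1; apply/ltW;
  apply: lt_le_trans h2 _; rewrite -lerBrDl ge_min lexx orbT.
apply: he; rewrite (lt_le_trans _ h1) ?gtrBl//=.
by apply: lt_le_trans h2 _; rewrite lerD2l ge_min lexx.
Qed.

Lemma rep_left_velocity k W (g : R -> V) c t s : smooth_chart k -> open W -> W t ->
  s < t -> differentiable g t -> cimg k (g t) ->
  (forall y, s <= y <= t -> W y -> c y = cinv k (g y)) ->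
  left_velocity c t = of_coord k (g t) ('D_1 g t).
Proof.
move=> sk oW Wt st dg ig hg; have [e e0 he] := open_ballR oW Wt.
apply: (@left_velocityE _ _ _ k c g t (Num.min e (t - s))) => //.
  by rewrite lt_min e0 subr_gt0.
move=> y /andP[h1 h2].
have h3 : Num.min e (t - s) <= e by rewrite ge_min lexx.
have h4 : Num.min e (t - s) <= t - s by rewrite ge_min lexx orbT.
apply: hg; first by rewrite h2 andbT; lra.
by apply: he; lra.
Qed.

Lemma rep_velocity k W (g : R -> V) c t s u : smooth_chart k -> open W -> W t ->
  s < t < u -> differentiable g t -> cimg k (g t) ->
  (forall y, s <= y <= u -> W y -> c y = cinv k (g y)) ->
  velocity c t = of_coord k (g t) ('D_1 g t).
Proof.
move=> sk oW Wt /andP[st tu] dg ig hg; apply: velocityE => //.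
have : nbhs t (W `&` `]s, u[%classic).
  apply: filterI; first exact: open_nbhs_nbhs.
  by apply: open_nbhs_nbhs; split; [exact: interval_open|rewrite /= in_itv /= st].
apply: filterS => y [Wy]; rewrite /= in_itv /= => /andP[h1 h2].
by apply: hg => //; rewrite !ltW.
Qed.

(** At each time of a piece some one-sided velocity is in [A] and is the derivative of the smooth
    representative; openness of [coord_set] then keeps the jet in [A] on a neighbourhood. *)
Lemma admissible_apiece a b c : admissible A a b c ->
  a < b /\ piecewise (apiece c) a b.
Proof.
move=> [ab ps rv lv]; split=> //.
apply: piecewise_imp_in ps => s u as_ su ub cr t tI k sk ct.
have [W [g [oW Wt hg gi eg]]] := Cr_map_locrep sk cr tI ct.
have dg y : W y -> differentiable g y by exact: Cr_differentiable hg.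
have CSt : CS k (g t, 'D_1 g t).
  split; first exact: gi.
  have et := eg t tI Wt; move: (tI); rewrite /= in_itv /= => /andP[st].
  (* At the right end of the piece the representative computes the left velocity; at its other times
     the right one. *)
  rewrite le_eqVlt => /predU1P[tu|tu].
    have := lv t; rewrite (@rep_left_velocity k W g c t s) ?et//.
    - by apply; rewrite tu ?(le_lt_trans as_ su).
    - by rewrite tu.
    - exact: dg.
    - exact: gi.
    - by move=> y yI Wy; apply: eg => //; rewrite /= in_itv /= -tu.
  have := rv t; rewrite (@rep_right_velocity k W g c t u) ?et//.
  - by apply; rewrite ?(le_trans as_ st)// (lt_le_trans tu ub).
  - exact: dg.
  - exact: gi.
  - move=> y /andP[h1 h2] Wy; apply: eg => //.
    by rewrite /= in_itv /= h2 (le_trans st).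
have cg y : W y -> {for y, continuous (fun y => (g y, 'D_1 g y))}.
  exact: Cr_continuous (Cr_jet oW hg).
pose W' := W `&` (fun y => (g y, 'D_1 g y)) @^-1` CS k.
exists W', g; split.
- by apply: open_preimage_on => //; exact: (open_coord_set hF sk).
- by [].
- by apply: Cr_sub hg => y [].
- by move=> y [].
- by move=> y yI [Wy _]; exact: eg.
Qed.

Lemma apiece_admissible a b c : a < b -> piecewise (apiece c) a b ->
  admissible A a b c.
Proof.
move=> ab ps; split=> //.
- by apply: piecewise_imp ps => I; exact: apiece_Cr_map.
- move=> t at_ tb.
  have [u [tu ub h]] := piecewise_right (@apiece_hereditary c) ps at_ tb.
  have tI : `[t, u]%classic t by rewrite /= in_itv /= lexx ltW.
  have sk := chart_at_smooth (c t).
  have [W [g [oW Wt hg cg eg]]] := h t tI _ sk (chart_at_dom (c t)).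
  have [ig Ag] := cg t Wt.
  rewrite (@rep_right_velocity (chart_at (c t)) W g c t u)//; first by rewrite {1}eg.
  exact: Cr_differentiable hg Wt.
- move=> t at_ tb.
  have [s [st as_ h]] := piecewise_left (@apiece_hereditary c) ps at_ tb.
  have tI : `[s, t]%classic t by rewrite /= in_itv /= lexx ltW.
  have sk := chart_at_smooth (c t).
  have [W [g [oW Wt hg cg eg]]] := h t tI _ sk (chart_at_dom (c t)).
  have [ig Ag] := cg t Wt.
  rewrite (@rep_left_velocity (chart_at (c t)) W g c t s)//; first by rewrite {1}eg.
  exact: Cr_differentiable hg Wt.
Qed.

Definition speed c t : R := F (c t) (velocity c t).

Lemma rep_speed k W (g : R -> V) c t s u : smooth_chart k -> open W -> W t ->
  s < t < u -> differentiable g t -> cimg k (g t) ->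
  (forall y, s <= y <= u -> W y -> c y = cinv k (g y)) ->
  speed c t = CF k (g t, 'D_1 g t).
Proof.
move=> sk oW Wt tI dg ig hg; rewrite /speed (rep_velocity sk oW Wt tI dg ig hg).
by rewrite hg//; case/andP: tI => /ltW -> /ltW ->.
Qed.

Lemma apiece_pcont c s u (f : R -> R) : continuous f -> s < u ->
  apiece c `[s, u]%classic -> pcont (fun t => f (speed c t)) s u.
Proof.
move=> cf su h.
(* The speed from one-sided velocities: equal to the speed inside the piece, and continuous up to
   both ends. *)
pose e t := F (c t) (if t == u then left_velocity c t else right_velocity c t).
have erep k W g t : smooth_chart k -> open W -> W t -> s <= t <= u ->
    differentiable g t -> cimg k (g t) ->
    (forall y, s <= y <= u -> W y -> c y = cinv k (g y)) ->
    e t = CF k (g t, 'D_1 g t).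
  move=> sk oW Wt /andP[st tu] dg ig hg; rewrite /e /coord_fun /= -hg ?st//.
  congr F; case: eqP => [te|tu'].
    by apply: (@rep_left_velocity k W g c t s) => //; rewrite te.
  apply: (@rep_right_velocity k W g c t u) => //.
    by rewrite lt_neqAle tu andbT; apply/eqP.
  by move=> y /andP[h1 h2]; apply: hg; rewrite h2 (le_trans st).
apply: (@pcont_piece _ _ (fun t => f (e t))) => //; last first.
  move=> t tI; congr f.
  have tI' : s <= t <= u by case/andP: tI => /ltW -> /ltW ->.
  have tI2 : `[s, u]%classic t by rewrite /= in_itv.
  have [W [g [oW Wt hg cg eg]]] := h t tI2 _ (chart_at_smooth (c t)) (chart_at_dom (c t)).
  have dg := Cr_differentiable hg Wt; have [ig _] := cg t Wt.
  have eg' y : s <= y <= u -> W y -> c y = cinv (chart_at (c t)) (g y).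
    by move=> yI; apply: eg; rewrite /= in_itv.
  rewrite (rep_speed (chart_at_smooth _) oW Wt tI dg ig eg').
  by rewrite (erep _ _ _ _ (chart_at_smooth _) oW Wt tI' dg ig eg').
apply: (@within_comp _ R R _ e f); last by move=> t _; exact: cf.
apply/subspace_continuousP => t tI.
have tI' : s <= t <= u by move: tI; rewrite /= in_itv.
have sk := chart_at_smooth (c t).
have [W [g [oW Wt hg cg eg]]] := h t tI _ sk (chart_at_dom (c t)).
have eg' y : s <= y <= u -> W y -> c y = cinv (chart_at (c t)) (g y).
  by move=> yI; apply: eg; rewrite /= in_itv.
have E y : s <= y <= u -> W y -> e y = CF (chart_at (c t)) (g y, 'D_1 g y).
  move=> yI Wy; apply: (@erep _ W) => //; first exact: Cr_differentiable hg Wy.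
  by have [] := cg y Wy.
suff : e @ within `[s, u]%classic (nbhs t) --> e t by [].
rewrite (E t tI' Wt).
apply: (@cvg_trans _ ((fun y => CF (chart_at (c t)) (g y, 'D_1 g y)) @ within `[s, u]%classic (nbhs t))).
  apply: near_eq_cvg; rewrite near_withinE.
  apply: filterS (open_nbhs_nbhs (conj oW Wt)) => y Wy yI.
  by rewrite E//; move: yI; rewrite /= in_itv.
apply: cvg_within_filter.
apply: (@continuous_comp _ _ _ (fun y => (g y, 'D_1 g y)) (CF (chart_at (c t)))).
  exact: Cr_continuous (Cr_jet oW hg) Wt.
by apply: (coord_fun_continuous hF sk); exact: cg.
Qed.

Lemma pcont_refl (f : R -> R) a : pcont f a a.
Proof.
split; last by exists [::] => t /andP[h1 h2]; have := lt_trans h1 h2; rewrite ltxx.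
apply: (continuous_compact_integrable (@segment_compact R a a)).
by rewrite set_itv1; exact: continuous_subspace1.
Qed.

Lemma piecewise_pcont c a b (f : R -> R) : continuous f ->
  piecewise (apiece c) a b -> pcont (fun t => f (speed c t)) a b.
Proof.
move=> cf hp; elim/(@piecewise_ind _ (apiece c)) : a b / hp.
  by move=> a; exact: pcont_refl.
move=> a x b ax xb Px _; apply: pcont_cat => //; first exact: ltW.
exact: apiece_pcont.
Qed.

End Admissible.

(** * First variation of the energy *)

Section Perturbation.
Context (R : realType) (V : normedModType R) (fV : findim V).
Implicit Types (g : R -> V) (xi : V) (m sg y : R) (W : set R).

(* With [m = 1] and [m = -1], the two sides of a variation by a hat function. *)
Definition pert m (s0 : R) xi g sg y : V := g y + (sg * (m * (y - s0))) *: xi.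

Lemma pert0 m (s0 : R) xi g y : pert m s0 xi g 0 y = g y.
Proof. by rewrite /pert mul0r scale0r addr0. Qed.

Lemma pert_s0 m (s0 : R) xi g sg : pert m s0 xi g sg s0 = g s0.
Proof. by rewrite /pert subrr !mulr0 scale0r addr0. Qed.

Lemma Cr_pert m (s0 : R) xi g sg W : open W -> Cr None W g ->
  Cr None W (pert m s0 xi g sg).
Proof.
move=> oW hg j; apply: (CkD oW (hg j)).
have h : Ck j W (fun y : R => (sg * m) * y + (- (sg * m * s0))).
  by apply: CkD => //; [apply: Ck_clin; exact: (clin_scaler R (sg * m))|exact: Ck_cst].
by apply: (Ck_eq oW) (CkZr xi oW h) => y _; congr (_ *: _); ring.
Qed.

Lemma derive_pert m (s0 : R) xi g sg y : differentiable g y ->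
  'D_1 (pert m s0 xi g sg) y = 'D_1 g y + (sg * m) *: xi.
Proof.
move=> dg.
have h : is_derive y 1 (fun y : R => (- (sg * m * s0)) *: xi + y *: ((sg * m) *: xi)) ((sg * m) *: xi).
  have := @is_derive_line R _ _ id (- (sg * m * s0) *: xi) ((sg * m) *: xi) y.
  by rewrite derive_id; apply.
have dg' : is_derive y 1 g ('D_1 g y) by apply: derivableP; exact/derivable1_diffP.
have := is_deriveD dg' h => -[_ <-]; congr ('D_1 _ y); apply/funext => z.
by rewrite /pert -[RHS]/(_ + (_ + _)) scalerA -scalerDl; congr (_ + _ *: _); ring.
Qed.

Lemma Cr_comp_snd (W0 X : normedModType R) (W : set W0) (g : W0 -> X) :
  findim W0 -> findim X -> open W -> Cr None W g ->
  open [set z : R * W0 | W z.2] /\ Cr None [set z : R * W0 | W z.2] (fun z => g z.2).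
Proof.
move=> f1 f2 oW hg; have o : open [set z : R * W0 | W z.2].
  by apply: open_comp => // z _; exact: cvg_snd.
split=> //; have hs : Cr None [set z : R * W0 | W z.2] snd.
  by move=> m; apply: Ck_clin; exact: clin_snd.
exact: (Cr_comp o oW f1 f2 (fun _ h => h) hs hg).
Qed.

Lemma Cr_pert2 m (s0 : R) xi g W : open W -> Cr None W g ->
  Cr None [set z : R * R | W z.2] (fun z : R * R => pert m s0 xi g z.1 z.2).
Proof.
move=> oW hg.
have [oW2 hg2] := Cr_comp_snd (findim_R R) fV oW hg.
move=> j; apply: (CkD oW2 (hg2 j)).
have h1 : Ck j [set z : R * R | W z.2] (fun z : R * R => z.1) by apply: Ck_clin; exact: clin_fst.
have h2 : Ck j [set z : R * R | W z.2] (fun z : R * R => m * z.2 + (- (m * s0))).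
  apply: CkD => //; last exact: Ck_cst.
  by apply: Ck_clin; exact: (clin_comp (clin_snd R R) (clin_scaler R m)).
by apply: (Ck_eq oW2) (CkZr xi oW2 (CkM oW2 h1 h2)) => z _; congr (_ *: _); ring.
Qed.

Lemma pert_close (z0 : V * V) m (s0 : R) xi g sg y (r d e : R) : `|m| <= 1 -> `|y - s0| <= d ->
  differentiable g y ->
  ball z0 r (g y, 'D_1 g y) -> `|sg| < e -> e * (1 + d) * (1 + `|xi|) <= r ->
  ball z0 (2 * r) (pert m s0 xi g sg y, 'D_1 (pert m s0 xi g sg) y).
Proof.
move=> m1 yd dg [b1 b2] se er; rewrite derive_pert//.
have d0 : 0 <= d by apply: le_trans yd.
have x0 : 0 <= `|xi| by [].
have e0 : 0 < e by apply: le_lt_trans se.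
have s0' : 0 <= `|sg| by [].
have q : `|sg| * (1 + d) * (1 + `|xi|) <= r.
  apply: le_trans er; rewrite ler_wpM2r ?addr_ge0// ler_wpM2r ?addr_ge0//.
  exact: ltW.
have aux p : `|p| <= `|sg| * (1 + d) -> `|p *: xi| <= r.
  move=> hp; rewrite normrZ; apply: le_trans q.
  apply: ler_pM => //; by rewrite lerDr.
rewrite -ball_normE /ball_ /= in b1; rewrite -ball_normE /ball_ /= in b2.
have h1 : `|(sg * (m * (y - s0))) *: xi| <= r.
  apply: aux; rewrite normrM ler_wpM2l// normrM.
  apply: (@le_trans _ _ (1 * d)); first by apply: ler_pM.
  by rewrite mul1r lerDr.
have h2 : `|(sg * m) *: xi| <= r.
  apply: aux; rewrite normrM ler_wpM2l//; apply: le_trans m1 _.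
  by rewrite lerDl.
split; rewrite /= -ball_normE /ball_ /=.
  rewrite /pert opprD addrA; apply: le_lt_trans (ler_normB _ _) _.
  have -> : 2 * r = r + r by ring.
  by rewrite ltr_leD.
rewrite opprD addrA; apply: le_lt_trans (ler_normB _ _) _.
have -> : 2 * r = r + r by ring.
by rewrite ltr_leD.
Qed.

Lemma jet_near (W : set R) g (t r : R) : open W -> Cr None W g -> W t -> 0 < r ->
  \forall y \near t, ball (g t, 'D_1 g t) r (g y, 'D_1 g y).
Proof.
move=> oW hg Wt r0; exact: (Cr_continuous (Cr_jet oW hg) Wt (nbhsx_ballx _ _ r0)).
Qed.

Lemma open_jet (W : set R) g (U : set (V * V)) : open W -> Cr None W g -> open U ->
  open (W `&` (fun y => (g y, 'D_1 g y)) @^-1` U).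
Proof.
move=> oW hg oU; apply: open_preimage_on => // y Wy.
exact: (Cr_continuous (Cr_jet oW hg) Wy).
Qed.

End Perturbation.

Lemma int_split4 (R : realType) (f g : R -> R) (a s m u b : R) :
  a <= s -> s <= m -> m <= u -> u <= b ->
  lebesgue_measure.-integrable `[a, b] (EFin \o f) ->
  lebesgue_measure.-integrable `[a, b] (EFin \o g) ->
  (forall t, a < t < s -> f t = g t) -> (forall t, u < t < b -> f t = g t) ->
  \int[lebesgue_measure]_(y in `[a, b]) f y =
  (\int[lebesgue_measure]_(y in `[s, m]) f y + \int[lebesgue_measure]_(y in `[m, u]) f y) +
  (\int[lebesgue_measure]_(y in `[a, s]) g y + \int[lebesgue_measure]_(y in `[u, b]) g y).
Proof.
move=> as_ sm mu ub iF iG e1 e2.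
have su := le_trans sm mu; have sb := le_trans su ub; have mb := le_trans mu ub.
have au := le_trans as_ su.
have sub (x y : R) h : a <= x -> y <= b -> lebesgue_measure.-integrable `[a, b] (EFin \o h) ->
    lebesgue_measure.-integrable `[x, y] (EFin \o h).
  by move=> ax yb; apply: integrableS => //; exact: subset_seg.
rewrite (int_split as_ sb iF) (int_split sm mb (sub _ _ _ as_ (lexx b) iF)).
rewrite (int_split mu ub (sub _ _ _ (le_trans as_ sm) (lexx b) iF)).
rewrite (eq_int_oo e1 (sub _ _ _ (lexx a) sb iF) (sub _ _ _ (lexx a) sb iG)).
rewrite (eq_int_oo e2 (sub _ _ _ au (lexx b) iF) (sub _ _ _ au (lexx b) iG)).
by ring.
Qed.

Lemma is_derive_addK (R : realType) (E f : R -> R) (K t d : R) : is_derive t 1 E d ->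
  (\forall x \near t, E x = f x + K) -> is_derive t 1 f d.
Proof.
move=> hE e; have := is_deriveB hE (is_derive_cst K t (1 : R)).
rewrite subr0; apply: near_eq_is_derive; apply: filterS e => x hx.
by rewrite fctE hx addrK.
Qed.

Section Variation.
Context (R : realType) (n : nat) (M : manifold R n)
  (A : M -> set 'rV[R]_n) (F : M -> 'rV[R]_n -> R) (hF : conic_finsler A F).
Implicit Types (k : chart R n M) (c : R -> M) (S : set R) (a b s t u : R).
Local Notation V := 'rV[R]_n.
Local Notation CS := (coord_set A).
Local Notation CF := (coord_fun F).

Lemma speed_near c c' t : (\near t, c t = c' t) -> speed F c t = speed F c' t.
Proof.
move=> e; rewrite /speed /velocity (nbhs_singleton e); congr (F _ _).
rewrite !derive1E; apply: near_eq_derive; apply: filterS e => x /=.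
by move=> ->.
Qed.

Lemma apiece_eq c c' S : (forall t, S t -> c t = c' t) -> apiece A c S -> apiece A c' S.
Proof.
move=> e h t St k sk ct; rewrite -e// in ct.
have [W [g [h1 h2 h3 h4 h5]]] := h t St k sk ct.
by exists W, g; split=> // y Sy Wy; rewrite -e// h5.
Qed.

Definition sqint k (g : R -> V) s u : R :=
  \int[lebesgue_measure]_(y in `[s, u]) (CF k (g y, 'D_1 g y) ^+ 2).

Lemma apiece_rep k (W : set R) (g : R -> V) c s u : smooth_chart k -> open W ->
  (forall y, s <= y <= u -> W y) -> Cr None W g ->
  (forall y, s <= y <= u -> CS k (g y, 'D_1 g y)) ->
  (forall y, s <= y <= u -> c y = cinv k (g y)) -> apiece A c `[s, u]%classic.
Proof.
move=> sk oW sW hg cg eg; apply: arep_apiece => t; rewrite /= in_itv /= => tI.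
exists k => //.
exists (W `&` (fun y => (g y, 'D_1 g y)) @^-1` CS k), g; split.
- exact: open_jet oW hg (open_coord_set hF sk).
- by split; [exact: sW|exact: cg].
- by apply: Cr_sub hg => y [].
- by move=> y [].
- by move=> y; rewrite /= in_itv /= => yI _; exact: eg.
Qed.

Lemma sqint_speed k W (g : R -> V) c s u : smooth_chart k -> s < u -> open W ->
  (forall y, s <= y <= u -> W y) -> Cr None W g ->
  (forall y, s <= y <= u -> CS k (g y, 'D_1 g y)) ->
  (forall y, s <= y <= u -> c y = cinv k (g y)) ->
  \int[lebesgue_measure]_(y in `[s, u]) (speed F c y ^+ 2) = sqint k g s u /\
  pcont (fun y => CF k (g y, 'D_1 g y) ^+ 2) s u.
Proof.
move=> sk su oW sW hg cg eg.
have csq : continuous (fun x : R => x ^+ 2) by move=> x; exact: exprn_continuous.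
have p1 := apiece_pcont hF csq su (apiece_rep sk oW sW hg cg eg).
have e y : s < y < u -> speed F c y ^+ 2 = CF k (g y, 'D_1 g y) ^+ 2.
  move=> yI; have yI' : s <= y <= u by case/andP: yI => /ltW -> /ltW ->.
  congr (_ ^+ 2); apply: (rep_speed F sk oW (sW y yI') yI).
  - exact: (Cr_differentiable hg (sW y yI')).
  - by have [] := cg y yI'.
  - by move=> z zI _; exact: eg.
have p2 : pcont (fun y => CF k (g y, 'D_1 g y) ^+ 2) s u.
  apply: (@pcont_piece _ _ (fun y => CF k (g y, 'D_1 g y) ^+ 2)) => //.
  apply: (@within_comp _ R R _ (fun y => CF k (g y, 'D_1 g y)) (fun x => x ^+ 2)); last by move=> t _; exact: csq.
  apply/subspace_continuousP => y; rewrite /= in_itv /= => yI.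
  apply: cvg_within_filter.
  apply: (@continuous_comp _ _ _ (fun y => (g y, 'D_1 g y)) (CF k)).
    by apply: Cr_continuous (Cr_jet oW hg) _; exact: sW.
  by apply: (coord_fun_continuous hF sk); exact: cg.
split=> //; apply: eq_int_oo => //; [exact: p1.1|exact: p2.1].
Qed.

(** Criticality tested on a hat supported in [[t0 - d, t0 + d]], with slopes one and minus one.
    There are two representatives because [t0] may be a break of [c]. Outside the hat the energy
    does not depend on the parameter, so only two integrals in the chart [k] remain. *)
Lemma hat_variation a b c k W (gm gp : R -> V) (t0 d r : R) (zm zp : V * V) (xi : V) :
  geodesic A F a b c -> smooth_chart k -> 0 < d -> a < t0 - d -> t0 + d < b ->
  open W -> (forall y, t0 - d <= y <= t0 + d -> W y) -> Cr None W gm -> Cr None W gp ->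
  (forall y, t0 - d <= y <= t0 -> c y = cinv k (gm y)) ->
  (forall y, t0 <= y <= t0 + d -> c y = cinv k (gp y)) ->
  0 < r ->
  (forall y, W y -> ball zm r (gm y, 'D_1 gm y)) -> ball zm (2 * r) `<=` CS k ->
  (forall y, W y -> ball zp r (gp y, 'D_1 gp y)) -> ball zp (2 * r) `<=` CS k ->
  is_derive (0 : R) 1 (fun sg => sqint k (pert 1 (t0 - d) xi gm sg) (t0 - d) t0 +
     sqint k (pert (-1) (t0 + d) xi gp sg) t0 (t0 + d)) 0.
Proof.
move=> [adm crit] sk d0 ad db oW sW hgm hgp em ep r0 bm bmC bp bpC.
have [ab pc] := admissible_apiece hF adm.
(* For [|sg| < e] the perturbed jets stay within [2 * r] of [zm] and [zp], hence in [coord_set]. *)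
pose e := r / ((1 + d) * (1 + `|xi|)).
have e0 : 0 < e.
  by rewrite divr_gt0// mulr_gt0// ?addr_gt0// ltr_pwDl.
have er : e * (1 + d) * (1 + `|xi|) <= r.
  by rewrite -mulrA /e divfK// gt_eqF// mulr_gt0// ?addr_gt0// ltr_pwDl.
have t0d : t0 - d < t0 by rewrite gtrBl.
have t0d' : t0 < t0 + d by rewrite ltrDl.
have Wm y : t0 - d <= y <= t0 -> W y.
  by move=> /andP[h1 h2]; apply: sW; rewrite h1; order_lra.
have Wp y : t0 <= y <= t0 + d -> W y.
  by move=> /andP[h1 h2]; apply: sW; rewrite h2; order_lra.
have dgm y : W y -> differentiable gm y := fun h => Cr_differentiable hgm h.
have dgp y : W y -> differentiable gp y := fun h => Cr_differentiable hgp h.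
have clm sg y : `|sg| < e -> t0 - d <= y <= t0 ->
   ball zm (2 * r) (pert 1 (t0 - d) xi gm sg y, 'D_1 (pert 1 (t0 - d) xi gm sg) y).
  move=> he yI; apply: (@pert_close _ _ zm 1 _ _ _ _ _ _ d e) => //; rewrite ?normr1//.
  - by rewrite ger0_norm; lra.
  - by apply: dgm; exact: Wm.
  - by apply: bm; exact: Wm.
have clp sg y : `|sg| < e -> t0 <= y <= t0 + d ->
   ball zp (2 * r) (pert (-1) (t0 + d) xi gp sg y, 'D_1 (pert (-1) (t0 + d) xi gp sg) y).
  move=> he yI; apply: (@pert_close _ _ zp (-1) _ _ _ _ _ _ d e) => //; rewrite ?normrN1//.
  - by rewrite ler0_norm; lra.
  - by apply: dgp; exact: Wp.
  - by apply: bp; exact: Wp.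
pose H (sg t : R) : M := if t <= t0 - d then c t else
  if t <= t0 then cinv k (pert 1 (t0 - d) xi gm sg t) else
  if t <= t0 + d then cinv k (pert (-1) (t0 + d) xi gp sg t) else c t.
(* Both sides of the hat have height [sg * d] at [t0], so the middle pieces of [H] fit together once
   the representatives do. *)
have gmp : gm t0 = gp t0.
  have tI1 : t0 - d <= t0 <= t0 by rewrite lexx ltW.
  have tI2 : t0 <= t0 <= t0 + d by rewrite lexx ltW.
  have [i1 _] := bmC _ (le_ball (ler_peMl (ltW r0) (ler1n _ 2)) (bm _ (Wm _ tI1))).
  have [i2 _] := bpC _ (le_ball (ler_peMl (ltW r0) (ler1n _ 2)) (bp _ (Wp _ tI2))).
  by rewrite /= in i1 i2; rewrite -(cinvK i1) -(cinvK i2) -em// -ep.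
have H1 sg t : t <= t0 - d -> H sg t = c t by rewrite /H => ->.
have H2 sg t : t0 - d <= t <= t0 -> H sg t = cinv k (pert 1 (t0 - d) xi gm sg t).
  move=> /andP[h1 h2]; rewrite /H; case: ifPn => h; last by rewrite h2.
  have -> : t = t0 - d by apply/le_anti; rewrite h h1.
  by rewrite pert_s0 em// lexx ltW.
have H3 sg t : t0 <= t <= t0 + d -> H sg t = cinv k (pert (-1) (t0 + d) xi gp sg t).
  move=> /andP[h1 h2]; rewrite /H ifF; last by apply/negbTE; rewrite -ltNge; order_lra.
  case: ifPn => h; last by rewrite h2.
  have -> : t = t0 by apply/le_anti; rewrite h h1.
  by rewrite /pert gmp; congr (cinv k (_ + _ *: _)); ring.
have H4 sg t : t0 + d <= t -> H sg t = c t.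
  move=> h1; rewrite /H ifF; last by apply/negbTE; rewrite -ltNge; order_lra.
  rewrite ifF; last by apply/negbTE; rewrite -ltNge; order_lra.
  case: ifPn => h //; have -> : t = t0 + d by apply/le_anti; rewrite h h1.
  by rewrite pert_s0 ep// lexx ltW.
have heA := @apiece_hereditary _ _ _ A c.
have [pc1 _] : piecewise (apiece A c) a (t0 - d) /\ piecewise (apiece A c) (t0 - d) b.
  by apply: piecewise_restrict => //; rewrite ltW//=; order_lra.
have [_ pc4] : piecewise (apiece A c) a (t0 + d) /\ piecewise (apiece A c) (t0 + d) b.
  by apply: piecewise_restrict => //; rewrite (ltW db) andbT; order_lra.
have CSm sg y : `|sg| < e -> t0 - d <= y <= t0 ->
    CS k (pert 1 (t0 - d) xi gm sg y, 'D_1 (pert 1 (t0 - d) xi gm sg) y).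
  by move=> he yI; apply: bmC; exact: clm.
have CSp sg y : `|sg| < e -> t0 <= y <= t0 + d ->
    CS k (pert (-1) (t0 + d) xi gp sg y, 'D_1 (pert (-1) (t0 + d) xi gp sg) y).
  by move=> he yI; apply: bpC; exact: clp.
have ap2 sg : `|sg| < e -> apiece A (H sg) `[t0 - d, t0]%classic.
  by move=> he; exact: (apiece_rep sk oW Wm (Cr_pert 1 (t0 - d) xi sg oW hgm) (fun y => CSm sg y he) (fun y => H2 sg y)).
have ap3 sg : `|sg| < e -> apiece A (H sg) `[t0, t0 + d]%classic.
  by move=> he; exact: (apiece_rep sk oW Wp (Cr_pert (-1) (t0 + d) xi sg oW hgp) (fun y => CSp sg y he) (fun y => H3 sg y)).
have pH sg : `|sg| < e -> piecewise (apiece A (H sg)) a b.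
  move=> he; apply: (@piecewise_cat _ _ a (t0 - d)).
    apply: piecewise_imp_in pc1 => s u _ _ ub; apply: apiece_eq => t.
    by rewrite /= in_itv /= => /andP[_ tu]; rewrite H1// (le_trans tu).
  apply: (piecewise_cons t0d (ap2 _ he)).
  apply: (piecewise_cons t0d' (ap3 _ he)).
  apply: piecewise_imp_in pc4 => s u as_ _ _; apply: apiece_eq => t.
  by rewrite /= in_itv /= => /andP[ts _]; rewrite H4// (le_trans as_).
(* Joint smoothness in parameter and time, piece by piece: [c1] for the pieces that do not move,
   [c2] for the two sides of the hat. *)
have crH : piecewise (fun I => Cr_map None (`]- e, e[%classic `*` I)
    (fun z : R * R => H z.1 z.2)) a b.
  have c1 (I : set R) : apiece A c I -> (forall sg t, I t -> H sg t = c t) ->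
      Cr_map None (`]- e, e[%classic `*` I) (fun z : R * R => H z.1 z.2).
    move=> hI eH; apply: locrep_Cr_map => -[sg t] [_ /= It].
    exists (chart_at (c t)); first exact: chart_at_smooth.
    have [W' [g [oW' W't hg cg eg]]] := hI t It _ (chart_at_smooth (c t)) (chart_at_dom (c t)).
    have [oW2 hg2] := Cr_comp_snd (findim_R R) (findim_rV R n) oW' hg.
    exists [set z : R * R | W' z.2], (fun z : R * R => g z.2); split=> //.
    - by move=> z /cg[].
    - by move=> [sg' t'] [_ /= It'] /= Wt'; rewrite eH// eg.
  have c2 (I : set R) (m s0 : R) g : Cr None W g -> I `<=` W -> (forall sg t, `|sg| < e -> I t -> cimg k (pert m s0 xi g sg t)) ->
      (forall sg t, I t -> H sg t = cinv k (pert m s0 xi g sg t)) ->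
      Cr_map None (`]- e, e[%classic `*` I) (fun z : R * R => H z.1 z.2).
    move=> hg IW ig eH; apply: locrep_Cr_map => -[sg t] [/= sI It].
    exists k => //.
    have h2 := Cr_pert2 (findim_rV R n) m s0 xi oW hg.
    have [oW2 _] := Cr_comp_snd (findim_R R) (findim_rV R n) oW hg.
    exists ([set z : R * R | W z.2] `&` (fun z : R * R => pert m s0 xi g z.1 z.2) @^-1` cimg k),
      (fun z : R * R => pert m s0 xi g z.1 z.2); split=> //.
    - apply: open_preimage_on; [exact: oW2| |exact: cimg_open].
      by move=> z Wz; exact: (Cr_continuous h2 Wz).
    - split; first exact: IW.
      by apply: ig => //; move: sI; rewrite in_itv /= ltr_norml.
    - by apply: Cr_sub h2 => z [].
    - by move=> z [].
    - by move=> [sg' t'] [_ /= It'] _; rewrite eH.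
  apply: (@piecewise_cat _ _ a (t0 - d)).
    apply: piecewise_imp_in pc1 => s u _ _ ub hI; apply: c1 => // sg t.
    by rewrite /= in_itv /= => /andP[_ tu]; rewrite H1// (le_trans tu).
  apply: (piecewise_cons t0d (c2 _ 1 (t0 - d) gm hgm Wm (fun sg t he tI => (CSm sg t he tI).1) H2)).
  apply: (piecewise_cons t0d' (c2 _ (-1) (t0 + d) gp hgp Wp (fun sg t he tI => (CSp sg t he tI).1) H3)).
  apply: piecewise_imp_in pc4 => s u as_ _ _ hI; apply: c1 => // sg t.
  by rewrite /= in_itv /= => /andP[ts _]; rewrite H4// (le_trans as_).
have H0 t : H 0 t = c t.
  case: (leP t (t0 - d)) => h1; first exact: H1.
  case: (leP t t0) => h2; first by rewrite H2 ?pert0 ?em// (ltW h1).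
  case: (leP t (t0 + d)) => h3; first by rewrite H3 ?pert0 ?ep// (ltW h2).
  by rewrite H4// ltW.
have var : admissible_variation A a b c e H.
  split=> // sg /andP[h1 h2]; have he : `|sg| < e by rewrite ltr_norml h1.
  split; [exact: apiece_admissible (pH _ he)|by rewrite H1 ?ltW|by rewrite H4 ?ltW].
have dE := crit e H var.
have csq : continuous (fun x : R => x ^+ 2) by move=> x; exact: exprn_continuous.
have pcc := piecewise_pcont hF csq pc.
pose K := \int[lebesgue_measure]_(y in `[a, t0 - d]) (speed F c y ^+ 2) +
  \int[lebesgue_measure]_(y in `[t0 + d, b]) (speed F c y ^+ 2).
have eE : \forall sg \near (0 : R), energy F a b (H sg) =
   (sqint k (pert 1 (t0 - d) xi gm sg) (t0 - d) t0 +
     sqint k (pert (-1) (t0 + d) xi gp sg) t0 (t0 + d)) + K.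
  have ne : \forall sg \near (0 : R), `|sg| < e.
    by have := nbhsx_ballx (0 : R) e e0; apply: filterS => x; rewrite -ball_normE /ball_ /= sub0r normrN.
  apply: filterS ne => sg he.
  have [q1 _] := sqint_speed sk t0d oW Wm (Cr_pert 1 (t0 - d) xi sg oW hgm) (fun y => CSm sg y he) (fun y => H2 sg y).
  have [q2 _] := sqint_speed sk t0d' oW Wp (Cr_pert (-1) (t0 + d) xi sg oW hgp) (fun y => CSp sg y he) (fun y => H3 sg y).
  have iH := (piecewise_pcont hF csq (pH sg he)).1.
  rewrite -[energy _ _ _ _]/(\int[lebesgue_measure]_(y in `[a, b]) (speed F (H sg) y ^+ 2)).
  rewrite -q1 -q2 /K; apply: (int_split4 _ (ltW t0d) (ltW t0d') _ iH pcc.1); first exact: ltW.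
  - exact: ltW.
  - move=> t /andP[_ h]; congr (_ ^+ 2); apply: speed_near.
    by have := lt_nbhsl h; apply: filterS => x /ltW; exact: H1.
  - move=> t /andP[h _]; congr (_ ^+ 2); apply: speed_near.
    by have := lt_nbhsr h; apply: filterS => x /ltW; exact: H4.
exact: is_derive_addK dE eE.
Qed.

End Variation.

(** * One-sided lower bounds for the energy of a variation *)

Section Half.
Context (R : realType).
Notation mu := (@lebesgue_measure R).

Lemma int_lower2 (f f0 h : R -> R) (s u : R) : s <= u -> pcont f s u -> pcont f0 s u ->
  {within `[s, u], continuous h} ->
  (forall t : R, s < t < u -> exists2 d, d <= f t - f0 t & is_derive t 1 h d) ->
  h u - h s <= \int[mu]_(x in `[s, u]) f x - \int[mu]_(x in `[s, u]) f0 x.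
Proof.
move=> su pf pf0 ch dh.
have [cI [E dI]] := pcont_primitive su pf0.
set I := (fun t => \int[mu]_(x in `[s, t]) f0 x) in cI dI.
have I0 : I s = 0 by rewrite /I set_itv1 Rintegral_set1.
have cH : {within `[s, u], continuous (fun t => h t + I t)}.
  by move=> t; apply: continuousD; [exact: ch|exact: cI].
have := int_lower su pf cH (E := E); rewrite I0 addr0 -/(I u) => H.
rewrite lerBrDr addrAC; apply: H => t tI tE.
have [d d1 d2] := dh t tI.
by exists (d + f0 t); [rewrite -lerBrDr|exact: is_deriveD d2 (dI t tI tE)].
Qed.

(** The primitive that performs the integration by parts. With [eta = m * (y - s0)] it is
    [al * (eta * P)] plus [al * k0] times the primitive [m * (y - s0) ^+ 2 / 2] of [eta], minus a
    linear error term. *)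
Lemma is_derive_hat (P : R -> R) (dP m s0 k0 al be y : R) : is_derive y 1 P dP ->
  is_derive y 1 (fun y : R => al * (m * (y - s0) * P y + k0 * (m * (y - s0) ^+ 2 / 2)) - be * y)
    (al * (m * P y + m * (y - s0) * dP + k0 * (m * (y - s0))) - be).
Proof.
move=> hP.
have hid : is_derive y 1 (fun y : R => y - s0) 1.
  have := is_deriveB (is_derive_id y (1 : R)) (is_derive_cst s0 y (1 : R)).
  by rewrite subr0.
have h1 := is_deriveZ m (is_deriveM hid hP).
have h2 := is_deriveZ (k0 * m / 2) (is_deriveM hid hid).
have h3 := is_deriveB (is_deriveZ al (is_deriveD h1 h2)) (is_deriveZ be (is_derive_id y (1 : R))).
have -> : (fun y : R => al * (m * (y - s0) * P y + k0 * (m * (y - s0) ^+ 2 / 2)) - be * y) =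
  (al *: (m *: ((fun y => y - s0) * P) + (k0 * m / 2) *: ((fun y => y - s0) * (fun y => y - s0))) - be *: id).
  apply/funext => x.
  rewrite -[RHS]/(al * (m * ((x - s0) * P x) + (k0 * m / 2) * ((x - s0) * (x - s0))) - be * x).
  by field.
apply: is_derive_eq h3 _.
rewrite -![_ *: _]/(_ * _); by field.
Qed.

(* At a zero velocity [L] is not differentiable, and only a one-sided estimate of
   the variation is available. *)
Definition half_bound (f : R -> R) (B : R) : Prop := exists K e : R, 0 < e /\
  forall x, 0 <= x < e -> 2 * x * B - K * x ^+ 2 <= f x - f 0.

(** For small positive [x] the sum changes by [o(x)], yet by at least [2 * x * (B1 + B2)] minus a
    quadratic term; a positive [B1 + B2] is therefore impossible. *)
Lemma half_bound_le (f1 f2 : R -> R) (B1 B2 : R) : half_bound f1 B1 -> half_bound f2 B2 ->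
  is_derive (0 : R) 1 (fun x => f1 x + f2 x) 0 -> B1 + B2 <= 0.
Proof.
move=> [K1 [e1 [e10 h1]]] [K2 [e2 [e20 h2]]] [df Df]; rewrite leNgt; apply/negP => B0.
have := df; rewrite /derivable => /cvg_ex [l hl].
have l0 : l = 0 by rewrite -Df /derive; apply/esym/cvg_lim.
rewrite l0 in hl.
set K := Num.max 1 (K1 + K2).
have K0 : 0 < K by rewrite lt_max ltr01.
move/cvgrPdist_lt : hl => /(_ _ B0).
rewrite /dnbhs /= near_withinE => /nbhs_ballP [e e0 he].
(* Small enough for the three neighbourhoods, and with [K * x <= B1 + B2], so that the quadratic
   term uses up at most half of [2 * x * (B1 + B2)]. *)
pose x := Num.min (Num.min (e / 2) (e1 / 2)) (Num.min (e2 / 2) ((B1 + B2) / (K))).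
have x0 : 0 < x by rewrite !lt_min !divr_gt0.
have [xe xe1 xe2 xK] : [/\ x <= e / 2, x <= e1 / 2, x <= e2 / 2 & x <= (B1 + B2) / K].
  by rewrite /x !ge_min !lexx !orbT.
have xne : x != 0 by rewrite gt_eqF.
have xb : ball (0 : R) e x.
  by rewrite -ball_normE /ball_ /= sub0r normrN gtr0_norm//; lra.
have := he x xb xne.
rewrite sub0r normrN !addr0.
rewrite -[x%:A]/(x * 1) mulr1 -[_ *: _]/(x^-1 * _) => h.
have q1 : 2 * x * B1 - K1 * x ^+ 2 <= f1 x - f1 0 by apply: h1; rewrite (ltW x0)/=; lra.
have q2 : 2 * x * B2 - K2 * x ^+ 2 <= f2 x - f2 0 by apply: h2; rewrite (ltW x0)/=; lra.
have := le_lt_trans (ler_norm _) h.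
rewrite mulrC ltr_pdivrMr// => q3.
have q4 : (K1 + K2) * x <= K * x by rewrite ler_wpM2r ?(ltW x0)// le_max lexx orbT.
have q5 : x * K <= B1 + B2 by rewrite -ler_pdivlMr.
have q6 : (K1 + K2) * x ^+ 2 <= (B1 + B2) * x.
  rewrite expr2 mulrA ler_wpM2r ?(ltW x0)//; lra.
lra.
Qed.

Context (V : normedModType R) (fV : findim V) (U : set (V * V)) (oU : open U)
  (L : V * V -> R) (hL : Cr None U L).

Lemma taylor_lower (z0 z ze : V * V) (d C x : R) : 0 <= x -> 0 <= C -> ball z0 d `<=` U ->
  (forall z1 z2 u, ball z0 d z1 -> ball z0 d z2 ->
      `|'D_u L z1 - 'D_u L z2| <= C * `|u| * `|z1 - z2|) ->
  ball z0 d z -> ball z0 d (z + x *: ze) ->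
  L z + x * 'D_ze L z - C * `|ze| ^+ 2 * x ^+ 2 <= L (z + x *: ze).
Proof.
move=> x0 C0 bU lip bz bx.
have seg t : 0 <= t <= x -> ball z0 d (z + t *: ze).
  move=> /andP[t0 tx]; case: (eqVneq x 0) => [xe|xn].
    by have -> : t = 0 by [apply/le_anti; rewrite t0 -xe tx]; rewrite scale0r addr0.
  have := @ball_segment _ _ z0 (z + x *: ze) z d (t / x).
  rewrite addrAC subrr add0r scalerA divfK//; apply => //.
  by rewrite divr_ge0//= ler_pdivrMr ?mul1r// lt_neqAle eq_sym xn.
pose f t := L (z + t *: ze) - t * 'D_ze L z.
have df t : 0 <= t <= x -> is_derive t 1 f ('D_ze L (z + t *: ze) - 'D_ze L z).
  move=> tI.
  have h1 : is_derive t 1 (fun t : R => L (z + t *: ze)) ('D_ze L (z + t *: ze)).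
    by apply: is_derive_line; apply: (Cr_differentiable hL); apply: bU; exact: seg.
  have h2 := is_deriveZ ('D_ze L z) (is_derive_id t (1 : R)).
  have h3 : is_derive t 1 (fun t : R => t * 'D_ze L z) ('D_ze L z).
    have -> : (fun t : R => t * 'D_ze L z) = 'D_ze L z *: id.
      by apply/funext => y; rewrite mulrC.
    by apply: is_derive_eq h2 _; rewrite -[_ *: _]/(_ * _) mulr1.
  exact: is_deriveB h1 h3.
have := @abs_mvt _ f (fun t => 'D_ze L (z + t *: ze) - 'D_ze L z) 0 x (C * `|ze| ^+ 2 * x) x0.
rewrite subr0 /f scale0r addr0 mul0r subr0 => H.
have {H} : `|L (z + x *: ze) - x * 'D_ze L z - L z| <= C * `|ze| ^+ 2 * x * x.
  apply: H.
  - apply/subspace_continuousP => t tI; apply: cvg_within_filter.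
    apply: differentiable_continuous; apply/derivable1_diffP.
    by have [] := df t; move: tI; rewrite /= in_itv.
  - by move=> t /andP[t1 t2]; apply: df; rewrite !ltW.
  - move=> t /andP[t1 t2]; apply: le_trans (lip _ _ _ _ bz) _.
      by apply: seg; rewrite !ltW.
    rewrite addrAC subrr add0r normrZ (gtr0_norm t1).
    have -> : C * `|ze| * (t * `|ze|) = C * `|ze| ^+ 2 * t by ring.
    by rewrite ler_wpM2l ?(ltW t2)// mulr_ge0// exprn_ge0.
rewrite ler_norml => /andP[h _].
have -> : C * `|ze| ^+ 2 * x ^+ 2 = C * `|ze| ^+ 2 * x * x by ring.
lra.
Qed.

(** First variation with a remainder. With [eta = m * (y - s0)], the integrand changes to first
    order by [2 * x * (eta * 'D_(xi, 0) L + m * P)]. Since [eta] is nonnegative and the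
    Euler-Lagrange defect ['D_(xi, 0) L - 'D_1 P] is at least [k0], this is at least [2 * x] times
    the derivative of [eta * P + k0 * (m * (y - s0) ^+ 2 / 2)]; the bound is the increment of that
    function from [s] to [u]. *)
Lemma half_estimate (Q : V * V -> R) (z0 : V * V) (d C e D m s0 s u k0 : R) (xi : V)
    (g : R -> V) (W : set R) :
  (forall z, L z = 2^-1 * Q z ^+ 2) -> 0 <= C -> ball z0 d `<=` U ->
  (forall z1 z2 w, ball z0 d z1 -> ball z0 d z2 ->
      `|'D_w L z1 - 'D_w L z2| <= C * `|w| * `|z1 - z2|) ->
  0 < e -> s < u -> `|m| <= 1 -> open W -> (forall y, s <= y <= u -> W y) -> Cr None W g ->
  (forall y, s <= y <= u -> 0 <= m * (y - s0) <= D) ->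
  (forall y, W y -> U (g y, 'D_1 g y)) ->
  (forall x y, `|x| < e -> s <= y <= u ->
     ball z0 d (pert m s0 xi g x y, 'D_1 (pert m s0 xi g x) y)) ->
  (forall x, `|x| < e -> pcont (fun y => Q (pert m s0 xi g x y, 'D_1 (pert m s0 xi g x) y) ^+ 2) s u) ->
  let P y := 'D_(0, xi) L (g y, 'D_1 g y) in
  (forall y, s < y < u -> k0 <= 'D_(xi, 0) L (g y, 'D_1 g y) - 'D_1 P y) ->
  half_bound (fun x => \int[mu]_(y in `[s, u])
      (Q (pert m s0 xi g x y, 'D_1 (pert m s0 xi g x) y) ^+ 2))
    ((m * (u - s0) * P u + k0 * (m * (u - s0) ^+ 2 / 2)) -
     (m * (s - s0) * P s + k0 * (m * (s - s0) ^+ 2 / 2))).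
Proof.
move=> eL C0 bU lip e0 su m1 oW sW hg eta gU bp pQ P hk.
have D0 : 0 <= D.
  have sI : s <= s <= u by rewrite lexx ltW.
  by have /andP[] := eta s sI; exact: le_trans.
(* [(1 + D) * |xi|] bounds the direction in which the jet moves, and the factor [2] comes from
   [Q ^+ 2 = 2 * L]. *)
pose K0 := 2 * C * ((1 + D) * `|xi|) ^+ 2.
have jet := Cr_jet oW hg.
have hP : Cr None W P.
  exact: (Cr_comp oW oU (findim_prod fV fV) (findim_R R) gU jet (Cr_S (0, xi) hL)).
have dP y : W y -> is_derive y 1 P ('D_1 P y).
  by move=> Wy; apply: derivableP; apply/derivable1_diffP; exact: Cr_differentiable hP Wy.
exists (K0 * (u - s)), e; split=> // x /andP[x0 xe].
have xa : `|x| < e by rewrite ger0_norm.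
have z0a : `|0 : R| < e by rewrite normr0.
pose h (y : R) := 2 * x * (m * (y - s0) * P y + k0 * (m * (y - s0) ^+ 2 / 2)) - K0 * x ^+ 2 * y.
have dh y : W y -> is_derive y 1 h (2 * x * (m * P y + m * (y - s0) * 'D_1 P y + k0 * (m * (y - s0))) - K0 * x ^+ 2).
  by move=> Wy; apply: is_derive_hat; exact: dP.
have -> : 2 * x * ((m * (u - s0) * P u + k0 * (m * (u - s0) ^+ 2 / 2)) -
     (m * (s - s0) * P s + k0 * (m * (s - s0) ^+ 2 / 2))) - K0 * (u - s) * x ^+ 2 = h u - h s.
  by rewrite /h; ring.
apply: int_lower2 (pQ _ xa) (pQ _ z0a) _ _; first exact: ltW.
  apply/subspace_continuousP => t tI; apply: cvg_within_filter.
  apply: differentiable_continuous; apply/derivable1_diffP.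
  have Wt : W t by apply: sW; move: tI; rewrite /= in_itv.
  by have [] := dh t Wt.
move=> y yI; have yI' : s <= y <= u by case/andP: yI => /ltW -> /ltW ->.
have Wy := sW y yI'; exists (2 * x * (m * P y + m * (y - s0) * 'D_1 P y + k0 * (m * (y - s0))) - K0 * x ^+ 2); last exact: dh.
have dg := Cr_differentiable hg Wy.
have bx := bp x y xa yI'; have b0 := bp 0 y z0a yI'.
rewrite (derive_pert _ _ _ _ dg) in bx *.
rewrite (derive_pert _ _ _ _ dg) in b0 *.
rewrite pert0 mul0r scale0r addr0 in b0 *.
set z := (g y, 'D_1 g y) in b0 *.
pose ze := ((m * (y - s0)) *: xi, m *: xi).
have ex : (pert m s0 xi g x y, 'D_1 g y + (x * m) *: xi) = z + x *: ze.
  by rewrite /z /ze pairZE pairDE !scalerA.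
rewrite ex in bx *.
have := taylor_lower x0 C0 bU lip b0 bx.
have Uz : U z by exact: bU.
have lD := derive_clin (Cr_differentiable hL Uz).
have eze : ze = (m * (y - s0)) *: (xi, 0) + m *: (0, xi).
  by rewrite /ze !pairZE pairDE !scaler0 addr0 add0r.
have -> : 'D_ze L z = m * (y - s0) * 'D_(xi, 0) L z + m * P y.
  by rewrite eze (clinD _ _ lD) !(clinZ _ _ lD).
have nze : `|ze| <= (1 + D) * `|xi|.
  have /andP[h1 h2] := eta y yI'.
  have hn : `|ze| <= (m * (y - s0)) * `|xi| + `|m| * `|xi|.
    rewrite eze; apply: le_trans (ler_normD _ _) _.
    have na (a : R) (w : V * V) : `|a *: w| = `|a| * `|w| by exact: normrZ.
    have e1 := na (m * (y - s0)) (xi, 0); have e2 := na m (0, xi).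
    by rewrite norm0Z (ger0_norm h1) in e1; rewrite normZ0 in e2; rewrite e1 e2.
  apply: le_trans hn _; rewrite -mulrDl ler_wpM2r//; lra.
have nze2 : C * `|ze| ^+ 2 <= C * ((1 + D) * `|xi|) ^+ 2.
  have z1 : 0 <= `|ze| by exact: normr_ge0.
  by rewrite ler_wpM2l// lerXn2r// nnegrE (le_trans z1).
have hk' := hk y yI.
have /andP[eta0 _] := eta y yI'.
have n3 : C * `|ze| ^+ 2 * x ^+ 2 <= C * ((1 + D) * `|xi|) ^+ 2 * x ^+ 2.
  by rewrite ler_wpM2r// sqr_ge0.
have n4 : (m * (y - s0)) * k0 <= (m * (y - s0)) * ('D_(xi, 0) L z - 'D_1 P y).
  by rewrite ler_wpM2l.
have n5 : x * ((m * (y - s0)) * k0) <= x * ((m * (y - s0)) * ('D_(xi, 0) L z - 'D_1 P y)).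
  by rewrite ler_wpM2l.
rewrite !eL /K0.
set a1 := Q _ ^+ 2; set a2 := Q _ ^+ 2; set a3 := 'D_(xi, 0) L z in n4 n5 *.
set a4 := 'D_1 P y in n4 n5 *; set a5 := m * (y - s0) in n4 n5 *.
set a6 := C * _ * _ in n3 *; set a7 := C * _ * _ in n3 *.
have -> : 2 * C * ((1 + D) * `|xi|) ^+ 2 * x ^+ 2 = 2 * a7 by rewrite /a7; ring.
move: n3 n5; set a8 := P y.
clear; move=> n3 n5 n6.
have -> : 2 * x * (m * a8 + a5 * a4 + k0 * a5) = 2 * (x * (a5 * a3 + m * a8)) - 2 * (x * (a5 * (a3 - a4))) + 2 * (x * (a5 * k0)) by ring.
lra.
Qed.

End Half.

(** The boundary terms of one side of a hat: the foot contributes nothing, the vertex contributes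
    the momentum with a sign that differs between the two sides, and each side has area
    [d ^+ 2 / 2]. *)
Lemma hat_left (R : realType) (t0 d kap p q : R) :
  1 * (t0 - (t0 - d)) * p + kap * (1 * (t0 - (t0 - d)) ^+ 2 / 2) -
   (1 * (t0 - d - (t0 - d)) * q + kap * (1 * (t0 - d - (t0 - d)) ^+ 2 / 2)) =
   d * p + kap * (d ^+ 2 / 2).
Proof. by field. Qed.

Lemma hat_right (R : realType) (t0 d kap p q : R) :
  -1 * (t0 + d - (t0 + d)) * q + kap * (-1 * (t0 + d - (t0 + d)) ^+ 2 / 2) -
   (-1 * (t0 - (t0 + d)) * p + kap * (-1 * (t0 - (t0 + d)) ^+ 2 / 2)) =
   - (d * p) + kap * (d ^+ 2 / 2).
Proof. by field. Qed.

Section WeakEL.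
Context (R : realType) (n : nat) (M : manifold R n)
  (A : M -> set 'rV[R]_n) (F : M -> 'rV[R]_n -> R) (hF : conic_finsler A F).
Implicit Types (k : chart R n M) (c : R -> M) (a b s t u : R).
Local Notation V := 'rV[R]_n.
Local Notation CS := (coord_set A).
Local Notation CSn := (CSn A).
Local Notation CF := (coord_fun F).
Local Notation lag := (lag F).

Definition lhat k (g : R -> V) (t0 : R) (xi : V) (d x : R) : R :=
  sqint F k (pert 1 (t0 - d) xi g x) (t0 - d) t0.
Definition rhat k (g : R -> V) (t0 : R) (xi : V) (d x : R) : R :=
  sqint F k (pert (-1) (t0 + d) xi g x) t0 (t0 + d).

Definition near_itv t0 (d : R) : set R := [set y | t0 - d < y < t0 + d].

Lemma open_near_itv t0 d : open (near_itv t0 d).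
Proof.
suff -> : near_itv t0 d = `]t0 - d, t0 + d[%classic by exact: interval_open.
by apply/seteqP; split => y; rewrite /near_itv /= in_itv.
Qed.

(* [2 * B d] bounds from below the derivative at [0] of one side of the variation
   by a hat of half-width [d]. *)
Definition half k (g : R -> V) (t0 : R) (f : R -> R -> R) (B : R -> R) : Prop :=
  exists2 r0 : R, 0 < r0 & forall r, 0 < r <= r0 ->
    ball (g t0, 'D_1 g t0) (2 * r) `<=` CS k /\
    exists d0 : R, [/\ 0 < d0, Cr None (near_itv t0 d0) g,
      forall y, near_itv t0 d0 y -> ball (g t0, 'D_1 g t0) r (g y, 'D_1 g y) &
      forall d, 0 < d < d0 -> half_bound (f d) (B d)].

(** The two one-sided bounds add up to a lower bound for a function with vanishing derivative.
    Either side may be in motion or at rest, which is why the bounds [Bm] and [Bp] are left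
    abstract. *)
Lemma corner a b c k (gm gp : R -> V) (t0 e : R) (xi : V) (Bm Bp : R -> R) :
  geodesic A F a b c -> smooth_chart k -> a < t0 < b -> 0 < e ->
  (forall y, t0 - e < y <= t0 -> c y = cinv k (gm y)) ->
  (forall y, t0 <= y < t0 + e -> c y = cinv k (gp y)) ->
  half k gm t0 (lhat k gm t0 xi) Bm -> half k gp t0 (rhat k gp t0 xi) Bp ->
  exists2 d1 : R, 0 < d1 & forall d, 0 < d < d1 -> Bm d + Bp d <= 0.
Proof.
move=> geo sk /andP[at0 tb] e0 em ep [r1 r10 h1] [r2 r20 h2].
pose r := Num.min r1 r2.
have r0 : 0 < r by rewrite lt_min r10.
have [C1 [d1 [d10 cm bm hm]]] : ball (gm t0, 'D_1 gm t0) (2 * r) `<=` CS k /\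
    exists d0 : R, [/\ 0 < d0, Cr None (near_itv t0 d0) gm,
      forall y, near_itv t0 d0 y -> ball (gm t0, 'D_1 gm t0) r (gm y, 'D_1 gm y) &
      forall d, 0 < d < d0 -> half_bound (lhat k gm t0 xi d) (Bm d)].
  by apply: h1; rewrite r0 ge_min lexx.
have [C2 [d2 [d20 cp bp hp]]] : ball (gp t0, 'D_1 gp t0) (2 * r) `<=` CS k /\
    exists d0 : R, [/\ 0 < d0, Cr None (near_itv t0 d0) gp,
      forall y, near_itv t0 d0 y -> ball (gp t0, 'D_1 gp t0) r (gp y, 'D_1 gp y) &
      forall d, 0 < d < d0 -> half_bound (rhat k gp t0 xi d) (Bp d)].
  by apply: h2; rewrite r0 ge_min lexx orbT.
pose d3 := Num.min (Num.min d1 d2) (Num.min e (Num.min (t0 - a) (b - t0))).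
exists d3; first by rewrite !lt_min d10 d20 e0 !subr_gt0 at0 tb.
have [w1 w2 q2 q3 q4] : [/\ d3 <= d1, d3 <= d2, d3 <= e, d3 <= t0 - a & d3 <= b - t0].
  by split; rewrite /d3 !ge_min lexx ?orbT.
have s1 : near_itv t0 d3 `<=` near_itv t0 d1 by move=> y /andP[i1 i2]; apply/andP; order_lra.
have s2 : near_itv t0 d3 `<=` near_itv t0 d2 by move=> y /andP[i1 i2]; apply/andP; order_lra.
move=> d /andP[d0 dd3].
have H : is_derive (0 : R) 1 (fun x => lhat k gm t0 xi d x + rhat k gp t0 xi d x) 0.
  apply: (@hat_variation _ _ _ _ _ hF a b c k (near_itv t0 d3) gm gp t0 d r
    (gm t0, 'D_1 gm t0) (gp t0, 'D_1 gp t0) xi geo sk d0).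
  - by order_lra.
  - by order_lra.
  - exact: open_near_itv.
  - by move=> y /andP[i1 i2]; apply/andP; order_lra.
  - exact: Cr_sub cm.
  - exact: Cr_sub cp.
  - by move=> y /andP[i1 i2]; apply: em; apply/andP; order_lra.
  - by move=> y /andP[i1 i2]; apply: ep; apply/andP; order_lra.
  - exact: r0.
  - by move=> y /s1; exact: bm.
  - exact: C1.
  - by move=> y /s2; exact: bp.
  - exact: C2.
apply: half_bound_le H; [apply: hm|apply: hp]; rewrite d0/=; order_lra.
Qed.

Lemma near_itvP t0 (P : set R) : (\near t0, P t0) -> exists2 d : R, 0 < d & near_itv t0 d `<=` P.
Proof.
move=> /nbhs_ballP [d d0 hd]; exists d => // y /andP[h1 h2]; apply: hd.
by rewrite -ball_normE /ball_ /= ltr_distlC h1 h2.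
Qed.

(** A curve at rest has energy zero and every variation of it has nonnegative energy. So [0] is a
    valid bound even though [lag] may fail to be differentiable at a zero vector. *)
Lemma half_zero k (x0 : V) t0 (f : R -> R -> R) m (sg : R -> R) (s u : R -> R) xi :
  smooth_chart k -> CS k (x0, 0) ->
  (forall d x, f d x = sqint F k (pert m (sg d) xi (cst x0) x) (s d) (u d)) ->
  half k (cst x0) t0 f (fun=> 0).
Proof.
move=> sk C0 ef.
have dc y : 'D_1 (cst x0 : R -> V) y = 0 by rewrite derive_cst.
have [r0 r00 hr] : exists2 r0 : R, 0 < r0 & ball (x0, 0 : V) r0 `<=` CS k.
  by have /nbhs_ballP [r0 r00 h] := open_nbhs_nbhs (conj (open_coord_set hF sk) C0); exists r0.
exists (r0 / 2); first by rewrite divr_gt0.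
move=> r /andP[rp rr].
rewrite dc; split.
  by apply: subset_trans hr; apply: le_ball; lra.
exists 1; split; [exact: ltr01|by move=> j; exact: Ck_cst|by move=> y _; rewrite dc; exact: ballxx|].
move=> d _; exists 0, 1; split; first exact: ltr01.
move=> x _.
have e0 : sqint F k (pert m (sg d) xi (cst x0) 0) (s d) (u d) = 0.
  have -> : pert m (sg d) xi (cst x0 : R -> V) 0 = cst x0.
    by apply/funext => y; rewrite pert0.
  rewrite /sqint.
  have -> : (fun y => CF k (cst x0 y, 'D_1 (cst x0 : R -> V) y) ^+ 2) = cst 0.
    by apply/funext => y; rewrite dc /= (CF_eq0 hF sk C0).2 ?expr0n.
  by rewrite Rintegral_cst// mul0r.
rewrite mulr0 mul0r subr0 subr_ge0 !ef e0.
by apply: Rintegral_ge0 => y _; exact: sqr_ge0.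
Qed.

(** [kap] lies strictly below the Euler-Lagrange defect at [t0]; by continuity it stays below it on
    a neighbourhood, which makes [half_estimate] available on both sides. *)
Lemma halves k (W : set R) (g : R -> V) t0 xi kap : smooth_chart k -> open W -> W t0 ->
  Cr None W g -> CSn k (g t0, 'D_1 g t0) ->
  let P := fun y => 'D_(0, xi) (lag k) (g y, 'D_1 g y) in
  kap < 'D_(xi, 0) (lag k) (g t0, 'D_1 g t0) - 'D_1 P t0 ->
  half k g t0 (lhat k g t0 xi) (fun d => d * P t0 + kap * (d ^+ 2 / 2)) /\
  half k g t0 (rhat k g t0 xi) (fun d => - (d * P t0) + kap * (d ^+ 2 / 2)).
Proof.
move=> sk oW Wt hg Ct P hk.
have fV := findim_rV R n.
have oC := open_CSn hF sk; have hL := Cr_lag hF sk.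
have jet := Cr_jet oW hg.
pose W1 := W `&` (fun y => (g y, 'D_1 g y)) @^-1` CSn k.
have oW1 : open W1.
  exact: open_jet oW hg oC.
have W1W : W1 `<=` W by move=> y [].
have jet1 := Cr_sub W1W jet.
have cmp (ze : V * V) : Cr None W1 (fun y => 'D_ze (lag k) (g y, 'D_1 g y)).
  by apply: (Cr_comp oW1 oC (findim_prod fV fV) (findim_R R) _ jet1 (Cr_S ze hL)) => y [].
have ck : \near t0, kap < 'D_(xi, 0) (lag k) (g t0, 'D_1 g t0) - 'D_1 P t0.
  have c1 := Cr_continuous (cmp (xi, 0)) (conj Wt Ct : W1 t0).
  have c2 := Cr_continuous (Cr_S (1 : R) (cmp (0, xi))) (conj Wt Ct : W1 t0).
  have c3 := continuousB c1 c2.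
  exact: (c3 _ (lt_nbhsr hk)).
have [d1 [C1 [d10 C10 dU [lip _]]]] := lag_lipschitz fV oC hL Ct.
suff HH r : 0 < r <= d1 / 2 -> ball (g t0, 'D_1 g t0) (2 * r) `<=` CS k /\
    exists d0 : R, [/\ 0 < d0, Cr None (near_itv t0 d0) g,
      forall y, near_itv t0 d0 y -> ball (g t0, 'D_1 g t0) r (g y, 'D_1 g y) &
      forall d, 0 < d < d0 -> half_bound (lhat k g t0 xi d) (d * P t0 + kap * (d ^+ 2 / 2)) /\
        half_bound (rhat k g t0 xi d) (- (d * P t0) + kap * (d ^+ 2 / 2))].
  have d20 : 0 < d1 / 2 by rewrite divr_gt0.
  split; (exists (d1 / 2); first exact: d20); move=> r hr;
    have [HH1 [d0 [q1 q2 q3 q4]]] := HH r hr; (split; first exact: HH1); exists d0; split;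
    [exact: q1|exact: q2|exact: q3|by move=> d hd; exact: (q4 d hd).1
    |exact: q1|exact: q2|exact: q3|by move=> d hd; exact: (q4 d hd).2].
move=> /andP[r0 rd].
have bb : ball (g t0, 'D_1 g t0) (2 * r) `<=` ball (g t0, 'D_1 g t0) d1 by apply: le_ball; order_lra.
split; first by move=> z /bb /dU [].
have [d0 d00 hd0] : exists2 d0 : R, 0 < d0 & near_itv t0 d0 `<=`
   [set y | [/\ W1 y, ball (g t0, 'D_1 g t0) r (g y, 'D_1 g y) & kap < 'D_(xi, 0) (lag k) (g y, 'D_1 g y) - 'D_1 P y]].
  apply: near_itvP.
  have n1 := open_nbhs_nbhs (conj oW1 (conj Wt Ct : W1 t0)).
  have n2 : nbhs t0 [set y | ball (g t0, 'D_1 g t0) r (g y, 'D_1 g y)].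
    exact: jet_near oW hg Wt r0.
  apply: filterS (filterI n1 (filterI n2 ck)) => y [i1 [i2 i3]].
  by split; [exact: i1|exact: i2|exact: i3].
exists d0; split; [exact: d00|by apply: Cr_sub hg => y /hd0 [[]]|by move=> y /hd0 []|].
move=> d /andP[dp dd].
have oI := @open_near_itv t0 d0.
have hgI : Cr None (near_itv t0 d0) g by apply: Cr_sub hg => y /hd0 [[]].
have dgI y : near_itv t0 d0 y -> differentiable g y by exact: Cr_differentiable hgI.
pose e := r / ((1 + d) * (1 + `|xi|)).
have e0 : 0 < e.
  by rewrite divr_gt0// mulr_gt0// ?addr_gt0// ltr_pwDl.
have er : e * (1 + d) * (1 + `|xi|) <= r.
  by rewrite -mulrA /e divfK// gt_eqF// mulr_gt0// ?addr_gt0// ltr_pwDl.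
have lip2 z1 z2 (w : V * V) : ball (g t0, 'D_1 g t0) (2 * r) z1 ->
   ball (g t0, 'D_1 g t0) (2 * r) z2 -> `|'D_w (lag k) z1 - 'D_w (lag k) z2| <= C1 * `|w| * `|z1 - z2|.
  by move=> /bb b1 /bb b2; exact: lip.
have bU : ball (g t0, 'D_1 g t0) (2 * r) `<=` CSn k by move=> z /bb /dU.
have est (m s0 s u : R) : `|m| <= 1 -> s < u -> t0 - d0 < s -> u < t0 + d0 ->
    (forall y, s <= y <= u -> 0 <= m * (y - s0) <= d) ->
    (forall y, s <= y <= u -> `|y - s0| <= d) ->
    half_bound (fun x => sqint F k (pert m s0 xi g x) s u)
    ((m * (u - s0) * P u + kap * (m * (u - s0) ^+ 2 / 2)) -
     (m * (s - s0) * P s + kap * (m * (s - s0) ^+ 2 / 2))).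
  move=> m1 su s1 u1 eta ad.
  have sub y : s <= y <= u -> near_itv t0 d0 y.
    by move=> /andP[i1 i2]; apply/andP; order_lra.
  have bp x y : `|x| < e -> s <= y <= u -> ball (g t0, 'D_1 g t0) (2 * r)
      (pert m s0 xi g x y, 'D_1 (pert m s0 xi g x) y).
    move=> xe yI; apply: (@pert_close _ _ _ m s0 xi g x y r d e m1 (ad y yI)) => //.
      exact: dgI (sub y yI).
    by have [] := hd0 y (sub y yI).
  have eL z : lag k z = 2^-1 * CF k z ^+ 2 by [].
  have gU y : near_itv t0 d0 y -> CSn k (g y, 'D_1 g y) by move=> /hd0 [[]].
  have pQ x : `|x| < e ->
      pcont (fun y => CF k (pert m s0 xi g x y, 'D_1 (pert m s0 xi g x) y) ^+ 2) s u.
    move=> xe; exact: (sqint_speed hF sk su oI sub (Cr_pert m s0 xi x oI hgI)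
      (fun y yI => (bU _ (bp x y xe yI)).1) (fun y _ => erefl (cinv k (pert m s0 xi g x y)))).2.
  have hk' y : s < y < u -> kap <= 'D_(xi, 0) (lag k) (g y, 'D_1 g y) - 'D_1 P y.
    move=> /andP[i1 i2]; have yI : s <= y <= u by rewrite (ltW i1) ltW.
    by have [_ _] := hd0 y (sub y yI); exact: ltW.
  exact: (@half_estimate _ _ fV (CSn k) oC (lag k) hL (CF k) (g t0, 'D_1 g t0) (2 * r) C1 e d m s0 s u kap xi g
     (near_itv t0 d0) eL (ltW C10) bU lip2 e0 su m1 oI sub hgI eta gU bp pQ hk').
have ltd : t0 - d < t0 by rewrite gtrBl.
have ltd' : t0 < t0 + d by rewrite ltrDl.
split.
- have h1 y : t0 - d <= y <= t0 -> 0 <= 1 * (y - (t0 - d)) <= d.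
    by move=> /andP[i1 i2]; apply/andP; order_lra.
  have h2 y : t0 - d <= y <= t0 -> `|y - (t0 - d)| <= d.
    by move=> /andP[i1 i2]; rewrite ger0_norm; order_lra.
  have i1 : t0 - d0 < t0 - d by order_lra.
  have i2 : t0 < t0 + d0 by order_lra.
  have n1 : `|1 : R| <= 1 by rewrite normr1.
  have := est 1 (t0 - d) (t0 - d) t0 n1 ltd i1 i2 h1 h2.
  by rewrite (hat_left t0 d kap (P t0) (P (t0 - d))).
- have h1 y : t0 <= y <= t0 + d -> 0 <= -1 * (y - (t0 + d)) <= d.
    by move=> /andP[i1 i2]; apply/andP; order_lra.
  have h2 y : t0 <= y <= t0 + d -> `|y - (t0 + d)| <= d.
    by move=> /andP[i1 i2]; rewrite ler0_norm; order_lra.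
  have i1 : t0 - d0 < t0 by order_lra.
  have i2 : t0 + d < t0 + d0 by order_lra.
  have n1 : `|-1 : R| <= 1 by rewrite normrN1.
  have := est (-1) (t0 + d) t0 (t0 + d) n1 ltd' i1 i2 h1 h2.
  by rewrite (hat_right t0 d kap (P t0) (P (t0 + d))).
Qed.

End WeakEL.

(** * The fundamental inequality in a fibre *)

Section FundamentalInequality.
Context (R : realType) (V : normedModType R) (fV : findim V)
  (U : set (V * V)) (oU : open U) (L : V * V -> R) (hL : Cr None U L)
  (posL : forall (z : V * V) (u : V), U z -> u != 0 -> 0 < 'D_(0, u) ('D_(0, u) L) z).
Context (y : V) (C : set V) (Q : V -> R)
  (CU : forall w, C w -> w != 0 -> U (y, w))
  (CZ : forall w (l : R), C w -> 0 < l -> C (l *: w))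
  (Cconv : forall w w' (t : R), C w -> C w' -> 0 <= t <= 1 -> C (w + t *: (w' - w)))
  (QZ : forall w (l : R), C w -> 0 < l -> Q (l *: w) = l * Q w)
  (Q0 : C 0 -> Q 0 = 0)
  (Qpos : forall w, C w -> w != 0 -> 0 < Q w)
  (LQ : forall w, L (y, w) = 2^-1 * Q w ^+ 2).

(** Euler's identity in degree two: differentiate [L (y, (1 + s) *: v) = (1 + s) ^+ 2 * L (y, v)] at
    [s = 0]. *)
Lemma euler_lag v : C v -> v != 0 -> 'D_(0, v) L (y, v) = Q v ^+ 2.
Proof.
move=> Cv v0; have Uv := CU Cv v0.
have dL := Cr_differentiable hL Uv.
have h1 : is_derive (0 : R) 1 (fun s : R => L ((y, v) + s *: (0, v))) ('D_(0, v) L (y, v)).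
  have dL' : differentiable L ((y, v) + (0 : R) *: (0, v)) by rewrite scale0r addr0.
  by have := is_derive_line dL'; rewrite scale0r addr0.
have h2 : is_derive (0 : R) 1 (fun s : R => (1 + s) ^+ 2 * (2^-1 * Q v ^+ 2)) (Q v ^+ 2).
  have hid : is_derive (0 : R) 1 (fun y : R => 1 + y) 1.
    have := is_deriveD (is_derive_cst (1 : R) (0 : R) (1 : R)) (is_derive_id (0 : R) (1 : R)).
    by rewrite add0r.
  have h := is_deriveZ (2^-1 * Q v ^+ 2) (is_deriveM hid hid).
  have -> : (fun s : R => (1 + s) ^+ 2 * (2^-1 * Q v ^+ 2)) =
      (2^-1 * Q v ^+ 2) *: ((fun y : R => 1 + y) * (fun y : R => 1 + y)).
    by apply/funext => s; rewrite mulrC expr2.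
  apply: is_derive_eq h _.
  rewrite -![_ *: _]/(_ * _); by field.
have e : \forall s \near (0 : R), (1 + s) ^+ 2 * (2^-1 * Q v ^+ 2) = L ((y, v) + s *: (0, v)).
  have n0 : \forall s \near (0 : R), -1 < s by apply: lt_nbhsr; rewrite ltrN10.
  apply: filterS n0 => s s1.
  have s2 : 0 < 1 + s by lra.
  have ev : v + s *: v = (1 + s) *: v by rewrite scalerDl scale1r.
  by rewrite pairZE pairDE scaler0 addr0 ev LQ QZ// exprMn; ring.
have [_ <-] := near_eq_is_derive e h2.
by have [_ <-] := h1.
Qed.

(** Rescale [u] so that [Q (l *: u) = Q v]. Strict convexity from [v] to [l *: u], with Euler's
    identity, gives [l * 'D_(0, u) L (y, v) < Q v ^+ 2] unless the two vectors coincide. The segment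
    must avoid zero, where [L] need not be smooth, so opposite vectors are treated apart. *)
Lemma fundamental_inequality v u : C v -> v != 0 -> C u ->
  'D_(0, u) L (y, v) <= Q v * Q u /\
  ('D_(0, u) L (y, v) = Q v * Q u -> exists2 l : R, 0 <= l & u = l *: v).
Proof.
move=> Cv v0 Cu; have Uv := CU Cv v0.
have lD := derive_clin (Cr_differentiable hL Uv).
have D0Z a w : 'D_(0, a *: w) L (y, v) = a * 'D_(0, w) L (y, v).
  by rewrite -[(0, a *: w)](_ : a *: (0, w) = _) ?(clinZ _ _ lD)// pairZE scaler0.
have Qv := Qpos Cv v0.
(* For a nonpositive multiple of [v] the segment may cross zero. There Euler's identity gives the
   derivative [- m * Q v ^+ 2], and equality forces [u = 0]. *)
have [[m m0 um]|nm] := pselect (exists2 m : R, 0 <= m & u = - m *: v).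
  have [m00|mn] := eqVneq m 0.
    have u0 : u = 0 by rewrite um m00 oppr0 scale0r.
    have e : 'D_(0, u) L (y, v) = 0 by rewrite u0; exact: (clin0 lD).
    rewrite e u0 Q0 ?mulr0 -?u0//; split=> // _.
    by exists 0 => //; rewrite scale0r.
  have mp : 0 < m by rewrite lt_neqAle eq_sym mn.
  have un : u != 0 by rewrite um scaler_eq0 oppr_eq0 negb_or mn.
  have Qu := Qpos Cu un.
  have e : 'D_(0, u) L (y, v) < 0.
    by rewrite um D0Z euler_lag// mulNr oppr_lt0 mulr_gt0// exprn_gt0.
  have p : 0 < Q v * Q u by rewrite mulr_gt0.
  split; first by apply/ltW; exact: lt_trans e p.
  by move=> h; rewrite h ltNge (ltW p) in e.
have un : u != 0.
  apply/negP => /eqP u0; apply: nm; exists 0 => //; by rewrite oppr0 scale0r.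
have Qu := Qpos Cu un.
set l := Q v / Q u; have l0 : 0 < l by rewrite divr_gt0.
have Qu' : Q (l *: u) = Q v by rewrite QZ// divfK// gt_eqF.
have [uv|uv] := eqVneq (l *: u) v.
  have ue : u = l^-1 *: v by rewrite -uv scalerA mulVf ?scale1r// gt_eqF.
  have e : 'D_(0, u) L (y, v) = Q v * Q u.
    rewrite ue D0Z euler_lag// QZ ?invr_gt0//; ring.
  by rewrite e; split=> // _; exists l^-1 => //; rewrite invr_ge0 ltW.
have seg t : 0 <= t <= 1 -> U (y, v + t *: (l *: u - v)).
  move=> tI; apply: CU; first by apply: Cconv => //; exact: CZ.
  (* If the segment met zero at [t], then [u] would be [- (1 - t) / (t * l)] times [v], the case
     already settled. *)
  apply/negP => /eqP h; apply: nm.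
  have t0 : t != 0 by apply: contra_neq v0 => t0; move: h; rewrite t0 scale0r addr0.
  have /andP[tp t1] := tI; have tp' : 0 < t by rewrite lt_neqAle eq_sym t0.
  exists ((1 - t) / (t * l)); first by rewrite divr_ge0 ?subr_ge0// mulr_ge0// ltW.
  have h2 : (t * l) *: u = - (1 - t) *: v.
    rewrite -[RHS]add0r -h scaleNr scalerBl scale1r opprB scalerBr scalerA.
    by rewrite [RHS]addrC addrA subrK addrC subrK.
  have tl : t * l != 0 by rewrite mulf_neq0// gt_eqF.
  by rewrite -mulNr mulrC -scalerA -h2 scalerA mulVf ?scale1r.
have := strict_convex hL posL seg uv.
have eD : 'D_(0, l *: u - v) L (y, v) = l * 'D_(0, u) L (y, v) - Q v ^+ 2.
  have -> : (0, l *: u - v) = (0, l *: u) - (0, v) :> V * V by rewrite -[RHS]/(_, _) subr0.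
  by rewrite (clinB _ _ lD) D0Z euler_lag.
rewrite !LQ Qu' eD => h.
have {}h : l * 'D_(0, u) L (y, v) < l * (Q v * Q u).
  have -> : l * (Q v * Q u) = Q v ^+ 2 by rewrite /l; field; rewrite gt_eqF.
  lra.
rewrite ltr_pM2l// in h; split; first exact: ltW.
by move=> e; rewrite e ltxx in h.
Qed.

End FundamentalInequality.

(** * Regularity of geodesics *)

Section RealInduction.
Context (R : realType).

(** Take the supremum of the times up to which [P] holds: the last clause gives [P] there, and the
    first one moves beyond it unless it is [b]. This is how local facts along a curve become facts
    on the whole interval. *)
Lemma real_induction (P : R -> Prop) (a b : R) : a <= b -> P a ->
  (forall t, a <= t < b -> (forall s, a <= s <= t -> P s) ->
    exists2 e, 0 < e & forall s, t <= s < t + e -> s <= b -> P s) ->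
  (forall t, a < t <= b -> (forall s, a <= s < t -> P s) -> P t) ->
  forall t, a <= t <= b -> P t.
Proof.
move=> ab Pa right cl.
pose S : set R := [set t | a <= t <= b /\ forall s, a <= s <= t -> P s].
have Sa : S a.
  split; first by rewrite lexx.
  by move=> s /andP[h1 h2]; have -> : s = a by apply/le_anti; rewrite h1 h2.
have hS : has_sup S.
  by split; [exists a|exists b => t [/andP[]]].
pose m := sup S.
have am : a <= m by exact: sup_upper_bound.
have mb : m <= b by apply: sup_le_ub; [exists a|move=> t [/andP[]]].
have below s : a <= s < m -> P s.
  move=> /andP[h1 h2]; have ms0 : 0 < m - s by rewrite subr_gt0.
  have [t [_ ht]] := sup_adherent ms0 hS; rewrite -/m subKr => st.
  by apply: ht; rewrite h1 ltW.
have Pm : P m.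
  have [->//|am'] := eqVneq m a; apply: cl => //.
  by rewrite mb andbT lt_neqAle eq_sym am'.
have upto s : a <= s <= m -> P s.
  move=> /andP[h1]; rewrite le_eqVlt => /predU1P[->//|h2].
  by apply: below; rewrite h1.
suff -> : b = m by [].
apply/le_anti; rewrite mb andbT leNgt; apply/negP => mlt.
have mI : a <= m < b by rewrite am.
have [e e0 he] := right m mI upto.
pose t := Num.min b (m + e / 2).
have mt : m < t by rewrite lt_min mlt ltrDl divr_gt0.
suff St : S t by have := sup_upper_bound hS St; rewrite leNgt mt.
split; first by rewrite (le_trans am (ltW mt)) ge_min lexx.
move=> s /andP[h1 h2]; have [sm|ms] := leP s m; first by apply: upto; rewrite h1.
have tb : t <= b by rewrite ge_min lexx.
have te : t <= m + e / 2 by rewrite ge_min lexx orbT.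
apply: he; last exact: le_trans tb.
by rewrite (ltW ms)/=; lra.
Qed.

Lemma within_neq (f : R -> R) (a b t v : R) : a <= t <= b ->
  {within `[a, b], continuous f} -> f t != v ->
  exists2 e, 0 < e & forall y, a <= y <= b -> `|t - y| < e -> f y != v.
Proof.
move=> tI cf ne; have /subspace_continuousP/(_ t) := cf.
rewrite /= in_itv /= => /(_ tI) hc.
have : within `[a, b]%classic (nbhs t) [set y | f y != v].
  exact: (hc [set y | y != v] (open_nbhs_nbhs (conj (@open_neq R v) ne))).
rewrite /within /= => /nbhs_ballP [e e0 he]; exists e => // y yI yt.
by have := he y; rewrite -ball_normE /ball_ /= in_itv /=; apply.
Qed.

Lemma within_closure (f : R -> R) (a b t v : R) : a <= t <= b ->
  {within `[a, b], continuous f} ->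
  (forall e, 0 < e -> exists y, [/\ a <= y <= b, `|t - y| < e & f y = v]) -> f t = v.
Proof.
move=> tI cf h; apply: contrapT => /eqP /(within_neq tI cf) [e e0 he].
by have [y [yI yt yv]] := h e e0; have := he y yI yt; rewrite yv eqxx.
Qed.

(** Along a geodesic [lag] is known to be stationary only where it does not vanish. That is enough:
    a nonzero value propagates forward from [a] by real induction, and if [f a = 0] a nonzero value
    at [t] would propagate backward to [a]. *)
Lemma derive0_unless (f : R -> R) (a b : R) : a <= b -> {within `[a, b], continuous f} ->
  (forall t, a < t < b -> f t != 0 -> is_derive t 1 f 0) ->
  forall t, a <= t <= b -> f t = f a.
Proof.
move=> ab cf df.
have cst (s u : R) : a <= s -> s <= u -> u <= b -> (forall y, s < y < u -> f y != 0) -> f u = f s.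
  move=> as_ su ub nz.
  have := @abs_mvt _ f (fun=> 0) s u 0 su (within_itv_sub as_ ub cf).
  rewrite mul0r => H; apply/eqP; rewrite -subr_eq0 -normr_le0; apply: H => y /andP[h1 h2].
    apply: df; first by rewrite (le_lt_trans as_ h1) (lt_le_trans h2 ub).
    by apply: nz; rewrite h1.
  by rewrite normr0.
have nzr (t : R) : a <= t <= b -> f t != 0 -> exists2 e : R, 0 < e &
    forall y, a <= y <= b -> t - e < y < t + e -> f y != 0.
  move=> tI /(within_neq tI cf) [e e0 he]; exists e => // y yI /andP[h1 h2].
  by apply: he => //; rewrite ltr_distlC h1.
have [fa|fa] := eqVneq (f a) 0; last first.
  apply: (@real_induction (fun t => f t = f a) a b ab erefl); last first.
    move=> t /andP[at_ tb] h; apply: (within_closure _ cf); first by rewrite (ltW at_).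
    move=> e e0; exists (Num.max a (t - e / 2)).
    have y1 : a <= Num.max a (t - e / 2) by rewrite le_max lexx.
    have y2 : Num.max a (t - e / 2) < t by rewrite gt_max at_ gtrBl divr_gt0.
    have y3 : t - e / 2 <= Num.max a (t - e / 2) by rewrite le_max lexx orbT.
    split; [by rewrite y1 (le_trans (ltW y2))|by rewrite gtr0_norm ?subr_gt0//; order_lra|].
    by apply: h; rewrite y1.
  move=> t /andP[at_ tb] h.
  have ft : f t = f a by apply: h; rewrite at_ lexx.
  have tI : a <= t <= b by rewrite at_ ltW.
  have [e e0 he] := nzr t tI (eq_ind_r (fun x => x != 0) fa ft).
  exists e => // s /andP[s1 s2] sb; rewrite -ft; apply: cst => // y /andP[y1 y2].
  by apply: he; [rewrite (le_trans at_ (ltW y1)) (le_trans (ltW y2))|apply/andP; split; order_lra].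
rewrite fa => t tI; apply: contrapT => /eqP ft.
have /andP[at_ tb] := tI.
(* Real induction in reversed time, from [t] back to [a]. *)
suff : forall s, 0 <= s <= t - a -> f (t - s) = f t.
  move=> /(_ (t - a)); rewrite lexx subr_ge0 at_ subKr fa => /(_ isT) h.
  by rewrite -h eqxx in ft.
apply: (@real_induction (fun s => f (t - s) = f t)); rewrite ?subr_ge0 ?subr0//.
  move=> s /andP[s0 s1] h.
  have fs : f (t - s) = f t by apply: h; rewrite s0 lexx.
  have sI : a <= t - s <= b by order_lra.
  have [e e0 he] := nzr (t - s) sI (eq_ind_r (fun x => x != 0) ft fs).
  exists e => // u /andP[u1 u2] ut; rewrite -fs; apply/esym; apply: cst; try order_lra.
  by move=> y /andP[y1 y2]; apply: he; apply/andP; order_lra.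
move=> s /andP[s0 s1] h.
apply: (within_closure _ cf); first by apply/andP; order_lra.
move=> e e0; set y := Num.max 0 (s - e / 2); exists (t - y).
have y1 : 0 <= y by rewrite le_max lexx.
have y2 : y < s by rewrite gt_max s0 gtrBl divr_gt0.
have y3 : s - e / 2 <= y by rewrite le_max lexx orbT.
split; [by apply/andP; order_lra|by rewrite ltr0_norm; order_lra|].
by apply: h; rewrite y1.
Qed.

End RealInduction.

Lemma derive_near_opp (R : realType) (f h : R -> R) (t : R) : differentiable f t ->
  (\forall s \near t, h s = - f s) -> 'D_1 h t = - 'D_1 f t.
Proof.
move=> df e; have hf : is_derive t 1 f ('D_1 f t) by apply: derivableP; exact/derivable1_diffP.
have e' : \forall s \near t, - f s = h s by apply: filterS e => s ->.
by have [_ <-] := near_eq_is_derive e' (is_deriveN hf).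
Qed.

Lemma half_sqr_inj (R : realType) (x y : R) : 0 <= x -> 0 <= y ->
  2^-1 * x ^+ 2 = 2^-1 * y ^+ 2 -> x = y.
Proof.
move=> x0 y0 /(mulfI (invr_neq0 (lt0r_neq0 (ltr0Sn R 1)))) /eqP.
by rewrite eqrXn2// => /eqP.
Qed.

Section Momentum.
Context (R : realType) (V : normedModType R) (fV : findim V)
  (U : set (V * V)) (oU : open U) (L : V * V -> R) (hL : Cr None U L).

Lemma Cr_momentum (W : set R) (g : R -> V) (ze : V * V) : open W -> Cr None W g ->
  (forall y, W y -> U (g y, 'D_1 g y)) -> Cr None W (fun y => 'D_ze L (g y, 'D_1 g y)).
Proof.
move=> oW hg gU.
exact: (Cr_comp oW oU (findim_prod fV fV) (findim_R R) gU (Cr_jet oW hg) (Cr_S ze hL)).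
Qed.

Lemma derive_fibN z (xi : V) : U z -> 'D_(0, - xi) L z = - 'D_(0, xi) L z /\ 'D_(- xi, 0) L z = - 'D_(xi, 0) L z.
Proof.
move=> Uz; have lD := derive_clin (Cr_differentiable hL Uz).
have e1 : (0, - xi) = -1 *: (0, xi) :> V * V by rewrite pairZE scaler0 scaleN1r.
have e2 : (- xi, 0) = -1 *: (xi, 0) :> V * V by rewrite pairZE scaler0 scaleN1r.
by rewrite e1 e2 !(clinZ _ _ lD) !scaleN1r.
Qed.

Lemma momentum_opp (W : set R) (g : R -> V) (xi : V) t : open W -> W t -> Cr None W g ->
  (forall y, W y -> U (g y, 'D_1 g y)) ->
  'D_1 (fun y => 'D_(0, - xi) L (g y, 'D_1 g y)) t = - 'D_1 (fun y => 'D_(0, xi) L (g y, 'D_1 g y)) t.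
Proof.
move=> oW Wt hg gU; apply: derive_near_opp.
  exact: Cr_differentiable (Cr_momentum (0, xi) oW hg gU) Wt.
by apply: filterS (open_nbhs_nbhs (conj oW Wt)) => s Ws; have [] := derive_fibN xi (gU s Ws).
Qed.

Lemma is_derive_jet (W : set R) (g : R -> V) t : W t -> Cr None W g ->
  is_derive t 1 g ('D_1 g t) /\ is_derive t 1 (fun s => 'D_1 g s) ('D_1 (fun s => 'D_1 g s) t).
Proof.
move=> Wt hg; split; apply: derivableP; apply/derivable1_diffP.
  exact: Cr_differentiable hg Wt.
exact: Cr_differentiable (Cr_S (1 : R) hg) Wt.
Qed.

Lemma jet_within (W : set R) (g : R -> V) (h : V * V -> R) (s u : R) : open W -> Cr None W g ->
  (forall y, s <= y <= u -> W y /\ {for (g y, 'D_1 g y), continuous h}) ->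
  {within `[s, u], continuous (fun y => h (g y, 'D_1 g y))}.
Proof.
move=> oW hg hc; apply/subspace_continuousP => y; rewrite /= in_itv /= => yI.
have [Wy cy] := hc y yI.
apply: cvg_within_filter; apply: (@continuous_comp _ _ _ (fun y => (g y, 'D_1 g y)) h) => //.
exact: (Cr_continuous (Cr_jet oW hg) Wy).
Qed.

End Momentum.

Section Geodesics.
Context (R : realType) (n : nat) (M : manifold R n)
  (A : M -> set 'rV[R]_n) (F : M -> 'rV[R]_n -> R) (hF : conic_finsler A F).
Implicit Types (k : chart R n M) (c : R -> M) (a b s t u e : R).
Local Notation V := 'rV[R]_n.
Local Notation CS := (coord_set A).
Local Notation CSn := (CSn A).
Local Notation CF := (coord_fun F).
Local Notation lag := (lag F).

Lemma CS_euler k y v : smooth_chart k -> CSn k (y, v) ->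
  'D_(0, v) (lag k) (y, v) = CF k (y, v) ^+ 2.
Proof.
move=> sk [Cv v0].
exact: (@euler_lag R V (CSn k) (lag k) (Cr_lag hF sk) y (fun w => CS k (y, w))
  (fun w => CF k (y, w)) (fun w h1 h2 => conj h1 h2) (fun w l h1 h2 => CF_homog hF sk h1 h2)
  (fun w => erefl _) v Cv v0).
Qed.

Lemma CS_fundamental (hA : pointwise_convex A) k y v (u : V) : smooth_chart k ->
  CSn k (y, v) -> CS k (y, u) ->
  'D_(0, u) (lag k) (y, v) <= CF k (y, v) * CF k (y, u) /\
  ('D_(0, u) (lag k) (y, v) = CF k (y, v) * CF k (y, u) -> exists2 l : R, 0 <= l & u = l *: v).
Proof.
move=> sk [Cv v0] Cu.
have pL (z : V * V) (w : V) : CSn k z -> w != 0 -> 0 < 'D_(0, w) ('D_(0, w) (lag k)) z.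
  by case: z => z1 z2; exact: lag_posdef.
have Qp w : CS k (y, w) -> w != 0 -> 0 < CF k (y, w) by move=> h1 h2; exact: (CF_gt0 hF sk (conj h1 h2)).
exact: (@fundamental_inequality R V (CSn k) (lag k) (Cr_lag hF sk) pL y
  (fun w => CS k (y, w)) (fun w => CF k (y, w)) (fun w h1 h2 => conj h1 h2)
  (fun w l h1 h2 => CS_conic hF sk h1 h2) (fun w w' t h1 h2 h3 => CS_convex sk hA h2 h1 h3)
  (fun w l h1 h2 => CF_homog hF sk h1 h2) (fun h => (CF_eq0 hF sk h).2 erefl) Qp (fun w => erefl _) v u Cv v0 Cu).
Qed.

(** A positive defect [gap] would allow [kap = gap / 2] on both sides. At a smooth point the
    momentum terms of the two sides cancel, and the hat of half-width [d] would give
    [kap * d ^+ 2 <= 0]. *)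
Lemma EL_le a b c k (W : set R) (g : R -> V) t e xi : geodesic A F a b c -> smooth_chart k ->
  a < t < b -> open W -> W t -> Cr None W g -> CSn k (g t, 'D_1 g t) -> 0 < e ->
  (forall y, t - e < y < t + e -> c y = cinv k (g y)) ->
  'D_(xi, 0) (lag k) (g t, 'D_1 g t) <= 'D_1 (fun s => 'D_(0, xi) (lag k) (g s, 'D_1 g s)) t.
Proof.
move=> geo sk tI oW Wt hg Ct e0 eg.
set P := fun s => 'D_(0, xi) (lag k) (g s, 'D_1 g s).
rewrite leNgt; apply/negP => lt.
set gap := 'D_(xi, 0) (lag k) (g t, 'D_1 g t) - 'D_1 P t.
have g0 : 0 < gap by rewrite subr_gt0.
have hk : gap / 2 < gap by rewrite ltr_pdivrMr// mulr_natr mulr2n ltrDl.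
have [h1 h2] := halves hF sk oW Wt hg Ct hk.
have em y : t - e < y <= t -> c y = cinv k (g y).
  by move=> /andP[i1 i2]; apply: eg; rewrite i1 (le_lt_trans i2)// ltrDl.
have ep y : t <= y < t + e -> c y = cinv k (g y).
  by move=> /andP[i1 i2]; apply: eg; rewrite i2 andbT (lt_le_trans _ i1)// gtrBl.
have [d1 d10 hd] := corner hF geo sk tI e0 em ep h1 h2.
have dd : 0 < d1 / 2 < d1 by rewrite divr_gt0//= ltr_pdivrMr// mulr_natr mulr2n ltrDl.
have := hd _ dd; set d := d1 / 2.
rewrite addrACA subrr add0r -mulr2n leNgt => /negP; apply.
have d0 : 0 < d by rewrite divr_gt0.
have q : 0 < gap / 2 * (d ^+ 2 / 2) by rewrite mulr_gt0// divr_gt0// exprn_gt0.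
by rewrite pmulrn_lgt0.
Qed.

Lemma EL_point a b c k (W : set R) (g : R -> V) t e xi : geodesic A F a b c -> smooth_chart k ->
  a < t < b -> open W -> W t -> Cr None W g -> CSn k (g t, 'D_1 g t) -> 0 < e ->
  (forall y, t - e < y < t + e -> c y = cinv k (g y)) ->
  is_derive t 1 (fun s => 'D_(0, xi) (lag k) (g s, 'D_1 g s)) ('D_(xi, 0) (lag k) (g t, 'D_1 g t)).
Proof.
move=> geo sk tI oW Wt hg Ct e0 eg.
have fV := findim_rV R n; have oC := open_CSn hF sk; have hL := Cr_lag hF sk.
have oW1 := open_jet oW hg oC.
set W1 := W `&` _ in oW1.
have W1t : W1 t by [].
have hg1 : Cr None W1 g by apply: Cr_sub hg => y [].
have gU y : W1 y -> CSn k (g y, 'D_1 g y) by case.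
have h1 := EL_le xi geo sk tI oW Wt hg Ct e0 eg.
have h2 := EL_le (- xi) geo sk tI oW Wt hg Ct e0 eg.
have [_ e1] := derive_fibN hL xi Ct.
have e2 := momentum_opp fV oC hL xi oW1 W1t hg1 gU.
rewrite e1 e2 lerN2 in h2.
have -> : 'D_(xi, 0) (lag k) (g t, 'D_1 g t) = 'D_1 (fun s => 'D_(0, xi) (lag k) (g s, 'D_1 g s)) t.
  by apply/le_anti; rewrite h1 h2.
apply: derivableP; apply/derivable1_diffP.
exact: Cr_differentiable (Cr_momentum fV oC hL (0, xi) oW1 hg1 gU) W1t.
Qed.

(** By Euler's identity momentum times velocity is [2 * lag], so the conserved Hamiltonian is [lag]
    itself. *)
Lemma lag_stationary a b c k (W : set R) (g : R -> V) t e : geodesic A F a b c -> smooth_chart k ->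
  a < t < b -> open W -> W t -> Cr None W g -> CSn k (g t, 'D_1 g t) -> 0 < e ->
  (forall y, t - e < y < t + e -> c y = cinv k (g y)) ->
  is_derive t 1 (fun s => lag k (g s, 'D_1 g s)) 0.
Proof.
move=> geo sk tI oW Wt hg Ct e0 eg.
have fV := findim_rV R n; have oC := open_CSn hF sk; have hL := Cr_lag hF sk.
have oW1 := open_jet oW hg oC.
set W1 := W `&` _ in oW1.
have W1t : W1 t by [].
have [d1 d2] := is_derive_jet Wt hg.
have h := @EL_energy R V fV (CSn k) oC (lag k) hL g ('D_1 g) t _ Ct d1 d2 (fun w : V => EL_point w geo sk tI oW Wt hg Ct e0 eg).
apply: near_eq_is_derive h.
apply: filterS (open_nbhs_nbhs (conj oW1 W1t)) => s [_ Cs].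
by rewrite (CS_euler sk Cs) /lag; field.
Qed.

(** Representatives on one side of [t], with jets in [A]. At a break the right one and its mirror
    image [lrep] may be unrelated smooth maps. *)
Definition rrep k c t e (W : set R) (g : R -> V) : Prop :=
  [/\ open W, Cr None W g, (forall y, W y -> CS k (g y, 'D_1 g y)), 0 < e &
    forall y, t <= y < t + e -> W y /\ c y = cinv k (g y)].

Definition lrep k c t e (W : set R) (g : R -> V) : Prop :=
  [/\ open W, Cr None W g, (forall y, W y -> CS k (g y, 'D_1 g y)), 0 < e &
    forall y, t - e < y <= t -> W y /\ c y = cinv k (g y)].

Lemma right_rep a b c k t : piecewise (apiece A c) a b -> a <= t < b ->
  smooth_chart k -> cdom k (c t) -> exists W g e, t + e <= b /\ rrep k c t e W g.
Proof.
move=> pc /andP[at_ tb] sk ct.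
have [u [tu ub h]] := piecewise_right (@apiece_hereditary _ _ _ A c) pc at_ tb.
have tI : `[t, u]%classic t by rewrite /= in_itv /= lexx ltW.
have [W [g [oW Wt hg cg eg]]] := h t tI k sk ct.
have [e e0 he] := open_ballR oW Wt.
exists W, g, (Num.min e (u - t)).
have m1 : Num.min e (u - t) <= e by rewrite ge_min lexx.
have m2 : Num.min e (u - t) <= u - t by rewrite ge_min lexx orbT.
have m0 : 0 < Num.min e (u - t) by rewrite lt_min e0 subr_gt0.
split; first by lra.
split=> // y /andP[h1 h2].
have Wy : W y by apply: he; apply/andP; lra.
by split=> //; apply: eg => //; rewrite /= in_itv /=; apply/andP; lra.
Qed.

Lemma left_rep a b c k t : piecewise (apiece A c) a b -> a < t <= b ->
  smooth_chart k -> cdom k (c t) -> exists W g e, a <= t - e /\ lrep k c t e W g.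
Proof.
move=> pc /andP[at_ tb] sk ct.
have [s [st as_ h]] := piecewise_left (@apiece_hereditary _ _ _ A c) pc at_ tb.
have tI : `[s, t]%classic t by rewrite /= in_itv /= lexx ltW.
have [W [g [oW Wt hg cg eg]]] := h t tI k sk ct.
have [e e0 he] := open_ballR oW Wt.
exists W, g, (Num.min e (t - s)).
have m1 : Num.min e (t - s) <= e by rewrite ge_min lexx.
have m2 : Num.min e (t - s) <= t - s by rewrite ge_min lexx orbT.
have m0 : 0 < Num.min e (t - s) by rewrite lt_min e0 subr_gt0.
split; first by lra.
split=> // y /andP[h1 h2].
have Wy : W y by apply: he; apply/andP; lra.
by split=> //; apply: eg => //; rewrite /= in_itv /=; apply/andP; lra.
Qed.

Lemma rrep_velocity k c t e W g y : smooth_chart k -> rrep k c t e W g -> t <= y < t + e ->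
  right_velocity c y = of_coord k (g y) ('D_1 g y) /\
  (t < y -> left_velocity c y = of_coord k (g y) ('D_1 g y)).
Proof.
move=> sk [oW hg cg e0 h] /andP[ty ye].
have [Wy _] : W y /\ c y = cinv k (g y) by apply: h; rewrite ty.
have dg := Cr_differentiable hg Wy; have [ig _] := cg y Wy.
split.
  apply: (@rep_right_velocity _ _ _ k W g c y ((y + (t + e)) / 2) sk oW Wy _ dg ig); first by lra.
  by move=> z /andP[z1 z2] Wz; apply: (h z _).2; apply/andP; lra.
move=> ty'; apply: (@rep_left_velocity _ _ _ k W g c y t sk oW Wy ty' dg ig).
by move=> z /andP[z1 z2] Wz; apply: (h z _).2; apply/andP; lra.
Qed.

Lemma lrep_velocity k c t e W g y : smooth_chart k -> lrep k c t e W g -> t - e < y <= t ->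
  left_velocity c y = of_coord k (g y) ('D_1 g y) /\
  (y < t -> right_velocity c y = of_coord k (g y) ('D_1 g y)).
Proof.
move=> sk [oW hg cg e0 h] /andP[ty ye].
have [Wy _] : W y /\ c y = cinv k (g y) by apply: h; rewrite ty.
have dg := Cr_differentiable hg Wy; have [ig _] := cg y Wy.
split.
  apply: (@rep_left_velocity _ _ _ k W g c y ((y + (t - e)) / 2) sk oW Wy _ dg ig); first by lra.
  by move=> z /andP[z1 z2] Wz; apply: (h z _).2; apply/andP; lra.
move=> ty'; apply: (@rep_right_velocity _ _ _ k W g c y t sk oW Wy ty' dg ig).
by move=> z /andP[z1 z2] Wz; apply: (h z _).2; apply/andP; lra.
Qed.

(** Along the piece [lag] is continuous, and it is stationary wherever it does not vanish: exactly
    the situation of [derive0_unless]. *)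
Lemma piece_speed a b c k (W : set R) (g : R -> V) s u : geodesic A F a b c -> smooth_chart k ->
  a <= s -> s <= u -> u <= b -> open W -> Cr None W g ->
  (forall y, W y -> CS k (g y, 'D_1 g y)) ->
  (forall y, s <= y <= u -> W y /\ c y = cinv k (g y)) ->
  CF k (g u, 'D_1 g u) = CF k (g s, 'D_1 g s).
Proof.
move=> geo sk as_ su ub oW hg cg eg.
pose f y := lag k (g y, 'D_1 g y).
have cf : {within `[s, u], continuous f}.
  apply: jet_within oW hg _ => y yI; have [Wy _] := eg y yI; split; first exact: Wy.
  have cCF := coord_fun_continuous hF sk (cg y Wy).
  apply: (@continuousM _ _ (cst 2^-1) (fun z => CF k z ^+ 2)); first exact: cvg_cst.
  apply: (@continuous_comp _ _ _ (CF k) (fun x : R => x ^+ 2)); first exact: cCF.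
  exact: exprn_continuous.
have df t : s < t < u -> f t != 0 -> is_derive t 1 f 0.
  move=> /andP[t1 t2] ft.
  have tI : s <= t <= u by rewrite !ltW.
  have [Wt et] := eg t tI.
  have Ct : CSn k (g t, 'D_1 g t).
    split; first exact: cg.
    apply: contra_neq ft => /= g0; rewrite /f /lag.
    by rewrite (CF_eq0 hF sk (cg t Wt)).2 ?expr0n ?mulr0.
  apply: (@lag_stationary a b c k W g t (Num.min (t - s) (u - t)) geo sk _ oW Wt hg Ct).
  - by rewrite (le_lt_trans as_ t1) (lt_le_trans t2 ub).
  - by rewrite lt_min !subr_gt0 t1.
  - move=> y /andP[h1 h2]; apply: (eg y _).2.
    have m1 : Num.min (t - s) (u - t) <= t - s by rewrite ge_min lexx.
    have m2 : Num.min (t - s) (u - t) <= u - t by rewrite ge_min lexx orbT.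
    by apply/andP; lra.
have := @derive0_unless _ f s u su cf df u; rewrite su lexx => /(_ isT).
have hu : CS k (g u, 'D_1 g u) by apply: cg; apply: (eg u _).1; rewrite su lexx.
have hs : CS k (g s, 'D_1 g s) by apply: cg; apply: (eg s _).1; rewrite su lexx.
exact: half_sqr_inj (CF_ge0 hF hu) (CF_ge0 hF hs).
Qed.

End Geodesics.

(** * From one-sided data to two-sided statements *)

Section Glue.
Context (R : realType).

(** Divide by [d] and let [d] tend to zero. This extracts a comparison of momenta from [corner],
    where the quadratic terms are of no consequence. *)
Lemma small_le (x kap d1 : R) : 0 < d1 ->
  (forall d, 0 < d < d1 -> d * x + kap * d ^+ 2 <= 0) -> x <= 0.
Proof.
move=> d10 h; rewrite leNgt; apply/negP => x0.
pose K := `|kap| + 1; have K0 : 0 < K by rewrite ltr_pwDr.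
pose d := Num.min (d1 / 2) (x / (2 * K)).
have dd1 : d <= d1 / 2 by rewrite ge_min lexx.
have dd2 : d <= x / (2 * K) by rewrite ge_min lexx orbT.
have d0 : 0 < d by rewrite lt_min !divr_gt0// mulr_gt0.
have dI : 0 < d < d1 by rewrite d0 (le_lt_trans dd1)// ltr_pdivrMr// mulr_natr mulr2n ltrDl.
have := h d dI.
have -> : d * x + kap * d ^+ 2 = d * (x + kap * d) by ring.
rewrite leNgt => /negP; apply; rewrite mulr_gt0//.
have q1 : - K * d <= kap * d.
  rewrite ler_wpM2r ?(ltW d0)// lerNl; apply: le_trans (ler_norm _) _.
  by rewrite normrN lerDl.
have q2 : K * d <= x / 2.
  have -> : x / 2 = K * (x / (2 * K)) by field; rewrite gt_eqF.
  by rewrite ler_wpM2l// ltW.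
lra.
Qed.

Lemma small_le2 (p q k1 k2 d1 : R) : 0 < d1 ->
  (forall d, 0 < d < d1 -> d * p + k1 * (d ^+ 2 / 2) + (- (d * q) + k2 * (d ^+ 2 / 2)) <= 0) ->
  p <= q.
Proof.
move=> d10 h; suff : p - q <= 0 by rewrite subr_le0.
apply: (small_le (kap := (k1 + k2) / 2) d10) => d /h; lra.
Qed.

Lemma small_le2l (p k1 d1 : R) : 0 < d1 ->
  (forall d, 0 < d < d1 -> d * p + k1 * (d ^+ 2 / 2) + 0 <= 0) -> p <= 0.
Proof. by move=> d10 h; apply: (small_le (kap := k1 / 2) d10) => d /h; lra. Qed.

Lemma small_le2r (q k2 d1 : R) : 0 < d1 ->
  (forall d, 0 < d < d1 -> 0 + (- (d * q) + k2 * (d ^+ 2 / 2)) <= 0) -> 0 <= q.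
Proof.
move=> d10 h; suff : - q <= 0 by rewrite oppr_le0.
by apply: (small_le (kap := k2 / 2) d10) => d /h; lra.
Qed.

(** Each side is demanded only if the interval extends to that side, so the endpoints are covered as
    well. *)
Lemma glue_within (T : topologicalType) (f f1 f2 : R -> T) (s u t e : R) : 0 < e ->
  (t < u -> {for t, continuous f2} /\ forall y, t <= y < t + e -> f y = f2 y) ->
  (s < t -> {for t, continuous f1} /\ forall y, t - e < y <= t -> f y = f1 y) ->
  f y @[y --> within `[s, u]%classic (nbhs t)] --> f t.
Proof.
move=> e0 h2 h1 N hN.
have r2 : exists2 d, 0 < d & forall y, t <= y < t + d -> y <= u -> N (f y).
  have [tu|ut] := ltP t u; last first.
    exists 1 => // y /andP[y1 y2] yu; have -> : y = t by apply/le_anti; rewrite y1 (le_trans yu).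
    exact: nbhs_singleton.
  have [c2 e2] := h2 tu.
  have ft : f t = f2 t by apply: e2; rewrite lexx ltrDl.
  rewrite ft in hN; have /nbhs_ballP[d d0 hd] := c2 _ hN.
  exists (Num.min e d); first by rewrite lt_min e0.
  move=> y /andP[y1 y2] _.
  have m1 : Num.min e d <= e by rewrite ge_min lexx.
  have m2 : Num.min e d <= d by rewrite ge_min lexx orbT.
  have yI : t <= y < t + e by apply/andP; order_lra.
  by rewrite (e2 y yI); apply: hd; rewrite -ball_normE /ball_ /= ler0_norm; order_lra.
have r1 : exists2 d, 0 < d & forall y, t - d < y <= t -> s <= y -> N (f y).
  have [st|ts] := ltP s t; last first.
    exists 1 => // y /andP[y1 y2] sy; have -> : y = t by apply/le_anti; rewrite y2 (le_trans ts).
    exact: nbhs_singleton.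
  have [c1 e1] := h1 st.
  have ft : f t = f1 t by apply: e1; rewrite lexx gtrBl e0.
  rewrite ft in hN; have /nbhs_ballP[d d0 hd] := c1 _ hN.
  exists (Num.min e d); first by rewrite lt_min e0.
  move=> y /andP[y1 y2] _.
  have m1 : Num.min e d <= e by rewrite ge_min lexx.
  have m2 : Num.min e d <= d by rewrite ge_min lexx orbT.
  have yI : t - e < y <= t by apply/andP; order_lra.
  by rewrite (e1 y yI); apply: hd; rewrite -ball_normE /ball_ /= ger0_norm; order_lra.
have [d2 d20 {}r2] := r2; have [d1 d10 {}r1] := r1.
apply/nbhs_ballP; exists (Num.min d1 d2); first by rewrite /= lt_min d10.
have m1 : Num.min d1 d2 <= d1 by rewrite ge_min lexx.
have m2 : Num.min d1 d2 <= d2 by rewrite ge_min lexx orbT.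
move=> y; rewrite -ball_normE /ball_ /= ltr_distlC in_itv /= => /andP[y1 y2] /andP[y3 y4].
have [ty|yt] := leP t y; first by apply: r2; rewrite ?ty//=; order_lra.
by apply: r1; rewrite ?(ltW yt) ?andbT//=; order_lra.
Qed.

Lemma glue_derive (V : normedModType R) (f f1 f2 : R -> V) (t e : R) (d : V) : 0 < e ->
  is_derive t 1 f1 d -> is_derive t 1 f2 d ->
  (forall y, t <= y < t + e -> f y = f2 y) ->
  (forall y, t - e < y <= t -> f y = f1 y) ->
  is_derive t 1 f d.
Proof.
move=> e0 h1 h2 e2 e1.
have q (g : R -> V) : is_derive t 1 g d -> h^-1 *: (g (h + t) - g t) @[h --> 0^'] --> d.
  move=> [dg Dg]; move: dg => /cvg_ex [l hl].
  have ld : l = d by rewrite -Dg /derive; apply/esym/cvg_lim.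
  rewrite -ld; apply: cvg_trans hl; apply: near_eq_cvg; apply: nearW => h.
  by rewrite /= -[h *: 1]/(h * 1) mulr1.
have f1t : f t = f1 t by apply: e1; rewrite lexx gtrBl e0.
have f2t : f t = f2 t by apply: e2; rewrite lexx ltrDl.
have main : h^-1 *: (f (h + t) - f t) @[h --> 0^'] --> d.
  apply/cvgrPdist_lt => eps eps0.
  have /cvgrPdist_lt/(_ _ eps0) q1 := q f1 h1.
  have /cvgrPdist_lt/(_ _ eps0) q2 := q f2 h2.
  have ne : \forall h \near (0 : R)^', `|h| < e.
    apply: nbhs_dnbhs; apply/nbhs_ballP; exists e => // h.
    by rewrite -ball_normE /ball_ /= sub0r normrN.
  apply: filterS3 ne q1 q2 => h; rewrite ltr_norml => /andP[he1 he2] q1 q2.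
  have [h0|h0] := leP 0 h.
    by rewrite f2t e2//; apply/andP; lra.
  by rewrite f1t e1//; apply/andP; lra.
have eD : (fun h : R => h^-1 *: ((f \o shift t) (h *: 1) - f t)) = (fun h => h^-1 *: (f (h + t) - f t)).
  by apply/funext => h; rewrite /= -[h *: 1]/(h * 1) mulr1.
split; first by rewrite /derivable eD; apply/cvg_ex; exists d.
by rewrite /derive eD; apply/cvg_lim.
Qed.

Lemma eq_left_limit (f1 f2 : R -> R) (t e : R) : 0 < e -> {for t, continuous f1} ->
  {for t, continuous f2} -> (forall y, t - e < y < t -> f1 y = f2 y) -> f1 t = f2 t.
Proof.
move=> e0 c1 c2 h; apply: contrapT => /eqP; rewrite -subr_eq0 => ne.
have c := continuousB c1 c2.
have /nbhs_ballP[d d0 hd] := c _ (open_nbhs_nbhs (conj (@open_neq R 0) ne)).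
have m1 : Num.min e d <= e by rewrite ge_min lexx.
have m2 : Num.min e d <= d by rewrite ge_min lexx orbT.
have m0 : 0 < Num.min e d by rewrite lt_min e0.
have yb : ball t d (t - Num.min e d / 2) by rewrite -ball_normE /ball_ /= ger0_norm; lra.
have /negP := hd _ yb; apply.
by rewrite /= fctE h ?subrr//; apply/andP; lra.
Qed.

Lemma eq_right_limit (f1 f2 : R -> R) (t e : R) : 0 < e -> {for t, continuous f1} ->
  {for t, continuous f2} -> (forall y, t < y < t + e -> f1 y = f2 y) -> f1 t = f2 t.
Proof.
move=> e0 c1 c2 h; apply: contrapT => /eqP; rewrite -subr_eq0 => ne.
have c := continuousB c1 c2.
have /nbhs_ballP[d d0 hd] := c _ (open_nbhs_nbhs (conj (@open_neq R 0) ne)).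
have m1 : Num.min e d <= e by rewrite ge_min lexx.
have m2 : Num.min e d <= d by rewrite ge_min lexx orbT.
have m0 : 0 < Num.min e d by rewrite lt_min e0.
have yb : ball t d (t + Num.min e d / 2) by rewrite -ball_normE /ball_ /= ler0_norm; lra.
have /negP := hd _ yb; apply.
by rewrite /= fctE h ?subrr//; apply/andP; lra.
Qed.

Lemma derive0_cst (V : normedModType R) (fV : findim V) (g : R -> V) (s u : R) : s <= u ->
  (forall y, s <= y <= u -> is_derive y 1 g 0) -> g u = g s.
Proof.
move=> su h; have [K K0 hK] := vec_mvt fV.
have := hK g (fun=> 0) s u 0 su; rewrite mulr0 mul0r => H.
apply/eqP; rewrite -subr_eq0 -normr_le0; apply: H.
- apply/subspace_continuousP => y; rewrite /= in_itv /= => yI; apply: cvg_within_filter.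
  by apply: differentiable_continuous; apply/derivable1_diffP; have [] := h y yI.
- by move=> y /andP[y1 y2]; apply: h; rewrite !ltW.
- by move=> y _; rewrite normr0.
Qed.

End Glue.

(** * Absence of corners *)

Section C1.
Context (R : realType) (n : nat) (M : manifold R n)
  (A : M -> set 'rV[R]_n) (F : M -> 'rV[R]_n -> R) (hF : conic_finsler A F)
  (hA : pointwise_convex A).
Implicit Types (k : chart R n M) (c : R -> M) (a b s t u e : R).
Local Notation V := 'rV[R]_n.
Local Notation CS := (coord_set A).
Local Notation CSn := (CSn A).
Local Notation CF := (coord_fun F).
Local Notation lag := (lag F).
Local Notation rrep := (rrep A).
Local Notation lrep := (lrep A).

(** Constant speed on the piece makes the velocity vanish throughout. The representative can then be
    replaced by a constant curve, as [half_zero] requires. *)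
Lemma rrep_zero a b c k t e W g : geodesic A F a b c -> smooth_chart k -> a <= t -> t + e <= b ->
  rrep k c t e W g -> 'D_1 g t = 0 -> forall y, t <= y < t + e -> g y = g t.
Proof.
move=> geo sk at_ tb [oW hg cg e0 eg] gt0 y /andP[ty ye].
have D0 z : t <= z <= y -> 'D_1 g z = 0.
  move=> /andP[tz zy].
  have eg' w : t <= w <= z -> W w /\ c w = cinv k (g w).
    by move=> /andP[w1 w2]; apply: eg; rewrite w1/=; lra.
  have zb : z <= b by lra.
  have := piece_speed hF geo sk at_ tz zb oW hg cg eg'.
  have Ct : CS k (g t, 'D_1 g t) by apply: cg; apply: (eg' t _).1; rewrite lexx.
  have Cz : CS k (g z, 'D_1 g z) by apply: cg; apply: (eg' z _).1; rewrite lexx tz.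
  rewrite ((CF_eq0 hF sk Ct).2 gt0) => h.
  exact: ((CF_eq0 hF sk Cz).1 h).
apply: (derive0_cst (findim_rV R n) ty) => z zI; rewrite -(D0 z zI).
apply: derivableP; apply/derivable1_diffP; apply: (Cr_differentiable hg).
by apply: (eg z _).1; case/andP: zI => z1 z2; rewrite z1/=; lra.
Qed.

Lemma lrep_zero a b c k t e W g : geodesic A F a b c -> smooth_chart k -> t <= b -> a <= t - e ->
  lrep k c t e W g -> 'D_1 g t = 0 -> forall y, t - e < y <= t -> g y = g t.
Proof.
move=> geo sk tb at_ [oW hg cg e0 eg] gt0 y /andP[ey yt].
have D0 z : y <= z <= t -> 'D_1 g z = 0.
  move=> /andP[yz zt].
  have eg' w : z <= w <= t -> W w /\ c w = cinv k (g w).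
    by move=> /andP[w1 w2]; apply: eg; rewrite w2 andbT; lra.
  have az : a <= z by lra.
  have := piece_speed hF geo sk az zt tb oW hg cg eg'.
  have Ct : CS k (g t, 'D_1 g t) by apply: cg; apply: (eg' t _).1; rewrite lexx zt.
  have Cz : CS k (g z, 'D_1 g z) by apply: cg; apply: (eg' z _).1; rewrite lexx.
  rewrite ((CF_eq0 hF sk Ct).2 gt0) => h.
  exact: ((CF_eq0 hF sk Cz).1 (esym h)).
apply/esym; apply: (derive0_cst (findim_rV R n) yt) => z zI; rewrite -(D0 z zI).
apply: derivableP; apply/derivable1_diffP; apply: (Cr_differentiable hg).
by apply: (eg z _).1; case/andP: zI => z1 z2; rewrite z2 andbT; lra.
Qed.

Lemma rrep_sub k c t e e' W g : 0 < e' -> e' <= e -> rrep k c t e W g -> rrep k c t e' W g.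
Proof.
by move=> e0 ee [h1 h2 h3 h4 h5]; split=> // y /andP[y1 y2]; apply: h5; rewrite y1/=; lra.
Qed.

Lemma lrep_sub k c t e e' W g : 0 < e' -> e' <= e -> lrep k c t e W g -> lrep k c t e' W g.
Proof.
by move=> e0 ee [h1 h2 h3 h4 h5]; split=> // y /andP[y1 y2]; apply: h5; rewrite y2 andbT; lra.
Qed.

(** The Weierstrass-Erdmann condition. Between nonzero velocities the hats give [Pm xi <= Pp xi] for
    the momenta before and after [t] and every [xi]. Taking [xi = vm] and [xi = - vp], Euler's
    identity and the fundamental inequality yield [F vm <= F vp] and the converse; equality makes
    [vm] a positive multiple of [vp], of the same norm. Passing between rest and motion is excluded
    by [xi = - vp] or [xi = vm], which would make a positive square nonpositive. *)
Lemma corner_velocity a b c k t e Wm gm Wp gp : geodesic A F a b c -> smooth_chart k ->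
  a < t < b -> a <= t - e -> t + e <= b -> lrep k c t e Wm gm -> rrep k c t e Wp gp ->
  'D_1 gm t = 'D_1 gp t.
Proof.
move=> geo sk tI ae eb lr rr.
have [oWm hgm cgm e0 em] := lr; have [oWp hgp cgp _ ep] := rr.
have [Wmt cm] : Wm t /\ c t = cinv k (gm t) by apply: em; rewrite lexx gtrBl e0.
have [Wpt cp] : Wp t /\ c t = cinv k (gp t) by apply: ep; rewrite lexx ltrDl.
have Cm := cgm t Wmt; have Cp := cgp t Wpt.
have gmp : gm t = gp t.
  have [i1 _] := Cm; have [i2 _] := Cp; rewrite /= in i1 i2.
  by rewrite -(cinvK i1) -(cinvK i2) -cm -cp.
have em' y : t - e < y <= t -> c y = cinv k (gm y) by move=> /em[].
have ep' y : t <= y < t + e -> c y = cinv k (gp y) by move=> /ep[].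
have /andP[at_ tb] := tI.
have [vm0|vm0] := eqVneq ('D_1 gm t) 0; have [vp0|vp0] := eqVneq ('D_1 gp t) 0.
- by rewrite vm0 vp0.
- exfalso.
  have Cpn : CSn k (gp t, 'D_1 gp t) := conj Cp vp0.
  set vp := 'D_1 gp t in vp0 Cpn *.
  have Cz : CS k (gm t, 0) by rewrite -vm0.
  have em2 y : t - e < y <= t -> c y = cinv k (cst (gm t) y).
    by move=> yI; rewrite /= em'// (lrep_zero geo sk (ltW tb) ae lr vm0 yI).
  have h1 : half A k (cst (gm t)) t (lhat F k (cst (gm t)) t (- vp)) (fun=> 0).
    exact: (@half_zero _ _ _ _ _ hF k (gm t) t (lhat F k (cst (gm t)) t (- vp)) 1 (fun d => t - d) (fun d => t - d) (fun=> t) (- vp) sk Cz (fun _ _ => erefl _)).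
  (* Any number below the defect serves: it multiplies a quadratic term that [small_le2r]
     discards. *)
  have kl : 'D_(- vp, 0) (lag k) (gp t, 'D_1 gp t) - 'D_1 (fun y => 'D_(0, - vp) (lag k) (gp y, 'D_1 gp y)) t - 1 <
    'D_(- vp, 0) (lag k) (gp t, 'D_1 gp t) - 'D_1 (fun y => 'D_(0, - vp) (lag k) (gp y, 'D_1 gp y)) t by rewrite gtrBl.
  have [_ h2] := halves hF sk oWp Wpt hgp Cpn kl.
  have [d1 d10 hd] := corner hF geo sk tI e0 em2 ep' h1 h2.
  have [eN _] := derive_fibN (Cr_lag hF sk) vp Cpn.
  have eu := CS_euler hF sk Cpn.
  have p0 : 0 < CF k (gp t, vp) ^+ 2 by rewrite exprn_gt0// (CF_gt0 hF sk Cpn).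
  have := small_le2r d10 hd; rewrite eN eu oppr_ge0 => p1.
  by have := lt_le_trans p0 p1; rewrite ltxx.
- exfalso.
  have Cmn : CSn k (gm t, 'D_1 gm t) := conj Cm vm0.
  set vm := 'D_1 gm t in vm0 Cmn *.
  have Cz : CS k (gp t, 0) by rewrite -vp0.
  have ep2 y : t <= y < t + e -> c y = cinv k (cst (gp t) y).
    by move=> yI; rewrite /= ep'// (rrep_zero geo sk (ltW at_) eb rr vp0 yI).
  have h1 : half A k (cst (gp t)) t (rhat F k (cst (gp t)) t vm) (fun=> 0).
    exact: (@half_zero _ _ _ _ _ hF k (gp t) t (rhat F k (cst (gp t)) t vm) (-1) (fun d => t + d) (fun=> t) (fun d => t + d) vm sk Cz (fun _ _ => erefl _)).
  have kl : 'D_(vm, 0) (lag k) (gm t, 'D_1 gm t) - 'D_1 (fun y => 'D_(0, vm) (lag k) (gm y, 'D_1 gm y)) t - 1 <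
    'D_(vm, 0) (lag k) (gm t, 'D_1 gm t) - 'D_1 (fun y => 'D_(0, vm) (lag k) (gm y, 'D_1 gm y)) t by rewrite gtrBl.
  have [h2 _] := halves hF sk oWm Wmt hgm Cmn kl.
  have [d1 d10 hd] := corner hF geo sk tI e0 em' ep2 h2 h1.
  have eu := CS_euler hF sk Cmn.
  have p0 : 0 < CF k (gm t, vm) ^+ 2 by rewrite exprn_gt0// (CF_gt0 hF sk Cmn).
  have := small_le2l d10 hd; rewrite eu => p1.
  by have := lt_le_trans p0 p1; rewrite ltxx.
have Cmn : CSn k (gm t, 'D_1 gm t) := conj Cm vm0.
have Cpn : CSn k (gp t, 'D_1 gp t) := conj Cp vp0.
have mom (xi : V) : 'D_(0, xi) (lag k) (gm t, 'D_1 gm t) <= 'D_(0, xi) (lag k) (gp t, 'D_1 gp t).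
  set Km := 'D_(xi, 0) (lag k) (gm t, 'D_1 gm t) - 'D_1 (fun y => 'D_(0, xi) (lag k) (gm y, 'D_1 gm y)) t.
  set Kp := 'D_(xi, 0) (lag k) (gp t, 'D_1 gp t) - 'D_1 (fun y => 'D_(0, xi) (lag k) (gp y, 'D_1 gp y)) t.
  have km : Km - 1 < Km by rewrite gtrBl.
  have kp : Kp - 1 < Kp by rewrite gtrBl.
  have [h1 _] := halves hF sk oWm Wmt hgm Cmn km.
  have [_ h2] := halves hF sk oWp Wpt hgp Cpn kp.
  have [d1 d10 hd] := corner hF geo sk tI e0 em' ep' h1 h2.
  exact: small_le2 d10 hd.
set vm := 'D_1 gm t in Cm Cmn vm0 mom *; set vp := 'D_1 gp t in Cp Cpn vp0 mom *.
rewrite -gmp in Cp Cpn mom.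
have Fm := CF_gt0 hF sk Cmn; have Fp := CF_gt0 hF sk Cpn.
have m1 := mom vm; rewrite (CS_euler hF sk Cmn) in m1.
have m2 := mom (- vp).
have [N1 _] := derive_fibN (Cr_lag hF sk) vp Cmn.
have [N2 _] := derive_fibN (Cr_lag hF sk) vp Cpn.
rewrite N1 N2 lerN2 (CS_euler hF sk Cpn) in m2.
have [f1 q1] := CS_fundamental hF hA sk Cpn Cm.
have [f2 _] := CS_fundamental hF hA sk Cmn Cp.
have l1 : CF k (gm t, vm) <= CF k (gm t, vp).
  by have := le_trans m1 f1; rewrite expr2 ler_pM2r.
have l2 : CF k (gm t, vp) <= CF k (gm t, vm).
  by have := le_trans m2 f2; rewrite expr2 ler_pM2r.
have eF : CF k (gm t, vm) = CF k (gm t, vp) by apply/le_anti; rewrite l1 l2.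
have e1 : 'D_(0, vm) (lag k) (gm t, vp) = CF k (gm t, vp) * CF k (gm t, vm).
  by apply/le_anti; rewrite f1/=; move: m1; rewrite eF expr2.
have [l l0 vl] := q1 e1.
have lp : 0 < l.
  rewrite lt_neqAle l0 andbT; apply: contra_neq vm0 => l00.
  by rewrite vl -l00 scale0r.
move: eF; rewrite vl (CF_homog hF sk Cp lp) => /eqP.
rewrite -subr_eq0 -[X in _ - X]mul1r -mulrBl mulf_eq0 (gt_eqF Fp) orbF subr_eq0 => /eqP ->.
by rewrite scale1r.
Qed.

End C1.

(** * Geodesics as solutions of the Euler-Lagrange equation *)

Section GeodesicFlow.
Context (R : realType) (n : nat) (M : manifold R n)
  (A : M -> set 'rV[R]_n) (F : M -> 'rV[R]_n -> R) (hF : conic_finsler A F)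
  (hA : pointwise_convex A).
Implicit Types (k : chart R n M) (c : R -> M) (a b s t u e : R).
Local Notation V := 'rV[R]_n.
Local Notation CS := (coord_set A).
Local Notation CSn := (CSn A).
Local Notation CF := (coord_fun F).
Local Notation lag := (lag F).
Local Notation rrep := (rrep A).
Local Notation lrep := (lrep A).

(** A velocity defined at all times of [[a, b]], breaks and ends included: the right one, and the
    left one at the terminal time. *)
Definition tv c b t : V := if t < b then right_velocity c t else left_velocity c t.
Definition cx k c t : V := cmap k (c t).
(* The vector [w t], tangent at [c t], read in the chart [k]. *)
Definition cw k c (w : R -> V) t : V := dtr (chart_at (c t)) k (cmap (chart_at (c t)) (c t)) (w t).
Definition cy k c b : R -> V := cw k c (tv c b).

Lemma geodesic_apiece a b c : geodesic A F a b c -> a < b /\ piecewise (apiece A c) a b.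
Proof. by move=> [adm _]; exact: (admissible_apiece hF). Qed.

Lemma interior_rep a b c k t : geodesic A F a b c -> smooth_chart k -> cdom k (c t) -> a < t < b ->
  exists e Wm gm Wp gp, [/\ 0 < e, a <= t - e, t + e <= b, lrep k c t e Wm gm & rrep k c t e Wp gp].
Proof.
move=> geo sk ct /andP[at_ tb]; have [_ pc] := geodesic_apiece geo.
have tI1 : a < t <= b by rewrite at_ ltW.
have tI2 : a <= t < b by rewrite tb ltW.
have [Wm [gm [e1 [ae lr]]]] := left_rep pc tI1 sk ct.
have [Wp [gp [e2 [eb rr]]]] := right_rep pc tI2 sk ct.
have e10 : 0 < e1 by case: lr.
have e20 : 0 < e2 by case: rr.
have m1 : Num.min e1 e2 <= e1 by rewrite ge_min lexx.
have m2 : Num.min e1 e2 <= e2 by rewrite ge_min lexx orbT.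
have m0 : 0 < Num.min e1 e2 by rewrite lt_min e10.
exists (Num.min e1 e2), Wm, gm, Wp, gp; split; [exact: m0|lra|lra| |].
  exact: lrep_sub lr.
exact: rrep_sub rr.
Qed.

Lemma rrep_at k c t e W g y : rrep k c t e W g -> t <= y < t + e ->
  [/\ W y, c y = cinv k (g y), CS k (g y, 'D_1 g y) & cimg k (g y)].
Proof.
by move=> [_ _ cg _ eg] yI; have [Wy cE] := eg y yI; have Cy := cg y Wy; have [iy _] := Cy.
Qed.

Lemma lrep_at k c t e W g y : lrep k c t e W g -> t - e < y <= t ->
  [/\ W y, c y = cinv k (g y), CS k (g y, 'D_1 g y) & cimg k (g y)].
Proof.
by move=> [_ _ cg _ eg] yI; have [Wy cE] := eg y yI; have Cy := cg y Wy; have [iy _] := Cy.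
Qed.

Lemma geodesic_C1 a b c t : geodesic A F a b c -> a < t < b ->
  left_velocity c t = right_velocity c t.
Proof.
move=> geo tI; have sk := chart_at_smooth (c t).
have [e [Wm [gm [Wp [gp [e0 ae eb lr rr]]]]]] := interior_rep geo sk (chart_at_dom (c t)) tI.
have tI1 : t - e < t <= t by rewrite lexx gtrBl e0.
have tI2 : t <= t < t + e by rewrite lexx ltrDl.
have [-> _] := lrep_velocity sk lr tI1; have [-> _] := rrep_velocity sk rr tI2.
have [_ e1 _ i1] := lrep_at lr tI1; have [_ e2 _ i2] := rrep_at rr tI2.
have -> : gm t = gp t by rewrite -(cinvK i1) -(cinvK i2) -e1 -e2.
by rewrite (corner_velocity hF hA geo sk tI ae eb lr rr).
Qed.

Lemma tv_rrep b c k t e W g y : smooth_chart k -> t + e <= b ->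
  rrep k c t e W g -> t <= y < t + e -> tv c b y = of_coord k (g y) ('D_1 g y).
Proof.
move=> sk eb rr yI; have [<- _] := rrep_velocity sk rr yI.
by rewrite /tv ifT//; case/andP: yI => _ h; exact: lt_le_trans h eb.
Qed.

Lemma tv_lrep a b c k t e W g y : geodesic A F a b c -> smooth_chart k -> a <= t - e -> t <= b ->
  lrep k c t e W g -> t - e < y <= t -> tv c b y = of_coord k (g y) ('D_1 g y).
Proof.
move=> geo sk ae tb lr yI; have [h1 h2] := lrep_velocity sk lr yI.
have /andP[ey yt] := yI; rewrite /tv; case: ifPn => yb; last exact: h1.
have [yt'|ty] := ltP y t; first exact: h2.
by rewrite -h1; apply/esym; apply: (geodesic_C1 geo); rewrite yb andbT; lra.
Qed.

Lemma tvF_rrep b c k t e W g y : smooth_chart k -> t + e <= b ->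
  rrep k c t e W g -> t <= y < t + e -> F (c y) (tv c b y) = CF k (g y, 'D_1 g y).
Proof.
move=> sk eb rr yI; rewrite (tv_rrep sk eb rr yI) /coord_fun /=.
by have [_ <- _ _] := rrep_at rr yI.
Qed.

Lemma tvF_lrep a b c k t e W g y : geodesic A F a b c -> smooth_chart k -> a <= t - e -> t <= b ->
  lrep k c t e W g -> t - e < y <= t -> F (c y) (tv c b y) = CF k (g y, 'D_1 g y).
Proof.
move=> geo sk ae tb lr yI; rewrite (tv_lrep geo sk ae tb lr yI) /coord_fun /=.
by have [_ <- _ _] := lrep_at lr yI.
Qed.

Lemma tv_mem a b c t : geodesic A F a b c -> a <= t <= b -> A (c t) (tv c b t).
Proof.
move=> geo /andP[at_ tb]; have [[ab _ h1 h2] _] := geo.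
rewrite /tv; case: ifPn => h; first exact: h1.
have tb' : t = b by apply/le_anti; rewrite tb leNgt.
by apply: h2 => //; rewrite tb'.
Qed.

(** Real induction over the pieces. Within a piece this is [piece_speed]; the passage through a
    break rests on the absence of corners, by which the left representative also computes [tv]. *)
Lemma speed_const a b c t : geodesic A F a b c -> a <= t <= b ->
  F (c t) (tv c b t) = F (c a) (tv c b a).
Proof.
move=> geo; have [ab pc] := geodesic_apiece geo; move: t.
apply: (@real_induction _ (fun t => F (c t) (tv c b t) = F (c a) (tv c b a)) a b (ltW ab) erefl).
- move=> t tI h; have /andP[at_ tb] := tI; have sk := chart_at_smooth (c t).
  rewrite -(h t) ?at_ ?lexx//.
  have [W [g [e [eb rr]]]] := right_rep pc tI sk (chart_at_dom (c t)).
  have [oW hg cg e0 eg] := rr.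
  exists e => // s sI _; have tI' : t <= t < t + e by rewrite lexx ltrDl.
  rewrite (tvF_rrep sk eb rr sI) (tvF_rrep sk eb rr tI').
  have /andP[ts se] := sI; have sb : s <= b by order_lra.
  apply: (piece_speed hF geo sk at_ ts sb oW hg cg) => y /andP[y1 y2].
  by apply: eg; rewrite y1/=; order_lra.
- move=> t tI h; have /andP[at_ tb] := tI; have sk := chart_at_smooth (c t).
  have [W [g [e [ae lr]]]] := left_rep pc tI sk (chart_at_dom (c t)).
  have [oW hg cg e0 eg] := lr.
  have sI : t - e < t - e / 2 <= t by order_lra.
  have tI' : t - e < t <= t by rewrite lexx gtrBl e0.
  rewrite -(h (t - e / 2)); last by order_lra.
  rewrite (tvF_lrep geo sk ae tb lr sI) (tvF_lrep geo sk ae tb lr tI').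
  have as_ : a <= t - e / 2 by order_lra.
  have st : t - e / 2 <= t by order_lra.
  apply: (piece_speed hF geo sk as_ st tb oW hg cg) => y /andP[y1 y2].
  by apply: eg; rewrite y2 andbT; order_lra.
Qed.

(** Constant speed again: a geodesic that starts with nonzero velocity never leaves the slit domain,
    where [lag] is smooth. *)
Lemma tv_eq0 a b c t : geodesic A F a b c -> a <= t <= b -> (tv c b t == 0) = (tv c b a == 0).
Proof.
move=> geo tI; have [ab _] := geodesic_apiece geo.
have aI : a <= a <= b by rewrite lexx ltW.
have e1 := cf_eq0 hF (tv_mem geo tI); have e2 := cf_eq0 hF (tv_mem geo aI).
by apply/eqP/eqP => /[dup] h; [move/e1|move/e2]; rewrite ?(speed_const geo tI) => h2; [apply/e2|apply/e1; rewrite (speed_const geo tI)].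
Qed.

Lemma cy_rep c b k t y w : smooth_chart k -> cimg k y -> c t = cinv k y ->
  tv c b t = of_coord k y w -> cx k c t = y /\ cy k c b t = w.
Proof.
move=> sk iy ct tvt; rewrite /cx /cy /cw tvt ct cinvK//; split=> //.
have h := tdom_chart_at iy.
have := dtrK w sk (chart_at_smooth (cinv k y)) h.
by rewrite of_coordE// transD.
Qed.

Lemma cw_of_coord c (w : R -> V) k t : smooth_chart k -> cdom k (c t) ->
  of_coord k (cx k c t) (cw k c w t) = w t.
Proof.
move=> sk ct; have ik := cmap_img ct; have ek := cmapK ct.
have h := tdom_chart_at ik; rewrite ek in h.
rewrite of_coordE//.
have e : cmap (chart_at (c t)) (c t) = trans k (chart_at (c t)) (cx k c t) by rewrite transD /cx /= ek.
rewrite /cw e ek.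
have h' := tdom_sym h.
have := dtrK (w t) (chart_at_smooth (c t)) sk h'.
have -> // : trans (chart_at (c t)) k (trans k (chart_at (c t)) (cx k c t)) = cx k c t.
by rewrite transE// transD /= ek.
Qed.

Lemma cy_mem a b c k t : geodesic A F a b c -> smooth_chart k -> a <= t <= b -> cdom k (c t) ->
  CS k (cx k c t, cy k c b t).
Proof.
move=> geo sk tI ct; split; first exact: cmap_img.
by rewrite /= /cy cw_of_coord// /cx cmapK//; exact: (tv_mem geo).
Qed.

Lemma cy_memn a b c k t : geodesic A F a b c -> tv c b a != 0 -> smooth_chart k -> a <= t <= b ->
  cdom k (c t) -> CSn k (cx k c t, cy k c b t).
Proof.
move=> geo reg sk tI ct; split; first exact: (cy_mem geo).
rewrite /=; apply: contra_neq reg => h; apply/eqP; rewrite -(tv_eq0 geo tI).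
rewrite -(cw_of_coord (tv c b) sk ct) -/(cy k c b t) h; apply/eqP; exact: clin0 (of_coord_clin sk (cmap_img ct)).
Qed.

Lemma cy_rrep b c k t e W g y : smooth_chart k -> t + e <= b ->
  rrep k c t e W g -> t <= y < t + e -> cx k c y = g y /\ cy k c b y = 'D_1 g y.
Proof.
move=> sk eb rr yI; have [_ cE _ iy] := rrep_at rr yI.
exact: cy_rep sk iy cE (tv_rrep sk eb rr yI).
Qed.

Lemma cy_lrep a b c k t e W g y : geodesic A F a b c -> smooth_chart k -> a <= t - e -> t <= b ->
  lrep k c t e W g -> t - e < y <= t -> cx k c y = g y /\ cy k c b y = 'D_1 g y.
Proof.
move=> geo sk ae tb lr yI; have [_ cE _ iy] := lrep_at lr yI.
exact: cy_rep sk iy cE (tv_lrep geo sk ae tb lr yI).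
Qed.

Lemma jet_continuous (W : set R) (g : R -> V) y : W y -> Cr None W g ->
  {for y, continuous g} /\ {for y, continuous (fun t => 'D_1 g t)}.
Proof. by move=> Wy hg; split; [exact: Cr_continuous hg Wy|exact: Cr_continuous (Cr_S (1 : R) hg) Wy]. Qed.

(** On each side of [t] position and velocity come from one smooth representative; that both sides
    give the same [tv] at a break is the absence of corners, contained in [cy_lrep]. *)
Lemma cxy_continuous a b c k t s u : geodesic A F a b c -> smooth_chart k -> a <= s -> u <= b ->
  s <= t <= u -> cdom k (c t) ->
  cx k c y @[y --> within `[s, u]%classic (nbhs t)] --> cx k c t /\
  cy k c b y @[y --> within `[s, u]%classic (nbhs t)] --> cy k c b t.
Proof.
move=> geo sk as_ ub /andP[st tu] ct; have [ab pc] := geodesic_apiece geo.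
have at_ : a <= t := le_trans as_ st; have tb : t <= b := le_trans tu ub.
have [e1 [e10 [gp hp]]] : exists e1, 0 < e1 /\ exists gp : R -> V, t < u ->
    ({for t, continuous gp} /\ {for t, continuous (fun t => 'D_1 gp t)}) /\
    forall y, t <= y < t + e1 -> cx k c y = gp y /\ cy k c b y = 'D_1 gp y.
  have [tu'|ut] := ltP t u; last by exists 1; split=> //; exists (cst 0).
  have tI : a <= t < b by rewrite at_ (lt_le_trans tu' ub).
  have [W [g [e [eb rr]]]] := right_rep pc tI sk ct.
  have [oW hg cg e0 eg] := rr.
  exists e; split=> //; exists g => _; split.
    have tI' : t <= t < t + e by rewrite lexx ltrDl.
    by have [Wt _ _ _] := rrep_at rr tI'; exact: jet_continuous Wt hg.
  by move=> y; exact: (cy_rrep sk eb rr).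
have [e2 [e20 [gm hm]]] : exists e1, 0 < e1 /\ exists gp : R -> V, s < t ->
    ({for t, continuous gp} /\ {for t, continuous (fun t => 'D_1 gp t)}) /\
    forall y, t - e1 < y <= t -> cx k c y = gp y /\ cy k c b y = 'D_1 gp y.
  have [tu'|ut] := ltP s t; last by exists 1; split=> //; exists (cst 0).
  have tI : a < t <= b by rewrite tb (le_lt_trans as_ tu').
  have [W [g [e [ae lr]]]] := left_rep pc tI sk ct.
  have [oW hg cg e0 eg] := lr.
  exists e; split=> //; exists g => _; split.
    have tI' : t - e < t <= t by rewrite lexx gtrBl e0.
    by have [Wt _ _ _] := lrep_at lr tI'; exact: jet_continuous Wt hg.
  by move=> y; exact: (cy_lrep geo sk ae tb lr).
pose e := Num.min e1 e2; have e0 : 0 < e by rewrite lt_min e10.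
have m1 : e <= e1 by rewrite ge_min lexx.
have m2 : e <= e2 by rewrite ge_min lexx orbT.
split.
  apply: (@glue_within _ _ (cx k c) gm gp s u t e e0) => [/hp|/hm] [[c1 c2] h]; split=> // y /andP[y1 y2].
    by apply: (h y _).1; rewrite y1/=; lra.
  by apply: (h y _).1; rewrite y2 andbT; lra.
apply: (@glue_within _ _ (cy k c b) ('D_1 gm) ('D_1 gp) s u t e e0) => [/hp|/hm] [[c1 c2] h]; split=> // y /andP[y1 y2].
  by apply: (h y _).2; rewrite y1/=; lra.
by apply: (h y _).2; rewrite y2 andbT; lra.
Qed.

(** At a break [EL_point] does not apply at [t] itself. It applies at nearby times on either side;
    letting them tend to [t] determines the derivative of the momentum of each representative. The
    two derivatives agree because the two jets at [t] do. *)
Lemma cxy_derive a b c k t : geodesic A F a b c -> tv c b a != 0 -> smooth_chart k -> a < t < b ->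
  cdom k (c t) -> is_derive t 1 (cx k c) (cy k c b t) /\
  forall xi : V, is_derive t 1 (fun s => 'D_(0, xi) (lag k) (cx k c s, cy k c b s))
    ('D_(xi, 0) (lag k) (cx k c t, cy k c b t)).
Proof.
move=> geo reg sk tI ct; have /andP[at_ tb] := tI.
have [e [Wm [gm [Wp [gp [e0 ae eb lr rr]]]]]] := interior_rep geo sk ct tI.
have tI1 : t - e < t <= t by rewrite lexx gtrBl e0.
have tI2 : t <= t < t + e by rewrite lexx ltrDl.
have Em := fun y => @cy_lrep a b c k t e Wm gm y geo sk ae (ltW tb) lr.
have Ep := fun y => @cy_rrep b c k t e Wp gp y sk eb rr.
have [oWm hgm cgm _ egm] := lr; have [oWp hgp cgp _ egp] := rr.
have [Wmt _ _ _] := lrep_at lr tI1; have [Wpt _ _ _] := rrep_at rr tI2.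
have [xm ym] := Em t tI1; have [xp yp] := Ep t tI2.
have [dm _] := is_derive_jet Wmt hgm; have [dp _] := is_derive_jet Wpt hgp.
split.
  rewrite -ym in dm; rewrite -yp in dp.
  exact: (glue_derive e0 dm dp (fun y yI => (Ep y yI).1) (fun y yI => (Em y yI).1)).
move=> xi.
have Ct := cy_memn geo reg sk (t := t) _ ct.
have {}Ct : CSn k (cx k c t, cy k c b t) by apply: Ct; rewrite !ltW.
have fV := findim_rV R n; have oC := open_CSn hF sk; have hL := Cr_lag hF sk.
have key (W : set R) (g : R -> V) : open W -> W t -> Cr None W g ->
    cx k c t = g t -> cy k c b t = 'D_1 g t ->
    [/\ is_derive t 1 (fun s => 'D_(0, xi) (lag k) (g s, 'D_1 g s)) ('D_1 (fun s => 'D_(0, xi) (lag k) (g s, 'D_1 g s)) t),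
     {for t, continuous (fun s => 'D_1 (fun s => 'D_(0, xi) (lag k) (g s, 'D_1 g s)) s)} &
     {for t, continuous (fun s => 'D_(xi, 0) (lag k) (g s, 'D_1 g s))}].
  move=> oW Wt hg x_ y_; rewrite x_ y_ in Ct.
  have oW1 := open_jet oW hg oC.
  set W1 := W `&` _ in oW1.
  have W1t : W1 t by [].
  have hg1 : Cr None W1 g by apply: Cr_sub hg => y [].
  have gU y : W1 y -> CSn k (g y, 'D_1 g y) by case.
  have h1 := Cr_momentum fV oC hL (0, xi) oW1 hg1 gU.
  have h2 := Cr_momentum fV oC hL (xi, 0) oW1 hg1 gU.
  split; [|exact: Cr_continuous (Cr_S (1 : R) h1) W1t|exact: Cr_continuous h2 W1t].
  by apply: derivableP; apply/derivable1_diffP; exact: Cr_differentiable h1 W1t.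
have [am1 am2 am3] := key Wm gm oWm Wmt hgm xm ym.
have [ap1 ap2 ap3] := key Wp gp oWp Wpt hgp xp yp.
have um : 'D_1 (fun s => 'D_(0, xi) (lag k) (gm s, 'D_1 gm s)) t = 'D_(xi, 0) (lag k) (gm t, 'D_1 gm t).
  apply: (eq_left_limit e0 am2 am3) => y /andP[y1 y2].
  have yI : t - e < y <= t by rewrite y1 ltW.
  have [Wy cE Cy iy] := lrep_at lr yI.
  have yab : a <= y <= b by apply/andP; order_lra.
  have cdy : cdom k (c y) by rewrite cE; exact: cinv_dom.
  have := cy_memn geo reg sk yab cdy; have [-> ->] := Em y yI => Cny.
  have yab' : a < y < b by apply/andP; order_lra.
  have m0 : 0 < Num.min (t - y) (y - (t - e)) by rewrite lt_min !subr_gt0 y2.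
  have hh z : y - Num.min (t - y) (y - (t - e)) < z < y + Num.min (t - y) (y - (t - e)) -> c z = cinv k (gm z).
    have m1 : Num.min (t - y) (y - (t - e)) <= t - y by rewrite ge_min lexx.
    have m2 : Num.min (t - y) (y - (t - e)) <= y - (t - e) by rewrite ge_min lexx orbT.
    by move=> /andP[z1 z2]; apply: (egm z _).2; apply/andP; order_lra.
  by have [_ <-] := EL_point hF xi geo sk yab' oWm Wy hgm Cny m0 hh.
have up : 'D_1 (fun s => 'D_(0, xi) (lag k) (gp s, 'D_1 gp s)) t = 'D_(xi, 0) (lag k) (gp t, 'D_1 gp t).
  apply: (eq_right_limit e0 ap2 ap3) => y /andP[y1 y2].
  have yI : t <= y < t + e by rewrite y2 ltW.
  have [Wy cE Cy iy] := rrep_at rr yI.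
  have yab : a <= y <= b by apply/andP; order_lra.
  have cdy : cdom k (c y) by rewrite cE; exact: cinv_dom.
  have := cy_memn geo reg sk yab cdy; have [-> ->] := Ep y yI => Cny.
  have yab' : a < y < b by apply/andP; order_lra.
  have m0 : 0 < Num.min (y - t) (t + e - y) by rewrite lt_min !subr_gt0 y1.
  have hh z : y - Num.min (y - t) (t + e - y) < z < y + Num.min (y - t) (t + e - y) -> c z = cinv k (gp z).
    have m1 : Num.min (y - t) (t + e - y) <= y - t by rewrite ge_min lexx.
    have m2 : Num.min (y - t) (t + e - y) <= t + e - y by rewrite ge_min lexx orbT.
    by move=> /andP[z1 z2]; apply: (egp z _).2; apply/andP; order_lra.
  by have [_ <-] := EL_point hF xi geo sk yab' oWp Wy hgp Cny m0 hh.
rewrite um -xm -ym in am1; rewrite up -xp -yp in ap1.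
apply: (glue_derive e0 am1 ap1) => y yI.
  have [q1 q2] := Ep y yI; exact: (f_equal2 (fun x1 x2 : V => 'D_(0, xi) (lag k) (x1, x2)) q1 q2).
have [q1 q2] := Em y yI; exact: (f_equal2 (fun x1 x2 : V => 'D_(0, xi) (lag k) (x1, x2)) q1 q2).
Qed.

Lemma geodesic_EL a b c k s u : geodesic A F a b c -> tv c b a != 0 -> smooth_chart k ->
  a <= s -> u <= b -> (forall t, s <= t <= u -> cdom k (c t)) ->
  EL (lag k) s u (cx k c) (cy k c b).
Proof.
move=> geo reg sk as_ ub ct; split.
- apply/subspace_continuousP => t; rewrite /= in_itv /= => tI.
  by have [] := cxy_continuous geo sk as_ ub tI (ct t tI).
- apply/subspace_continuousP => t; rewrite /= in_itv /= => tI.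
  by have [] := cxy_continuous geo sk as_ ub tI (ct t tI).
- move=> t /andP[t1 t2].
  have tI : a < t < b by rewrite (le_lt_trans as_ t1) (lt_le_trans t2 ub).
  have ctt : cdom k (c t) by apply: ct; rewrite !ltW.
  exact: (cxy_derive geo reg sk tI ctt).
Qed.

Lemma apiece_continuous a b c t : piecewise (apiece A c) a b -> a <= t <= b ->
  c y @[y --> within `[a, b]%classic (nbhs t)] --> c t.
Proof.
move=> pc /andP[at_ tb].
have sk := chart_at_smooth (c t); have ct := chart_at_dom (c t).
set k := chart_at (c t) in sk ct *.
have cc (W : set R) (g : R -> V) : W t -> Cr None W g -> cimg k (g t) -> {for t, continuous (fun y => cinv k (g y))}.
  move=> Wt hg ig; apply: (@continuous_comp _ _ _ g (cinv k)); first exact: Cr_continuous hg Wt.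
  exact: cinv_continuous.
have [e1 [e10 [gp hp]]] : exists e1, 0 < e1 /\ exists gp : R -> M, t < b ->
    {for t, continuous gp} /\ forall y, t <= y < t + e1 -> c y = gp y.
  have [tu'|ut] := ltP t b; last by exists 1; split=> //; exists (cst (c t)).
  have tI : a <= t < b by rewrite at_.
  have [W [g [e [eb rr]]]] := right_rep pc tI sk ct.
  have [oW hg cg e0 eg] := rr.
  exists e; split=> //; exists (fun y => cinv k (g y)) => _; split; last by move=> y /eg[].
  have tI' : t <= t < t + e by rewrite lexx ltrDl.
  by have [Wt _ _ it] := rrep_at rr tI'; exact: cc Wt hg it.
have [e2 [e20 [gm hm]]] : exists e1, 0 < e1 /\ exists gp : R -> M, a < t ->
    {for t, continuous gp} /\ forall y, t - e1 < y <= t -> c y = gp y.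
  have [tu'|ut] := ltP a t; last by exists 1; split=> //; exists (cst (c t)).
  have tI : a < t <= b by rewrite tb tu'.
  have [W [g [e [ae lr]]]] := left_rep pc tI sk ct.
  have [oW hg cg e0 eg] := lr.
  exists e; split=> //; exists (fun y => cinv k (g y)) => _; split; last by move=> y /eg[].
  have tI' : t - e < t <= t by rewrite lexx gtrBl e0.
  by have [Wt _ _ it] := lrep_at lr tI'; exact: cc Wt hg it.
pose e := Num.min e1 e2; have e0 : 0 < e by rewrite lt_min e10.
have m1 : e <= e1 by rewrite ge_min lexx.
have m2 : e <= e2 by rewrite ge_min lexx orbT.
apply: (@glue_within _ _ c gm gp a b t e e0) => [/hp|/hm] [c1 h]; split=> // y /andP[y1 y2]; apply: h.
  by rewrite y1/=; lra.
by rewrite y2 andbT; lra.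
Qed.

Lemma geodesic_continuous a b c t : geodesic A F a b c -> a <= t <= b ->
  c y @[y --> within `[a, b]%classic (nbhs t)] --> c t.
Proof. by move=> geo; apply: apiece_continuous; have [] := geodesic_apiece geo. Qed.

Lemma geodesic_cst a b c t : geodesic A F a b c -> tv c b a = 0 -> a <= t <= b -> c t = c a.
Proof.
move=> geo tv0; have [ab pc] := geodesic_apiece geo; move: t.
have tvt t : a <= t <= b -> tv c b t = 0 by move=> tI; apply/eqP; rewrite (tv_eq0 geo tI) tv0.
apply: (@real_induction _ (fun t => c t = c a) a b (ltW ab) erefl).
- move=> t tI h; have /andP[at_ tb] := tI; have sk := chart_at_smooth (c t).
  have [W [g [e [eb rr]]]] := right_rep pc tI sk (chart_at_dom (c t)).
  have [oW hg cg e0 eg] := rr.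
  have tI' : t <= t < t + e by rewrite lexx ltrDl.
  have [_ et _ it] := rrep_at rr tI'.
  have g0 : 'D_1 g t = 0.
    have := tv_rrep sk eb rr tI'; rewrite tvt ?at_ ?ltW// => /esym /eqP.
    by rewrite of_coord_eq0// => /eqP.
  exists e => // s sI _; rewrite -(h t) ?at_ ?lexx//.
  by have [_ -> _ _] := rrep_at rr sI; rewrite (rrep_zero hF geo sk at_ eb rr g0 sI) -et.
- move=> t tI h; have /andP[at_ tb] := tI; have sk := chart_at_smooth (c t).
  have [W [g [e [ae lr]]]] := left_rep pc tI sk (chart_at_dom (c t)).
  have [oW hg cg e0 eg] := lr.
  have tI' : t - e < t <= t by rewrite lexx gtrBl e0.
  have [_ et _ it] := lrep_at lr tI'.
  have g0 : 'D_1 g t = 0.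
    have := tv_lrep geo sk ae tb lr tI'; rewrite tvt ?tb ?andbT ?ltW// => /esym /eqP.
    by rewrite of_coord_eq0// => /eqP.
  have sI : t - e < t - e / 2 <= t by lra.
  rewrite -(h (t - e / 2)); last by lra.
  have [_ es _ _] := lrep_at lr sI.
  by rewrite es (lrep_zero hF geo sk tb ae lr g0 sI) -et.
Qed.

End GeodesicFlow.

(** * Uniqueness and dependence on the initial velocity *)

Section Misc.
Context (R : realType).

Lemma compact_sphere_rV n : compact [set v : 'rV[R]_n | `|v| = 1].
Proof.
apply: bounded_closed_compact.
  exists 1; split; first exact: real1.
  by move=> x x1 v /= ->; exact: ltW.
apply: (@closed_comp _ _ (fun v : 'rV[R]_n => `|v|) [set 1]); last exact: closed_eq.
by move=> v _; exact: norm_continuous.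
Qed.

Lemma within_near (T : topologicalType) (f : R -> T) (D : set R) t N :
  f y @[y --> within D (nbhs t)] --> f t -> nbhs (f t) N ->
  exists2 e, 0 < e & forall y, D y -> `|t - y| < e -> N (f y).
Proof.
move=> h hN; have /nbhs_ballP [e e0 he] := h _ hN.
by exists e => // y Dy ty; apply: he => //; rewrite -ball_normE.
Qed.

Lemma within_unique (T : topologicalType) (f1 f2 : R -> T) (D : set R) t : hausdorff_space T ->
  f1 y @[y --> within D (nbhs t)] --> f1 t -> f2 y @[y --> within D (nbhs t)] --> f2 t ->
  (forall e, 0 < e -> exists y, [/\ D y, `|t - y| < e & f1 y = f2 y]) -> f1 t = f2 t.
Proof.
move=> hT h1 h2 h; apply: hT => A B hA hB.
have [e1 e10 H1] := within_near h1 hA; have [e2 e20 H2] := within_near h2 hB.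
have [|y [Dy yt e12]] := h (Num.min e1 e2); first by rewrite lt_min e10.
exists (f1 y); split; first by apply: H1 => //; apply: lt_le_trans yt _; rewrite ge_min lexx.
by rewrite e12; apply: H2 => //; apply: lt_le_trans yt _; rewrite ge_min lexx orbT.
Qed.

Lemma within_at (V : normedModType R) (f : R -> V) (s u t : R) : {within `[s, u], continuous f} ->
  s <= t <= u -> f y @[y --> within `[s, u]%classic (nbhs t)] --> f t.
Proof. by move=> /subspace_continuousP h tI; apply: h; rewrite /= in_itv. Qed.

Lemma is_derive_rescale (V : normedModType R) (f : R -> V) (l t : R) (d : V) :
  is_derive (l * t) 1 f d -> is_derive t 1 (fun s => f (l * s)) (l *: d).
Proof.
move=> [df <-].
have hl : is_derive t 1 (fun s : R => l * s) l.
  have := is_deriveZ l (is_derive_id t (1 : R)).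
  by rewrite -[_ *: _]/(_ * _) mulr1.
have dF : differentiable f (l * t) by apply/derivable1_diffP.
have := is_derive_comp hl dF.
have -> // : 'D_l f (l * t) = l *: 'D_1 f (l * t).
have := clinZ l (1 : R) (derive_clin dF).
by rewrite -[l *: 1]/(l * 1) mulr1.
Qed.

Lemma EL_unique_local (V : normedModType R) (fV : findim V) (cS : compact [set v : V | `|v| = 1])
  (U : set (V * V)) (oU : open U) (L : V * V -> R) (hL : Cr None U L)
  (posL : forall (z : V * V) (u : V), U z -> u != 0 -> 0 < 'D_(0, u) ('D_(0, u) L) z)
  (t u : R) (x1 y1 x2 y2 : R -> V) : t < u -> EL L t u x1 y1 -> EL L t u x2 y2 ->
  x1 t = x2 t -> y1 t = y2 t -> U (x1 t, y1 t) ->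
  exists2 d, 0 < d & forall s, t <= s < t + d -> s <= u /\ x1 s = x2 s /\ y1 s = y2 s.
Proof.
move=> tu E1 E2 ex ey Uz.
have [d [T [C [d0 T0 C0 bU [stab _]]]]] := EL_stab fV cS oU hL posL Uz.
have tI : t <= t <= u by rewrite lexx ltW.
have nearz x y : EL L t u x y -> (x t, y t) = (x1 t, y1 t) ->
    exists2 e', 0 < e' & forall s, t <= s <= u -> `|t - s| < e' -> ball (x1 t, y1 t) d (x s, y s).
  move=> [q1 q2 _] ez.
  have bz := nbhsx_ballx (x t, y t) d d0; rewrite {2}ez in bz.
  have [e' e'0 he'] := within_near (within_at (within_pair q1 q2) tI) bz.
  by exists e' => // s sI; apply: he'; rewrite /= in_itv.
have [e3 e30 h3] := nearz x1 y1 E1 erefl.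
have [e4 e40 h4] := nearz x2 y2 E2 (f_equal2 pair (esym ex) (esym ey)).
pose dl := Num.min (Num.min e3 e4) (Num.min T (u - t)).
have dl0 : 0 < dl by rewrite !lt_min e30 e40 T0 subr_gt0.
have [n1 n2 n3 n4] : [/\ dl <= e3, dl <= e4, dl <= T & dl <= u - t].
  by split; rewrite /dl !ge_min lexx ?orbT.
have sub : t + dl / 2 <= u by order_lra.
have abT : t <= t + dl / 2 <= t + T by apply/andP; order_lra.
have b1 s : t <= s <= t + dl / 2 -> ball (x1 t, y1 t) d (x1 s, y1 s).
  by move=> /andP[s1 s2]; apply: h3; [apply/andP; order_lra|rewrite ler0_norm; order_lra].
have b2 s : t <= s <= t + dl / 2 -> ball (x1 t, y1 t) d (x2 s, y2 s).
  by move=> /andP[s1 s2]; apply: h4; [apply/andP; order_lra|rewrite ler0_norm; order_lra].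
have res := stab t (t + dl / 2) _ _ _ _ abT (EL_sub (lexx t) sub E1) (EL_sub (lexx t) sub E2) b1 b2.
exists (dl / 2); first by rewrite divr_gt0.
move=> s /andP[s1 s2].
have sI : t <= s <= t + dl / 2 by rewrite s1 ltW.
have [r1 r2] := res s sI; rewrite ex ey !subrr !normr0 addr0 mulr0 in r1 r2.
rewrite mulr0 add0r in r2.
split; first by order_lra.
by split; apply/eqP; rewrite -subr_eq0 -normr_le0.
Qed.

Section ELscale.
Context (V : normedModType R) (U : set (V * V)) (oU : open U) (L : V * V -> R) (hL : Cr None U L).

Lemma EL_ext a b (x y x' y' : R -> V) : (forall t, a <= t <= b -> x t = x' t /\ y t = y' t) ->
  EL L a b x y -> EL L a b x' y'.
Proof.
move=> e [cx cy d].
have ex : {in `[a, b]%classic, x =1 x'} by move=> t; rewrite inE /= in_itv /= => /e[].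
have ey : {in `[a, b]%classic, y =1 y'} by move=> t; rewrite inE /= in_itv /= => /e[].
split.
- exact: (subspace_eq_continuous ex cx).
- exact: (subspace_eq_continuous ey cy).
move=> t tI; have [d1 d2] := d t tI.
have tI' : a <= t <= b by case/andP: tI => /ltW -> /ltW ->.
have nr : \forall s \near t, x s = x' s /\ y s = y' s.
  have : `]a, b[%classic t by rewrite /= in_itv.
  move=> /(conj (@interval_open _ (BRight a) (BLeft b) isT isT)) /open_nbhs_nbhs.
  by apply: filterS => s; rewrite /= in_itv /= => /andP[s1 s2]; apply: e; rewrite !ltW.
have [e1 e2] := e t tI'; rewrite -e1 -e2; split.
  by apply: near_eq_is_derive d1; apply: filterS nr => s [].
by move=> u; apply: near_eq_is_derive (d2 u); apply: filterS nr => s [-> ->].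
Qed.

Lemma derive_homog (l : R) z ze : 0 < l -> U z -> U (z.1, l *: z.2) ->
  (forall z, U z -> L (z.1, l *: z.2) = l ^+ 2 * L z) ->
  'D_(ze.1, l *: ze.2) L (z.1, l *: z.2) = l ^+ 2 * 'D_ze L z.
Proof.
move=> l0 Uz Ulz hom.
pose S (z : V * V) := (z.1, l *: z.2).
have cS : clin S by apply: clin_pair (clin_fst _ _) (clin_comp (clin_snd _ _) (clin_scaler _ l)).
have dS := clin_differentiable z cS.
have dL := Cr_differentiable hL Ulz.
have h1 := derive_compE ze dS dL; rewrite (clin_derive z ze cS) in h1.
rewrite -(deriveE (S ze) dL) in h1.
rewrite -[LHS]h1 -(derive_scale (l ^+ 2) ze (Cr_differentiable hL Uz)).
apply: near_eq_derive; apply: filterS (open_nbhs_nbhs (conj oU Uz)) => z' Uz'.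
exact: hom.
Qed.

(** Running time [l] times faster multiplies the velocity and the momentum by [l] and the derivative
    along the base by [l ^+ 2]; both sides of the equation gain the same factor. *)
Lemma EL_scale (l a b : R) (x y : R -> V) : 0 < l ->
  (forall z, U z -> U (z.1, l *: z.2)) ->
  (forall z, U z -> L (z.1, l *: z.2) = l ^+ 2 * L z) ->
  (forall t, l * a <= t <= l * b -> U (x t, y t)) ->
  EL L (l * a) (l * b) x y -> EL L a b (fun s => x (l * s)) (fun s => l *: y (l * s)).
Proof.
move=> l0 US hom hU [cx cy d].
have sI s : a <= s <= b -> l * a <= l * s <= l * b by rewrite !ler_pM2l.
have cl (f : R -> V) : {within `[l * a, l * b], continuous f} ->
    {within `[a, b], continuous (fun s => f (l * s))}.
  move=> cf; apply/subspace_continuousP => t; rewrite /= in_itv /= => tI N hN.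
  have [e e0 he] := within_near (within_at cf (sI t tI)) hN.
  apply/nbhs_ballP; exists (e / l); first by rewrite /= divr_gt0.
  move=> s; rewrite -ball_normE /ball_ /= => st; rewrite in_itv /= => sI'.
  apply: he; first by rewrite /= in_itv /=; exact: sI.
  by rewrite -mulrBr normrM gtr0_norm// mulrC -ltr_pdivlMr.
have fibE z : U z -> (forall xi : V, 'D_(0, xi) L (z.1, l *: z.2) = l * 'D_(0, xi) L z) /\
    (forall xi : V, 'D_(xi, 0) L (z.1, l *: z.2) = l * (l * 'D_(xi, 0) L z)).
  move=> Uz; split=> xi.
    have := derive_homog (0, xi) l0 Uz (US z Uz) hom; rewrite /=.
    have lD := derive_clin (Cr_differentiable hL (US z Uz)).
    have -> : (0, l *: xi) = l *: (0, xi) :> V * V by rewrite pairZE scaler0.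
    rewrite (clinZ _ _ lD) -[_ *: _]/(_ * _) expr2 -mulrA => /mulfI; apply.
    by rewrite gt_eqF.
  have := derive_homog (xi, 0) l0 Uz (US z Uz) hom; rewrite /= scaler0 => ->.
  by rewrite expr2 mulrA.
split.
- exact: cl.
- move=> t; apply: cvgZr; exact: (cl y cy t).
move=> t /andP[t1 t2].
have tI : l * a < l * t < l * b by rewrite !ltr_pM2l ?t1.
have tI' : l * a <= l * t <= l * b by case/andP: tI => /ltW -> /ltW ->.
have [d1 d2] := d _ tI; split; first exact: is_derive_rescale d1.
move=> u; have [_ h2] := fibE _ (hU _ tI'); rewrite /= in h2; rewrite h2.
have d3 := is_deriveZ l (is_derive_rescale (d2 u)).
apply: near_eq_is_derive d3.
have : `]a, b[%classic t by rewrite /= in_itv /= t1.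
move=> /(conj (@interval_open _ (BRight a) (BLeft b) isT isT)) /open_nbhs_nbhs.
apply: filterS => s; rewrite /= in_itv /= => /andP[s1 s2].
have sI' : l * a <= l * s <= l * b by apply: sI; rewrite !ltW.
by have [h1 _] := fibE _ (hU _ sI'); rewrite /= in h1; rewrite h1.
Qed.

End ELscale.
End Misc.

(** * Uniqueness and rescaling of solutions on the manifold *)

Section Solutions.
Context (R : realType) (n : nat) (M : manifold R n)
  (A : M -> set 'rV[R]_n) (F : M -> 'rV[R]_n -> R) (hF : conic_finsler A F).
Implicit Types (k : chart R n M) (c : R -> M) (w : R -> 'rV[R]_n) (a b s t u e : R).
Local Notation V := 'rV[R]_n.
Local Notation CS := (coord_set A).
Local Notation CSn := (CSn A).
Local Notation CF := (coord_fun F).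
Local Notation lag := (lag F).

(** The equation in every compatible chart, with nonzero velocity [w]. It is kept apart from
    [geodesic] because restriction to a subinterval and rescaling of time are transparent for
    solutions, but not for critical points of the energy. *)
Definition Gsol a b c w : Prop :=
  (forall t, a <= t <= b -> c y @[y --> within `[a, b]%classic (nbhs t)] --> c t) /\
  forall k, smooth_chart k -> forall s u, a <= s -> s <= u -> u <= b ->
    (forall t, s <= t <= u -> cdom k (c t)) ->
    EL (lag k) s u (cx k c) (cw k c w) /\
    forall t, s <= t <= u -> CSn k (cx k c t, cw k c w t).

Lemma geodesic_Gsol (hA : pointwise_convex A) a b c : geodesic A F a b c -> tv c b a != 0 ->
  Gsol a b c (tv c b).
Proof.
move=> geo reg; split=> [t tI|k sk s u as_ su ub ct]; first exact: geodesic_continuous geo tI.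
split; first exact: (geodesic_EL hF hA geo reg sk as_ ub ct).
move=> t /andP[st tu]; apply: (cy_memn hF hA geo reg sk).
  by rewrite (le_trans as_ st) (le_trans tu ub).
by apply: ct; rewrite st.
Qed.

Lemma Gsol_near a b c w k t : Gsol a b c w -> smooth_chart k -> a <= t <= b -> cdom k (c t) ->
  exists2 e, 0 < e & forall y, a <= y <= b -> `|t - y| < e -> cdom k (c y).
Proof.
move=> [h _] sk tI ct.
have [e e0 he] := within_near (h t tI) (open_nbhs_nbhs (conj (open_cdom k) ct)).
by exists e => // y yI ty; apply: he => //; rewrite /= in_itv.
Qed.

Lemma cx_eq k c1 c2 w1 w2 t : smooth_chart k -> cdom k (c1 t) -> cdom k (c2 t) ->
  cx k c1 t = cx k c2 t -> cw k c1 w1 t = cw k c2 w2 t -> c1 t = c2 t /\ w1 t = w2 t.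
Proof.
move=> sk h1 h2 ex ew; split; first by rewrite -(cmapK h1) -(cmapK h2) -!/(cx k _ t) ex.
by rewrite -(cw_of_coord w1 sk h1) -(cw_of_coord w2 sk h2) ex ew.
Qed.

Lemma eq_cx k c1 c2 w1 w2 t : c1 t = c2 t -> w1 t = w2 t ->
  cx k c1 t = cx k c2 t /\ cw k c1 w1 t = cw k c2 w2 t.
Proof. by rewrite /cx /cw => -> ->. Qed.

(** Real induction. To the right of a common value, local uniqueness in a chart applies; at a limit
    time positions agree because [M] is Hausdorff, and velocities by continuity in a chart. *)
Lemma Gsol_unique a b c1 w1 c2 w2 t : a <= b -> Gsol a b c1 w1 -> Gsol a b c2 w2 ->
  c1 a = c2 a -> w1 a = w2 a -> a <= t <= b -> c1 t = c2 t /\ w1 t = w2 t.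
Proof.
move=> ab G1 G2 ca wa; move: t.
have [ct1 S1] := G1; have [ct2 S2] := G2.
apply: (@real_induction _ (fun t => c1 t = c2 t /\ w1 t = w2 t) a b ab (conj ca wa)).
- move=> t tI h; have /andP[at_ tb] := tI.
  have [ec ew] : c1 t = c2 t /\ w1 t = w2 t by apply: h; rewrite at_ lexx.
  have sk := chart_at_smooth (c1 t); have cd1 := chart_at_dom (c1 t).
  set k := chart_at (c1 t) in sk cd1.
  have cd2 : cdom k (c2 t) by rewrite -ec.
  have tI' : a <= t <= b by rewrite at_ ltW.
  have [e1 e10 h1] := Gsol_near G1 sk tI' cd1.
  have [e2 e20 h2] := Gsol_near G2 sk tI' cd2.
  pose e := Num.min (Num.min e1 e2) (b - t).
  have e0 : 0 < e by rewrite !lt_min e10 e20 subr_gt0.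
  have [m1 m2 m3] : [/\ e <= e1, e <= e2 & e <= b - t].
    by split; rewrite /e !ge_min lexx ?orbT.
  have tu : t <= t + e / 2 by order_lra.
  have ub : t + e / 2 <= b by order_lra.
  have dm1 y : t <= y <= t + e / 2 -> cdom k (c1 y).
    by move=> /andP[y1 y2]; apply: h1; [apply/andP; order_lra|rewrite ler0_norm; order_lra].
  have dm2 y : t <= y <= t + e / 2 -> cdom k (c2 y).
    by move=> /andP[y1 y2]; apply: h2; [apply/andP; order_lra|rewrite ler0_norm; order_lra].
  have [EL1 C1] := S1 k sk t (t + e / 2) at_ tu ub dm1.
  have [EL2 C2] := S2 k sk t (t + e / 2) at_ tu ub dm2.
  have tI2 : t <= t <= t + e / 2 by rewrite lexx tu.
  have Cz := C1 t tI2.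
  have [ex0 ew0] := eq_cx k ec ew.
  have pL (z : V * V) (x : V) : CSn k z -> x != 0 -> 0 < 'D_(0, x) ('D_(0, x) (lag k)) z.
    by case: z => z1 z2; exact: lag_posdef.
  have tu' : t < t + e / 2 by order_lra.
  have [d d0 hd] := EL_unique_local (findim_rV R n) (@compact_sphere_rV R n)
    (open_CSn hF sk) (Cr_lag hF sk) pL tu' EL1 EL2 ex0 ew0 Cz.
  exists d => // s sI _; have [su [r1 r2]] := hd s sI.
  have sI2 : t <= s <= t + e / 2 by case/andP: sI => ->.
  exact: (cx_eq sk (dm1 s sI2) (dm2 s sI2) r1 r2).
- move=> t tI h; have /andP[at_ tb] := tI.
  have tI' : a <= t <= b by rewrite tb ltW.
  have pts s u : s < t -> forall e, 0 < e -> exists y, [/\ s <= y, y < t & `|t - y| < e].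
    move=> st e e0; exists (Num.max s (t - e / 2)).
    have y1 : s <= Num.max s (t - e / 2) by rewrite le_max lexx.
    have y2 : Num.max s (t - e / 2) < t by rewrite gt_max st gtrBl divr_gt0.
    have y3 : t - e / 2 <= Num.max s (t - e / 2) by rewrite le_max lexx orbT.
    by split=> //; rewrite gtr0_norm ?subr_gt0//; order_lra.
  have ec : c1 t = c2 t.
    apply: (within_unique (@manifold_hausdorff _ _ M) (ct1 t tI') (ct2 t tI')) => e e0.
    have [y [y1 y2 y3]] := pts a t at_ e e0; exists y; split=> //.
      by rewrite /= in_itv /= y1 (le_trans (ltW y2)).
    by have [] := h y _; rewrite ?y1.
  have sk := chart_at_smooth (c1 t); have cd1 := chart_at_dom (c1 t).
  set k := chart_at (c1 t) in sk cd1.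
  have cd2 : cdom k (c2 t) by rewrite -ec.
  have [e1 e10 h1] := Gsol_near G1 sk tI' cd1.
  have [e2 e20 h2] := Gsol_near G2 sk tI' cd2.
  pose e := Num.min (Num.min e1 e2) (t - a).
  have e0 : 0 < e by rewrite !lt_min e10 e20 subr_gt0.
  have [m1 m2 m3] : [/\ e <= e1, e <= e2 & e <= t - a].
    by split; rewrite /e !ge_min lexx ?orbT.
  have ut : t - e / 2 <= t by order_lra.
  have ua : a <= t - e / 2 by order_lra.
  have dm1 y : t - e / 2 <= y <= t -> cdom k (c1 y).
    by move=> /andP[y1 y2]; apply: h1; [apply/andP; order_lra|rewrite ger0_norm; order_lra].
  have dm2 y : t - e / 2 <= y <= t -> cdom k (c2 y).
    by move=> /andP[y1 y2]; apply: h2; [apply/andP; order_lra|rewrite ger0_norm; order_lra].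
  have [[_ q1 _] _] := S1 k sk (t - e / 2) t ua ut tb dm1.
  have [[_ q2 _] _] := S2 k sk (t - e / 2) t ua ut tb dm2.
  have tI2 : t - e / 2 <= t <= t by rewrite lexx ut.
  have ew : cw k c1 w1 t = cw k c2 w2 t.
    apply: (within_unique (@norm_hausdorff _ _) (within_at q1 tI2) (within_at q2 tI2)) => e' e'0.
    have st : t - e / 2 < t by order_lra.
    have [y [y1 y2 y3]] := pts (t - e / 2) t st e' e'0; exists y; split=> //.
      by rewrite /= in_itv /= y1 ltW.
    have [] := h y _; first by rewrite y2 andbT; order_lra.
    by move=> E1 E2; have [] := eq_cx k E1 E2.
  have ex : cx k c1 t = cx k c2 t by rewrite /cx ec.
  exact: (cx_eq sk cd1 cd2 ex ew).
Qed.

Lemma Gsol_sub a b a' b' c w : a <= a' -> b' <= b -> Gsol a b c w -> Gsol a' b' c w.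
Proof.
move=> aa bb [h1 h2]; split=> [t /andP[t1 t2]|k sk s u s1 su u1].
  apply: cvg_trans (h1 t _); last by rewrite (le_trans aa t1) (le_trans t2 bb).
  by apply: cvg_fmap2; apply: within_subset; exact: subset_seg.
by apply: h2; rewrite ?(le_trans aa s1) ?(le_trans u1 bb).
Qed.

Lemma CSn_scale k z (l : R) : smooth_chart k -> 0 < l -> CSn k z -> CSn k (z.1, l *: z.2).
Proof.
case: z => z1 z2 sk l0 [h1 h2]; split; first exact: (CS_conic hF sk h1 l0).
by rewrite /= scaler_eq0 negb_or gt_eqF.
Qed.

Lemma Gsol_scale a b c w (l : R) : 0 < l -> Gsol (l * a) (l * b) c w ->
  Gsol a b (fun s => c (l * s)) (fun s => l *: w (l * s)).
Proof.
move=> l0 [h1 h2].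
have sI s s1 s2 : s1 <= s <= s2 -> l * s1 <= l * s <= l * s2 by rewrite !ler_pM2l.
split=> [t tI N hN|k sk s u s1 su u1 cd].
  have [e e0 he] := within_near (h1 _ (sI _ _ _ tI)) hN.
  apply/nbhs_ballP; exists (e / l); first by rewrite /= divr_gt0.
  move=> s; rewrite -ball_normE /ball_ /= => st; rewrite in_itv /= => sI'.
  apply: he; first by rewrite /= in_itv /=; exact: sI.
  by rewrite -mulrBr normrM gtr0_norm// mulrC -ltr_pdivlMr.
have cd' t : l * s <= t <= l * u -> cdom k (c t).
  move=> /andP[t1 t2]; have -> : t = l * (t / l) by rewrite mulrCA divff ?mulr1// gt_eqF.
  by apply: cd; rewrite ler_pdivlMr// ler_pdivrMr// mulrC t1 mulrC.
have ls1 : l * a <= l * s by rewrite ler_pM2l.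
have lsu : l * s <= l * u by rewrite ler_pM2l.
have lu1 : l * u <= l * b by rewrite ler_pM2l.
have [E C] := h2 k sk (l * s) (l * u) ls1 lsu lu1 cd'.
have ew t : s <= t <= u -> l *: cw k c w (l * t) = cw k (fun s => c (l * s)) (fun s => l *: w (l * s)) t.
  move=> tI; rewrite /cw /=; apply/esym.
  apply: (clinZ l (w (l * t))); apply: dtr_clin => //; first exact: chart_at_smooth.
  have ct := chart_at_dom (c (l * t)).
  split; first exact: cmap_img.
  by rewrite /preimage /= cmapK//; exact: cd.
split.
  apply: (@EL_ext _ _ _ s u (fun t => cx k c (l * t)) (fun t => l *: cw k c w (l * t))).
    by move=> t tI; split=> //; exact: ew.
  apply: (EL_scale (open_CSn hF sk) (Cr_lag hF sk) l0 _ _ C E) => -[z1 z2] Cz.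
    exact: CSn_scale.
  by apply: (lag_homog hF sk) => //; case: Cz.
move=> t tI; rewrite -ew//.
exact: (CSn_scale sk l0 (C (l * t) (sI _ _ _ tI))).
Qed.

End Solutions.

(** * Short-time confinement of solutions *)

Section Drift.
Context (R : realType) (V : normedModType R) (fV : findim V)
  (cS : compact [set v : V | `|v| = 1])
  (U : set (V * V)) (oU : open U) (L : V * V -> R) (hL : Cr None U L)
  (posL : forall (z : V * V) (u : V), U z -> u != 0 -> 0 < 'D_(0, u) ('D_(0, u) L) z).

Definition EL_in (z0 : V * V) (d s : R) (x y : R -> V) : Prop :=
  EL L 0 s x y /\ forall t, 0 <= t <= s -> ball z0 d (x t, y t).

(** The first clause is an a priori estimate: a solution that starts within [d / 4] of [z0] and
    stays in the ball of radius [d] is in fact within [d / 2]. The room between [d / 2] and [d] is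
    what a continuation argument needs. *)
Lemma EL_drift z0 : U z0 -> exists d T C : R,
  [/\ 0 < d, 0 < T, 0 < C, ball z0 d `<=` U &
  [/\ forall s x y, 0 <= s <= T -> EL_in z0 d s x y -> `|z0 - (x 0, y 0)| <= d / 4 ->
        `|z0 - (x s, y s)| <= d / 2,
      forall s x y, 0 <= s <= T -> EL_in z0 d s x y -> `|x s - x 0 - s *: y 0| <= C * s ^+ 2,
      forall s x1 y1 x2 y2, 0 <= s <= T -> EL_in z0 d s x1 y1 -> EL_in z0 d s x2 y2 ->
        x1 0 = x2 0 -> `|x1 s - x2 s| <= C * s * `|y1 0 - y2 0| &
      forall z u, ball z0 d z -> `|'D_u L z| <= C * `|u|]].
Proof.
move=> Uz0.
have [d1 [T [C1 [d10 T0 C10 b1 [st2 st1]]]]] := EL_stab fV cS oU hL posL Uz0.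
have [d2 [C2 [d20 C20 b2 [_ bD]]]] := lag_lipschitz fV oU hL Uz0.
pose d := Num.min d1 d2; pose C := Num.max C1 C2.
have d0 : 0 < d by rewrite lt_min d10.
have [dd1 dd2] : d <= d1 /\ d <= d2 by rewrite /d !ge_min !lexx orbT.
have [cc1 cc2] : C1 <= C /\ C2 <= C by rewrite /C !le_max !lexx orbT.
have C0 : 0 < C := lt_le_trans C10 cc1.
(* [s * N] bounds the drift over time [s]: the initial velocity is at most [|z0| + d / 4], and [C]
   enters twice, for the change of velocity and for the quadratic term. *)
pose N := `|z0| + d + 2 * C.
have N0 : 0 < N by rewrite /N addr_gt0 ?mulr_gt0// ltr_wpDl//.
pose T' := Num.min (Num.min T 1) (d / 4 / N).
have T'0 : 0 < T' by rewrite !lt_min T0 ltr01 !divr_gt0.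
have [t1 t2 t3] : [/\ T' <= T, T' <= 1 & T' <= d / 4 / N].
  by split; rewrite /T' !ge_min lexx ?orbT.
have inb s x y : EL_in z0 d s x y -> forall t, 0 <= t <= s -> ball z0 d1 (x t, y t).
  by move=> [_ h] t /h; exact: le_ball.
have sT s : 0 <= s <= T' -> 0 <= s <= 0 + T.
  by rewrite add0r => /andP[-> h]; exact: le_trans t1.
have one s x y : 0 <= s <= T' -> EL_in z0 d s x y ->
    `|y s - y 0| <= C * s /\ `|x s - x 0 - s *: y 0| <= C * s ^+ 2.
  move=> sI hE; have /andP[s0 s1] := sI; have sI' : 0 <= s <= s by rewrite s0 lexx.
  have := st1 0 s x y (sT s sI) hE.1 (inb s x y hE) s sI'.
  rewrite subr0 => -[q1 q2]; split; [apply: le_trans q1 _|apply: le_trans q2 _].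
    by rewrite ler_wpM2r.
  by rewrite ler_wpM2r// sqr_ge0.
exists d, T', C; split=> //; first by apply: subset_trans b1; exact: le_ball.
split.
- move=> s x y sI hE hz; have [q1 q2] := one s x y sI hE.
  have /andP[s0 s1] := sI.
  have y0b : `|y 0| <= `|z0| + d / 4.
    have h : `|z0.2 - y 0| <= d / 4 by apply: le_trans hz; rewrite [leRHS]prod_normE le_max lexx orbT.
    have h2 : `|z0.2| <= `|z0| by rewrite prod_normE le_max lexx orbT.
    have -> : y 0 = z0.2 - (z0.2 - y 0) by rewrite subKr.
    by apply: le_trans (ler_normB _ _) _; exact: lerD.
  have e1 : `|x 0 - x s| <= s * (`|z0| + d / 4) + C * s.
    have -> : x 0 - x s = - (s *: y 0 + (x s - x 0 - s *: y 0)).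
      by rewrite [X in _ = - X]addrC subrK opprB.
    rewrite normrN; apply: le_trans (ler_normD _ _) _; apply: lerD.
      by rewrite normrZ (ger0_norm s0) ler_wpM2l.
    apply: le_trans q2 _; rewrite expr2 ler_wpM2l ?(ltW C0)//.
    by rewrite ler_piMr// (le_trans s1).
  have e2 : `|y 0 - y s| <= C * s by rewrite distrC.
  have tri : `|z0 - (x s, y s)| <= `|z0 - (x 0, y 0)| + (`|x 0 - x s| + `|y 0 - y s|).
    have -> : z0 - (x s, y s) = (z0 - (x 0, y 0)) + ((x 0, y 0) - (x s, y s)) by rewrite addrA subrK.
    by apply: le_trans (ler_normD _ _) _; rewrite lerD2l; exact: norm_pairB_le.
  have e3 : s * N <= d / 4.
    apply: (@le_trans _ _ (T' * N)); first by rewrite ler_wpM2r// ltW.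
    by rewrite -ler_pdivlMr.
  move: tri e1 e2 e3 hz; rewrite /N; clear -d0 s0 => tri e1 e2 e3 hz.
  have e4 : s * (d / 4) <= s * d by rewrite ler_wpM2l//; lra.
  lra.
- by move=> s x y sI hE; have [] := one s x y sI hE.
- move=> s x1 y1 x2 y2 sI h1 h2 ex; have /andP[s0 s1] := sI.
  have sI' : 0 <= s <= s by rewrite s0 lexx.
  have [_] := st2 0 s x1 y1 x2 y2 (sT s sI) h1.1 h2.1 (inb _ _ _ h1) (inb _ _ _ h2) s sI'.
  rewrite ex subrr normr0 !add0r subr0 => h; apply: le_trans h _.
  by rewrite ler_wpM2r// ler_wpM2r.
- move=> z u bz; apply: le_trans (bD z u _) _; first exact: le_ball bz.
  by rewrite ler_wpM2r.
Qed.
End Drift.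

Lemma norm_fstB (R : realType) (V : normedModType R) (z0 z : V * V) :
  `|z0.1 - z.1| <= `|z0 - z|.
Proof. by rewrite [leRHS]prod_normE le_max lexx. Qed.

Lemma norm_pair_fst (R : realType) (V : normedModType R) (z0 : V * V) (y : V) :
  `|z0 - (y, z0.2)| = `|z0.1 - y|.
Proof. by rewrite prod_normE /= subrr normr0; apply/max_idPl. Qed.

Lemma closed_ball_norm (R : realType) (V' : normedModType R) (z0 : V') (r : R) :
  closed [set z : V' | `|z0 - z| <= r].
Proof.
apply: (@closed_comp _ _ (fun z : V' => `|z0 - z|) [set x | x <= r]); last exact: closed_le.
move=> z _; apply: (@continuous_comp _ _ _ (fun z : V' => z0 - z) (fun z : V' => `|z|)).
  by apply: (@continuousB _ _ _ (cst z0) id); [exact: cvg_cst|exact: cvg_id].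
exact: norm_continuous.
Qed.

Lemma within_closed (R : realType) (T : topologicalType) (f : R -> T) (D : set R) (K : set T) (t : R) : closed K ->
  f y @[y --> within D (nbhs t)] --> f t ->
  (forall e, 0 < e -> exists y, [/\ D y, `|t - y| < e & K (f y)]) -> K (f t).
Proof.
move=> cK hf h; apply: cK => N hN; have [e e0 he] := within_near hf hN.
by have [y [Dy ty Ky]] := h e e0; exists (f y); split=> //; exact: he.
Qed.

Lemma left_points (R : realType) (s t : R) : s < t -> forall e, 0 < e -> exists y, [/\ s <= y, y < t & `|t - y| < e].
Proof.
move=> st e e0; exists (Num.max s (t - e / 2)).
have y1 : s <= Num.max s (t - e / 2) by rewrite le_max lexx.
have y2 : Num.max s (t - e / 2) < t by rewrite gt_max st gtrBl divr_gt0.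
have y3 : t - e / 2 <= Num.max s (t - e / 2) by rewrite le_max lexx orbT.
by split=> //; rewrite gtr0_norm ?subr_gt0//; lra.
Qed.

Lemma within_closed_norm (R : realType) (V : normedModType R) (z0 : V * V) (x y : R -> V) (s t r : R) :
  s < t -> {within `[s, t], continuous x} -> {within `[s, t], continuous y} ->
  (forall u, s <= u < t -> `|z0 - (x u, y u)| <= r) -> `|z0 - (x t, y t)| <= r.
Proof.
move=> st cx cy h; have tI : s <= t <= t by rewrite lexx ltW.
have hz := within_at (within_pair cx cy) tI.
apply: (@within_closed R (V * V)%type (fun u => (x u, y u)) _ [set z | `|z0 - z| <= r] t _ hz) => [|e e0].
  exact: closed_ball_norm.
have [u [u1 u2 u3]] := left_points st e0; exists u; split=> //.
  by rewrite /= in_itv /= u1 ltW.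
by apply: h; rewrite u1.
Qed.

Section Stay.
Context (R : realType) (n : nat) (M : manifold R n)
  (A : M -> set 'rV[R]_n) (F : M -> 'rV[R]_n -> R) (hF : conic_finsler A F).
Implicit Types (k : chart R n M) (c : R -> M) (w : R -> 'rV[R]_n) (a b s t u e : R).
Local Notation V := 'rV[R]_n.
Local Notation CS := (coord_set A).
Local Notation CSn := (CSn A).
Local Notation CF := (coord_fun F).
Local Notation lag := (lag F).
Local Notation Gsol := (Gsol A F).

Lemma posdef_lag k (z : V * V) (x : V) : smooth_chart k -> CSn k z -> x != 0 ->
  0 < 'D_(0, x) ('D_(0, x) (lag k)) z.
Proof. by case: z => z1 z2 sk; exact: (lag_posdef hF sk). Qed.

Lemma compact_ball_rV (y : V) (r : R) : compact [set z : V | `|y - z| <= r].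
Proof.
apply: bounded_closed_compact; last exact: closed_ball_norm.
exists (`|y| + r); split; first exact: num_real.
move=> x hx z /= hz; apply: le_trans (ltW hx).
have -> : z = y - (y - z) by rewrite subKr.
by apply: le_trans (ler_normB _ _) _; rewrite lerD2l.
Qed.

Definition stays k (z0 : V * V) (d s : R) c w : Prop := forall t, 0 <= t <= s ->
  cdom k (c t) /\ ball z0 d (cx k c t, cw k c w t).

(** Continuation: on the manifold the solution could leave the chart as well as the ball. Real
    induction is run on the closed condition of being within [d / 2]; by continuity the solution
    remains in the ball of radius [d] a little longer, and [EL_drift] restores [d / 2]. *)
Lemma Gsol_stay k z0 : smooth_chart k -> CSn k z0 -> exists d T C : R,
  [/\ 0 < d, 0 < T, 0 < C, ball z0 d `<=` CSn k &
  [/\ forall s c w, 0 <= s <= T -> Gsol 0 s c w -> cdom k (c 0) ->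
        `|z0 - (cx k c 0, cw k c w 0)| <= d / 4 -> stays k z0 d s c w,
      forall s c w, 0 <= s <= T -> Gsol 0 s c w -> stays k z0 d s c w ->
        `|cx k c s - cx k c 0 - s *: cw k c w 0| <= C * s ^+ 2,
      forall s c1 w1 c2 w2, 0 <= s <= T -> Gsol 0 s c1 w1 -> stays k z0 d s c1 w1 ->
        Gsol 0 s c2 w2 -> stays k z0 d s c2 w2 ->
        cx k c1 0 = cx k c2 0 -> `|cx k c1 s - cx k c2 s| <= C * s * `|cw k c1 w1 0 - cw k c2 w2 0| &
      forall z u' : V * V, ball z0 d z -> `|'D_u' (lag k) z| <= C * `|u'|]].
Proof.
move=> sk Cz0.
have [d [T [C [d0 T0 C0 bU [h1 h2 h3 h4]]]]] := EL_drift (findim_rV R n) (@compact_sphere_rV R n)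
  (open_CSn hF sk) (Cr_lag hF sk) (fun (z : V * V) (x : V) => @posdef_lag k z x sk) Cz0.
have inE s c w : 0 <= s -> Gsol 0 s c w -> stays k z0 d s c w ->
    EL_in (lag k) z0 d s (cx k c) (cw k c w).
  move=> s0 [_ G] st; split; last by move=> t /st [].
  by have [] := G k sk 0 s (lexx _) s0 (lexx _) (fun t tI => (st t tI).1).
exists d, T, C; split; [exact: d0|exact: T0|exact: C0|exact: bU|]; split.
- move=> S c w /andP[S0 ST] G c0 hz.
  suff main t : 0 <= t <= S -> cdom k (c t) /\ `|z0 - (cx k c t, cw k c w t)| <= d / 2.
    move=> t /main [q1 q2]; split; first exact: q1.
    rewrite -ball_normE /ball_ /=; apply: le_lt_trans q2 _.
    by rewrite ltr_pdivrMr// mulr_natr mulr2n ltrDl.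
  have [ct G2] := G; move: t.
  have dd : d / 2 < d by rewrite ltr_pdivrMr// mulr_natr mulr2n ltrDl.
  apply: (@real_induction _ (fun t => cdom k (c t) /\ `|z0 - (cx k c t, cw k c w t)| <= d / 2) 0 S S0).
  + by split=> //; apply: le_trans hz _; rewrite ler_pM2l// lef_pV2 ?posrE// ler_nat.
  + move=> t tI h; have /andP[t0 tS] := tI.
    have [cdt zt] := h t ltac:(by rewrite t0 lexx).
    have tI' : 0 <= t <= S by rewrite t0 ltW.
    have [e1 e10 he1] := Gsol_near G sk tI' cdt.
    pose e := Num.min e1 (S - t).
    have e0 : 0 < e by rewrite lt_min e10 subr_gt0.
    have m1 : e <= e1 by rewrite ge_min lexx.
    have m2 : e <= S - t by rewrite ge_min lexx orbT.
    have cdu y : 0 <= y <= t + e / 2 -> cdom k (c y).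
      move=> /andP[y0 y1]; have [yt|ty] := leP y t; first by have [] := h y; rewrite ?y0.
      by apply: he1; [rewrite y0/=; order_lra|rewrite ltr0_norm; order_lra].
    have u0 : 0 <= t + e / 2 by order_lra.
    have uS : t + e / 2 <= S by order_lra.
    have [ELu _] := G2 k sk 0 (t + e / 2) (lexx _) u0 uS cdu.
    have tI2 : 0 <= t <= t + e / 2 by rewrite t0/=; order_lra.
    have bt : ball z0 d (cx k c t, cw k c w t).
      by rewrite -ball_normE /ball_ /=; exact: le_lt_trans zt dd.
    have [q1 q2 _] := ELu.
    have [e2 e20 he2] := within_near (within_at (within_pair q1 q2) tI2)
      (open_nbhs_nbhs (conj (ball_open z0 d) bt)).
    pose e' := Num.min (e / 2) e2.
    have e'0 : 0 < e' by rewrite lt_min e20 divr_gt0.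
    have m3 : e' <= e / 2 by rewrite ge_min lexx.
    have m4 : e' <= e2 by rewrite ge_min lexx orbT.
    exists e' => // s /andP[s1 s2] sS.
    have sI : 0 <= s <= t + e / 2 by apply/andP; order_lra.
    split; first exact: cdu.
    have s0 : 0 <= s := le_trans t0 s1.
    apply: h1 => //; first by rewrite s0 (le_trans sS).
    have su : s <= t + e / 2 by order_lra.
    split; first exact: EL_sub (lexx _) su ELu.
    move=> y /andP[y0 ys]; have [yt|ty] := leP y t.
      have [_ zy] := h y ltac:(by rewrite y0).
      by rewrite -ball_normE /ball_ /=; exact: le_lt_trans zy dd.
    apply: he2; first by rewrite /= in_itv /= y0/=; order_lra.
    by rewrite ltr0_norm; order_lra.
  + move=> t tI h; have /andP[t0 tS] := tI.
    have tI' : 0 <= t <= S by rewrite ltW.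
    have sbz (z : V * V) : `|z0 - z| <= d / 2 -> CSn k z.
      by move=> hz'; apply: bU; rewrite -ball_normE /ball_ /=; exact: le_lt_trans hz' dd.
    (* At a limit time the curve is still in the domain of [k]: its earlier points lie in the
       compact, hence closed, set [K] inside that domain. *)
    pose K := cinv k @` [set y : V | `|z0.1 - y| <= d / 2].
    have sub1 (z : V * V) : `|z0 - z| <= d / 2 -> `|z0.1 - z.1| <= d / 2.
      by apply: le_trans; exact: norm_fstB.
    have z0i y : `|z0.1 - y| <= d / 2 -> cimg k y.
      by rewrite -norm_pair_fst => /sbz [[]].
    have cK : closed K.
      apply: compact_closed; first exact: manifold_hausdorff.
      apply: continuous_compact; last exact: compact_ball_rV.
      apply/subspace_continuousP => y /= hy; apply: cvg_within_filter.
      by apply: cinv_continuous; exact: z0i.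
    have Kt : K (c t).
      apply: (within_closed cK (ct t tI')) => e e0.
      have [y [y1 y2 y3]] := left_points t0 e0; exists y; split=> //.
        by rewrite /= in_itv /= y1 (le_trans (ltW y2)).
      have [cdy zy] := h y ltac:(by rewrite y1).
      by exists (cx k c y); [exact: sub1 zy|rewrite /cx cmapK].
    have cdt : cdom k (c t) by have [y hy <-] := Kt; apply: cinv_dom; exact: z0i.
    split; first exact: cdt.
    have cdu y : 0 <= y <= t -> cdom k (c y).
      move=> /andP[y0]; rewrite le_eqVlt => /predU1P[->//|yt].
      by have [] := h y ltac:(by rewrite y0).
    have [[q1 q2 _] _] := G2 k sk 0 t (lexx _) (ltW t0) tS cdu.
    by apply: (within_closed_norm t0 q1 q2) => y yI; have [] := h y yI.
- move=> s c w sI G st; have /andP[s0 _] := sI; exact: h2 sI (inE s c w s0 G st).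
- move=> s c1 w1 c2 w2 sI G1 st1 G2 st2; have /andP[s0 _] := sI.
  exact: h3 sI (inE s c1 w1 s0 G1 st1) (inE s c2 w2 s0 G2 st2).
- exact: h4.
Qed.

End Stay.

(** * The exponential map and the Gauss lemma *)

Section Slice.
Context (R : realType) (V W : normedModType R).

Lemma Cr_slice (U : set (V * W)) (h : V * W -> R) (y : V) : findim V -> findim W -> open U ->
  Cr None U h -> open [set w | U (y, w)] /\ Cr None [set w | U (y, w)] (fun w => h (y, w)).
Proof.
move=> fV fW oU hh.
have hs : Cr None setT (fun w : W => (y, w)).
  apply: Cr_pair; [exact: openT|move=> m; exact: Ck_cst|].
  by apply: Cr_clin; exact: clin_id.
have o : open [set w | U (y, w)].
  by apply: open_comp => // w _; exact: (Cr_continuous hs).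
split=> //.
exact: (Cr_comp o oU (findim_prod fV fW) (findim_R R) (fun w h => h) (Cr_sub (@subsetT _ _) hs) hh).
Qed.

Lemma slice_continuous_pair (y : V) (w : W) : {for w, continuous (fun w : W => (y, w))}.
Proof. by apply: cvg_pair; [exact: cvg_cst|exact: cvg_id]. Qed.

Lemma open_nonzero0 : open [set w : W | w != 0].
Proof.
have -> : [set w : W | w != 0] = (fun w => `|w|) @^-1` [set x : R | x != 0].
  by apply/seteqP; split=> w /=; rewrite normr_eq0.
by apply: open_comp; [move=> w _; exact: norm_continuous|exact: open_neq].
Qed.

Lemma slice_continuous (h : V * W -> R) y w : {for (y, w), continuous h} ->
  {for w, continuous (fun w => h (y, w))}.
Proof.
move=> hc; apply: (@continuous_comp _ _ _ (fun w => (y, w)) h) => //.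
exact: slice_continuous_pair.
Qed.

End Slice.

Section Exponential.
Context (R : realType) (n : nat) (M : manifold R n)
  (A : M -> set 'rV[R]_n) (F : M -> 'rV[R]_n -> R) (hF : conic_finsler A F)
  (hA : pointwise_convex A) (p : M) (r : R).
Implicit Types (k : chart R n M) (c : R -> M) (w : R -> 'rV[R]_n) (a b s t e : R).
Local Notation V := 'rV[R]_n.
Implicit Types (u v xi : V).
Local Notation CS := (coord_set A).
Local Notation CSn := (CSn A).
Local Notation CF := (coord_fun F).
Local Notation lag := (lag F).
Local Notation Gsol := (Gsol A F).
Local Notation B := (tangent_ball A F p r).
Local Notation f := (expmap A F p).
Local Notation kp := (chart_at p).
Local Notation yp := (cmap (chart_at p) p).

Lemma CS_p u : CS kp (yp, u) <-> A p u.
Proof.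
rewrite /coord_set /= cmapK ?of_coord_chart_at; last exact: chart_at_dom.
by split=> [[]|h] //; split=> //; apply: cmap_img; exact: chart_at_dom.
Qed.

Lemma CF_p u : CF kp (yp, u) = F p u.
Proof. by rewrite /coord_fun /= cmapK ?of_coord_chart_at//; exact: chart_at_dom. Qed.

Lemma CSn_p u : CSn kp (yp, u) <-> A p u /\ u != 0.
Proof. by split=> -[h1 h2]; split=> //; apply/CS_p. Qed.

Definition En u : R := 2^-1 * F p u ^+ 2.

Lemma Cr_En : open (A p `\ 0) /\ Cr None (A p `\ 0) (F p) /\ Cr None (A p `\ 0) En.
Proof.
have sk := chart_at_smooth p.
have fV := findim_rV R n.
have eS : [set u | CSn kp (yp, u)] = A p `\ 0.
  by apply/seteqP; split=> u /=; rewrite CSn_p => -[h1 h2]; split=> //; apply/eqP.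
have [oS h1] := Cr_slice yp fV fV (open_CSn hF sk) (Cr_coord_fun hF sk).
have [_ h2] := Cr_slice yp fV fV (open_CSn hF sk) (Cr_lag hF sk).
rewrite eS in oS h1 h2; split; [exact: oS|split].
  by apply: (Cr_eq oS) h1 => u _; rewrite CF_p.
by apply: (Cr_eq oS) h2 => u _; rewrite /En /lag CF_p.
Qed.

Lemma open_Ap : open (A p).
Proof.
have -> : A p = [set u | CS kp (yp, u)] by apply/seteqP; split=> u /=; rewrite CS_p.
apply: open_comp; last exact: (open_coord_set hF (chart_at_smooth p)).
move=> u _; apply: (@slice_continuous_pair R V V yp u).
Qed.

Lemma Fp_continuous u : A p u -> {for u, continuous (F p)}.
Proof.
move=> /CS_p h; have := slice_continuous (coord_fun_continuous hF (chart_at_smooth p) h).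
by have -> : (fun u => CF kp (yp, u)) = F p by apply/funext => x; rewrite CF_p.
Qed.

Lemma open_B : open B.
Proof.
have -> : B = A p `&` F p @^-1` [set x | x < r] by [].
by apply: open_preimage_on; [exact: open_Ap|exact: Fp_continuous|exact: open_lt].
Qed.

Lemma open_B0 : open (B `\ 0).
Proof.
have -> : B `\ 0 = B `&` [set u | u != 0].
  by apply/seteqP; split=> u [h1 h2]; split=> //; apply/eqP.
apply: openI; [exact: open_B|exact: open_nonzero0].
Qed.

Lemma Fp_scale u t : A p u -> 0 < t -> F p (t *: u) = t * F p u.
Proof. exact: (cf_homog hF). Qed.

Lemma B_scale u t : B u -> 0 < t <= 1 -> B (t *: u).
Proof.
move=> [Au Fu] /andP[t0 t1]; split; first exact: (cf_conic hF).
rewrite Fp_scale//; apply: le_lt_trans Fu.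
by rewrite ler_piMl// (cf_ge0 hF).
Qed.

Lemma Fp_gt0 u : A p u -> u != 0 -> 0 < F p u.
Proof.
move=> Au u0; rewrite lt_neqAle (cf_ge0 hF Au) andbT eq_sym.
by apply: contra_neq u0 => h; apply/(cf_eq0 hF Au).
Qed.

Lemma tv0 c : tv c 1 0 = right_velocity c 0.
Proof. by rewrite /tv ltr01. Qed.

Context (hdef : forall v, B v -> exp_defined A F p v).

Lemma exp_graphP u : B u -> exp_graph A F p u (f u).
Proof. by move=> /hdef [q hq]; exact: (xgetPex p (ex_intro (exp_graph A F p u) q hq)). Qed.

(** [expmap] picks a separate geodesic for each [t *: u]. The geodesic with velocity [u], with time
    rescaled by [t], solves the equation with initial velocity [t *: u], so uniqueness identifies
    its value at [t] with [exp_p (t u)]. *)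
Lemma ray_geodesic u : B u -> exists c, [/\ geodesic A F 0 1 c, tv c 1 0 = u &
  forall t, 0 <= t <= 1 -> c t = radial_geodesic A F p u t].
Proof.
move=> Bu; have [c [geo c0 cv c1]] := exp_graphP Bu.
exists c; rewrite tv0; split=> // t /andP[t0 t1]; rewrite /radial_geodesic.
case: eqP => [->//|/eqP tn].
have tp : 0 < t by rewrite lt_neqAle eq_sym tn.
(* A zero initial velocity lies outside [Gsol]; the geodesic is then constant. *)
have [u0|u0] := eqVneq u 0.
  have e x : 0 <= x <= 1 -> c x = c 0.
    by apply: (geodesic_cst hF hA geo); rewrite tv0 cv.
  have z1 : (0 : R) <= (1 : R) <= 1 by apply/andP; lra.
  by rewrite e ?t0// -(e 1 z1) c1 u0 scaler0.
have tI : 0 < t <= 1 by rewrite tp.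
have [c' [geo' c0' cv' c1']] := exp_graphP (B_scale Bu tI).
have G : Gsol 0 1 c (tv c 1) by apply: (geodesic_Gsol hF hA geo); rewrite tv0 cv.
have G' : Gsol 0 1 c' (tv c' 1).
  by apply: (geodesic_Gsol hF hA geo'); rewrite tv0 cv' scaler_eq0 negb_or tn.
have G2 : Gsol (t * 0) (t * 1) c (tv c 1) by apply: Gsol_sub G; rewrite ?mulr0 ?mulr1.
have G3 := Gsol_scale hF tp G2.
have z1 : (0 : R) <= (1 : R) <= 1 by apply/andP; lra.
have ec : c (t * 0) = c' 0 by rewrite mulr0 c0 c0'.
have ew : t *: tv c 1 (t * 0) = tv c' 1 0 by rewrite mulr0 !tv0 cv cv'.
have [] := Gsol_unique hF ler01 G3 G' ec ew z1.
by rewrite mulr1 => -> _.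
Qed.

(** The geodesic from [ray_geodesic] agrees with the ray on [[0, 1]] only, so the clauses of [Gsol]
    are transported pointwise. *)
Lemma ray_Gsol u : B u -> u != 0 -> exists w, [/\ Gsol 0 1 (radial_geodesic A F p u) w, w 0 = u &
  forall t, 0 <= t <= 1 -> F (radial_geodesic A F p u t) (w t) = F p u].
Proof.
move=> Bu u0; have [c [geo cv ce]] := ray_geodesic Bu.
have z0 : (0 : R) <= (0 : R) <= 1 by apply/andP; lra.
have c0 : c 0 = p by rewrite ce// /radial_geodesic eqxx.
have G : Gsol 0 1 c (tv c 1) by apply: (geodesic_Gsol hF hA geo); rewrite cv.
exists (tv c 1); split=> //.
  have [h1 h2] := G; split=> [t tI N hN|k sk s x s0 sx x1 cd].
    rewrite -ce// in hN.
    have hh : nbhs t (fun y => `[0, 1]%classic y -> N (c y)) := h1 t tI N hN.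
    have : nbhs t (fun y => `[0, 1]%classic y -> N (radial_geodesic A F p u y)).
      apply: filterS hh => y hy yI; rewrite -ce; first exact: hy.
      by move: yI; rewrite /= in_itv.
    by [].
  have I t : s <= t <= x -> 0 <= t <= 1.
    by move=> /andP[q1 q2]; rewrite (le_trans s0 q1) (le_trans q2 x1).
  have cd' t : s <= t <= x -> cdom k (c t) by move=> tI; rewrite ce ?I//; exact: cd.
  have [E C] := h2 k sk s x s0 sx x1 cd'.
  have e t : s <= t <= x -> cx k c t = cx k (radial_geodesic A F p u) t /\
      cw k c (tv c 1) t = cw k (radial_geodesic A F p u) (tv c 1) t.
    by move=> tI; apply: eq_cx => //; apply: ce; exact: I.
  split; first exact: EL_ext e E.
  by move=> t tI; have [<- <-] := e t tI; exact: C.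
by move=> t tI; rewrite -ce// (speed_const hF hA geo tI) cv c0.
Qed.

End Exponential.

(** * The Gauss lemma for a Lagrangian *)

Section GaussAbstract.
Context (R : realType).

Lemma norm_pair_snd (V : normedModType R) (y v u : V) : `|(y, v) - (y, u)| = `|v - u|.
Proof. by rewrite prod_normE /= subrr normr0; apply/max_idPr. Qed.

Lemma derive_lip (V W : normedModType R) (X : V -> W) (v xi : V) (K e : R) : differentiable X v ->
  0 < e -> (forall u, `|v - u| < e -> `|X u - X v| <= K * `|u - v|) -> `|'D_xi X v| <= K * `|xi|.
Proof.
move=> dX e0 h.
have cl : closed [set z : W | `|z| <= K * `|xi|].
  apply: (@closed_comp _ _ (fun z : W => `|z|) [set x | x <= K * `|xi|]); last exact: closed_le.
  by move=> z _; exact: norm_continuous.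
have dq : h^-1 *: ((X \o shift v) (h *: xi) - X v) @[h --> (0 : R)^'] --> 'D_xi X v.
  by have /cvg_ex [l hl] := diff_derivable (v := xi) dX; rewrite /derive (cvg_lim _ hl).
apply: (@closed_cvg _ _ _ _ (fun h : R => h^-1 *: ((X \o shift v) (h *: xi) - X v)) _ cl _ _ dq).
have ne : \forall h \near (0 : R)^', `|h| * `|xi| < e.
  apply: nbhs_dnbhs; apply/nbhs_ballP; exists (e / (`|xi| + 1)).
    by rewrite /= divr_gt0// ltr_wpDl.
  move=> x; rewrite -ball_normE /ball_ /= sub0r normrN => hx.
  have x1 : 0 < `|xi| + 1 by rewrite ltr_wpDl.
  apply: (@le_lt_trans _ _ (`|x| * (`|xi| + 1))); first by rewrite ler_wpM2l// lerDl.
  by rewrite -ltr_pdivlMr.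
have nz : \forall h \near (0 : R)^', h != 0 by exact: nbhs_dnbhs_neq.
apply: filterS2 ne nz => x hx x0 /=.
have e1 : x *: xi + v - v = x *: xi by rewrite addrK.
have := h (x *: xi + v); rewrite -normrN opprB e1 normrZ => /(_ hx) q.
rewrite normrZ normfV ler_pdivrMl ?normr_gt0//.
by rewrite mulrCA.
Qed.

Context (V : normedModType R) (fV : findim V) (U : set (V * V)) (oU : open U)
  (L : V * V -> R) (hL : Cr None U L) (E : V -> R).

(* Differentiating [L (t v, v) = E v] in [v] and using the equation of the ray,
   [t * 'D_(0, xi) L (t v, v) - t * 'D_xi E v] is constant in [t]; it vanishes as
   [t] tends to [0]. *)
Lemma gauss_abstract (v xi : V) : differentiable E v ->
  (forall t : R, 0 < t <= 1 -> U (t *: v, v)) ->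
  (\forall u \near v, forall t : R, 0 < t <= 1 -> L (t *: u, u) = E u) ->
  (forall t : R, 0 < t < 1 -> is_derive t 1 (fun s => 'D_(0, xi) L (s *: v, v)) ('D_(xi, 0) L (t *: v, v))) ->
  (exists K T : R, 0 < T /\ forall t, 0 < t <= T -> `|t * 'D_(0, xi) L (t *: v, v)| <= t * K) ->
  'D_(0, xi) L (v, v) = 'D_xi E v.
Proof.
move=> dE Uv LE EL lim.
set a := 'D_xi E v.
(* The identity [L (t u, u) = E u] differentiated at [v] along [xi]: [u] occurs as base point,
   scaled by [t], and as velocity. *)
have sumE (t : R) : 0 < t <= 1 -> t * 'D_(xi, 0) L (t *: v, v) + 'D_(0, xi) L (t *: v, v) = a.
  move=> tI; have Ut := Uv t tI; have dL := Cr_differentiable hL Ut.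
  pose S (u : V) := (t *: u, u).
  have cS : clin S by apply: clin_pair; [exact: clin_scaler|exact: clin_id].
  have := derive_compE xi (clin_differentiable v cS) dL.
  rewrite (clin_derive v xi cS) -(deriveE (S xi) dL) => h.
  have lD := derive_clin dL.
  have eS : S xi = t *: (xi, 0) + (0, xi) by rewrite pairZE pairDE scaler0 addr0 add0r.
  rewrite eS (clinD _ _ lD) (clinZ _ _ lD) in h; rewrite -[LHS]h.
  apply: near_eq_derive; apply: filterS LE => u hu; exact: hu.
pose m (t : R) := 'D_(0, xi) L (t *: v, v).
pose phi (t : R) := t * m t - t * a.
have cm (t : R) : 0 < t <= 1 -> {for t, continuous m}.
  move=> tI; have Ut := Uv t tI.
  apply: (@continuous_comp _ _ _ (fun t : R => (t *: v, v)) (fun z => 'D_(0, xi) L z)).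
    apply: cvg_pair; last exact: cvg_cst.
    by have [_] := clin_scalel v; apply.
  exact: (Cr_continuous (Cr_S (0, xi) hL) Ut).
have dphi (t : R) : 0 < t < 1 -> is_derive t 1 phi 0.
  move=> tI; have tI' : 0 < t <= 1 by case/andP: tI => -> /ltW ->.
  have dm : is_derive t 1 m ('D_(xi, 0) L (t *: v, v)) by exact: EL.
  have h1 := is_deriveM (is_derive_id t (1 : R)) dm.
  have h2 := is_deriveZ a (is_derive_id t (1 : R)).
  have := is_deriveB h1 h2.
  have -> : (id * m - a *: id) = phi by apply/funext => x; rewrite /phi /= (mulrC x a).
  move=> h; apply: is_derive_eq h _.
  have e1 : t * 'D_(xi, 0) L (t *: v, v) + m t * 1 - a * 1 = 0.
    by rewrite !mulr1 /m sumE// subrr.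
  exact: e1.
have cst (s : R) : 0 < s < 1 -> phi 1 = phi s.
  move=> /andP[s0 s1].
  apply: (@derive0_unless _ phi s 1 (ltW s1)).
  - apply/subspace_continuousP => t; rewrite /= in_itv /= => /andP[t1 t2].
    apply: cvg_within_filter.
    have tI : 0 < t <= 1 by rewrite t2 andbT (lt_le_trans s0).
    have c1 : {for t, continuous (fun t : R => t * m t)}.
      by apply: continuousM; [exact: cvg_id|exact: cm].
    have c2 : {for t, continuous (fun t : R => t * a)}.
      by apply: continuousM; [exact: cvg_id|exact: cvg_cst].
    exact: continuousB c1 c2.
  - move=> t /andP[t1 t2] _; apply: dphi; rewrite t2 andbT; exact: lt_trans s0 t1.
  - by rewrite lexx andbT ltW.
(* [phi] is controlled at positive times only. There it is constant and bounded by [s * (K + |a|)]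
   for small [s], so the constant is zero. *)
have phi1 : phi 1 = 0.
  have [K [T [T0 hK]]] := lim.
  apply/eqP; rewrite -normr_le0; apply: (@small_le _ _ (- (K + `|a|)) (Num.min T 1)).
    by rewrite lt_min T0 ltr01.
  move=> s /andP[s0]; rewrite lt_min => /andP[sT s1].
  have sI : 0 < s < 1 by rewrite s0.
  have sI' : 0 < s <= T by rewrite s0 ltW.
  have b1 : `|phi s| <= s * K + s * `|a|.
    apply: le_trans (ler_normB _ _) _; apply: lerD; first exact: hK.
    by rewrite normrM gtr0_norm.
  rewrite (cst s sI).
  have -> : s * `|phi s| + - (K + `|a|) * s ^+ 2 = s * (`|phi s| - (s * K + s * `|a|)) by ring.
  by rewrite pmulr_rle0// subr_le0.
move: phi1; rewrite /phi /m !mul1r scale1r => /eqP; rewrite subr_eq0 => /eqP.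
by [].
Qed.

(** The momentum is a covector: a fibrewise linear change of coordinates that preserves the
    Lagrangian carries fibre derivatives along. *)
Lemma fiber_derive_eq (L1 L2 : V * V -> R) (y y' : V) (S : V -> V) (w eta : V) :
  clin S -> differentiable L1 (y, w) -> differentiable L2 (y', S w) ->
  (forall w, L2 (y', S w) = L1 (y, w)) ->
  'D_(0, S eta) L2 (y', S w) = 'D_(0, eta) L1 (y, w).
Proof.
move=> cS d1 d2 h.
have d1' : differentiable L1 ((y, w) + (0 : R) *: (0, eta)) by rewrite scale0r addr0.
have d2' : differentiable L2 ((y', S w) + (0 : R) *: (0, S eta)) by rewrite scale0r addr0.
have [_ e1] := is_derive_line d1'; have [_ e2] := is_derive_line d2'.
rewrite scale0r addr0 in e1; rewrite scale0r addr0 in e2.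
rewrite -e1 -e2.
suff -> : (fun s : R => L2 ((y', S w) + s *: (0, S eta))) = (fun s : R => L1 ((y, w) + s *: (0, eta))) by [].
apply/funext => s.
rewrite !pairZE !pairDE !scaler0 !addr0 -h; congr (L2 (_, _)).
by rewrite (clinD _ _ cS) (clinZ _ _ cS).
Qed.

End GaussAbstract.

Lemma is_derive_ray (R : realType) (V : normedModType R) (u : V) (y : R) :
  is_derive y 1 (fun s : R => s *: u) u.
Proof.
have c := clin_scalel u; split.
  by apply/derivable1_diffP; exact: clin_differentiable.
by rewrite (clin_derive y (1 : R) c) scale1r.
Qed.

(** * The exponential chart *)

Section ExpChart.
Context (R : realType) (n : nat) (M : manifold R n)
  (A : M -> set 'rV[R]_n) (F : M -> 'rV[R]_n -> R) (hF : conic_finsler A F)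
  (hA : pointwise_convex A) (p : M) (r : R).
Implicit Types (k : chart R n M) (c : R -> M) (w : R -> 'rV[R]_n) (a b s t e : R).
Local Notation V := 'rV[R]_n.
Implicit Types (u v xi : V).
Local Notation CS := (coord_set A).
Local Notation CSn := (CSn A).
Local Notation CF := (coord_fun F).
Local Notation lag := (lag F).
Local Notation Gsol := (Gsol A F).
Local Notation B := (tangent_ball A F p r).
Local Notation f := (expmap A F p).
Local Notation kp := (chart_at p).
Local Notation yp := (cmap (chart_at p) p).
Local Notation ray := (radial_geodesic A F p).
Context (hdef : forall v, B v -> exp_defined A F p v).

Lemma ray0 u : ray u 0 = p. Proof. by rewrite /radial_geodesic eqxx. Qed.

Lemma rayE u t : 0 < t -> ray u t = f (t *: u).
Proof. by move=> t0; rewrite /radial_geodesic gt_eqF. Qed.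

Lemma CF_cw c w k t : smooth_chart k -> cdom k (c t) ->
  CF k (cx k c t, cw k c w t) = F (c t) (w t).
Proof. by move=> sk ct; rewrite /coord_fun /= cw_of_coord// /cx cmapK. Qed.

Lemma cx_trans k1 k2 c t : cdom k1 (c t) -> cx k2 c t = trans k1 k2 (cx k1 c t).
Proof. by move=> h1; rewrite transD /cx /= cmapK. Qed.

Lemma tdom_cx k1 k2 c t : cdom k1 (c t) -> cdom k2 (c t) -> tdom k1 k2 (cx k1 c t).
Proof. by move=> h1 h2; split; [exact: cmap_img|rewrite /preimage /= /cx cmapK]. Qed.

Lemma cw_trans k1 k2 c w t : smooth_chart k1 -> smooth_chart k2 -> cdom k1 (c t) ->
  cdom k2 (c t) -> cw k2 c w t = dtr k1 k2 (cx k1 c t) (cw k1 c w t).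
Proof.
move=> s1 s2 h1 h2; rewrite /cw (cx_trans k1 (chart_at_dom (c t))).
by rewrite -(dtr_comp _ (chart_at_smooth (c t)) s1 s2 (tdom_cx (chart_at_dom (c t)) h1)
  (tdom_cx (chart_at_dom (c t)) h2)).
Qed.

(** All rays with velocity near [v] start at [p] and stay in one chart for a common time [T].
    Uniformly in [u], then, [exp_p (t u)] is [yp + t u] up to order [t ^+ 2] and is Lipschitz in [u]
    with a constant of order [t]. These bounds stand in for a differential of [exp_p] at the
    origin. *)
Lemma ray_stay v : B v -> v != 0 -> exists d T C : R, [/\ 0 < d, 0 < T <= 1, 0 < C,
  (forall u, `|v - u| <= d -> B u /\ u != 0) &
  [/\ forall t u, 0 < t <= T -> `|v - u| <= d ->
        cdom kp (f (t *: u)) /\ `|cmap kp (f (t *: u)) - yp - t *: u| <= C * t ^+ 2,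
      forall t u u', 0 < t <= T -> `|v - u| <= d -> `|v - u'| <= d ->
        `|cmap kp (f (t *: u)) - cmap kp (f (t *: u'))| <= C * t * `|u - u'| &
      forall w t (ze : V * V), 0 < t <= T -> Gsol 0 1 (ray v) w -> w 0 = v ->
        `|'D_ze (lag kp) (cx kp (ray v) t, cw kp (ray v) w t)| <= C * `|ze|]].
Proof.
move=> Bv v0; have sk := chart_at_smooth p.
have Cz : CSn kp (yp, v) by apply/CSn_p; split=> //; case: Bv.
have [d [T [C [d0 T0 C0 bU [h1 h2 h3 h4]]]]] := Gsol_stay hF sk Cz.
have B0v : (B `\ 0) v by split=> //; apply/eqP.
have /nbhs_ballP[d' d'0 hd'] := open_nbhs_nbhs (conj (@open_B0 _ _ _ _ _ hF p r) B0v).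
(* [d / 4] is the tolerance on initial data in [Gsol_stay]; [d'] keeps the velocities nonzero and
   inside the ball. *)
pose dd := Num.min (d / 4) (d' / 2).
have dd0 : 0 < dd by rewrite lt_min !divr_gt0.
have [m1 m2] : dd <= d / 4 /\ dd <= d' / 2 by rewrite /dd !ge_min !lexx orbT.
pose T' := Num.min T 1.
have T'0 : 0 < T' by rewrite lt_min T0 ltr01.
have [t1 t2] : T' <= T /\ T' <= 1 by rewrite /T' !ge_min !lexx orbT.
have nb u : `|v - u| <= dd -> B u /\ u != 0.
  move=> hu; have [|Bu u0] := hd' u.
    by rewrite -ball_normE /ball_ /=; apply: le_lt_trans hu _; lra.
  by split=> //; apply/eqP.
have start u w : w 0 = u -> cx kp (ray u) 0 = yp /\ cw kp (ray u) w 0 = u.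
  by move=> w0; rewrite /cx /cw ray0 w0 dtr_id//; apply: cmap_img; exact: chart_at_dom.
have st u w t : `|v - u| <= dd -> 0 < t <= T' -> Gsol 0 1 (ray u) w -> w 0 = u ->
    Gsol 0 t (ray u) w /\ stays kp (yp, v) d t (ray u) w.
  move=> hu /andP[tp tT] G w0.
  have tI : 0 <= t <= T by rewrite (ltW tp) (le_trans tT).
  have G' : Gsol 0 t (ray u) w by apply: Gsol_sub G => //; exact: le_trans tT t2.
  split=> //; apply: h1 => //; first by rewrite ray0; exact: chart_at_dom.
  have [-> ->] := start u w w0.
  by rewrite norm_pair_snd; exact: le_trans hu m1.
exists dd, T', C; split=> //; first by rewrite T'0.
split.
- move=> t u tI hu; have [Bu u0] := nb u hu.
  have [w [G w0 _]] := ray_Gsol hF hA hdef Bu u0.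
  have [G' S] := st u w t hu tI G w0.
  have /andP[tp tT] := tI.
  have tI' : 0 <= t <= t by rewrite lexx ltW.
  have [cd _] := S t tI'.
  have := h2 t (ray u) w _ G' S; have [-> ->] := start u w w0.
  rewrite /cx rayE//; rewrite rayE// in cd; split=> //.
  by have := h2 t (ray u) w; have [-> ->] := start u w w0; rewrite /cx rayE//; apply=> //;
    rewrite (ltW tp) (le_trans tT).
- move=> t u u' tI hu hu'; have [Bu u0] := nb u hu; have [Bu' u0'] := nb u' hu'.
  have [w [G w0 _]] := ray_Gsol hF hA hdef Bu u0.
  have [w' [G' w0' _]] := ray_Gsol hF hA hdef Bu' u0'.
  have [H S] := st u w t hu tI G w0; have [H' S'] := st u' w' t hu' tI G' w0'.
  have /andP[tp tT] := tI.
  have tI' : 0 <= t <= T by rewrite (ltW tp) (le_trans tT).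
  have := h3 t (ray u) w (ray u') w' tI' H S H' S'.
  have [-> ->] := start u w w0; have [-> ->] := start u' w' w0'.
  by rewrite /cx !rayE//; apply.
- move=> w t ze tI G w0; apply: h4.
  have hv : `|v - v| <= dd by rewrite subrr normr0 ltW.
  have [_ S] := st v w t hv tI G w0.
  by have [] := S t; rewrite ?lexx ?andbT//; case/andP: tI => /ltW.
Qed.

Context (g : M -> V) (oI : open (f @` B)) (gf : forall v, B v -> g (f v) = v)
  (g1 : Cr_from (Some 1%N) (f @` B) g) (fs : Cr_map None (B `\ 0) f)
  (gs : Cr_from None (f @` (B `\ 0)) g).

Lemma g_continuous (x : M) : (f @` B) x -> {for x, continuous g}.
Proof.
move=> Ix; have cd := chart_at_dom x; set k := chart_at x in cd.
have := g1 (chart_at_atlas x); rewrite -/k /= => -[dg _].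
have dgx : differentiable (g \o cinv k) (cmap k x).
  apply: dg; split; first exact: cmap_img.
  by rewrite /preimage /= cmapK.
have c1 : {for x, continuous ((g \o cinv k) \o cmap k)}.
  apply: (@continuous_comp _ _ _ (cmap k) (g \o cinv k)); first exact: cmap_continuous.
  exact: differentiable_continuous.
move=> N hN; rewrite -[g x](_ : ((g \o cinv k) \o cmap k) x = _) in hN; last by rewrite /= cmapK.
have := c1 N hN.
have nd := open_nbhs_nbhs (conj (open_cdom k) cd).
move=> h; have h' : nbhs x (fun y => N (((g \o cinv k) \o cmap k) y)) := h.
have : nbhs x (fun y => N (g y)).
  by apply: filterS2 nd h' => y cy /=; rewrite cmapK.
by [].
Qed.

Lemma image_B0 : f @` (B `\ 0) = f @` B `&` g @^-1` [set u | u != 0].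
Proof.
apply/seteqP; split=> [x [u [Bu u0] <-]|x [[u Bu <-]]].
  by split; [exists u|rewrite /preimage /= gf//; apply/eqP].
by rewrite /preimage /= gf// => /eqP u0; exists u.
Qed.

Lemma open_image_B0 : open (f @` (B `\ 0)).
Proof. by rewrite image_B0; apply: open_preimage_on; [exact: oI|exact: g_continuous|exact: open_nonzero0]. Qed.

Lemma f_continuous v : (B `\ 0) v -> {for v, continuous f}.
Proof.
move=> Bv; have sk := chart_at_smooth (f v).
have h := locrep_continuous (Cr_map_locrep sk fs Bv (chart_at_dom (f v))) Bv.
move=> N hN; have := h N hN => h'.
have h2 : nbhs v (fun y => (B `\ 0) y -> N (f y)) := h'.
have : nbhs v (fun y => N (f y)).
  by apply: filterS2 (open_nbhs_nbhs (conj (@open_B0 _ _ _ _ _ hF p r) Bv)) h2 => y By; apply.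
by [].
Qed.

Lemma f_img u : (B `\ 0) u -> (f @` (B `\ 0)) (f u). Proof. by exists u. Qed.
Lemma g_img x : (f @` (B `\ 0)) x -> (B `\ 0) (g x).
Proof. by move=> [u [Bu u0] <-]; rewrite gf. Qed.
Lemma gK x : (f @` (B `\ 0)) x -> f (g x) = x.
Proof. by move=> [u [Bu u0] <-]; rewrite gf. Qed.
Lemma fK u : (B `\ 0) u -> g (f u) = u. Proof. by move=> [Bu _]; exact: gf. Qed.
Lemma g_continuous0 x : (f @` (B `\ 0)) x -> {for x, continuous g}.
Proof. by move=> [u [Bu _] <-]; apply: g_continuous; exists u. Qed.

(** Restricted to images of nonzero vectors, where [exp_p] and its inverse are both smooth. *)
Definition exp_chart : chart R n M :=
  Chart open_image_B0 (@open_B0 _ _ _ _ _ hF p r) g_img f_img gK fK g_continuous0 f_continuous.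

Lemma exp_chart_smooth : smooth_chart exp_chart.
Proof.
move=> c ac; have sc := atlas_smooth_chart ac; split; last by rewrite transD; exact: gs.
apply: Cr_at => y [By cy].
have [W [h [oW Wy hh hi hE]]] := Cr_map_locrep sc fs By cy.
have oW' : open (W `&` (B `\ 0)) by apply: openI => //; exact: open_B0.
exists (W `&` (B `\ 0)); first by split.
have hh' : Cr None (W `&` (B `\ 0)) h by apply: Cr_sub hh => z [].
apply: (Cr_eq oW') hh' => z [Wz Bz].
by rewrite transD /= hE// cinvK//; exact: hi.
Qed.

Local Notation ec := exp_chart.
Local Notation se := exp_chart_smooth.

Lemma B0_scale u t : (B `\ 0) u -> 0 < t <= 1 -> (B `\ 0) (t *: u).
Proof.
move=> [Bu u0] tI; split; first exact: (B_scale hF).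
move=> /eqP; rewrite scaler_eq0 => /orP[/eqP t0|/eqP//].
by case/andP: tI; rewrite t0 ltxx.
Qed.

Lemma ray_dom u t : (B `\ 0) u -> 0 < t <= 1 -> cdom ec (ray u t) /\ cx ec (ray u) t = t *: u.
Proof.
move=> Bu tI; have Btu := B0_scale Bu tI; have /andP[t0 _] := tI.
by rewrite /cx rayE//; split; [exact: f_img|exact: fK].
Qed.

(** The position in this chart is [t *: u]. The equation on [[t / 2, t]] gives the derivative before
    [t], and continuity gives it at [t], so that [t = 1] is included. *)
Lemma ray_cw u w t : (B `\ 0) u -> Gsol 0 1 (ray u) w -> 0 < t <= 1 -> cw ec (ray u) w t = u.
Proof.
move=> Bu [G1 G2] tI; have /andP[t0 t1] := tI.
have s0 : 0 < t / 2 by rewrite divr_gt0.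
have st : t / 2 < t by rewrite ltr_pdivrMr// mulr_natr mulr2n ltrDl.
have cd y : t / 2 <= y <= t -> 0 < y <= 1.
  by move=> /andP[y1 y2]; rewrite (lt_le_trans s0 y1) (le_trans y2).
have [[q1 q2 q3] _] := G2 ec se (t / 2) t (ltW s0) (ltW st) t1 (fun y yI => (ray_dom Bu (cd y yI)).1).
have inn y : t / 2 < y < t -> cw ec (ray u) w y = u.
  move=> yI; have [[_ d1] _] := q3 y yI.
  have d2 := is_derive_ray u y.
  have /andP[y1 y2] := yI.
  have nr : \forall s \near y, s *: u = cx ec (ray u) s.
    have : `]t / 2, t[%classic y by rewrite /= in_itv.
    move=> /(conj (@interval_open _ (BRight (t / 2)) (BLeft t) isT isT)) /open_nbhs_nbhs.
    apply: filterS => s; rewrite /= in_itv /= => /andP[s1 s2].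
    have sI : 0 < s <= 1 by apply: cd; rewrite !ltW.
    by have [_ h] := ray_dom Bu sI; exact: esym h.
  by have [_ d3] := near_eq_is_derive nr d2; exact: etrans (esym d1) d3.
have tI2 : t / 2 <= t <= t by rewrite lexx ltW.
apply: (@within_unique _ _ (cw ec (ray u) w) (cst u) `[t / 2, t]%classic t (@norm_hausdorff _ _)).
- exact: within_at q2 tI2.
- exact: cvg_cst.
have st' : 3 / 4 * t < t by lra.
move=> d d0; have [y [y1 y2 y3]] := left_points st' d0.
have yI : t / 2 < y < t by rewrite y2 andbT; lra.
exists y; split=> //; last exact: inn.
by rewrite /= in_itv /= (ltW y2) andbT; case/andP: yI => /ltW.
Qed.

Lemma lag_ray u t : (B `\ 0) u -> 0 < t <= 1 -> CSn ec (t *: u, u) /\ CF ec (t *: u, u) = F p u.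
Proof.
move=> Bu tI; have [Bu' /eqP u0] := Bu; have /andP[t0 t1] := tI.
have [w [G w0 Fw]] := ray_Gsol hF hA hdef Bu' u0.
have [cd cxe] := ray_dom Bu tI; have cwe := ray_cw Bu G tI.
have [_ G2] := G.
have cdd y : t <= y <= t -> cdom ec (ray u y).
  by move=> /andP[y1 y2]; have -> : y = t by apply/le_anti; rewrite y2 y1.
have [_ C] := G2 ec se t t (ltW t0) (lexx t) t1 cdd.
have tI0 : 0 <= t <= 1 by rewrite t1 ltW.
have tt : t <= t <= t by rewrite lexx.
rewrite -(Fw t tI0) -(CF_cw w se cd) cxe cwe; split=> //.
by have := C t tt; rewrite cxe cwe.
Qed.

Lemma ray_EL u t xi : (B `\ 0) u -> 0 < t < 1 ->
  is_derive t 1 (fun s => 'D_(0, xi) (lag ec) (s *: u, u)) ('D_(xi, 0) (lag ec) (t *: u, u)).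
Proof.
move=> Bu tI; have [Bu' /eqP u0] := Bu; have /andP[t0 t1] := tI.
have [w [G w0 Fw]] := ray_Gsol hF hA hdef Bu' u0.
have [_ G2] := G.
have cd y : t / 2 <= y <= 1 -> 0 < y <= 1.
  by move=> /andP[y1 y2]; rewrite y2 andbT (lt_le_trans _ y1)// divr_gt0.
have s0 : 0 <= t / 2 by rewrite divr_ge0// ltW.
have s1 : t / 2 <= 1 by lra.
have [[_ _ q3] _] := G2 ec se (t / 2) 1 s0 s1 (lexx 1) (fun y yI => (ray_dom Bu (cd y yI)).1).
have tI2 : t / 2 < t < 1 by rewrite t1 andbT ltr_pdivrMr// mulr_natr mulr2n ltrDl.
have [_ h] := q3 t tI2.
have eq y : 0 < y <= 1 -> cx ec (ray u) y = y *: u /\ cw ec (ray u) w y = u.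
  by move=> yI; split; [have [] := ray_dom Bu yI|exact: ray_cw Bu G yI].
have tI3 : 0 < t <= 1 by rewrite t0 ltW.
have [e1 e2] := eq t tI3; have := h xi; rewrite e1 e2.
apply: near_eq_is_derive.
have : `]0, 1[%classic t by rewrite /= in_itv.
move=> /(conj (@interval_open _ (BRight 0) (BLeft 1) isT isT)) /open_nbhs_nbhs.
apply: filterS => s; rewrite /= in_itv /= => /andP[s2 s3].
have sI : 0 < s <= 1 by rewrite s2 ltW.
have [q1 q2] := eq s sI.
exact: (f_equal2 (fun x1 x2 : V => 'D_(0, xi) (lag ec) (x1, x2)) q1 q2).
Qed.

Lemma lag_trans k1 k2 y (w : V) : smooth_chart k1 -> smooth_chart k2 -> tdom k1 k2 y ->
  lag k2 (trans k1 k2 y, dtr k1 k2 y w) = lag k1 (y, w).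
Proof.
move=> s1 s2 td; rewrite /lag; congr (_ * _ ^+ 2).
exact: (@coord_fun_trans _ _ _ F k1 k2 (y, w) s1 s2 td).
Qed.

Lemma CSn_trans k1 k2 y (w : V) : smooth_chart k1 -> smooth_chart k2 -> tdom k1 k2 y ->
  CSn k1 (y, w) -> CSn k2 (trans k1 k2 y, dtr k1 k2 y w).
Proof.
move=> s1 s2 td [h1 h2]; split.
  exact: ((@coord_set_trans _ _ _ A k1 k2 (y, w) s1 s2 td).2 h1).
by rewrite /= dtr_eq0.
Qed.

(** [t] times the momentum on [xi] is the momentum on [t *: xi]. In the chart at [p] the momentum of
    the ray stays bounded, and [t *: xi] becomes the derivative of [u |-> exp_p (t u)] along [xi],
    of order [t] by the Lipschitz bound. *)
Lemma ray_limit v xi : (B `\ 0) v -> exists K T : R, 0 < T /\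
  forall t, 0 < t <= T -> `|t * 'D_(0, xi) (lag ec) (t *: v, v)| <= t * K.
Proof.
move=> Bv; have [Bv' /eqP v0] := Bv; have sk := chart_at_smooth p.
have [d [T [C [d0 /andP[T0 T1] C0 nb [h1 h2 h3]]]]] := ray_stay Bv' v0.
have [w [G w0 Fw]] := ray_Gsol hF hA hdef Bv' v0.
exists (C * (C * `|xi|)), T; split=> // t tI; have /andP[t0 tT] := tI.
have tI1 : 0 < t <= 1 by rewrite t0 (le_trans tT).
have hv : `|v - v| <= d by rewrite subrr normr0 ltW.
have [cdk _] := h1 t v tI hv; rewrite -rayE// in cdk.
have [cde cxe] := ray_dom Bv tI1; have cwe := ray_cw Bv G tI1.
have td : tdom ec kp (t *: v) by rewrite -cxe; exact: tdom_cx.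
have cS := dtr_clin se sk td.
have [Cn _] := lag_ray Bv tI1.
have d1 := Cr_differentiable (Cr_lag hF se) Cn.
have d2 := Cr_differentiable (Cr_lag hF sk) (CSn_trans se sk td Cn).
have key := fiber_derive_eq (t *: xi) cS d1 d2 (fun x => lag_trans x se sk td).
have lD := derive_clin d1.
have e0 : (0, t *: xi) = t *: (0, xi) :> V * V by rewrite pairZE scaler0.
have e1 : 'D_(0, t *: xi) (lag ec) (t *: v, v) = t * 'D_(0, xi) (lag ec) (t *: v, v).
  by rewrite e0; exact: (clinZ t (0, xi) lD).
rewrite -e1 -key.
have -> : trans ec kp (t *: v) = cx kp (ray v) t by rewrite (cx_trans kp cde) cxe.
have -> : dtr ec kp (t *: v) v = cw kp (ray v) w t by rewrite (cw_trans w se sk cde cdk) cxe cwe.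
apply: le_trans (h3 w t _ tI G w0) _.
rewrite normZ0.
have bS : `|dtr ec kp (t *: v) (t *: xi)| <= C * t * `|xi|.
  have dT := trans_differentiable se sk td.
  have dl := clin_differentiable v (clin_scaler V t).
  have eX := derive_compE xi dl dT.
  rewrite (clin_derive v xi (clin_scaler V t)) -(deriveE (t *: xi) dT) -dtrD in eX.
  have dX : differentiable (fun y : V => trans ec kp (t *: y)) v := differentiable_comp dl dT.
  rewrite -eX; apply: (@derive_lip _ V V (fun y : V => trans ec kp (t *: y)) v xi (C * t) d dX d0) => u hu.
  by rewrite !transD /=; apply: h2 => //; exact: ltW.
apply: (@le_trans _ _ (C * (C * t * `|xi|))); first by rewrite ler_wpM2l// ltW.
by rewrite le_eqVlt; apply/orP; left; apply/eqP; ring.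
Qed.

Lemma gauss v xi : (B `\ 0) v -> 'D_(0, xi) (lag ec) (v, v) = 'D_xi (En F p) v.
Proof.
move=> Bv; have [oA [_ hE]] := Cr_En hF p.
have BA u : (B `\ 0) u -> (A p `\ 0) u by move=> [[h _] h2].
apply: (@gauss_abstract _ V (CSn ec) (lag ec) (Cr_lag hF se) (En F p) v xi).
- exact: Cr_differentiable hE (BA _ Bv).
- by move=> t tI; have [] := lag_ray Bv tI.
- apply: filterS (open_nbhs_nbhs (conj (@open_B0 _ _ _ _ _ hF p r) Bv)) => u Bu t tI.
  by have [_ h] := lag_ray Bu tI; rewrite /lag /En h.
- by move=> t tI; exact: ray_EL.
- exact: ray_limit.
Qed.

End ExpChart.

(** * Lengths of competitors *)

Lemma within_comp_at (R : realType) (T U : topologicalType) (c : R -> T) (g : T -> U) (D : set R) (t : R) (x : T) :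
  c y @[y --> within D (nbhs t)] --> x -> {for x, continuous g} ->
  g (c y) @[y --> within D (nbhs t)] --> g x.
Proof. by move=> h1 h2; exact: (@cvg_comp _ _ _ c g (within D (nbhs t)) (nbhs x) (nbhs (g x)) h1 h2). Qed.

Lemma half_sqr_derive (R : realType) (l : R -> R) (t l' : R) : is_derive t 1 l l' ->
  is_derive t 1 (fun s => 2^-1 * l s ^+ 2) (l t * l').
Proof.
move=> d; have := is_deriveZ 2^-1 (is_deriveM d d).
have -> : 2^-1 \*: (l * l) = (fun s => 2^-1 * l s ^+ 2).
  by apply/funext => s; rewrite expr2.
by move/is_derive_eq; apply; rewrite -![_ *: _]/(_ * _); field.
Qed.

Lemma is_derive_comp_fun (R : realType) (V : normedModType R) (G : V -> R) (y : R -> V) (t : R) (y' : V) :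
  is_derive t 1 y y' -> differentiable G (y t) -> is_derive t 1 (fun s => G (y s)) ('D_y' G (y t)).
Proof. by move=> d dG; exact: (is_derive_comp d dG). Qed.

(* Real induction along the segment from [X v1] to [Y]: the set of points reached
   is open by local solvability and closed by compactness. *)
Lemma local_surjectivity (R : realType) (V : normedModType R) (X : V -> V) (v1 y0 Y : V) (d s : R) :
  compact [set u : V | `|v1 - u| <= d / 2] -> 0 < d -> 0 < s ->
  (forall u, `|v1 - u| <= d -> {for u, continuous X}) ->
  (forall u, `|v1 - u| <= d / 2 -> exists2 e, 0 < e & forall y, `|X u - y| < e ->
     exists2 u', `|u - u'| < d / 2 & X u' = y) ->
  (forall u, `|v1 - u| <= d -> `|X u - y0 - s *: u| <= s * (d / 4)) ->
  `|Y - y0 - s *: v1| <= s * (d / 4) ->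
  exists2 u, `|v1 - u| <= d & X u = Y.
Proof.
move=> cK d0 s0 cX oX bX bY.
have dd : d / 2 <= d by lra.
have v1d : `|v1 - v1| <= d / 2 by rewrite subrr normr0 divr_ge0// ltW.
pose y (l : R) := X v1 + l *: (Y - X v1).
(* A solution within [d] of [v1] is within [d / 2]: [X u - y0] is [s *: u] up to [s * (d / 4)], and
   [y l - y0] is [s *: v1] up to the same error, by convexity in [l]. *)
have near_v1 (l : R) (u : V) : 0 <= l <= 1 -> `|v1 - u| <= d -> X u = y l -> `|v1 - u| <= d / 2.
  move=> /andP[l0 l1] ud e.
  have h1 := bX u ud; have h2 := bX v1 (le_trans v1d dd).
  have e2 : s *: (v1 - u) = (X u - y0 - s *: u) -
      ((1 - l) *: (X v1 - y0 - s *: v1) + l *: (Y - y0 - s *: v1)).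
    have -> : (1 - l) *: (X v1 - y0 - s *: v1) + l *: (Y - y0 - s *: v1) = y l - y0 - s *: v1.
      rewrite /y scalerBl scale1r [_ - _ + _]addrAC -addrA -scalerBr.
      have -> : Y - y0 - s *: v1 - (X v1 - y0 - s *: v1) = Y - X v1.
        by rewrite !opprB addrA subrK addrA subrK.
      by rewrite addrC !addrA [_ *: _ + X v1]addrC.
    rewrite e scalerBr.
    have g3 (a b c : V) : b - c = (a - c) - (a - b) by rewrite opprB [RHS]addrC subrKA.
    exact: g3.
  have e3 : `|s *: (v1 - u)| <= s * (d / 2).
    rewrite e2; apply: le_trans (ler_normB _ _) _.
    have -> : s * (d / 2) = s * (d / 4) + ((1 - l) * (s * (d / 4)) + l * (s * (d / 4))) by field.
    apply: lerD => //; apply: le_trans (ler_normD _ _) _; apply: lerD.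
      by rewrite normrZ ger0_norm ?subr_ge0// ler_wpM2l// subr_ge0.
    by rewrite normrZ ger0_norm// ler_wpM2l.
  by move: e3; rewrite normrZ gtr0_norm// ler_pM2l.
suff H (l : R) : 0 <= l <= 1 -> exists2 u, `|v1 - u| <= d / 2 & X u = y l.
  have [|u u1 u2] := H 1; first by rewrite ler01 lexx.
  exists u; first exact: le_trans dd.
  by rewrite u2 /y scale1r addrC subrK.
move: l; apply: (@real_induction _ (fun l => exists2 u, `|v1 - u| <= d / 2 & X u = y l) 0 1 ler01).
- by exists v1 => //; rewrite /y scale0r addr0.
- move=> l /andP[l0 l1] h; have [|u ud Xu] := h l; first by rewrite l0 lexx.
  have [e e0 he] := oX u ud.
  pose N := `|Y - X v1| + 1; have N0 : 0 < N by rewrite ltr_wpDl.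
  exists (e / N); first by rewrite divr_gt0.
  move=> l' /andP[ll' l'e] l'1.
  have [|u' uu' Xu'] := he (y l').
    have -> : X u - y l' = (l - l') *: (Y - X v1).
      by rewrite Xu /y opprD addrACA subrr add0r -scalerBl.
    rewrite normrZ ler0_norm ?subr_le0// opprB.
    apply: (@le_lt_trans _ _ ((l' - l) * N)); first by rewrite ler_wpM2l ?subr_ge0// lerDl.
    by rewrite -ltr_pdivlMr// ltrBlDl.
  exists u' => //; apply: (near_v1 l') => //; first by rewrite (le_trans l0 ll').
  have -> : v1 - u' = (v1 - u) + (u - u') by rewrite addrA subrK.
  by apply: le_trans (ler_normD _ _) _; move: uu' ud; clear; lra.
- move=> l /andP[l0 l1] h.
  have cl : closed (X @` [set u : V | `|v1 - u| <= d / 2]).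
    apply: compact_closed; first exact: norm_hausdorff.
    apply: continuous_compact cK; apply/subspace_continuousP => u /= ud.
    by apply: cvg_within_filter; apply: cX; exact: le_trans dd.
  have cy : {for l, continuous y}.
    have [_ c1] := clin_scalel (Y - X v1).
    by apply: (@continuousD _ _ _ (cst (X v1)) (fun l : R => l *: (Y - X v1))); [exact: cvg_cst|exact: c1].
  have : (X @` [set u : V | `|v1 - u| <= d / 2]) (y l).
    apply: (@within_closed _ _ y `[0, l]%classic _ l cl); first exact: cvg_within_filter.
    move=> e e0; have [x [x1 x2 x3]] := left_points l0 e0; exists x; split=> //.
      by rewrite /= in_itv /= x1 ltW.
    by have [|u ud Xu] := h x; [rewrite x1|exists u].
  by move=> [u ud Xu]; exists u.
Qed.

Section Length.
Context (R : realType) (n : nat) (M : manifold R n)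
  (A : M -> set 'rV[R]_n) (F : M -> 'rV[R]_n -> R) (hF : conic_finsler A F)
  (hA : pointwise_convex A) (p : M) (r : R).
Implicit Types (k : chart R n M) (c : R -> M) (a b s t e : R).
Local Notation V := 'rV[R]_n.
Implicit Types (u v w xi : V).
Local Notation CS := (coord_set A).
Local Notation CSn := (CSn A).
Local Notation CF := (coord_fun F).
Local Notation lag := (lag F).
Local Notation B := (tangent_ball A F p r).
Local Notation f := (expmap A F p).
Local Notation kp := (chart_at p).
Local Notation yp := (cmap (chart_at p) p).
Local Notation ray := (radial_geodesic A F p).
Context (hdef : forall v, B v -> exp_defined A F p v)
  (g : M -> V) (oI : open (f @` B)) (gf : forall v, B v -> g (f v) = v)
  (g1 : Cr_from (Some 1%N) (f @` B) g) (fs : Cr_map None (B `\ 0) f)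
  (gs : Cr_from None (f @` (B `\ 0)) g).
Local Notation ec := (exp_chart hF oI gf g1 fs).
Local Notation se := (exp_chart_smooth hF oI gf g1 fs gs).

(** The Gauss lemma makes the momentum at [w] equal to the differential of [En], that is
    [F p w * 'D_xi (F p) w]; the fundamental inequality is then divided by [F p w]. *)
Lemma speed_lower w xi : (B `\ 0) w -> CS ec (w, xi) ->
  'D_xi (F p) w <= CF ec (w, xi) /\ ('D_xi (F p) w = CF ec (w, xi) -> exists2 l : R, 0 <= l & xi = l *: w).
Proof.
move=> Bw Cx; have [[Aw _] /eqP w0] := Bw.
have [_ [hFp hE]] := Cr_En hF p.
have Aw0 : (A p `\ 0) w by split=> //; exact/eqP.
have o1 : (0 : R) < (1 : R) <= 1 by rewrite ltr01 lexx.
have [Cn Fw] := lag_ray hF hA hdef oI gf g1 fs gs Bw o1.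
rewrite scale1r in Cn Fw.
have dF := Cr_differentiable hFp Aw0.
have Fw0 : 0 < F p w by exact: (Fp_gt0 hF).
have dE : 'D_xi (En F p) w = F p w * 'D_xi (F p) w.
  have lE : is_derive (0 : R) 1 (fun s : R => F p (w + s *: xi)) ('D_xi (F p) w).
    have dF' : differentiable (F p) (w + (0 : R) *: xi) by rewrite scale0r addr0.
    by have := is_derive_line dF'; rewrite scale0r addr0.
  have dEn := Cr_differentiable hE Aw0.
  have lE2 : is_derive (0 : R) 1 (fun s : R => En F p (w + s *: xi)) ('D_xi (En F p) w).
    have dE' : differentiable (En F p) (w + (0 : R) *: xi) by rewrite scale0r addr0.
    by have := is_derive_line dE'; rewrite scale0r addr0.
  have [_ h3] := half_sqr_derive lE; have [_ h4] := lE2.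
  by have := etrans (esym h4) h3; rewrite scale0r addr0.
have [f1 f2] := CS_fundamental hF hA se Cn Cx.
rewrite (gauss hF hA hdef oI gf g1 fs gs xi Bw) dE Fw in f1 f2.
split; first by rewrite ler_pM2l in f1.
by move=> e; apply: f2; rewrite e.
Qed.

Section Curve.
Context (c : R -> M) (a b : R) (ab : a < b) (pc : piecewise (apiece A c) a b)
  (t0 : R) (at0 : a <= t0) (t0b : t0 < b)
  (ct : forall t, t0 < t <= b -> (f @` (B `\ 0)) (c t)).
Local Notation h := (fun t => F p (g (c t))).

Lemma g_ct t : t0 < t <= b -> (B `\ 0) (g (c t)).
Proof. by move=> /ct; exact: g_img. Qed.

Lemma curve_continuous t1 : t0 < t1 -> t1 <= b -> {within `[t1, b], continuous (fun t => g (c t))} /\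
  {within `[t1, b], continuous h}.
Proof.
move=> t01 t1b.
have hg t : t1 <= t <= b -> (g (c y)) @[y --> within `[t1, b]%classic (nbhs t)] --> g (c t).
  move=> /andP[h1 h2].
  have tI : t0 < t <= b by rewrite h2 (lt_le_trans t01).
  have tI' : a <= t <= b by rewrite h2 andbT; apply: le_trans at0 (ltW _); case/andP: tI.
  have cc := apiece_continuous pc tI'.
  have gc := g_continuous0 g1 (ct tI).
  apply: cvg_trans (within_comp_at cc gc); apply: cvg_fmap2; apply: within_subset.
  by apply: subset_seg => //; apply: le_trans at0 (ltW t01).
split; apply/subspace_continuousP => t; rewrite /= in_itv /= => tI; first exact: hg.
have tI' : t0 < t <= b by case/andP: tI => h1 h2; rewrite h2 (lt_le_trans t01).
have [[Aw _] _] := g_ct tI'.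
exact: (within_comp_at (hg t tI) (Fp_continuous hF Aw)).
Qed.

Lemma curve_derive (t s u : R) : a <= s -> s < t -> t < u -> u <= b -> t0 < t ->
  apiece A c `[s, u]%classic -> exists xi, [/\ is_derive t 1 (fun t => g (c t)) xi,
    is_derive t 1 h ('D_xi (F p) (g (c t))), CS ec (g (c t), xi) & speed F c t = CF ec (g (c t), xi)].
Proof.
move=> as_ st tu ub t0t ap.
have tI : t0 < t <= b by rewrite t0t ltW// (lt_le_trans tu).
have cdt : cdom ec (c t) := ct tI.
have tS : `[s, u]%classic t by rewrite /= in_itv /= !ltW.
have [W [gr [oW Wt hgr cg eg]]] := ap t tS ec se cdt.
have e1 y : s <= y <= u -> W y -> c y = f (gr y).
  by move=> yI Wy; apply: eg => //; rewrite /= in_itv.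
have e2 y : s <= y <= u -> W y -> g (c y) = gr y.
  by move=> yI Wy; rewrite e1// gf//; have [[]] := cg y Wy.
have st' : s <= t <= u by rewrite !ltW.
have nr : \forall y \near t, gr y = g (c y).
  have : nbhs t (W `&` `]s, u[%classic).
    apply: filterI; first exact: open_nbhs_nbhs.
    by apply: open_nbhs_nbhs; split; [exact: interval_open|rewrite /= in_itv /= st].
  by apply: filterS => y [Wy]; rewrite /= in_itv /= => /andP[q1 q2]; rewrite e2// !ltW.
have [d1 _] := is_derive_jet Wt hgr.
have Ct := cg t Wt; have et := e2 t st' Wt.
have d2 := near_eq_is_derive nr d1.
have [[Aw _] w0] := g_ct tI.
have [_ [hFp _]] := Cr_En hF p.
have dFp := Cr_differentiable hFp (conj Aw w0).
exists ('D_1 gr t); split.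
- exact: d2.
- exact: is_derive_comp_fun d2 dFp.
- by rewrite et; exact: Ct.
- have stu : s < t < u by rewrite st.
  have [ig _] := Ct.
  rewrite et; apply: (rep_speed F se oW Wt stu (Cr_differentiable hgr Wt) ig).
  by move=> y yI Wy; exact: e1.
Qed.

Lemma curve_breaks : exists E : seq R, forall t, t0 < t < b -> t \notin E ->
  exists xi, [/\ is_derive t 1 (fun t => g (c t)) xi,
    is_derive t 1 h ('D_xi (F p) (g (c t))), CS ec (g (c t), xi) & speed F c t = CF ec (g (c t), xi)].
Proof.
have [E hE] := piecewise_breaks (@apiece_hereditary _ _ _ A c) pc.
exists E => t /andP[q1 q2] tE.
have tI : a < t < b by rewrite q2 (le_lt_trans at0).
have [s [u [h1 h2 h3 h4 h5]]] := hE t tI tE.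
exact: curve_derive h1 h2 h3 h4 q1 h5.
Qed.

(** Stated from a time after [t0], since at [t0] itself the height need not be continuous. *)
Lemma length_lower_from t1 t2 : t0 < t1 -> t1 <= t2 -> t2 <= b ->
  h t2 - h t1 <= \int[lebesgue_measure]_(t in `[t1, t2]) speed F c t.
Proof.
move=> t01 t12 t2b; have [E hE] := curve_breaks.
have pcs := piecewise_pcont hF (fun x : R => @cvg_id _ (nbhs x)) pc.
have [_ hc] := curve_continuous t01 (le_trans t12 t2b).
apply: (@int_lower _ _ h E _ _ t12).
- apply: pcont_sub pcs => //; exact: le_trans at0 (ltW t01).
- exact: within_itv_sub (lexx _) t2b hc.
- move=> t /andP[q1 q2] tE.
  have tI : t0 < t < b by rewrite (lt_trans t01 q1) (lt_le_trans q2).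
  have [xi [d1 d2 Cx sp]] := hE t tI tE.
  have tI' : t0 < t <= b by case/andP: tI => -> /ltW.
  have [ss _] := speed_lower (g_ct tI') Cx.
  by exists ('D_xi (F p) (g (c t))) => //; rewrite sp.
Qed.

End Curve.

(** At a break the velocity is a default value and [F] is arbitrary outside [A], so the speed could
    be negative there. Comparison with the constant zero off the breaks sidesteps these times. *)
Lemma speed_ge0_int a b c t1 t2 : a <= t1 -> t1 <= t2 -> t2 <= b -> a < b -> piecewise (apiece A c) a b ->
  0 <= \int[lebesgue_measure]_(t in `[t1, t2]) speed F c t.
Proof.
move=> a1 t12 b2 ab pc.
have [E hE] := piecewise_breaks (@apiece_hereditary _ _ _ A c) pc.
have pcs := piecewise_pcont hF (fun x : R => @cvg_id _ (nbhs x)) pc.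
have := @int_lower _ (speed F c) (cst 0) E t1 t2 t12 (pcont_sub a1 b2 pcs).
rewrite /= subrr; apply; first by move=> x; exact: cvg_cst.
move=> t /andP[q1 q2] tE; exists 0; last exact: is_derive_cst.
have tI : a < t < b by rewrite (le_lt_trans a1 q1) (lt_le_trans q2).
have [s [u [h1 h2 h3 h4 h5]]] := hE t tI tE.
have sk := chart_at_smooth (c t).
have tS : `[s, u]%classic t by rewrite /= in_itv /= !ltW.
have [W [gr [oW Wt hgr cg eg]]] := h5 t tS _ sk (chart_at_dom (c t)).
have stu : s < t < u by rewrite h2.
have Ct := cg t Wt; have [ig _] := Ct.
rewrite (rep_speed F sk oW Wt stu (Cr_differentiable hgr Wt) ig); first exact: (CF_ge0 hF Ct).
by move=> y yI Wy; apply: eg => //; rewrite /= in_itv.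
Qed.

End Length.

Lemma is_derive_small (R : realType) (V : normedModType R) (g : R -> V) (t : R) (l : V) (e : R) :
  is_derive t 1 g l -> 0 < e ->
  exists2 d, 0 < d & forall h, 0 < h < d -> `|g (t + h) - g t - h *: l| <= e * h.
Proof.
move=> [dg dl] e0.
have q : h^-1 *: (g (h + t) - g t) @[h --> (0 : R)^'] --> l.
  have eD : (fun h : R => h^-1 *: ((g \o shift t) (h *: 1) - g t)) = (fun h => h^-1 *: (g (h + t) - g t)).
    by apply/funext => h; rewrite /= [h *: _]mulr1.
  by rewrite -dl -eD; exact: dg.
have /cvgr_dist_le /(_ e e0) := q.
move=> /nbhs_ballP [d d0 hd].
exists d => // h /andP[h0 hd'].
have := hd h; rewrite /ball /= sub0r normrN gtr0_norm// => /(_ hd').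
rewrite gt_eqF// => /(_ isT) le.
have -> : g (t + h) - g t - h *: l = - (h *: (l - h^-1 *: (g (h + t) - g t))).
  by rewrite scalerBr scalerA divff ?gt_eqF// scale1r opprB addrC [t + h]addrC addrC.
by rewrite normrN normrZ gtr0_norm// mulrC ler_wpM2r// ltW.
Qed.

(** * The beginning of a competitor at [p] *)

Section Start.
Context (R : realType) (n : nat) (M : manifold R n)
  (A : M -> set 'rV[R]_n) (F : M -> 'rV[R]_n -> R) (hF : conic_finsler A F)
  (hA : pointwise_convex A) (p : M) (r : R).
Implicit Types (k : chart R n M) (c : R -> M) (a b s t e : R).
Local Notation V := 'rV[R]_n.
Implicit Types (u v w xi : V).
Local Notation CS := (coord_set A).
Local Notation B := (tangent_ball A F p r).
Local Notation f := (expmap A F p).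
Local Notation kp := (chart_at p).
Local Notation yp := (cmap (chart_at p) p).
Local Notation ray := (radial_geodesic A F p).
Context (hdef : forall v, B v -> exp_defined A F p v)
  (g : M -> V) (oI : open (f @` B)) (gf : forall v, B v -> g (f v) = v)
  (g1 : Cr_from (Some 1%N) (f @` B) g) (fs : Cr_map None (B `\ 0) f).

Lemma exp0 : B 0 -> f 0 = p.
Proof.
move=> B0; have [c [geo c0 ce]] := ray_geodesic hF hA hdef B0.
have o1 : (0 : R) <= (1 : R) <= 1 by rewrite lexx ler01.
have o0 : (0 : R) <= (0 : R) <= 1 by rewrite lexx ler01.
have := geodesic_cst hF hA geo c0 o1.
by rewrite !ce// ray0 rayE ?ltr01// scaler0.
Qed.

(** [local_surjectivity] for [u |-> exp_p (s u)] in the chart at [p]. The local solvability that it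
    asks for comes from continuity of [g]: a point [y] close to the image of [u] is reached from
    [s^-1 *: g (cinv kp y)]. *)
Lemma exp_onto v : B v -> v != 0 -> exists d T : R, [/\ 0 < d, 0 < T <= 1 &
  forall s (Y : V), 0 < s <= T -> `|Y - yp - s *: v| <= s * d ->
  exists u, [/\ B u, u != 0, cdom kp (f (s *: u)) & cmap kp (f (s *: u)) = Y] /\ `|v - u| <= 4 * d].
Proof.
move=> Bv v0; have [d [T [C [d0 /andP[T0 T1] C0 hu [hd _ _]]]]] := ray_stay hF hA hdef Bv v0.
(* For [s <= d / (4 * C)] the error [C * s ^+ 2] is at most [s * (d / 4)]. *)
have m0 : 0 < Num.min T (d / (4 * C)) by rewrite lt_min T0 divr_gt0 ?mulr_gt0.
exists (d / 4), (Num.min T (d / (4 * C))); split; first by rewrite divr_gt0.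
  by rewrite m0 ge_min T1.
move=> s Y /andP[s0]; rewrite le_min => /andP[sT sC] bY.
have sI : 0 < s <= 1 by rewrite s0 (le_trans sT).
have sI' : 0 < s <= T by rewrite s0.
have Bs u : `|v - u| <= d -> (B `\ 0) (s *: u).
  by move=> /hu [Bu /eqP u0]; apply: (B0_scale hF).
have [u ud Xu] : exists2 u, `|v - u| <= d & cmap kp (f (s *: u)) = Y.
  apply: (@local_surjectivity R V (fun u => cmap kp (f (s *: u))) v yp Y d s) => //.
  - exact: compact_ball_rV.
  - move=> u ud; have [_ ls] := clin_scaler V s.
    have c1 : {for u, continuous (fun u => f (s *: u))}.
      by apply: (@continuous_comp _ _ _ (fun u : V => s *: u) f); [exact: ls|exact: (f_continuous hF fs (Bs u ud))].
    apply: (@continuous_comp _ _ _ (fun u => f (s *: u)) (cmap kp)) => //.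
    by apply: cmap_continuous; have [] := hd s u sI' ud.
  - move=> u ud2; have ud : `|v - u| <= d by apply: le_trans ud2 _; lra.
    have [du _] := hd s u sI' ud; have Bsu := Bs u ud.
    set y0 := cmap kp (f (s *: u)).
    have cy0 : cimg kp y0 := cmap_img du.
    have iy0 : cinv kp y0 = f (s *: u) by rewrite cmapK.
    have ci := cinv_continuous cy0.
    have Iy : (f @` (B `\ 0)) (cinv kp y0) by rewrite iy0; exists (s *: u).
    have cg : {for y0, continuous (fun y => s^-1 *: g (cinv kp y))}.
      have [_ ls] := clin_scaler V s^-1.
      have c1 : {for y0, continuous (fun y => g (cinv kp y))}.
        apply: (@continuous_comp _ _ _ (cinv kp) g) => //.
        exact: (g_continuous0 g1 Iy).
      by apply: (@continuous_comp _ _ _ (fun y => g (cinv kp y)) (fun u : V => s^-1 *: u)); [exact: c1|exact: ls].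
    have val0 : s^-1 *: g (cinv kp y0) = u.
      by rewrite iy0 gf ?scalerA ?mulVf ?gt_eqF ?scale1r//; case: Bsu.
    have n1 : nbhs y0 (fun y => `|u - s^-1 *: g (cinv kp y)| < d / 2).
      have d2 : 0 < d / 2 by rewrite divr_gt0.
      have := cg _ (nbhsx_ballx _ _ d2); rewrite val0 => h.
      have h' : nbhs y0 (fun y => ball u (d / 2) (s^-1 *: g (cinv kp y))) := h.
      by apply: filterS h' => y; rewrite -ball_normE.
    have n2 : nbhs y0 (fun y => (f @` (B `\ 0)) (cinv kp y)).
      by apply: ci; apply: open_nbhs_nbhs; split=> //; exact: (open_image_B0 oI gf g1).
    have n3 : nbhs y0 (cimg kp) by apply: open_nbhs_nbhs; split=> //; exact: cimg_open.
    have n4 : nbhs y0 ((fun y => `|u - s^-1 *: g (cinv kp y)| < d / 2) `&`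
      ((fun y => (f @` (B `\ 0)) (cinv kp y)) `&` cimg kp)).
      by apply: filterI; [exact: n1|apply: filterI; [exact: n2|exact: n3]].
    have /nbhs_ballP [e e0 he] := n4.
    exists e => // y ye; have [|q1 [q2 q3]] := he y; first by rewrite -ball_normE.
    exists (s^-1 *: g (cinv kp y)) => //.
    by rewrite scalerA divff ?gt_eqF// scale1r (gK gf)// cinvK.
  - move=> u ud; have [_ h] := hd s u sI' ud; apply: le_trans h _.
    rewrite expr2 mulrCA ler_wpM2l ?(ltW s0)//.
    rewrite ler_pdivlMr//; have -> : C * s * 4 = s * (4 * C) by ring.
    by rewrite ler_pdivlMr ?mulr_gt0// in sC.
have [Bu u0] := hu u ud; have [du _] := hd s u sI' ud.
by exists u; split=> //; lra.
Qed.

Section Competitor.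
Context (c : R -> M) (a b : R) (ab : a < b) (pc : piecewise (apiece A c) a b)
  (ca : c a = p) (cB : forall t, a < t <= b -> (f @` B) (c t)) (v : V) (Bv : B v) (v0 : v != 0)
  (cb : c b = f v).

Lemma start_nonzero : ~ A p 0 -> (forall t, a < t <= b -> (f @` (B `\ 0)) (c t)) /\
  forall e d, 0 < e -> 0 < d -> exists t, [/\ a < t, t < a + d, t < b & F p (g (c t)) < e].
Proof.
move=> nA; split.
  move=> t /cB [u Bu <-]; exists u => //; split=> // u0.
  by apply: nA; rewrite -u0; case: Bu.
have aI : a <= a < b by rewrite lexx.
have dp : cdom kp (c a) by rewrite ca; exact: chart_at_dom.
have [W [gr [e1 [eb [oW hgr cg e10 eg]]]]] := right_rep pc aI (chart_at_smooth p) dp.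
have aI1 : a <= a < a + e1 by rewrite lexx ltrDl.
have [Wa ea] := eg a aI1.
have [gia _] := cg a Wa.
have gra : gr a = yp.
  have h : cmap kp (c a) = gr a by rewrite ea cinvK.
  by rewrite -h ca.
set u0 := 'D_1 gr a.
have Au0 : A p u0 by apply/CS_p; rewrite -gra; exact: cg.
have u00 : u0 != 0 by apply/eqP => h; apply: nA; rewrite -h.
have Fu0 := Fp_gt0 hF Au0 u00.
have r0 : 0 < r by have [Av Fv] := Bv; apply: le_lt_trans Fv; exact: (cf_ge0 hF).
(* Brings the initial velocity into the ball: [F p (la *: u0) = r / 2]. *)
pose la := r / (2 * F p u0); have la0 : 0 < la by rewrite divr_gt0 ?mulr_gt0.
have Bv1 : B (la *: u0).
  split; first exact: (cf_conic hF).
  rewrite (Fp_scale hF)// /la; have -> : r / (2 * F p u0) * F p u0 = r / 2 by field; rewrite gt_eqF.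
  lra.
have v10 : la *: u0 != 0 by rewrite scaler_eq0 negb_or u00 gt_eqF.
have [d1 [T [d10 /andP[T0 T1] honto]]] := exp_onto Bv1 v10.
have [dg _] := is_derive_jet Wa hgr.
have dl0 : 0 < d1 / la by rewrite divr_gt0.
have [d2 d20 hd2] := is_derive_small dg dl0.
move=> e d e0 d0.
(* [la * T] makes [exp_onto] applicable, and [la * (e / r)] gives [s < e / r], hence a final height
   [s * F p u < e]. *)
pose m := Num.min (Num.min (Num.min d d2) (Num.min e1 (la * T))) (Num.min (la * (e / r)) (b - a)).
have mm : [/\ m <= d, m <= d2, m <= e1, m <= la * T & m <= la * (e / r)] /\ m <= b - a.
  by rewrite /m; split; first split; rewrite !ge_min lexx ?orbT.
have er0 : 0 < e / r by rewrite divr_gt0.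
have laT : 0 < la * T by exact: mulr_gt0.
have ler : 0 < la * (e / r) by exact: mulr_gt0.
have ba : 0 < b - a by rewrite subr_gt0.
have m0 : 0 < m by rewrite /m !lt_min; do ?(apply/andP; split).
have [[m1 m2 m3 m4 m5] m6] := mm; clear mm; clearbody m.
pose ta := m / 2; have ta0 : 0 < ta by rewrite /ta; lra.
have tam : ta < m by rewrite /ta; lra.
clearbody ta.
(* Then [s *: (la *: u0) = ta *: u0], the first-order displacement of the curve after time [ta]. *)
pose s := ta / la; have s0 : 0 < s by rewrite divr_gt0.
have sla : s * la = ta by rewrite /s divfK// gt_eqF.
have sT : 0 < s <= T by rewrite s0 /s ler_pdivrMr// mulrC; apply: le_trans (ltW tam) m4.
have tI : a <= a + ta < a + e1.
  by rewrite lerDl ltW//= ltrD2l; apply: lt_le_trans tam m3.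
have [Wt et] := eg _ tI.
have td : 0 < ta < d2 by rewrite ta0 (lt_le_trans tam m2).
have bnd : `|gr (a + ta) - yp - s *: (la *: u0)| <= s * d1.
  rewrite scalerA sla -gra; apply: le_trans (hd2 ta td) _.
  by rewrite mulrC mulrA mulrAC.
have [u [[Bu un dfu Xu] _]] := honto s _ sT bnd.
have cu : c (a + ta) = f (s *: u) by rewrite et -Xu cmapK.
have [Au Fu] := Bu.
have sI : 0 < s <= 1 by case/andP: sT => -> /le_trans; apply.
exists (a + ta); split.
- by rewrite ltrDl.
- by rewrite ltrD2l (lt_le_trans tam m1).
- by rewrite -ltrBrDl (lt_le_trans tam m6).
- rewrite cu gf; last exact: (B_scale hF).
  rewrite (Fp_scale hF)//.
  have se : s < e / r by rewrite /s ltr_pdivrMr// mulrC (lt_le_trans tam m5).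
  have : s * r < e by rewrite ltr_pdivlMr in se.
  apply: le_lt_trans; rewrite ler_wpM2l// ltW//.
Qed.

(** Here [p] is [exp_p 0] and [g] is continuous at it with value [0]. The curve may return to [p];
    [t0] is its last visit, after which it stays in the exponential chart. *)
Lemma start_zero : A p 0 -> exists t0, [/\ a <= t0, t0 < b, c t0 = p,
  forall t, t0 < t <= b -> (f @` (B `\ 0)) (c t) &
  forall e d, 0 < e -> 0 < d -> exists t, [/\ t0 < t, t < t0 + d, t < b & F p (g (c t)) < e]].
Proof.
move=> Ap0.
have Fp0 : F p 0 = 0 by apply/(cf_eq0 hF Ap0).
have B0 : B 0 by split=> //; have [Av Fv] := Bv; rewrite Fp0; apply: le_lt_trans Fv; exact: (cf_ge0 hF).
have f0 := exp0 B0.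
have gp : g p = 0 by rewrite -f0 gf.
pose S := [set t : R | a <= t <= b /\ c t = p].
have Sa : S a by split=> //; rewrite lexx ltW.
have sS : has_sup S.
  by split; [exists a|exists b => t [/andP[]]].
pose t0 := sup S.
have at0 : a <= t0 := sup_upper_bound sS Sa.
have t0b' : t0 <= b by apply: ge_sup; [exists a|move=> t [/andP[]]].
have t0I : a <= t0 <= b by rewrite at0.
have cc := apiece_continuous pc t0I.
have ct0 : c t0 = p.
  have cl : closed [set p].
    by apply: accessible_closed_set1; apply: hausdorff_accessible; exact: manifold_hausdorff.
  apply: (within_closed cl cc) => e e0.
  have [t [tI ctp] te] := sup_adherent e0 sS.
  have tt0 : t <= t0 by apply: sup_upper_bound.
  exists t; split=> //; rewrite ger0_norm ?subr_ge0//; by rewrite ltrBlDl -ltrBlDr; exact: te.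
have t0b : t0 < b.
  rewrite lt_neqAle t0b' andbT; apply/eqP => h.
  by move: v0; rewrite -(gf Bv) -cb -h ct0 gp eqxx.
exists t0; split=> //.
- move=> t /andP[tt0 tb]; have tI : a < t <= b by rewrite tb (le_lt_trans at0).
  have [u Bu fu] := cB tI; exists u => //; split=> // u0.
  have : S t by split; [rewrite tb ltW// (le_lt_trans at0)|rewrite -fu u0 f0].
  by move/(sup_upper_bound sS); rewrite leNgt tt0.
- move=> e d e0 d0.
  have Ip : (f @` B) (c t0) by rewrite ct0; exists 0.
  have cg := within_comp_at cc (g_continuous g1 Ip).
  have Ag : A p (g (c t0)) by rewrite ct0 gp.
  have ch := within_comp_at cg (Fp_continuous hF Ag).
  have N0 : nbhs (F p (g (c t0))) [set x | x < e].
    by apply: open_nbhs_nbhs; split; [exact: open_lt|rewrite /= ct0 gp Fp0].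
  have [d1 d10 hd1] := within_near (f := fun t => F p (g (c t))) ch N0.
  pose m := Num.min (Num.min d d1) (b - t0).
  have m0 : 0 < m by rewrite /m !lt_min d0 d10 subr_gt0.
  have [m1 m2 m3] : [/\ m <= d, m <= d1 & m <= b - t0].
    by rewrite /m; split; rewrite !ge_min lexx ?orbT.
  clearbody m.
  exists (t0 + m / 2); split; [lra|lra|lra|].
  apply: hd1; first by rewrite /= in_itv /=; apply/andP; lra.
  rewrite ltr0_norm; lra.
Qed.

Lemma start : exists t0, [/\ a <= t0, t0 < b, c t0 = p,
  forall t, t0 < t <= b -> (f @` (B `\ 0)) (c t) &
  forall e d, 0 < e -> 0 < d -> exists t, [/\ t0 < t, t < t0 + d, t < b & F p (g (c t)) < e]].
Proof.
have [Ap0|nA] := pselect (A p 0); first exact: start_zero.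
have [h1 h2] := start_nonzero nA; exists a; split=> //.
Qed.

End Competitor.
End Start.

(** * Minimizers *)

(** Smoothness of the inverse by bootstrapping: its derivative is [1 / psi'] evaluated at [th], so
    each order of regularity of [th] yields the next. *)
Lemma smooth_inverse1 (R : realType) (W : set R) (psi : R -> R) (x0 : R) :
  open W -> W x0 -> Cr None W psi -> 0 < 'D_1 psi x0 ->
  exists (U : set R) (th : R -> R) (d : R), [/\ open U, 0 < d, Cr None U th &
    forall x, `|x0 - x| < d -> U (psi x) /\ th (psi x) = x].
Proof.
move=> oW Wx0 hpsi p0.
have hp1 := Cr_S (1 : R) hpsi.
have c1 : {for x0, continuous (fun x => 'D_1 psi x)} := Cr_continuous hp1 Wx0.
have [d d0 hd] : exists2 d, 0 < d & forall x, `|x0 - x| < d -> W x /\ 0 < 'D_1 psi x.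
  have nW : nbhs x0 (W `&` [set x | 0 < 'D_1 psi x]).
    apply: filterI; first exact: open_nbhs_nbhs.
    exact: (c1 _ (open_nbhs_nbhs (conj (@open_gt R 0) p0))).
  have /nbhs_ballP [d d0 hd] := nW; exists d; [exact: d0|exact: hd].
pose I := [set x : R | `|x0 - x| < d].
have oI : open I.
  have -> : I = ball x0 d by rewrite -ball_normE.
  exact: ball_open.
have dpsi x : I x -> is_derive x 1 psi ('D_1 psi x).
  by move=> /hd [Wx _]; apply: derivableP; apply/derivable1_diffP; exact: Cr_differentiable hpsi Wx.
have inj x y : I x -> I y -> x < y -> psi x < psi y.
  rewrite /I /= !ltr_distlC => /andP[x1 x2] /andP[y1 y2] xy.
  have sub z : x <= z <= y -> I z.
    by move=> /andP[z1 z2]; rewrite /I /= ltr_distlC (lt_le_trans x1)//= (le_lt_trans z2).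
  have xI : x \in `[x, y] by rewrite in_itv /= lexx ltW.
  have yI : y \in `[x, y] by rewrite in_itv /= lexx ltW.
  apply: (fun h1 h2 h3 => @gtr0_derive1_lt_cc R psi x y h1 h2 h3 x y xI yI xy).
  - move=> z; rewrite in_itv /= => /andP[z1 z2].
    by have [] := dpsi z (sub z _); rewrite ?(ltW z1) ?(ltW z2).
  - move=> z; rewrite in_itv /= => /andP[z1 z2]; rewrite derive1E.
    by have [] := hd z (sub z _); rewrite ?(ltW z1) ?(ltW z2).
  - apply/subspace_continuousP => z; rewrite /= in_itv /= => zI.
    apply: cvg_within_filter; have [Wz _] := hd z (sub z zI).
    exact: (Cr_continuous hpsi Wz).
pose th y := xget x0 [set x | I x /\ psi x = y].
have thK x : I x -> th (psi x) = x.
  move=> Ix; rewrite /th; case: xgetP => [x' _ [Ix' e]|h]; last by have := h x; case.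
  apply/eqP; rewrite eq_le !leNgt; apply/andP; split; apply/negP => lt.
    by have := inj _ _ Ix Ix' lt; rewrite e ltxx.
  by have := inj _ _ Ix' Ix lt; rewrite e ltxx.
have nI x : I x -> nbhs x I by move=> Ix; exact: open_nbhs_nbhs.
have n1 x : I x -> {near x, cancel psi th} by move=> /nI; apply: filterS => y; exact: thK.
have n2 x : I x -> {near x, continuous psi}.
  by move=> /nI; apply: filterS => y /hd [Wy _]; exact: (Cr_continuous hpsi Wy).
pose U := psi @` I.
have dth x : I x -> is_derive (psi x) 1 th ('D_1 psi x)^-1.
  move=> Ix; apply: is_derive_inverse (n1 x Ix) (n2 x Ix) (dpsi x Ix) _.
  by have [_ h] := hd x Ix; rewrite gt_eqF.
have dfth y : U y -> differentiable th y.
  by move=> [x Ix <-]; have [h _] := dth x Ix; apply/derivable1_diffP.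
have oU : open U.
  rewrite openE => y [x Ix <-]; rewrite /interior.
  have cth := near_continuous_can_sym (n2 x Ix) (n1 x Ix).
  have Uy : U (psi x) by exists x.
  have c2 := differentiable_continuous (dfth _ Uy).
  have n3 : nbhs (psi x) (th @^-1` I) by apply: c2; rewrite thK//; exact: nI.
  by apply: filterS2 cth n3 => z e h; exists (th z).
exists U, th, d; split=> // [m|x xd]; last by split; [exists x|exact: thK].
elim: m => [|m IH].
  by move=> y Uy; exact: differentiable_continuous (dfth y Uy).
split; first exact: dfth.
move=> v.
have thW y : U y -> W (th y) by move=> [x Ix <-]; rewrite thK//; have [] := hd x Ix.
have hc : Ck m U (fun y => 'D_1 psi (th y)).
  exact: (@Ck_comp R R R R m U W th (fun x => 'D_1 psi x) oU oW (@findim_R R) (@findim_R R) thW IH (hp1 m)).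
have hi : Ck m U (fun y => ('D_1 psi (th y))^-1).
  apply: CkV => // y [x Ix <-]; rewrite thK//.
  by have [_ h] := hd x Ix; rewrite gt_eqF.
apply: (Ck_eq oU) (CkM oU (Ck_cst m U v) hi) => y [x Ix <-].
rewrite thK//; have Uy : U (psi x) by exists x.
have [_ e1] := dth x Ix.
have dt := dfth _ Uy.
have e2 : 'd th (psi x) v = v * 'd th (psi x) 1.
  by have := clinZ v (1 : R) (clin_of_diff dt); rewrite -[v *: 1]/(v * 1) mulr1.
by rewrite (etrans (deriveE v dt) e2) -e1; congr (v * _); exact: (deriveE (1 : R) dt).
Qed.

Lemma derive0_ends (R : realType) (K : R -> R) (E : seq R) (a b : R) : a <= b ->
  {within `[a, b], continuous K} ->
  (forall t : R, a < t < b -> t \notin E -> is_derive t 1 K 0) -> K a = K b.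
Proof.
move=> ab cK dK; apply/eqP; rewrite eq_le; apply/andP; split.
  by apply: (ge0_derive_mono ab cK (E := E)) => t tI tE; exists 0 => //; exact: dK.
rewrite -lerN2; apply: (ge0_derive_mono (g := fun t => - K t) ab (E := E)).
  apply/subspace_continuousP => t tI; apply: cvgN.
  by move/subspace_continuousP: cK => /(_ t tI).
move=> t tI tE; exists 0 => //; rewrite -[X in is_derive _ _ _ X]oppr0.
by apply: is_deriveN; exact: dK.
Qed.

Section Minimal.
Context (R : realType) (n : nat) (M : manifold R n)
  (A : M -> set 'rV[R]_n) (F : M -> 'rV[R]_n -> R) (hF : conic_finsler A F)
  (hA : pointwise_convex A) (p : M) (r : R).
Implicit Types (k : chart R n M) (c : R -> M) (a b s t e : R).
Local Notation V := 'rV[R]_n.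
Implicit Types (u v w xi : V).
Local Notation CS := (coord_set A).
Local Notation CF := (coord_fun F).
Local Notation B := (tangent_ball A F p r).
Local Notation f := (expmap A F p).
Local Notation kp := (chart_at p).
Local Notation yp := (cmap (chart_at p) p).
Local Notation ray := (radial_geodesic A F p).
Context (hdef : forall v, B v -> exp_defined A F p v)
  (g : M -> V) (oI : open (f @` B)) (gf : forall v, B v -> g (f v) = v)
  (g1 : Cr_from (Some 1%N) (f @` B) g) (fs : Cr_map None (B `\ 0) f)
  (gs : Cr_from None (f @` (B `\ 0)) g).
Local Notation ec := (exp_chart hF oI gf g1 fs).
Local Notation se := (exp_chart_smooth hF oI gf g1 fs gs).
Local Notation len c a b := (\int[lebesgue_measure]_(t in `[a, b]) speed F c t).

Lemma ray_zero t : B 0 -> ray 0 t = p.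
Proof. by move=> B0; rewrite /radial_geodesic; case: eqP => // _; rewrite scaler0 (exp0 hF hA hdef B0). Qed.

Lemma ray_speed v t : B v -> 0 < t < 1 -> speed F (ray v) t = F p v.
Proof.
move=> Bv /andP[t0 t1]; have [v0|v0] := eqVneq v 0.
  rewrite v0 in Bv *; rewrite /speed /velocity.
  have -> : ray 0 = cst p by apply/funext => s; exact: ray_zero.
  have -> : cmap (chart_at (cst p t)) \o cst p = cst yp by [].
  by rewrite derive1_cst.
have B0v : (B `\ 0) v by split=> //; exact/eqP.
have tI : 0 < t <= 1 by rewrite t0 ltW.
have [_ c2] := lag_ray hF hA hdef oI gf g1 fs gs B0v tI.
have d := is_derive_ray v t.
have [dr dv] := d.
have tI2 : t / 2 < t < 1 by rewrite t1 andbT; lra.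
have -> : speed F (ray v) t = CF ec (t *: v, 'D_1 (fun s : R => s *: v) t).
  apply: (@rep_speed _ _ _ _ ec setT (fun s : R => s *: v) _ _ (t / 2) 1 se openT).
  - by [].
  - exact: tI2.
  - exact/derivable1_diffP.
  - exact: (B0_scale hF B0v tI).
  - move=> y /andP[y1 _] _; apply: rayE; lra.
rewrite dv; exact: c2.
Qed.

Lemma ray_apiece v : B v -> piecewise (apiece A (ray v)) 0 1.
Proof.
move=> Bv; have [c [geo _ ce]] := ray_geodesic hF hA hdef Bv.
have [_ pc] := geodesic_apiece hF geo.
apply: piecewise_imp_in pc => s u s0 su u1; apply: apiece_eq => t.
rewrite /= in_itv /= => /andP[h1 h2]; apply: ce.
by rewrite (le_trans s0 h1) (le_trans h2 u1).
Qed.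

Lemma ray_length v : B v -> len (ray v) 0 1 = F p v.
Proof.
move=> Bv.
have [i1 _] := piecewise_pcont hF (fun x : R => @cvg_id _ (nbhs x)) (ray_apiece Bv).
have [i2 _] : pcont (cst (F p v)) 0 1.
  apply: (@pcont_piece R _ (cst (F p v)) 0 1 ltr01) => //.
  by apply/subspace_continuousP => t _; exact: cvg_cst.
rewrite (eq_int_oo (fun t tI => ray_speed Bv tI) i1 i2) Rintegral_cst//.
have := @lebesgue_measure_itv R `[(0 : R), (1 : R)].
rewrite /= lte_fin ltr01 oppr0 adde0 => e.
by rewrite -[RHS]mulr1; congr (_ * _); rewrite [X in fine X]e.
Qed.

Lemma ray_competitor v : B v -> competitor A F p (f v) r 0 1 (ray v).
Proof.
move=> Bv; split; [|exact: ray0|by rewrite rayE ?ltr01// scale1r|].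
  by apply: apiece_admissible; [exact: ltr01|exact: ray_apiece].
move=> t tI; have /andP[t0 t1] := tI; rewrite rayE//.
by exists (t *: v) => //; exact: (B_scale hF).
Qed.

Section Curve.
Context (c : R -> M) (a b : R) (pc : piecewise (apiece A c) a b).

Lemma len_split t1 t2 : a <= t1 -> t1 <= t2 -> t2 <= b -> len c a t2 = len c a t1 + len c t1 t2.
Proof.
move=> h1 h2 h3; apply: int_split => //.
have := piecewise_pcont hF (fun x : R => @cvg_id _ (nbhs x)) pc.
by move=> /(pcont_sub (lexx a) h3) [].
Qed.

End Curve.

(** Cut at a time shortly after [t0] where the height is below [e]: the remaining arc has length at
    least [F p v - e], and the arc before has nonnegative length. *)
Lemma len_ge c a b v : a < b -> piecewise (apiece A c) a b -> c a = p ->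
  (forall t, a < t <= b -> (f @` B) (c t)) -> B v -> c b = f v -> F p v <= len c a b.
Proof.
move=> ab pc ca cB Bv cb; have [v0|v0] := eqVneq v 0.
  have [Av _] := Bv; have -> : F p v = 0 by apply/(cf_eq0 hF Av).
  exact: (speed_ge0_int hF (lexx a) (ltW ab) (lexx b) ab pc).
have [t0 [at0 t0b ct0 ct hs]] := start hF hA hdef oI gf g1 fs ab pc ca cB Bv v0 cb.
apply/ler_addgt0Pr => e e0.
have d0 : 0 < b - t0 by rewrite subr_gt0.
have [t [t0t _ tb he]] := hs e _ e0 d0.
have := length_lower_from hF hA hdef oI gf g1 fs gs pc at0 ct t0t (ltW tb) (lexx b).
rewrite /= cb gf// => h.
have at_ : a <= t := le_trans at0 (ltW t0t).
have h2 := speed_ge0_int hF (lexx a) at_ (ltW tb) ab pc.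
rewrite (len_split pc at_ (ltW tb) (lexx b)).
move: h h2 he; set x1 := len c t b; set x2 := len c a t; lra.
Qed.

(** The arc up to [t] is itself a competitor, towards [c t = exp_p u]; its length bounds [F p u]
    from above, so [u = 0]. *)
Lemma zero_length_cst c a b t : piecewise (apiece A c) a b -> c a = p ->
  (forall t, a < t <= b -> (f @` B) (c t)) -> len c a b <= 0 -> a <= t <= b -> c t = p.
Proof.
move=> pc ca cB l0 /andP[at_ tb]; move: at_; rewrite le_eqVlt => /orP[/eqP <-//|at_].
have tI : a < t <= b by rewrite at_.
have ab : a < b by exact: lt_le_trans tb.
have tI' : a <= t <= b by rewrite tb ltW.
have [pt _] := piecewise_restrict (@apiece_hereditary _ _ _ A c) tI' pc.
have [u Bu fu] := cB t tI.
have cB' s : a < s <= t -> (f @` B) (c s).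
  by move=> /andP[s1 s2]; apply: cB; rewrite s1 (le_trans s2).
have h1 := len_ge at_ pt ca cB' Bu (esym fu).
have h2 := speed_ge0_int hF (ltW at_) tb (lexx b) ab pc.
rewrite (len_split pc (ltW at_) tb (lexx b)) in l0.
have Fu : F p u <= 0 by move: h1 h2 l0; set x1 := len c a t; set x2 := len c t b; lra.
have [u0|u0] := eqVneq u 0; first by rewrite -fu u0 (exp0 hF hA hdef)// -u0.
by have [Au _] := Bu; move: Fu; rewrite leNgt (Fp_gt0 hF Au u0).
Qed.

Lemma derive_scaleF w (l : R) : A p w -> w != 0 -> 'D_(l *: w) (F p) w = l * F p w.
Proof.
move=> Aw w0; have [_ [hFp _]] := Cr_En hF p.
have dF : differentiable (F p) w by apply: Cr_differentiable hFp _; split=> //; exact/eqP.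
have e1 : 'D_w (F p) w = F p w.
  have dF0 : differentiable (F p) (w + (0 : R) *: w) by rewrite scale0r addr0.
  have := is_derive_line dF0; rewrite scale0r addr0 => d1.
  have d2 : is_derive (0 : R) 1 (fun s : R => (1 + s) * F p w) (F p w).
    have h := is_deriveM (is_deriveD (is_derive_cst (1 : R) (0 : R) 1) (is_derive_id (0 : R) 1)) (is_derive_cst (F p w) (0 : R) 1).
    apply: (is_derive_eq h).
    by rewrite /= scaler0 !add0r -[LHS]/(_ * _) mulr1.
  have nr : \forall s \near (0 : R), F p (w + s *: w) = (1 + s) * F p w.
    have n1 : nbhs (0 : R) (ball (0 : R) 1) by exact: nbhsx_ballx.
    apply: filterS n1 => s; rewrite /ball /= sub0r normrN => s1.
    rewrite -{1}[w]scale1r -scalerDl (Fp_scale hF)//.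
    by move: s1; rewrite ltr_norml => /andP[h _]; lra.
  have d3 := near_eq_is_derive nr d1.
  by have [_ q1] := d3; have [_ q2] := d2; exact: etrans (esym q1) q2.
rewrite deriveE//; rewrite (clinZ l w (clin_of_diff dF)) -deriveE// e1.
by [].
Qed.

Section Equality.
Context (c : R -> M) (a b : R) (ab : a < b) (pc : piecewise (apiece A c) a b)
  (ca : c a = p) (cB : forall t, a < t <= b -> (f @` B) (c t)) (v : V) (Bv : B v) (v0 : v != 0)
  (cb : c b = f v) (lc : len c a b <= F p v)
  (t0 : R) (at0 : a <= t0) (t0b : t0 < b) (ct0 : c t0 = p)
  (ct : forall t, t0 < t <= b -> (f @` (B `\ 0)) (c t)).
Local Notation h := (fun t => F p (g (c t))).

(** A curve no longer than [F p v] leaves no slack: its arcs over [[a, t1]], [[t1, t2]] and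
    [[t2, b]] are each at least as long as the gain in height, and the three gains add up to
    [F p v]. *)
Lemma height_dist t1 t2 : t0 < t1 -> t1 <= t2 -> t2 <= b -> len c t1 t2 = h t2 - h t1.
Proof.
move=> t01 t12 t2b; have at1 : a < t1 := le_lt_trans at0 t01.
have t1b := le_trans t12 t2b.
have tI1 : a <= t1 <= b by rewrite t1b ltW.
have [pt _] := piecewise_restrict (@apiece_hereditary _ _ _ A c) tI1 pc.
have cB' s : a < s <= t1 -> (f @` B) (c s).
  by move=> /andP[s1 s2]; apply: cB; rewrite s1 (le_trans s2).
have tI : t0 < t1 <= b by rewrite t01.
have [Bg _] := g_img gf (ct tI).
have h1 := len_ge at1 pt ca cB' Bg (esym (gK gf (ct tI))).
have h2 := length_lower_from hF hA hdef oI gf g1 fs gs pc at0 ct t01 t12 t2b.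
have h3 := length_lower_from hF hA hdef oI gf g1 fs gs pc at0 ct (lt_le_trans t01 t12) t2b (lexx b).
have at2 := le_trans (ltW at1) t12.
have := lc; rewrite (len_split pc at2 t2b (lexx b)) (len_split pc (ltW at1) t12 t2b).
move: h1 h2 h3; rewrite /= cb gf//.
set x1 := len c a t1; set x2 := len c t1 t2; set x3 := len c t2 b.
move=> h1 h2 h3 h4; apply/eqP; rewrite eq_le h2 andbT.
by move: h1 h3 h4; lra.
Qed.

(** The arc from [t0] on already uses the whole length, so the arc before has length zero. *)
Lemma before_start t : a <= t <= t0 -> c t = p.
Proof.
move=> tI; have at0b : a <= t0 <= b by rewrite at0 ltW.
have [p1 p2] := piecewise_restrict (@apiece_hereditary _ _ _ A c) at0b pc.
have cB1 s : a < s <= t0 -> (f @` B) (c s).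
  by move=> /andP[s1 s2]; apply: cB; rewrite s1 (le_trans s2)// ltW.
have cB2 s : t0 < s <= b -> (f @` B) (c s).
  by move=> /andP[s1 s2]; apply: cB; rewrite s2 (le_lt_trans at0).
apply: (zero_length_cst p1 ca cB1 _ tI).
have h1 := len_ge t0b p2 ct0 cB2 Bv cb.
have := lc; rewrite (len_split pc at0 (ltW t0b) (lexx b)).
by move: h1; set x1 := len c t0 b; set x2 := len c a t0; lra.
Qed.

(** Minimality makes the height a primitive of the speed. Off the breaks both derivatives exist and
    coincide, which is the equality case of [speed_lower]. *)
Lemma radial_derive t1 : t0 < t1 -> t1 < b -> exists E : seq R, forall t : R, t1 < t < b -> t \notin E ->
  exists l : R, is_derive t 1 (fun t => g (c t)) (l *: g (c t)) /\ is_derive t 1 h (l * h t).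
Proof.
move=> t01 t1b.
have [E1 hE1] := curve_breaks hF oI gf g1 fs gs pc at0 ct.
have pcs := piecewise_pcont hF (fun x : R => @cvg_id _ (nbhs x)) pc.
have at1 : a <= t1 := le_trans at0 (ltW t01).
have [_ [E2 hE2]] := pcont_primitive (ltW t1b) (pcont_sub at1 (lexx b) pcs).
exists (E1 ++ E2) => t tI; rewrite mem_cat negb_or => /andP[tE1 tE2].
have /andP[t1t tb] := tI.
have tI0 : t0 < t < b by rewrite tb (lt_trans t01).
have [xi [d1 d2 Cx sp]] := hE1 t tI0 tE1.
have tI1 : t0 < t <= b by case/andP: tI0 => -> /ltW.
have B0 := g_img gf (ct tI1).
have [_ eqc] := speed_lower hA hdef gs B0 Cx.
have d3 := hE2 t tI tE2.
have nr : \forall s \near t, h s - h t1 = len c t1 s.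
  have : nbhs t `]t1, b[%classic.
    by apply: open_nbhs_nbhs; split; [exact: interval_open|rewrite /= in_itv].
  apply: filterS => s; rewrite /= in_itv /= => /andP[s1 s2].
  by rewrite height_dist// ltW.
have d4 := near_eq_is_derive nr (is_deriveB d2 (is_derive_cst (h t1) t 1)).
have e1 : 'D_xi (F p) (g (c t)) = CF ec (g (c t), xi).
  by have [_ q1] := d3; have [_ q2] := d4; rewrite -sp -q1 q2 subr0.
have [l _ xl] := eqc e1; exists l; rewrite -xl; split; first exact: d1.
have [[Aw _] /eqP w0] := B0.
by rewrite -(derive_scaleF l Aw w0) -xl.
Qed.

Lemma h_gt0 t : t0 < t <= b -> 0 < h t.
Proof. by move=> tI; have [[Aw _] /eqP w0] := g_img gf (ct tI); exact: (Fp_gt0 hF). Qed.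

(** Position and height grow at the same logarithmic rate [l], so each coordinate of their quotient
    is constant up to time [b], where the position is [v]. *)
Lemma radial_form t : t0 < t <= b -> g (c t) = (h t / F p v) *: v.
Proof.
move=> /andP[t0t]; rewrite le_eqVlt => /orP[/eqP ->|tb].
  rewrite cb gf// divff ?scale1r//; have [Av _] := Bv.
  by rewrite gt_eqF//; exact: (Fp_gt0 hF).
have [E hE] := radial_derive t0t tb.
have [cg ch] := curve_continuous hF gf g1 pc at0 ct t0t (ltW tb).
have Fv0 : 0 < F p v by have [Av _] := Bv; exact: (Fp_gt0 hF).
have ht0 : 0 < h t by apply: h_gt0; rewrite t0t ltW.
apply/rowP => i.
have hc := clin_coord R i.
pose K (s : R) := (h s)^-1 * (g (c s) : 'M[R]_(1, n)) 0 i.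
have eK : K t = K b.
  apply: (@derive0_ends R K E t b (ltW tb)).
    apply/subspace_continuousP => s sI.
    move/subspace_continuousP: cg => /(_ s sI) cgs; move/subspace_continuousP: ch => /(_ s sI) chs.
    have sI' : t0 < s <= b by move: sI; rewrite /= in_itv /= => /andP[q1 ->]; rewrite (lt_le_trans t0t).
    have hs0 : h s != 0 by rewrite gt_eqF//; exact: h_gt0.
    apply: cvgM; first exact: cvgV.
    have [_ cc] := hc.
    exact: (within_comp_at cgs (cc _)).
  move=> s sI sE; have [l [d1 d2]] := hE s sI sE.
  have sI' : t0 < s <= b by case/andP: sI => q1 /ltW ->; rewrite (lt_trans t0t).
  have hs0 : h s != 0 by rewrite gt_eqF//; exact: h_gt0.
  have d3 := is_derive_clin d1 hc.
  have d4 := is_deriveM (is_deriveV hs0 d2) d3.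
  apply: (is_derive_eq d4).
  rewrite mxE -![_ *: _]/(_ * _); set x := (g (c s)) 0 i; move: hs0; set y := F p (g (c s)) => hs0.
  by field.
have -> : (g (c t) : 'M[R]_(1, n)) 0 i = h t * K t by rewrite /K mulrA divff ?gt_eqF// mul1r.
by rewrite eK /K /= cb gf// mxE mulrA.
Qed.

End Equality.
End Minimal.

(** * Regularity of the change of parameter *)

Section Reparam.
Context (R : realType) (n : nat) (M : manifold R n)
  (A : M -> set 'rV[R]_n) (F : M -> 'rV[R]_n -> R) (hF : conic_finsler A F)
  (hA : pointwise_convex A) (p : M) (r : R).
Implicit Types (k : chart R n M) (c : R -> M) (a b s t e : R).
Local Notation V := 'rV[R]_n.
Implicit Types (u v w xi : V).
Local Notation CS := (coord_set A).
Local Notation B := (tangent_ball A F p r).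
Local Notation f := (expmap A F p).
Local Notation kp := (chart_at p).
Local Notation yp := (cmap (chart_at p) p).
Local Notation ray := (radial_geodesic A F p).
Context (hdef : forall v, B v -> exp_defined A F p v)
  (g : M -> V) (oI : open (f @` B)) (gf : forall v, B v -> g (f v) = v)
  (g1 : Cr_from (Some 1%N) (f @` B) g) (fs : Cr_map None (B `\ 0) f)
  (gs : Cr_from None (f @` (B `\ 0)) g).
Local Notation ec := (exp_chart hF oI gf g1 fs).
Local Notation se := (exp_chart_smooth hF oI gf g1 fs gs).
Local Notation len c a b := (\int[lebesgue_measure]_(t in `[a, b]) speed F c t).

(** Near time zero the ray is read in the chart at [p], by a representative smooth across zero. Its
    derivative there is nonzero because [v] is. *)
Lemma ray_start_rep v : B v -> v != 0 -> exists (W : set R) (gr : R -> V) (e : R),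
  [/\ open W, Cr None W gr, 0 < e, 'D_1 gr 0 != 0 &
   forall y, 0 <= y < e -> [/\ W y, cimg kp (gr y) & ray v y = cinv kp (gr y)]].
Proof.
move=> Bv v0; have [c [geo tv0' ce]] := ray_geodesic hF hA hdef Bv.
have [_ pc] := geodesic_apiece hF geo.
have I0 : (0 : R) <= (0 : R) < 1 by rewrite lexx ltr01.
have I0' : (0 : R) <= (0 : R) <= 1 by rewrite lexx ler01.
have c0 : c 0 = p by rewrite ce// ray0.
have dp : cdom kp (c 0) by rewrite c0; exact: chart_at_dom.
have sk := chart_at_smooth p.
have [W [gr [e [e1 rr]]]] := right_rep pc I0 sk dp.
have [oW hgr cg e0 eg] := rr.
have I1 : (0 : R) <= 0 < 0 + e by rewrite lexx add0r.
have [rv _] := rrep_velocity sk rr I1.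
exists W, gr, e; split=> //.
- apply/eqP => d0; move: v0; rewrite -tv0' tv0 rv d0.
  by rewrite /of_coord linear0 eqxx.
- move=> y /andP[y0 ye]; have yI : 0 <= y < 0 + e by rewrite y0 add0r.
  have [Wy ey] := eg y yI; have [iy _] := cg y Wy.
  split=> //; rewrite -ey ce// y0/=; apply: le_trans (ltW ye) _.
  by rewrite add0r in e1.
Qed.

Context (c : R -> M) (a b : R) (ab : a < b) (pc : piecewise (apiece A c) a b)
  (ca : c a = p) (cB : forall t, a < t <= b -> (f @` B) (c t)) (v : V) (Bv : B v) (v0 : v != 0)
  (cb : c b = f v) (lc : len c a b <= F p v)
  (t0 : R) (at0 : a <= t0) (t0b : t0 < b) (ct0 : c t0 = p)
  (ct : forall t, t0 < t <= b -> (f @` (B `\ 0)) (c t))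
  (hs : forall e d : R, 0 < e -> 0 < d -> exists t, [/\ t0 < t, t < t0 + d, t < b & F p (g (c t)) < e]).
Local Notation h := (fun t => F p (g (c t))).

(** Up to the last visit the minimizer rests at [p]; afterwards the parameter is the height,
    normalized to reach [1] at [b]. *)
Definition phi t : R := if t <= t0 then 0 else h t / F p v.

Lemma phiE t : t0 < t -> phi t = h t / F p v.
Proof. by move=> tt; rewrite /phi leNgt tt. Qed.

Lemma phi0 t : t <= t0 -> phi t = 0. Proof. by rewrite /phi => ->. Qed.

Lemma Fv_gt0 : 0 < F p v. Proof. by have [Av _] := Bv; exact: (Fp_gt0 hF). Qed.

Lemma phi_gt0 t : t0 < t <= b -> 0 < phi t.
Proof.
move=> tI; have /andP[t0t _] := tI; rewrite phiE//; apply: divr_gt0; last exact: Fv_gt0.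
exact: (h_gt0 hF gf ct tI).
Qed.

Lemma phi_ge0 t : t <= b -> 0 <= phi t.
Proof. by move=> tb; have [tt|tt] := leP t t0; [rewrite phi0|rewrite ltW// phi_gt0// tt]. Qed.

Lemma phi_mono s t : s <= t -> t <= b -> phi s <= phi t.
Proof.
move=> st tb; have [ss|ss] := leP s t0; first by rewrite (phi0 ss) phi_ge0.
have tt := lt_le_trans ss st; rewrite !phiE// ler_pM2r ?invr_gt0 ?Fv_gt0//.
rewrite -subr_ge0 -(height_dist hF hA hdef oI gf g1 fs gs pc ca cB Bv cb lc at0 ct ss st tb).
exact: (speed_ge0_int hF (le_trans at0 (ltW ss)) st tb ab pc).
Qed.

(** Monotonicity spreads the smallness from the single time supplied by [hs] to all earlier times,
    which gives right continuity at [t0]. *)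
Lemma phi_small e : 0 < e -> exists2 d, 0 < d & forall t, t0 <= t -> t < t0 + d -> 0 <= phi t < e.
Proof.
move=> e0; have Fv := Fv_gt0; have e1 : 0 < e * F p v by rewrite mulr_gt0.
have [t [t1 _ t2 t3]] := hs e1 ltr01.
exists (t - t0); first by rewrite subr_gt0.
move=> s s0; rewrite addrC subrK => st.
rewrite phi_ge0 ?(le_trans (ltW st) (ltW t2))//=.
apply: le_lt_trans (phi_mono (ltW st) (ltW t2)) _.
by rewrite phiE// ltr_pdivrMr.
Qed.

Lemma phi_ray t : a <= t <= b -> c t = ray v (phi t).
Proof.
move=> /andP[at_ tb]; have [tt|tt] := leP t t0.
  rewrite phi0// ray0; apply: (before_start hF hA hdef oI gf g1 fs gs pc ca cB Bv cb lc at0 t0b ct0).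
  by rewrite at_.
have tI : t0 < t <= b by rewrite tt.
rewrite rayE; last exact: phi_gt0.
rewrite phiE// -(radial_form hF hA hdef oI gf g1 fs gs pc ca cB Bv v0 cb lc at0 ct tI).
by rewrite (gK gf)//; exact: ct.
Qed.

Lemma phi_smooth (s u : R) : t0 <= s -> s < u -> u <= b -> apiece A c `[s, u]%classic ->
  Cr_on None `[s, u]%classic phi.
Proof.
move=> t0s su ub ap x xS; have := xS; rewrite /= in_itv /= => /andP[sx xu].
have : t0 <= x := le_trans t0s sx.
rewrite le_eqVlt => /orP[/eqP t0x|t0x].
- have dp : cdom kp (c x) by rewrite -t0x ct0; exact: chart_at_dom.
  have [W [gp [oW Wx hgp cgp egp]]] := ap x xS kp (chart_at_smooth p) dp.
  have [W0 [gr [e [oW0 hgr e0 D0 egr]]]] := ray_start_rep Bv v0.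
  have [i Di] : exists i : 'I_n, ('D_1 gr 0 : 'M[R]_(1, n)) 0 i != 0.
    apply/existsP; apply: contraNT D0; rewrite negb_exists => /forallP H.
    by apply/eqP/rowP => i; rewrite [RHS]mxE; apply/eqP; move: (H i); rewrite negbK.
  set y0 := ('D_1 gr 0 : 'M[R]_(1, n)) 0 i in Di.
  (* A coordinate in which the ray moves at time zero, multiplied by its own derivative [y0], so
     that the derivative along the ray is [y0 ^+ 2] and hence positive. *)
  pose l (w : V) : R := y0 *: (w : 'M[R]_(1, n)) 0 i.
  have cl : clin l := clin_comp (clin_coord R i) (clin_scaler R^o y0).
  have I0 : (0 : R) <= 0 < e by rewrite lexx e0.
  have [W00 _ _] := egr 0 I0.
  have hpsi : Cr None W0 (fun y => l (gr y)).
    exact: (@Cr_comp R R V R W0 setT gr l oW0 openT (@findim_rV R n) (@findim_R R) (fun _ _ => I) hgr (Cr_clin setT cl)).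
  have [d1 _] := is_derive_jet W00 hgr.
  have [_ d2] := is_derive_clin d1 cl.
  have pos : 0 < 'D_1 (fun y => l (gr y)) 0.
    by rewrite d2 /l -/y0 -[_ *: _]/(_ * _) -expr2 exprn_even_gt0.
  have [U1 [th [d [oU1 d0 hth eth]]]] := smooth_inverse1 oW0 W00 hpsi pos.
  have m0 : 0 < Num.min d e by rewrite lt_min d0.
  have [dl dl0 hdl] := phi_small m0.
  (* [phi_small] keeps [phi y] where the representative of the ray and the inverse [th] are valid.
     There [gp y = gr (phi y)], so [phi] is the smooth map [th] of [l] of [gp]. *)
  have key y : s <= y <= u -> W y -> y < t0 + dl -> U1 (l (gp y)) /\ th (l (gp y)) = phi y.
    move=> /andP[sy yu] Wy yd.
    have /andP[q1 ] := hdl y (le_trans t0s sy) yd; rewrite lt_min => /andP[q2 q3].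
    have yI : 0 <= phi y < e by rewrite q1.
    have [W0y iy ry] := egr _ yI.
    have e1 : gp y = gr (phi y).
      have yS : `[s, u]%classic y by rewrite /= in_itv /= sy.
      have e2 := egp y yS Wy.
      have yab : a <= y <= b by rewrite (le_trans (le_trans at0 t0s) sy) (le_trans yu ub).
      have e3 := phi_ray yab; rewrite ry in e3.
      have [igp _] := cgp y Wy.
      by rewrite -[LHS](cinvK igp) -e2 e3 cinvK.
    rewrite e1; apply: eth.
    by rewrite sub0r normrN ger0_norm.
  pose U := (W `&` (fun y => l (gp y)) @^-1` U1) `&` [set y | y < t0 + dl].
  have hlgp : Cr None W (fun y => l (gp y)).
    exact: (@Cr_comp R R V R W setT gp l oW openT (@findim_rV R n) (@findim_R R) (fun _ _ => I) hgp (Cr_clin setT cl)).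
  have oU2 : open (W `&` (fun y => l (gp y)) @^-1` U1).
    apply: open_preimage_on; [exact: oW| |exact: oU1].
    by move=> y Wy; exact: (Cr_continuous hlgp Wy).
  have oU : open U by apply: openI => //; exact: open_lt.
  exists U, (fun y => th (l (gp y))); split.
  + exact: oU.
  + have xd : x < t0 + dl by rewrite -t0x ltrDl.
    have xI : s <= x <= u by rewrite sx.
    by have [k1 _] := key x xI Wx xd.
  + have hU : Cr None U (fun y => l (gp y)) by apply: Cr_sub hlgp => y [[]].
    by apply: (@Cr_comp R R R R U U1 (fun y => l (gp y)) th oU oU1 (@findim_R R) (@findim_R R) _ hU hth) => y [[]].
  + move=> y; rewrite /= in_itv /= => yI [[Wy _] yd].
    by have [_ k2] := key y yI Wy yd.
(* After [t0] the curve is in the exponential chart, away from zero vectors, and [phi] is the smooth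
   function [F p] of its position, up to a constant factor. *)
- have xI : t0 < x <= b by rewrite t0x (le_trans xu).
  have cdt : cdom ec (c x) := ct xI.
  have [W [gr [oW Wx hgr cg eg]]] := ap x xS ec se cdt.
  have [oA [hFp _]] := Cr_En hF p.
  have oU : open (W `&` [set y | t0 < y]) by apply: openI => //; exact: open_gt.
  exists (W `&` [set y | t0 < y]), (fun y => (F p v)^-1 *: F p (gr y)); split=> //.
  + have hU : Cr None (W `&` [set y | t0 < y]) gr by apply: Cr_sub hgr => y [].
    have hc : Cr None (W `&` [set y | t0 < y]) (fun y => F p (gr y)).
      apply: (@Cr_comp R R V R _ (A p `\ 0) gr (F p) oU oA (@findim_rV R n) (@findim_R R) _ hU hFp).
      by move=> y [Wy _]; have [[[Ay _] y0] _] := cg y Wy.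
    exact: (@Cr_comp R R R R _ setT (fun y => F p (gr y)) (fun z : R => (F p v)^-1 *: z) oU openT
      (@findim_R R) (@findim_R R) (fun _ _ => I) hc (Cr_clin setT (clin_scaler R^o (F p v)^-1))).
  + move=> y yS [Wy ty]; rewrite phiE// (eg y yS Wy) /=.
    by have [[Bg _] _] := cg y Wy; rewrite gf// mulrC.
Qed.

Lemma minimizer_reparam : reparametrization (ray v) a b c.
Proof.
have at0b : a <= t0 <= b by rewrite at0 ltW.
have [p1 p2] := piecewise_restrict (@apiece_hereditary _ _ _ A c) at0b pc.
exists phi; split.
- apply: (piecewise_cat (m := t0)).
    move: at0; rewrite le_eqVlt => /orP[/eqP <-|at0']; first exact: piecewise_refl.
    apply: piecewise_single => // x; rewrite /= in_itv /= => /andP[_ xt].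
    exists setT, (fun _ => 0); split=> //; first exact: openT.
      by move=> m; exact: Ck_cst.
    by move=> y; rewrite /= in_itv /= => /andP[_ yt] _; exact: phi0.
  by apply: piecewise_imp_in p2 => s u; exact: phi_smooth.
- exact: phi0.
- by rewrite phiE// cb gf// divff// gt_eqF// Fv_gt0.
- by move=> s t _ st tb; exact: phi_mono.
- exact: phi_ray.
Qed.

End Reparam.

(** With both curves constant any change of parameter serves; the affine one is smooth and
    increasing. *)
Lemma constant_reparam (R : realType) (n : nat) (M : manifold R n) (c0 c : R -> M) (a b : R) :
  a < b -> (forall s t, a <= t <= b -> c t = c0 s) -> reparametrization c0 a b c.
Proof.
move=> ab hc; have d0 : 0 < b - a by rewrite subr_gt0.
have cl : clin (fun z : R => (b - a)^-1 *: z) := clin_scaler R^o (b - a)^-1.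
exists (fun t => (b - a)^-1 *: (t - a)); split.
- apply: piecewise_single => // x _.
  exists setT, (fun t => (b - a)^-1 *: (t - a)); split=> //; first exact: openT.
  have h1 : Cr None [set: R] (fun t : R => t - a).
    by move=> m; apply: (CkD openT); [exact: Ck_clin (@clin_id R R)|exact: Ck_cst].
  exact: (@Cr_comp R R R R setT setT (fun t => t - a) (fun z : R => (b - a)^-1 *: z) openT openT
    (@findim_R R) (@findim_R R) (fun _ _ => I) h1 (Cr_clin setT cl)).
- by rewrite subrr scaler0.
- by rewrite -[_ *: _]/(_ * _) mulVf// gt_eqF.
- by move=> s t _ st _; rewrite -![_ *: _]/(_ * _) ler_wpM2l ?invr_ge0 ?(ltW d0)// lerD2r.
- by move=> t; exact: hc.
Qed.

Theorem proposition3p21 (R : realType) (n : nat) (M : manifold R n)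
    (A : M -> set 'rV[R]_n) (F : M -> 'rV[R]_n -> R)
    (hF : conic_finsler A F) (hA : pointwise_convex A)
    (p : M) (r : R) (hr : 0 < r)
    (hdef : forall v, tangent_ball A F p r v -> exp_defined A F p v)
    (hdiff : diffeo_onto_image (tangent_ball A F p r) (expmap A F p))
    (v : 'rV[R]_n) (q : M)
    (hv : tangent_ball A F p r v) (hq : q = expmap A F p v) :
  length_minimizer A F p q r 0 1 (radial_geodesic A F p v) /\
  forall (a b : R) (c : R -> M), length_minimizer A F p q r a b c ->
    reparametrization (radial_geodesic A F p v) a b c.
Proof.
have [oI [g [gf _ g1 fs gs]]] := hdiff; subst q.
have rc := ray_competitor hF hA hdef hv.
have rl := ray_length hF hA hdef oI gf g1 fs gs hv.
split.
  split; first exact: rc.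
  move=> a b c [adm ca cb cB].
  have [ab pc] := admissible_apiece hF adm.
  apply: le_trans (_ : F p v <= _); first by rewrite -rl; exact: lexx.
  exact: (len_ge hF hA hdef oI gf g1 fs gs ab pc ca cB hv cb).
move=> a b c [[adm ca cb cB] min].
have [ab pc] := admissible_apiece hF adm.
have lc : curve_length F a b c <= F p v by rewrite -rl; exact: min rc.
(* For [v = 0] the radial geodesic rests at [p], and a minimizer has length zero, hence rests there
   too. *)
have [v0|v0] := eqVneq v 0.
  rewrite v0 in hv lc *; have [A0 _] := hv.
  have F0 : F p 0 = 0 by apply/(cf_eq0 hF A0).
  rewrite F0 in lc; apply: constant_reparam => // s t tI.
  rewrite (ray_zero hF hA hdef s hv).
  exact: (zero_length_cst hF hA hdef oI gf g1 fs gs pc ca cB lc tI).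
have [t0 [at0 t0b ct0 ct hs]] := start hF hA hdef oI gf g1 fs ab pc ca cB hv v0 cb.
exact: (minimizer_reparam hF hA hdef oI gf g1 fs gs ab pc ca cB hv v0 cb lc at0 t0b ct0 ct hs).
Qed.
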